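(* Let $M$ be an $n$-dimensional Cartan-Hadamard manifold with sectional curvatures that satisfy, for all $x\in M$ and all two-dimensional subspaces $\sigma\subset T_xM$, $-c_m\le\mathcal{K}(x;\sigma)\le0$ for some constant $c_m>0$. Also assume that $h:[0,\infty)\to[-\infty,\infty)$ is a non-decreasing lower semi-continuous function which satisfies $$\liminf_{\theta\to0+}\left(h(\theta)-A_1\log\theta\right)>-\infty\qquad\text{and}\qquad\liminf_{\theta\to\infty}\left(h(\theta)-\phi(\theta)\right)>-\infty,$$ for some $0<A_1<2n$, where $\phi$ is a non-decreasing convex function on $[0,\infty)$ with the property that $\lim_{\theta\to\infty}\phi(\theta)/\theta=\infty$. Then there exists a global minimum of $E[\rho]$ in $\mathcal{P}_o(M)$, for any $o\in M$ fixed.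
   Context: A Cartan-Hadamard manifold is a complete, simply connected Riemannian manifold with everywhere non-positive sectional curvature. $d$ denotes the geodesic distance, $\mathcal{K}(x;\sigma)$ the sectional curvature of $\sigma$ at $x$, $\mathrm{d}x$ the Riemannian volume measure, and $\log_o:M\to T_oM$ the Riemannian logarithm map at $o$ (the inverse of $\exp_o$). $\mathcal{P}(M)$ is the set of probability measures on $M$; $\mathcal{P}_{ac}(M)\subset\mathcal{P}(M)$ is the set of those absolutely continuous with respect to $\mathrm{d}x$, identified with their densities $\rho$; $\mathcal{P}_1(M)\subset\mathcal{P}(M)$ is the set of those $\mu$ with $\int_M d(x,x_0)\,\mathrm{d}\mu(x)<\infty$ for some fixed (but arbitrary) $x_0\in M$. Set $$\mathcal{P}_o(M)=\left\{\rho\in\mathcal{P}_{ac}(M)\cap\mathcal{P}_1(M):\int_M\log_ox\,\rho(x)\,\mathrm{d}x=0\right\}.$$ The energy $E:\mathcal{P}(M)\to[-\infty,\infty]$ is given for $\rho\in\mathcal{P}_{ac}(M)$ by $$E[\rho]=\int_M\rho(x)\log\rho(x)\,\mathrm{d}x+\frac12\iint_{M\times M}h(d(x,y))\rho(x)\rho(y)\,\mathrm{d}x\,\mathrm{d}y,$$ and otherwise by the infimum of $\liminf_{k\to\infty}E[\rho_k]$ over all sequences $\rho_k\in\mathcal{P}_{ac}(M)$ converging weakly to $\rho$ (tested against bounded continuous functions). Only its values on $\mathcal{P}_{ac}(M)$ are needed here. *)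

(* Defs.v *)
From HB Require Import structures.
From mathcomp Require Import all_boot all_order all_algebra.
From mathcomp Require Import all_classical all_reals all_analysis.

Set Implicit Arguments.
Unset Strict Implicit.
Unset Printing Implicit Defensive.

Import Order.TTheory GRing.Theory Num.Theory.
Import numFieldNormedType.Exports.

Local Open Scope classical_set_scope.
Local Open Scope ring_scope.

(* Riemannian geometry is developed in coordinates: tangent vectors at a point
   of the domain of a chart [c] are row vectors, namely their components in the
   coordinate frame of [c].  The metric of a manifold is given by its Gram
   matrices in the charts of a smooth atlas. *)

Section Smooth.
Context {R : realType} {n : nat} {W : normedModType R}.

Definition partial (i : 'I_n) (f : 'rV[R]_n -> W) : 'rV[R]_n -> W :=
  fun v => 'D_(delta_mx 0 i) f v.

(* C^oo on U: every iterated partial derivative is (Frechet) differentiable,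
   in particular continuous, at each point of U. *)
Definition smooth_on (U : set 'rV[R]_n) (f : 'rV[R]_n -> W) : Prop :=
  forall (s : seq 'I_n) (v : 'rV[R]_n), U v ->
    differentiable (foldr partial f s) v.

End Smooth.

Record chart (R : realType) (n : nat) (M : ptopologicalType) := Chart {
  dom : set M;
  coor :> M -> 'rV[R]_n;
  param : 'rV[R]_n -> M;
  open_dom : open dom;
  open_coor : open (coor @` dom);
  coor_continuous : forall x, dom x -> {for x, continuous coor};
  param_continuous : forall v, (coor @` dom) v -> {for v, continuous param};
  coorK : forall x, dom x -> param (coor x) = x }.

Record manifold (R : realType) (n : nat) (M : ptopologicalType) := Manifold {
  atlas : set (chart R n M);
  manifold_hausdorff : hausdorff_space M;
  manifold_second_countable : @second_countable M;
  atlas_cover : forall x, exists2 c, atlas c & dom c x;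
  atlas_smooth : forall c c', atlas c -> atlas c' ->
    smooth_on (c @` (dom c `&` dom c')) (c' \o param c) }.

(* [gram c v] is the matrix of the metric in the coordinates of [c], at the
   point with coordinates [v].  Since jacobians act on row vectors on the
   right, [gram_change] says that the change of coordinates is isometric. *)
Record riemannian_metric (R : realType) (n : nat) (M : ptopologicalType)
    (X : manifold R n M) := RiemannianMetric {
  gram : chart R n M -> 'rV[R]_n -> 'M[R]_n;
  gram_smooth : forall c, atlas X c -> smooth_on (c @` dom c) (gram c);
  gram_sym : forall c v, atlas X c -> (c @` dom c) v ->
    (gram c v)^T = gram c v;
  gram_pos : forall c v (u : 'rV[R]_n), atlas X c -> (c @` dom c) v ->
    u != 0 -> 0 < (u *m gram c v *m u^T) 0 0;
  gram_change : forall c c' x, atlas X c -> atlas X c' ->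
    dom c x -> dom c' x ->
    let J := jacobian (c' \o param c) (c x) in
    gram c (c x) = J *m gram c' (c' x) *m J^T }.

Section RiemannianGeometry.
Context {R : realType} {n : nat} {M : ptopologicalType} {X : manifold R n M}.
Variable g : riemannian_metric X.
Implicit Types (c : chart R n M) (u v w : 'rV[R]_n) (x y z o : M).

Definition inner c v u w : R := (u *m gram g c v *m w^T) 0 0.

(* Gamma^k_ij *)
Definition christoffel c (k i j : 'I_n) v : R :=
  2^-1 * \sum_(l < n) invmx (gram g c v) k l *
    (partial i (gram g c) v j l + partial j (gram g c) v i l
     - partial l (gram g c) v i j).

(* the component along d_l of R(d_i, d_j) d_k, with the convention
   R(A, B) C = nabla_A nabla_B C - nabla_B nabla_A C - nabla_[A, B] C *)
Definition riemann c (l k i j : 'I_n) v : R :=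
  partial i (christoffel c l j k : _ -> R^o) v
  - partial j (christoffel c l i k : _ -> R^o) v
  + \sum_(m < n) (christoffel c l i m v * christoffel c m j k v
                  - christoffel c l j m v * christoffel c m i k v).

(* R(u, w) w *)
Definition curvature c v u w : 'rV[R]_n :=
  \row_l \sum_(k < n) \sum_(i < n) \sum_(j < n)
    riemann c l k i j v * u 0 i * w 0 j * w 0 k.

(* the curvature of the plane spanned by the independent vectors u and w *)
Definition sectional c v u w : R :=
  inner c v (curvature c v u w) u /
  (inner c v u u * inner c v w w - inner c v u w ^+ 2).

Definition sectional_bounds (a b : R) : Prop :=
  forall c x u w, atlas X c -> dom c x -> row_free (col_mx u w) ->
    a <= sectional c (c x) u w <= b.

Definition geodesic (gamma : R -> M) : Prop :=
  continuous gamma /\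
  forall c t, atlas X c -> dom c (gamma t) ->
    let e : R -> 'rV[R]_n := c \o gamma in
    [/\ derivable e t 1, derivable (derive1 e) t 1 &
        forall k, derive1 (derive1 e) t 0 k +
          \sum_(i < n) \sum_(j < n)
            christoffel c k i j (e t) * derive1 e t 0 i * derive1 e t 0 j = 0].

Definition geodesic_from c o u (gamma : R -> M) : Prop :=
  [/\ geodesic gamma, gamma 0 = o & derive1 (c \o gamma) 0 = u].

Definition geodesically_complete : Prop :=
  forall c o u, atlas X c -> dom c o -> exists gamma, geodesic_from c o u gamma.

(* Here o belongs to the domain of c, and T_oM is identified with 'rV_n by the
   coordinate frame of c. *)
Definition exp_map c o u : M :=
  xget o [set gamma 1 | gamma in geodesic_from c o u].

Definition log_map c o x : 'rV[R]_n :=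
  xget 0 [set u | exp_map c o u = x].

(* a C^1 curve of length l from x to y, inside the domain of one chart *)
Definition C1_arc x y (l : R) : Prop :=
  exists c (e : R -> 'rV[R]_n),
  [/\ atlas X c,
      forall t, t \in `[0, 1] -> (c @` dom c) (e t) /\ derivable e t 1,
      {within `[0, 1], continuous (derive1 e)},
      x = param c (e 0) /\ y = param c (e 1) &
      l = \int[lebesgue_measure]_(t in `[0, 1])
            Num.sqrt (inner c (e t) (derive1 e t) (derive1 e t))].

(* Piecewise C^1 curves: a compact one can be subdivided into finitely many
   C^1 arcs, each contained in the domain of a chart. *)
Inductive curve_length : M -> M -> R -> Prop :=
| curve_nil x : curve_length x x 0
| curve_cons x y z l l' :
    C1_arc x y l -> curve_length y z l' -> curve_length x z (l + l').

Definition geodesic_dist x y : R := inf [set l | curve_length x y l].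

End RiemannianGeometry.

Definition simply_connected (R : realType) (T : topologicalType) : Prop :=
  (forall x y : T, exists gamma : R -> T,
     [/\ {within `[0, 1], continuous gamma}, gamma 0 = x & gamma 1 = y]) /\
  (forall gamma : R -> T,
     {within `[0, 1], continuous gamma} -> gamma 0 = gamma 1 ->
     exists H : R * R -> T,
       {within `[0, 1] `*` `[0, 1], continuous H} /\
       forall s, s \in `[0, 1] ->
         [/\ H (s, 0) = gamma s, H (s, 1) = gamma 0,
             H (0, s) = gamma 0 & H (1, s) = gamma 0]).

Definition cartan_hadamard (R : realType) (n : nat) (M : ptopologicalType)
    (X : manifold R n M) (g : riemannian_metric X) : Prop :=
  [/\ geodesically_complete g, simply_connected R M &
      forall c x (u w : 'rV[R]_n), atlas X c -> dom c x ->
        row_free (col_mx u w) -> sectional g c (c x) u w <= 0].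

Definition borel (T : ptopologicalType) := g_sigma_algebraType (@open T).

(* the n-dimensional Lebesgue integral of a nonnegative Borel function, written
   as an iterated integral *)
Fixpoint integral_rV (R : realType) (n : nat) : ('rV[R]_n -> \bar R) -> \bar R :=
  match n return ('rV[R]_n -> \bar R) -> \bar R with
  | 0 => fun f => f 0
  | m.+1 => fun f => (\int[lebesgue_measure]_t
      integral_rV (fun v : 'rV[R]_m => f (row_mx (const_mx t : 'rV[R]_1) v)))%E
  end.

(* The Riemannian volume is sqrt(det g) times Lebesgue measure in any chart;
   as M is second countable, this determines a unique measure, which is
   sigma-finite. *)
Definition riemannian_volume (R : realType) (n : nat) (M : ptopologicalType)
    (X : manifold R n M) (g : riemannian_metric X)
    (vol : {sigma_finite_measure set (borel M) -> \bar R}) : Prop :=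
  forall c (A : set (borel M)), atlas X c -> measurable A -> A `<=` dom c ->
    vol A = integral_rV (fun v : 'rV[R]_n =>
      (\1_(c @` A) v * Num.sqrt (\det (gram g c v)))%:E).

(* Integral of an extended real-valued function with the convention
   +oo - +oo = +oo, whereas the library's integral yields -oo.  The operations
   of scope dE are those of the library with this convention. *)
Definition integral_dE d (T : measurableType d) (R : realType)
    (mu : {measure set T -> \bar R}) (f : T -> \bar R) : \bar R :=
  let pos := (\int[mu]_x f^\+ x)%E in
  let neg := (\int[mu]_x f^\- x)%E in
  (pos - neg)%dE.

Section Energy.
Context {R : realType} {n : nat} {M : ptopologicalType} {X : manifold R n M}.
Variable g : riemannian_metric X.
Variable vol : {sigma_finite_measure set (borel M) -> \bar R}.
Implicit Types rho : borel M -> R.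

Definition P_ac rho : Prop :=
  [/\ measurable_fun setT rho, forall x, 0 <= rho x &
      (\int[vol]_x (rho x)%:E = 1)%E].

Definition finite_first_moment rho : Prop :=
  exists x0 : M, (\int[vol]_x (geodesic_dist g x x0 * rho x)%:E < +oo)%E.

Definition centered (o : M) rho : Prop :=
  forall c, atlas X c -> dom c o -> forall k : 'I_n,
    (\int[vol]_x (log_map g c o x 0 k * rho x)%:E = 0)%E.

Definition P_o (o : M) rho : Prop :=
  [/\ P_ac rho, finite_first_moment rho & centered o rho].

(* ln 0 = 0, so that 0 * ln 0 = 0; a sum +oo - oo is +oo, so that a density
   with undefined energy does not compete. *)
Definition energy (h : R -> \bar R) rho : \bar R :=
  let entropy := integral_dE vol (fun x => (rho x * ln (rho x))%:E) in
  let interaction := integral_dE (vol \x vol)%E (fun xy =>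
    (h (geodesic_dist g xy.1 xy.2) * (rho xy.1 * rho xy.2)%:E)%E) in
  (entropy + (2^-1)%:E * interaction)%dE.

End Energy.

(* Main.v *)
(* The curvature bounds give, for a Jacobi field Y with Y(0) = 0 and Y'(0) = w, that
   |w| <= |Y(1)| <= C exp(C |u|) |w| along the geodesic of u.  Hence exp_o expands and has
   at most exponentially growing dilatation; as M is complete and simply connected, lifting
   curves and homotopies shows that exp_o is bijective, that log_o is 1-Lipschitz up to the
   choice of a norm, and that the points with |log_o x - v| <= r have volume at most
   C exp(C (|v| + r)) r^n.

   Let E be finite.  Since A1 < 2n, the volume growth makes exp (- t h(d(x, y)) - a |log_o x|)
   integrable in x, uniformly in y, for some t > 1/2 and for h negative; Jensen's inequality
   then bounds the negative part of the interaction by a fraction of the entropy plus a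
   multiple of the first moment of log_o.  For centered densities this moment is at most the
   double integral of |log_o x - log_o y|, hence is absorbed by the superlinear growth of h.
   So a minimizing sequence has bounded entropy relative to a weight exp (- C |log_o x|) and
   bounded positive interaction, which makes it uniformly integrable.

   The limit of its integrals along an ultrafilter is a measure, whose density (Radon-Nikodym)
   is the minimizer: by the superlinear bound the constraint passes to the limit, and the
   energy is lower semicontinuous by convex duality for s ln s, because the densities and
   their products converge when tested against all bounded measurable functions. *)

From HB Require Import structures.
Require Import Defs.
From mathcomp Require Import all_boot all_order all_algebra.
From mathcomp Require Import all_classical all_reals all_analysis.
From mathcomp Require Import measurable_realfun ring lra.

Import Order.TTheory GRing.Theory Num.Theory.
Import numFieldNormedType.Exports.

Local Open Scope classical_set_scope.
Local Open Scope ring_scope.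

(** * Calculus on row vectors *)

(** Completeness supplies geodesics, but not their smooth dependence on the initial data. Jacobi
    fields are therefore obtained as ultralimits of difference quotients of pairs of geodesics,
    which Gronwall's inequality bounds; the comparison estimate itself then gives their uniqueness,
    hence their linearity in the initial velocity. The outcome is strict differentiability of exp_o,
    with both end points varying, and a contraction argument makes it a local homeomorphism. Volumes
    are transported without a change of variables: strict differentiability bounds the volume of
    small cubes, and a bisection argument extends the bound to all cubes.

    The threshold [2 n] comes from the diagonal: exp (- t h(d)) is at worst of order d^(- t A1),
    integrable if t A1 < n, while the factor 1/2 of the interaction asks for t > 1/2. The negative
    part of the interaction is not lower semicontinuous by itself, so entropy and interaction pass
    to the limit together, as a single integral over M x M. As h may jump, this needs convergence of
    the products of densities against measurable functions and not only continuous ones. *)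

Section IntervalInduction.
Context {R : realType}.
Implicit Types a b s t d : R.

(** Compactness of [[a, b]] without choosing a subdivision: the supremum of the points related to
    [a] is reached by the left half of the local hypothesis and passed by its right half. *)
Lemma interval_ind a b (Q : R -> R -> Prop) : a <= b ->
  (forall s t r, a <= s -> s <= t -> t <= r -> r <= b ->
    Q s t -> Q t r -> Q s r) ->
  (forall t, a <= t <= b -> exists2 d, 0 < d & forall s, a <= s <= b ->
     (t - d < s -> s <= t -> Q s t) /\ (t <= s -> s < t + d -> Q t s)) ->
  Q a b.
Proof.
move=> ab Qtr Qloc.
pose S := [set t | a <= t <= b /\ Q a t].
have Saa : S a.
  have [|d d0 /(_ a)] := Qloc a; first by rewrite lexx.
  rewrite lexx ab /= => -[//|_ H]; split; first by rewrite lexx.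
  by apply: H => //; rewrite ltrDl.
have supS : has_sup S.
  by split; [exists a | exists b => t [/andP[]]].
pose T := sup S.
have aT : a <= T by apply: sup_upper_bound.
have Tb : T <= b by apply: ge_sup; [exists a | move=> t [/andP[]]].
have [|d d0 locT] := Qloc T; first by rewrite aT Tb.
have QaT : Q a T.
  have [s [/andP[as_ sb] Qas] Ts] := sup_adherent d0 supS.
  have sT : s <= T by apply: sup_upper_bound => //; split => //; rewrite as_.
  have [|QsT _] := locT s; first by rewrite as_ sb.
  by apply: (Qtr a s T) => //; apply: QsT.
have [->//|Tb'] := eqVneq b T.
have {Tb'} Tltb : T < b by rewrite lt_neqAle eq_sym Tb'.
pose t := Num.min b (T + d / 2).
have Tt : T < t by rewrite lt_min Tltb ltrDl divr_gt0.
have tb : t <= b by rewrite ge_min lexx.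
have [|_ QTt] := locT t; first by rewrite tb (le_trans aT (ltW Tt)).
have : S t.
  split; first by rewrite tb (le_trans aT (ltW Tt)).
  apply: (Qtr a T t) => //; first exact: ltW.
  apply: QTt; first exact: ltW.
  by rewrite gt_min; apply/orP; right; rewrite ltrD2l ltr_pdivrMr // ltr_pMr // ltr1n.
by move=> /(sup_upper_bound supS); rewrite leNgt Tt.
Qed.

(** The same supremum argument for a predicate. It serves where arriving at a limit time needs an
    argument of its own, as for liftings of curves and for geodesics confined to a ball. *)
Lemma real_ind a b (P : R -> Prop) : a <= b -> P a ->
  (forall t, a <= t -> t < b -> (forall s, a <= s -> s <= t -> P s) ->
     exists2 d, 0 < d & forall s, t < s -> s < t + d -> s <= b -> P s) ->
  (forall t, a < t -> t <= b -> (forall s, a <= s -> s < t -> P s) -> P t) ->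
  forall t, a <= t -> t <= b -> P t.
Proof.
move=> ab Pa Pr Pl.
pose S := [set t | a <= t <= b /\ forall s, a <= s -> s <= t -> P s].
have Saa : S a.
  split; first by rewrite lexx.
  by move=> s as_ sa; have -> : s = a by apply/eqP; rewrite eq_le as_ sa.
have supS : has_sup S.
  by split; [exists a | exists b => t [/andP[]]].
pose T := sup S.
have aT : a <= T by apply: sup_upper_bound.
have Tb : T <= b by apply: ge_sup; [exists a | move=> t [/andP[]]].
have PltT s : a <= s -> s < T -> P s.
  move=> as_ sT; have e0 : 0 < T - s by rewrite subr_gt0.
  have [t [_ Pt]] := sup_adherent e0 supS.
  by rewrite -/T opprB addrCA subrr addr0 => /ltW; exact: Pt.
have PT : P T.
  have := aT; rewrite le_eqVlt => /predU1P[<-//|aT']; exact: Pl.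
have PleT s : a <= s -> s <= T -> P s.
  by move=> as_; rewrite le_eqVlt => /predU1P[->//|]; exact: PltT.
have [Tltb|bT] := ltP T b; last first.
  by move=> t at_ tb; apply: PleT => //; apply: le_trans bT.
have [d d0 dP] := Pr T aT Tltb PleT.
pose t := Num.min b (T + d / 2).
have Tt : T < t by rewrite lt_min Tltb ltrDl divr_gt0.
have tb : t <= b by rewrite ge_min lexx.
have td : t < T + d.
  by rewrite gt_min; apply/orP; right; rewrite ltrD2l ltr_pdivrMr // ltr_pMr // ltr1n.
have : S t.
  split; first by rewrite tb (le_trans aT (ltW Tt)).
  move=> s as_ st; have [sT|Ts] := leP s T; first exact: PleT.
  by apply: dP => //; [exact: le_lt_trans td | exact: le_trans tb].
by move=> /(sup_upper_bound supS); rewrite leNgt Tt.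
Qed.

End IntervalInduction.

(** * The maximum norm on row vectors *)

Section RowNorm.
Context {R : realType} {n : nat}.
Implicit Types (u v w : 'rV[R]_n).

Lemma coord_le_norm u i : `|u 0 i| <= `|u|.
Proof.
rewrite [leRHS]/Num.Def.normr/= mx_normrE.
by apply: le_trans; last exact: (le_bigmax _ _ (0, i)).
Qed.

Lemma norm_le_coord u (r : R) : 0 <= r -> (forall i, `|u 0 i| <= r) -> `|u| <= r.
Proof.
move=> r0 H; rewrite [leLHS]/Num.Def.normr/= mx_normrE.
by apply: bigmax_le => // -[i j] _ /=; rewrite ord1.
Qed.

Lemma norm_lt_coord u (r : R) : 0 < r -> (forall i, `|u 0 i| < r) -> `|u| < r.
Proof.
move=> r0 H; rewrite [ltLHS]/Num.Def.normr/= mx_normrE.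
by apply/bigmax_ltP; split => // -[i j] _ /=; rewrite ord1.
Qed.

Lemma row_coord_sum u : u = \sum_i u 0 i *: delta_mx 0 i.
Proof.
apply/rowP => j; rewrite summxE (bigD1 j)//= big1 ?addr0.
  by rewrite !mxE !eqxx mulr1.
by move=> i ij; rewrite !mxE eqxx eq_sym (negbTE ij) mulr0.
Qed.

Lemma linear_coord {W : lmodType R} (f : {linear 'rV[R]_n -> W}) u :
  f u = \sum_i u 0 i *: f (delta_mx 0 i).
Proof.
rewrite {1}(row_coord_sum u) linear_sum; apply: eq_bigr => i _.
by rewrite linearZ.
Qed.

Lemma cvg_rowP {I : Type} {F : set_system I} {FF : Filter F} (f : I -> 'rV[R]_n) v :
  (f @ F --> v) <-> forall i, (fun k => f k 0 i) @ F --> v 0 i.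
Proof.
split=> [fv i|H].
  apply: (cvg_comp f (fun u : 'rV[R]_n => u 0 i) fv).
  exact: (@coord_continuous R 1 n 0 i v).
apply/cvgrPdist_lt => e e0.
have : \forall k \near F, forall i, `|v 0 i - f k 0 i| < e.
  apply: filter_forall => i.
  by have /cvgrPdist_lt/(_ e e0) := H i.
by apply: filterS => k Hk; apply: norm_lt_coord => // i; rewrite !mxE.
Qed.

(** Closed bounded sets are compact, so along an ultrafilter a bounded family converges as it
    stands, with no extraction of subsequences. *)
Lemma row_ultra_cvg {I : Type} {F : set_system I} {UF : UltraFilter F}
    (f : I -> 'rV[R]_n) (K : R) :
  (\forall k \near F, `|f k| <= K) -> exists v, f @ F --> v /\ `|v| <= K.
Proof.
move=> fK; pose A := [set u : 'rV[R]_n | `|u| <= K].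
have cA : compact A.
  apply: bounded_closed_compact.
    exists K; split; first exact: num_real.
    by move=> M KM u /le_trans; apply; exact: ltW.
  rewrite (_ : A = (fun u : 'rV[R]_n => `|u|) @^-1` [set x | x <= K])//.
  apply: closed_comp; last exact: closed_le.
  by move=> u _; exact: norm_continuous.
have UfF : UltraFilter (f @ F).
  split; first exact: fmap_proper_filter.
  move=> G PG sFG; rewrite predeqE => B; split; last exact: sFG.
  move=> GB; have [//|nB] := in_ultra_setVsetC (f @^-1` B) UF.
  have : G (~` B) by apply: sFG.
  by move=> /(filterI GB); rewrite setICr => /filter_ex [].
move: cA; rewrite compact_ultra => /(_ (f @ F) UfF fK) [v [Av fv]].
by exists v.
Qed.

End RowNorm.

Section CvgDist.
Context {R : realType} {W : normedModType R} {I : Type} {F : set_system I} {FF : Filter F}.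

Lemma cvg_near_dist (x : I -> W) (v : W) (r : R) :
  x @ F --> v -> 0 < r -> \forall k \near F, `|x k - v| < r.
Proof.
move=> /cvgrPdist_lt/[apply]; apply: filterS => k; by rewrite distrC.
Qed.

Lemma cvg_sumr (J : Type) (r : seq J) (f : J -> I -> W) (l : J -> W) :
  (forall i, f i @ F --> l i) ->
  (fun k => \sum_(i <- r) f i k) @ F --> \sum_(i <- r) l i.
Proof.
move=> fl; elim: r => [|i r IH].
  rewrite big_nil (_ : (fun k => _) = fun=> 0); first exact: cvg_cst.
  by apply/funext => k; rewrite big_nil.
rewrite big_cons (_ : (fun k => _) = f i \+ fun k => \sum_(j <- r) f j k).
  exact: cvgD.
by apply/funext => k; rewrite big_cons.
Qed.

End CvgDist.

(** * Differentials and functions of class C^1 *)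

Section Differentials.
Context {R : realType} {n : nat}.
Implicit Types (f g : 'rV[R]_n -> R) (u v w x y : 'rV[R]_n) (V : set 'rV[R]_n).

Definition dd {W : normedModType R} (f : 'rV[R]_n -> W) (x e : 'rV[R]_n) : W := 'd f x e.

Lemma is_diff_dd {W : normedModType R} (f : 'rV[R]_n -> W) x (Df : 'rV[R]_n -> W) e :
  is_diff x f Df -> dd f x e = Df e.
Proof. by move=> H; rewrite /dd (@diff_val _ _ _ _ _ _ _ H). Qed.

Lemma is_diff_ex {W : normedModType R} (f : 'rV[R]_n -> W) x (Df : 'rV[R]_n -> W) :
  is_diff x f Df -> differentiable f x.
Proof. by case. Qed.

Lemma ddP {W : normedModType R} (f : 'rV[R]_n -> W) x :
  differentiable f x -> is_diff x f (dd f x).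
Proof. by move=> H; apply: DiffDef. Qed.

Lemma ddZ {W : normedModType R} (f : 'rV[R]_n -> W) x c e :
  dd f x (c *: e) = c *: dd f x e.
Proof. by rewrite /dd linearZ. Qed.

Lemma ddD {W : normedModType R} (f : 'rV[R]_n -> W) x e e' :
  dd f x (e + e') = dd f x e + dd f x e'.
Proof. by rewrite /dd linearD. Qed.

Lemma dd_coord {W : normedModType R} (f : 'rV[R]_n -> W) x e :
  dd f x e = \sum_i e 0 i *: dd f x (delta_mx 0 i).
Proof. by rewrite /dd linear_coord. Qed.

Lemma chain_curve {W : normedModType R} (f : 'rV[R]_n -> W) (x : R -> 'rV[R]_n) (t : R) x' :
  differentiable f (x t) -> is_derive t 1 x x' ->
  is_derive t (1 : R) (f \o x) (dd f (x t) x').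
Proof.
move=> df [dx <-].
have dxt : differentiable x t by apply/derivable1_diffP.
have dfx : differentiable (f \o x) t by exact: differentiable_comp.
apply: DeriveDef; first exact/derivable1_diffP.
by rewrite /dd !deriveE // diff_comp.
Qed.

Lemma derive_row (x : R -> 'rV[R]_n) (t : R) x' :
  is_derive t 1 x x' <-> forall i, is_derive t 1 (fun s => x s 0 i) (x' 0 i).
Proof.
split=> [[dx <-] i|H].
  rewrite derive_mx// mxE; apply: derivableP.
  by move/derivable_mxP: dx; apply.
have dx : derivable x t 1.
  by apply/derivable_mxP => i j; rewrite ord1; apply: ex_derive.
apply: DeriveDef => //; rewrite derive_mx//; apply/rowP => i; rewrite mxE.
exact: derive_val.
Qed.

Lemma isd_cst (c t : R) : is_derive t (1 : R) (fun=> c) (0 : R).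
Proof. exact: (is_derive_cst c t 1). Qed.

Lemma isd_id (t : R) : is_derive t (1 : R) (fun s => s) (1 : R).
Proof. exact: (is_derive_id t 1). Qed.

Lemma isd_eq (f : R -> R) (t a b : R) :
  is_derive t (1 : R) f a -> a = b -> is_derive t (1 : R) f b.
Proof. by move=> + <-. Qed.

Lemma isdD (f g : R -> R) (t a b : R) : is_derive t (1 : R) f a ->
  is_derive t (1 : R) g b -> is_derive t (1 : R) (fun s => f s + g s) (a + b).
Proof. exact: is_deriveD. Qed.

Lemma isdN (f : R -> R) (t a : R) : is_derive t (1 : R) f a ->
  is_derive t (1 : R) (fun s => - f s) (- a).
Proof. exact: is_deriveN. Qed.

Lemma isdM (f g : R -> R) (t a b : R) : is_derive t (1 : R) f a ->
  is_derive t (1 : R) g b ->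
  is_derive t (1 : R) (fun s => f s * g s) (a * g t + f t * b).
Proof.
move=> fa gb.
have H : is_derive t (1 : R) (f * g) (f t *: b + g t *: a) by exact: is_deriveM.
by apply: (isd_eq _ _ _ _ H); rewrite addrC [g t *: a]mulrC.
Qed.

Lemma isd_sum (J : Type) (r : seq J) (f : J -> R -> R) (t : R) (a : J -> R) :
  (forall i, is_derive t (1 : R) (f i) (a i)) ->
  is_derive t (1 : R) (fun s => \sum_(i <- r) f i s) (\sum_(i <- r) a i).
Proof.
move=> fa; elim: r => [|i r IH].
  rewrite big_nil (_ : (fun k => _) = fun=> 0); first exact: isd_cst.
  by apply/funext => k; rewrite big_nil.
rewrite big_cons (_ : (fun k => _) = fun k => f i k + \sum_(j <- r) f j k).
  exact: isdD.
by apply/funext => k; rewrite big_cons.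
Qed.

Lemma line_derive x w (t : R) : is_derive t 1 (fun s : R => x + s *: w) w.
Proof.
apply/derive_row => i.
rewrite (_ : (fun s => _) = (fun s => x 0 i + s * w 0 i)); last first.
  by apply/funext => s; rewrite !mxE.
have H := isdD _ _ _ _ _ (isd_cst (x 0 i) t) (isdM _ _ _ _ _ (isd_id t) (isd_cst (w 0 i) t)).
apply: (isd_eq _ _ _ _ H).
by rewrite add0r mulr0 addr0 mul1r.
Qed.

Lemma mvt_segment_rV f x y :
  (forall s : R, 0 <= s <= 1 -> differentiable f (x + s *: (y - x))) ->
  exists2 s, 0 <= s <= 1 & f y - f x = dd f (x + s *: (y - x)) (y - x).
Proof.
move=> df.
pose g s := f (x + s *: (y - x)).
have dg (s : R) : 0 <= s <= 1 -> is_derive s 1 g (dd f (x + s *: (y - x)) (y - x)).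
  by move=> s01; apply: chain_curve; [exact: df | exact: line_derive].
have [||s] := @MVT_segment R g (fun s => dd f (x + s *: (y - x)) (y - x)) 0 1 ler01.
- by move=> s; rewrite in_itv /= => /andP[s0 s1]; apply: dg; rewrite !ltW.
- apply: derivable_within_continuous => s; rewrite in_itv /= => s01.
  exact: (@ex_derive _ _ _ _ _ _ _ (dg s s01)).
rewrite in_itv /= subr0 mulr1 /g scale1r scale0r addr0 subrKC => s01 ->.
by exists s.
Qed.

(** Continuity of the differential is asked direction by direction, which suffices in finite
    dimension. The differential is a datum, so that the calculus rules are instances of those for
    [is_diff]. *)
Variant C1 V f : Prop := C1Def Df of (forall v, V v -> is_diff v f (Df v)) &
  (forall v e, V v -> (fun x : 'rV[R]_n => Df x e) @ nbhs v --> Df v e).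

Lemma C1_diff V f v : C1 V f -> V v -> differentiable f v.
Proof. by move=> [Df df _] Vv; have [] := df v Vv. Qed.

Lemma segment_ball x y v r s : 0 <= s <= 1 -> `|x - v| < r -> `|y - v| < r ->
  `|x + s *: (y - x) - v| < r.
Proof.
move=> /andP[s0 s1] xr yr.
have -> : x + s *: (y - x) - v = (1 - s) *: (x - v) + s *: (y - v).
  by apply/rowP => i; rewrite !mxE; ring.
apply: le_lt_trans (ler_normD _ _) _; rewrite !normrZ !ger0_norm ?subr_ge0//.
set a := `|x - v| in xr *; set b := `|y - v| in yr *.
pose m := Num.max a b.
have mr : m < r by rewrite gt_max xr.
have am : (1 - s) * a <= (1 - s) * m by rewrite ler_wpM2l ?subr_ge0// le_max lexx.
have bm : s * b <= s * m by rewrite ler_wpM2l// le_max lexx orbT.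
apply: le_lt_trans (lerD am bm) _.
by rewrite -mulrDl subrK mul1r.
Qed.

Lemma open_ballP V v : open V -> V v ->
  exists2 r, 0 < r & forall x, `|x - v| < r -> V x.
Proof.
move=> oV Vv.
have /nbhs_ballP[r r0 rV] : nbhs v V by apply: open_nbhs_nbhs.
exists r => // x xr; apply: rV.
by rewrite -ball_normE /= distrC.
Qed.

Lemma C1_d_continuous V f v e : open V -> C1 V f -> V v ->
  (fun x => dd f x e) @ nbhs v --> dd f v e.
Proof.
move=> oV [Df df kf] Vv; have := kf v e Vv.
have E : \forall x \near v, Df x e = dd f x e.
  have : nbhs v V by exact: open_nbhs_nbhs.
  by apply: filterS => x Vx; rewrite (is_diff_dd _ _ _ _ (df x Vx)).
rewrite (is_diff_dd _ _ _ _ (df v Vv)).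
by apply: cvg_trans; apply: near_eq_cvg; apply: filterS E => x ->.
Qed.

(** Strict differentiability: both points move, as they do when two neighbouring geodesics are
    compared. The mean value theorem writes the increment as a differential at an intermediate
    point, which also tends to [v]. *)
Lemma C1_strict {I : Type} {F : set_system I} {FF : Filter F} V f
    (x y : I -> 'rV[R]_n) (eps : I -> R) v Y : open V -> V v -> C1 V f ->
  x @ F --> v -> y @ F --> v -> (fun k => (eps k)^-1 *: (y k - x k)) @ F --> Y ->
  (fun k => (eps k)^-1 * (f (y k) - f (x k))) @ F --> dd f v Y.
Proof.
move=> oV Vv cf xv yv zY.
have [r r0 rV] := open_ballP _ _ oV Vv.
have xr : \forall k \near F, `|x k - v| < r by exact: cvg_near_dist.
have yr : \forall k \near F, `|y k - v| < r by exact: cvg_near_dist.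
have Hxi k : exists xi, `|x k - v| < r -> `|y k - v| < r ->
   `|xi - v| <= `|x k - v| + `|y k - v| /\ f (y k) - f (x k) = dd f xi (y k - x k).
  have [[xk yk]|nxy] := pselect (`|x k - v| < r /\ `|y k - v| < r); last first.
    by exists v => ? ?; exfalso; apply: nxy.
  have [|s s01 E] := @mvt_segment_rV f (x k) (y k).
    by move=> s s01; apply: (C1_diff _ _ _ cf); apply: rV; exact: segment_ball.
  exists (x k + s *: (y k - x k)) => _ _; split => //.
  have -> : x k + s *: (y k - x k) - v = (1 - s) *: (x k - v) + s *: (y k - v).
    by apply/rowP => i; rewrite !mxE; ring.
  case/andP: s01 => s0 s1.
  apply: le_trans (ler_normD _ _) _; rewrite !normrZ !ger0_norm ?subr_ge0//.
  by apply: lerD; rewrite ler_piMl//; lra.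
have [xi Hxi'] := choice Hxi.
have xiv : xi @ F --> v.
  apply/cvgrPdist_lt => e e0.
  have h1 : \forall k \near F, `|x k - v| < e / 2.
    by apply: cvg_near_dist => //; rewrite divr_gt0.
  have h2 : \forall k \near F, `|y k - v| < e / 2.
    by apply: cvg_near_dist => //; rewrite divr_gt0.
  near=> k.
  have [||H _] := Hxi' k; [by near: k|by near: k|].
  rewrite distrC; apply: le_lt_trans H _; rewrite [e]splitr; apply: ltrD; by near: k.
rewrite dd_coord.
have E : \forall k \near F, (eps k)^-1 * (f (y k) - f (x k)) =
   \sum_i ((eps k)^-1 *: (y k - x k)) 0 i *: dd f (xi k) (delta_mx 0 i).
  near=> k.
  have [||_ ->] := Hxi' k; [by near: k|by near: k|].
  by rewrite -dd_coord ddZ.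
apply: cvg_trans; first by apply: near_eq_cvg; apply: filterS E => k ->.
apply: cvg_sumr => i; apply: cvgM; first exact: (cvg_rowP _ _).1.
apply: (cvg_comp xi (fun x => dd f x (delta_mx 0 i)) xiv).
exact: (C1_d_continuous V).
Unshelve. all: by end_near. Qed.

Lemma C1_lip V f v : open V -> V v -> C1 V f ->
  exists2 r, 0 < r & exists2 K, 0 < K & forall x y, `|x - v| < r -> `|y - v| < r ->
    V x /\ `|f x - f y| <= K * `|x - y|.
Proof.
move=> oV Vv cf.
have [r r0 rV] := open_ballP _ _ oV Vv.
pose K := \sum_i (`|dd f v (delta_mx 0 i)| + 1) + 1.
have [r' r'0 Hr'] : exists2 r, 0 < r & forall x, `|x - v| < r -> forall i,
    `|dd f x (delta_mx 0 i)| <= `|dd f v (delta_mx 0 i)| + 1.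
  have : \forall x \near v, forall i,
      `|dd f x (delta_mx 0 i)| <= `|dd f v (delta_mx 0 i)| + 1.
    apply: (@filter_forall _ _ (fun i x => `|dd f x (delta_mx 0 i)| <= `|dd f v (delta_mx 0 i)| + 1) (nbhs v) (nbhs_filter v)) => i.
    have /cvgrPdist_le/(_ 1 ltr01) := C1_d_continuous _ _ _ (delta_mx 0 i) oV cf Vv.
    apply: filterS => x H; rewrite -lerBlDl.
    by apply: le_trans (lerB_dist _ _) _; rewrite distrC.
  move/nbhs_ballP => [s s0 sH]; exists s => // x xs; apply: sH.
  by rewrite -ball_normE /= distrC.
exists (Num.min r r'); first by rewrite lt_min r0.
exists K; first by rewrite ltr_wpDl// sumr_ge0// => i _; rewrite addr_ge0.
move=> x y; rewrite !lt_min => /andP[xr xr'] /andP[yr yr'].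
split; first exact: rV.
have [|s s01 ->] := @mvt_segment_rV f y x.
  by move=> s s01; apply: (C1_diff _ _ _ cf); apply: rV; exact: segment_ball.
rewrite dd_coord; apply: le_trans (ler_norm_sum _ _ _) _.
apply: (@le_trans _ _ (\sum_i (`|dd f v (delta_mx 0 i)| + 1) * `|x - y|)).
  apply: ler_sum => i _; rewrite [_ *: _]/(_ * _) normrM mulrC; apply: ler_pM => //.
    by apply: Hr'; exact: segment_ball.
  exact: coord_le_norm.
by rewrite -mulr_suml ler_wpM2r// lerDl.
Qed.

Lemma C1_cst V (c : R) : C1 V (fun=> c).
Proof.
refine (@C1Def _ _ (fun _ _ => 0) _ _).
by move=> v e _; exact: cvg_cst.
Qed.

Lemma C1D V f g : C1 V f -> C1 V g -> C1 V (fun x => f x + g x).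
Proof.
move=> [Df df kf] [Dg dg kg].
apply: (@C1Def _ _ (fun x e => Df x e + Dg x e)) => v => [Vv|e Vv].
  exact: (is_diffD (df v Vv) (dg v Vv)).
exact: (cvgD (kf v e Vv) (kg v e Vv)).
Qed.

Lemma C1_cont V f v : C1 V f -> V v -> f @ nbhs v --> f v.
Proof. by move=> cf Vv; apply: differentiable_continuous; exact: (C1_diff _ _ _ cf Vv). Qed.

Lemma C1M V f g : C1 V f -> C1 V g -> C1 V (fun x => f x * g x).
Proof.
move=> cf cg; case: (cf) => Df df kf; case: (cg) => Dg dg kg.
apply: (@C1Def _ _ (fun x e => f x * Dg x e + g x * Df x e)) => v => [Vv|e Vv].
  exact: (is_diffM (df v Vv) (dg v Vv)).
exact: (cvgD (cvgM (C1_cont _ _ _ cf Vv) (kg v e Vv))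
             (cvgM (C1_cont _ _ _ cg Vv) (kf v e Vv))).
Qed.

Lemma C1V V f : C1 V f -> (forall x, V x -> f x != 0) -> C1 V (fun x => (f x)^-1).
Proof.
move=> cf f0; case: (cf) => Df df kf.
apply: (@C1Def _ _ (fun x e => - (f x * f x)^-1 * Df x e)) => v => [Vv|e Vv].
  have [dfv <-] := df v Vv.
  apply: DiffDef; first by apply: differentiableV => //; exact: f0.
  by rewrite diffV//; exact: f0.
have c := C1_cont _ _ _ cf Vv.
have ff : f v * f v != 0 by rewrite mulf_neq0// f0.
exact: (cvgM (cvgN (cvgV ff (cvgM c c))) (kf v e Vv)).
Qed.

Lemma C1_eq V f g : open V -> C1 V f -> (forall x, V x -> f x = g x) -> C1 V g.
Proof.
move=> oV [Df df kf] fg; apply: (@C1Def _ _ Df) => // v Vv.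
have [dfv <-] := df v Vv.
have E : \forall x \near v, g x = f x.
  have : nbhs v V by exact: open_nbhs_nbhs.
  by apply: filterS => x /fg.
move/diff_locallyP : dfv => [c1 H1].
have H : g \o shift v = cst (g v) + 'd f v +o_ (0 : 'rV[R]_n) id.
  rewrite (nbhs_singleton E); apply/eqaddoP => e e0.
  have E' : \forall h \near (0 : 'rV[R]_n), g (h + v) = f (h + v).
    have c : (fun h => h + v) @ nbhs (0 : 'rV[R]_n) --> v.
      by rewrite -[X in _ --> X]add0r; exact: (cvgD cvg_id (cvg_cst v)).
    exact: c E.
  move/eqaddoP : H1 => /(_ e e0); apply: filterS2 E' => x /= gf.
  by rewrite !fctE /= gf.
apply: DiffDef; first by apply/diff_locallyP; rewrite (diff_unique c1 H).
by rewrite (diff_unique c1 H).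
Qed.

Lemma C1_sum V (J : Type) (r : seq J) (P : pred J) (f : J -> 'rV[R]_n -> R) :
  (forall i, C1 V (f i)) -> C1 V (fun x => \sum_(i <- r | P i) f i x).
Proof.
move=> cf; elim: r => [|i r IH].
  rewrite (_ : (fun k => _) = fun=> 0); first exact: C1_cst.
  by apply/funext => k; rewrite big_nil.
rewrite (_ : (fun k => _) = fun k => (if P i then f i k else 0) +
   \sum_(j <- r | P j) f j k).
  apply: C1D IH; case: (P i); [exact: cf | exact: C1_cst].
by apply/funext => k; rewrite big_cons; case: (P i); rewrite ?add0r.
Qed.

Lemma C1_prod V (J : Type) (r : seq J) (f : J -> 'rV[R]_n -> R) :
  (forall i, C1 V (f i)) -> C1 V (fun x => \prod_(i <- r) f i x).
Proof.
move=> cf; elim: r => [|i r IH].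
  rewrite (_ : (fun k => _) = fun=> 1); first exact: C1_cst.
  by apply/funext => k; rewrite big_nil.
rewrite (_ : (fun k => _) = fun k => f i k * \prod_(j <- r) f j k).
  exact: (C1M _ _ _ (cf i) IH).
by apply/funext => k; rewrite big_cons.
Qed.

Lemma C1_det V m (A : 'rV[R]_n -> 'M[R]_m) :
  (forall i j, C1 V (fun x => A x i j)) -> C1 V (fun x => \det (A x)).
Proof.
move=> cA; apply: C1_sum => s; apply: C1M; first exact: C1_cst.
by apply: C1_prod => i; exact: cA.
Qed.

Lemma C1_invmx V m (A : 'rV[R]_n -> 'M[R]_m) i j : open V ->
  (forall i j, C1 V (fun x => A x i j)) -> (forall x, V x -> A x \in unitmx) ->
  C1 V (fun x => invmx (A x) i j).
Proof.
move=> oV cA uA.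
apply: (@C1_eq _ (fun x => (\det (A x))^-1 * cofactor (A x) j i)) => //.
  apply: C1M.
    by apply: C1V; [exact: C1_det | move=> x /uA; rewrite unitmxE unitfE].
  apply: C1M; first exact: C1_cst.
  apply: C1_det => k l; rewrite (_ : (fun x => _) = fun x => A x (lift j k) (lift i l)).
    exact: cA.
  by apply/funext => x; rewrite !mxE.
by move=> x /uA ux; rewrite /invmx ux !mxE.
Qed.

Lemma diff_near f v r : differentiable f v -> 0 < r ->
  exists2 d, 0 < d & forall h, `|h| < d -> `|f (v + h) - f v - dd f v h| <= r * `|h|.
Proof.
move=> df r0; have /eqaddoP : f \o shift v = cst (f v) + 'd f v +o_ (0 : 'rV[R]_n) id.
  exact: diff_locally.
move=> /(_ r r0) /nbhs_ballP[d d0 H]; exists d => // h hd.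
have := H h; rewrite -ball_normE /= sub0r normrN => /(_ hd).
have -> : (f \o shift v - (cst (f v) + 'd f v)) h = f (h + v) - (f v + dd f v h) by [].
by rewrite [h + v]addrC opprD addrA.
Qed.

(* Both mixed derivatives are the limit of the second difference
   [f (v + h a + h b) - f (v + h a) - f (v + h b) + f v] divided by [h^2]. *)
Lemma schwarz V f (F : 'rV[R]_n -> 'rV[R]_n -> R) v a b : open V -> V v ->
  (forall x, V x -> is_diff x f (F x)) ->
  (forall e, differentiable (fun x => F x e) v) ->
  dd (fun x => F x a) v b = dd (fun x => F x b) v a.
Proof.
move=> oV Vv df dF.
pose D h := f (v + h *: a + h *: b) - f (v + h *: a) - f (v + h *: b) + f v.
have DC : forall a b, forall r, 0 < r -> exists2 d, 0 < d & forall h, 0 < h -> h < d ->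
   `|(f (v + h *: a + h *: b) - f (v + h *: a) - f (v + h *: b) + f v)
      - h ^+ 2 * dd (fun x => F x a) v b| <= r * h ^+ 2.
  move=> {D} {a b} a b r r0.
  have [q q0 qV] := open_ballP _ _ oV Vv.
  pose N := `|a| + `|b| + 1.
  have N0 : 0 < N by rewrite ltr_wpDl// addr_ge0.
  have r'0 : 0 < r / (2 * N) by rewrite divr_gt0// mulr_gt0.
  have [d d0 Hd] := diff_near _ v _ (dF a) r'0.
  exists (Num.min d q / N); first by rewrite divr_gt0// lt_min d0.
  move=> h h0; rewrite ltr_pdivlMr// lt_min => /andP[hNd hNq].
  have small s : 0 <= s <= 1 -> forall t, 0 <= t <= 1 ->
      `|(s * h) *: a + (t * h) *: b| <= h * N.
    move=> /andP[s0 s1] t /andP[t0 t1].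
    have h0' : 0 <= h by exact: ltW.
    have sh : 0 <= s * h by rewrite mulr_ge0.
    have th : 0 <= t * h by rewrite mulr_ge0.
    apply: le_trans (ler_normD _ _) _; rewrite !normrZ !ger0_norm//.
    rewrite /N !mulrDr mulr1.
    have ha : s * h * `|a| <= h * `|a| by rewrite ler_wpM2r// ler_piMl.
    have hb : t * h * `|b| <= h * `|b| by rewrite ler_wpM2r// ler_piMl.
    lra.
  (* The mean value theorem is applied along [a] only. The second difference becomes an increment of
     [F _ a], which is read off from the differentiability of [F _ a] at [v]. *)
  pose g s := f (v + (s * h) *: a + h *: b) - f (v + (s * h) *: a).
  have dg (s : R) : 0 <= s <= 1 -> is_derive s 1 g
      (h * F (v + (s * h) *: a + h *: b) a - h * F (v + (s * h) *: a) a).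
    move=> s01.
    have Ld (w : 'rV[R]_n) : is_derive s 1 (fun s => w + (s * h) *: a) (h *: a).
      rewrite (_ : (fun s => _) = fun s => w + s *: (h *: a)); first exact: line_derive.
      by apply/funext => t; rewrite scalerA.
    have E w : V (w + (s * h) *: a) -> is_derive s 1 (fun s => f (w + (s * h) *: a))
        (h * F (w + (s * h) *: a) a).
      move=> /df dfw.
      have dfe : differentiable f (w + (s * h) *: a) by exact: is_diff_ex dfw.
      have := @chain_curve _ f (fun s => w + (s * h) *: a) s (h *: a) dfe (Ld w).
      by rewrite ddZ (is_diff_dd _ _ _ _ dfw).
    rewrite /g; apply: (isdD (fun s => f (v + (s * h) *: a + h *: b))); last first.
      by apply: isdN; apply: E; apply: qV; rewrite addrC addKr;
         have := small s s01 0; rewrite mul0r scale0r addr0 => H;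
         apply: le_lt_trans (H _) hNq; rewrite lexx ler01.
    rewrite (_ : (fun s => _) = fun s => f ((v + h *: b) + (s * h) *: a)); last first.
      by apply/funext => t; rewrite addrAC.
    rewrite addrAC; apply: E; apply: qV.
    have -> : v + h *: b + (s * h) *: a - v = (s * h) *: a + h *: b.
      by rewrite addrC addrA addKr addrC.
    have := small s s01 1; rewrite mul1r => H.
    by apply: le_lt_trans (H _) hNq; rewrite lexx ler01.
  have [||s] := @MVT_segment R g (fun s => h * F (v + (s * h) *: a + h *: b) a -
     h * F (v + (s * h) *: a) a) 0 1 ler01.
  - by move=> s; rewrite in_itv /= => /andP[s0 s1]; apply: dg; rewrite !ltW.
  - apply: derivable_within_continuous => s; rewrite in_itv /= => s01.
    exact: (@ex_derive _ _ _ _ _ _ _ (dg s s01)).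
  rewrite in_itv /= subr0 mulr1 /g mul1r mul0r scale0r addr0 => s01 E.
  rewrite opprD addrA in E.
  have -> : f (v + h *: a + h *: b) - f (v + h *: a) - f (v + h *: b) + f v =
    h * (F (v + (s * h) *: a + h *: b) a - F (v + (s * h) *: a) a).
    by rewrite mulrBr -E; ring.
  rewrite expr2 -mulrA -mulrBr normrM (ger0_norm (ltW h0)) [leRHS]mulrCA.
  apply: ler_wpM2l; first exact: ltW.
  have s1 : 0 <= (1 : R) <= 1 by rewrite ler01 lexx.
  have s0 : 0 <= (0 : R) <= 1 by rewrite ler01 lexx.
  have H1 := Hd ((s * h) *: a + h *: b).
  have H2 := Hd ((s * h) *: a).
  have n1 := small s s01 1 s1; have n2 := small s s01 0 s0.
  rewrite mul1r in n1; rewrite mul0r scale0r addr0 in n2.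
  have := H1 (le_lt_trans n1 hNd); have := H2 (le_lt_trans n2 hNd).
  rewrite !addrA ddD !ddZ.
  set A := F _ a - F v a - _; set B := _ - F v a - _ => AN BN.
  have -> : F (v + (s * h) *: a + h *: b) a - F (v + (s * h) *: a) a
      - h * dd (fun x => F x a) v b = B - A.
    by rewrite /A /B /GRing.scale /=; ring.
  apply: (@le_trans _ _ (`|B| + `|A|)); first exact: ler_normB.
  apply: (@le_trans _ _ (r / (2 * N) * (h * N) + r / (2 * N) * (h * N))).
    apply: lerD; [apply: le_trans BN _|apply: le_trans AN _];
      by rewrite ler_wpM2l// ltW.
  rewrite le_eqVlt; apply/orP; left; apply/eqP; field.
  exact: lt0r_neq0.
apply/eqP; rewrite -subr_eq0 -normr_le0; apply/ler_addgt0Pl => r r0; rewrite addr0.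
have r2 : 0 < r / 2 by rewrite divr_gt0.
have [d1 d10 H1] := DC a b _ r2; have [d2 d20 H2] := DC b a _ r2.
pose h := Num.min d1 d2 / 2.
have m0 : 0 < Num.min d1 d2 by rewrite lt_min d10.
have h0 : 0 < h by rewrite divr_gt0.
have hm : h < Num.min d1 d2 by rewrite ltr_pdivrMr // ltr_pMr // ltr1n.
have := hm; rewrite lt_min => /andP[hd1 hd2].
have {}H1 := H1 h h0 hd1; have {}H2 := H2 h h0 hd2.
rewrite -(ler_pM2l (exprn_gt0 2 h0)).
rewrite -{1}(ger0_norm (exprn_ge0 2 (ltW h0))) -normrM mulrBr.
move: H1 H2.
rewrite [v + h *: b + h *: a]addrAC.
set x := f (v + h *: a + h *: b); set y := f (v + h *: a); set z := f (v + h *: b).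
set p := h ^+ 2 * dd _ v b; set q := h ^+ 2 * dd _ v a => H1 H2.
have -> : p - q = (x - z - y + f v - q) - (x - y - z + f v - p) by ring.
apply: le_trans (ler_normB _ _) _; apply: le_trans (lerD H2 H1) _.
by rewrite -mulrDl -splitr mulrC.
Qed.

End Differentials.

Lemma dd_jacobian {R : realType} {n : nat} (f : 'rV[R]_n -> 'rV[R]_n) v a :
  dd f v a = a *m jacobian f v.
Proof. by rewrite /dd /jacobian mul_rV_lin1. Qed.

#[global] Opaque dd.

Set Implicit Arguments.
Unset Strict Implicit.
Unset Printing Implicit Defensive.

(** * Connection and curvature in a chart *)

Section BilinearFields.
Context {R : realType} {n : nat}.
Implicit Types (a b e u v w x y : 'rV[R]_n) (V : set 'rV[R]_n).

Lemma diff_eq_on {W : normedModType R} V (f g : 'rV[R]_n -> W) Df v : open V -> V v ->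
  (forall x, V x -> f x = g x) -> is_diff v f Df -> is_diff v g Df.
Proof.
move=> oV Vv fg [dfv <-].
have E : \forall x \near v, g x = f x.
  have : nbhs v V by exact: open_nbhs_nbhs.
  by apply: filterS => x /fg.
move/diff_locallyP : dfv => [c1 H1].
have H : g \o shift v = cst (g v) + 'd f v +o_ (0 : 'rV[R]_n) id.
  rewrite (nbhs_singleton E); apply/eqaddoP => r r0.
  have E' : \forall h \near (0 : 'rV[R]_n), g (h + v) = f (h + v).
    have c : (fun h => h + v) @ nbhs (0 : 'rV[R]_n) --> v.
      by rewrite -[X in _ --> X]add0r; exact: (cvgD cvg_id (cvg_cst v)).
    exact: c E.
  move/eqaddoP : H1 => /(_ r r0); apply: filterS2 E' => x /= gf.
  by rewrite !fctE /= gf.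
apply: DiffDef; first by apply/diff_locallyP; rewrite (diff_unique c1 H).
by rewrite (diff_unique c1 H).
Qed.

Lemma dd_eq_on {W : normedModType R} V (f g : 'rV[R]_n -> W) v e : open V -> V v ->
  (forall x, V x -> f x = g x) -> differentiable f v -> dd f v e = dd g v e.
Proof.
move=> oV Vv fg /ddP df; apply/esym; apply: is_diff_dd.
exact: (diff_eq_on oV Vv fg df).
Qed.

Definition C2 V (f : 'rV[R]_n -> R) := C1 V f /\ forall e, C1 V (fun x => dd f x e).

Lemma entry_diff m p (K : 'rV[R]_n -> 'M[R]_(m, p)) v i j : differentiable K v ->
  is_diff v (fun x => K x i j) (fun e => dd K v e i j).
Proof.
move=> dK.
have @f : {linear 'M[R]_(m, p) -> R}.
  by exists (fun N : 'M[R]_(_, _) => N i j); do 2![eexists]; do ?[constructor];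
     rewrite ?mxE// => ? *; rewrite ?mxE//; move=> ?; rewrite !mxE.
have cf : continuous f by exact: coord_continuous.
have df : differentiable f (K v) by exact: linear_differentiable.
have E : (fun x => K x i j) = f \o K by [].
rewrite E; apply: DiffDef; first exact: differentiable_comp.
by rewrite (diff_comp dK df) (diff_lin _ cf).
Qed.

Lemma partial_dd {W : normedModType R} (f : 'rV[R]_n -> W) i v : differentiable f v ->
  partial i f v = dd f v (delta_mx 0 i).
Proof. by move=> df; rewrite /partial deriveE. Qed.

Lemma smooth_C1 m p V (K : 'rV[R]_n -> 'M[R]_(m, p)) i j : open V ->
  smooth_on V K -> C1 V (fun x => K x i j).
Proof.
move=> oV sK.
apply: (@C1Def _ _ _ _ (fun x e => \sum_k e 0 k * (partial k K x) i j)) => v.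
  move=> Vv; have dK : differentiable K v by exact: (sK [::]).
  have := entry_diff i j dK; congr is_diff_def; apply/funext => e.
  rewrite dd_coord summxE; apply: eq_bigr => k _.
  by rewrite mxE partial_dd.
move=> e Vv; apply: cvg_sumr => k; apply: cvgM; first exact: cvg_cst.
have dK : differentiable (partial k K) v by exact: (sK [:: k]).
apply: differentiable_continuous; exact: is_diff_ex (entry_diff i j dK).
Qed.

Lemma smooth_partial m p V (K : 'rV[R]_n -> 'M[R]_(m, p)) k :
  smooth_on V K -> smooth_on V (partial k K).
Proof. by move=> sK s v Vv; have := sK (rcons s k) v Vv; rewrite foldr_rcons. Qed.

Lemma C1Z V (c : R) f : C1 V f -> C1 V (fun x : 'rV[R]_n => c * f x).
Proof. by move=> cf; apply: C1M => //; exact: C1_cst. Qed.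

Lemma smooth_C2 m p V (K : 'rV[R]_n -> 'M[R]_(m, p)) i j : open V ->
  smooth_on V K -> C2 V (fun x => K x i j).
Proof.
move=> oV sK; split; first exact: smooth_C1.
move=> e; apply: (@C1_eq _ _ _ (fun x => \sum_k e 0 k * (partial k K x) i j)) => //.
  by apply: C1_sum => k; apply: C1Z; apply: smooth_C1 => //; exact: smooth_partial.
move=> x Vx; have dK : differentiable K x by exact: (sK [::]).
rewrite (is_diff_dd _ _ _ _ (entry_diff i j dK)) dd_coord summxE.
by apply: eq_bigr => k _; rewrite mxE partial_dd.
Qed.

Lemma C2_schwarz V f v a b : open V -> V v -> C2 V f ->
  dd (fun x => dd f x a) v b = dd (fun x => dd f x b) v a.
Proof.
move=> oV Vv [cf cdf]; apply: (@schwarz _ _ V f (dd f)) => //.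
  by move=> x Vx; apply: ddP; exact: C1_diff cf Vx.
by move=> e; exact: C1_diff (cdf e) Vv.
Qed.

(** The common shape of the metric and of each component of the connection: a bilinear form whose
    coefficients are functions of the point. [dqs] differentiates the coefficients only. *)
Definition qs (K : 'I_n -> 'I_n -> 'rV[R]_n -> R) v a b : R :=
  \sum_i \sum_j K i j v * a 0 i * b 0 j.

Definition dqs (K : 'I_n -> 'I_n -> 'rV[R]_n -> R) v e a b : R :=
  \sum_i \sum_j dd (K i j) v e * a 0 i * b 0 j.

Implicit Type K : 'I_n -> 'I_n -> 'rV[R]_n -> R.

Lemma qsDl K v a a' b : qs K v (a + a') b = qs K v a b + qs K v a' b.
Proof.
rewrite -big_split; apply: eq_bigr => i _; rewrite -big_split; apply: eq_bigr => j _.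
by rewrite !mxE /=; ring.
Qed.

Lemma qsDr K v a b b' : qs K v a (b + b') = qs K v a b + qs K v a b'.
Proof.
rewrite -big_split; apply: eq_bigr => i _; rewrite -big_split; apply: eq_bigr => j _.
by rewrite !mxE /=; ring.
Qed.

Lemma qsZl K v (k : R) a b : qs K v (k *: a) b = k * qs K v a b.
Proof.
rewrite mulr_sumr; apply: eq_bigr => i _; rewrite mulr_sumr; apply: eq_bigr => j _.
by rewrite !mxE /=; ring.
Qed.

Lemma qsZr K v (k : R) a b : qs K v a (k *: b) = k * qs K v a b.
Proof.
rewrite mulr_sumr; apply: eq_bigr => i _; rewrite mulr_sumr; apply: eq_bigr => j _.
by rewrite !mxE /=; ring.
Qed.

Lemma qsNl K v a b : qs K v (- a) b = - qs K v a b.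
Proof. by rewrite -scaleN1r qsZl mulN1r. Qed.

Lemma qsNr K v a b : qs K v a (- b) = - qs K v a b.
Proof. by rewrite -scaleN1r qsZr mulN1r. Qed.

Lemma qs_sym K v a b : (forall i j, K i j v = K j i v) -> qs K v a b = qs K v b a.
Proof.
move=> sK; rewrite /qs exchange_big; apply: eq_bigr => i _; apply: eq_bigr => j _.
by rewrite sK; ring.
Qed.

Lemma dqs_lin K v (k : R) e e' a b :
  dqs K v (k *: e + e') a b = k * dqs K v e a b + dqs K v e' a b.
Proof.
rewrite mulr_sumr -big_split; apply: eq_bigr => i _.
rewrite mulr_sumr -big_split; apply: eq_bigr => j _.
by rewrite ddD ddZ -[k *: dd _ _ _]/(k * dd _ _ _) /=; ring.
Qed.

Lemma dqs_curve K (x A B : R -> 'rV[R]_n) (t : R) x' A' B' :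
  (forall i j, differentiable (K i j) (x t)) ->
  is_derive t (1 : R) x x' -> is_derive t (1 : R) A A' -> is_derive t (1 : R) B B' ->
  is_derive t (1 : R) (fun s => qs K (x s) (A s) (B s))
    (dqs K (x t) x' (A t) (B t) + qs K (x t) A' (B t) + qs K (x t) (A t) B').
Proof.
move=> dK dx /derive_row dA /derive_row dB.
have H : is_derive t (1 : R) (fun s => qs K (x s) (A s) (B s))
  (\sum_i \sum_j ((dd (K i j) (x t) x' * A t 0 i + K i j (x t) * A' 0 i) * B t 0 j
     + K i j (x t) * A t 0 i * B' 0 j)).
  apply: isd_sum => i; apply: isd_sum => j.
  apply: (isdM _ _ _ _ _ (isdM _ _ _ _ _ (chain_curve (K i j) x _ _ (dK i j) dx) (dA i)) (dB j)).
apply: (isd_eq _ _ _ _ H); rewrite -!big_split; apply: eq_bigr => i _.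
rewrite -!big_split; apply: eq_bigr => j _ /=; ring.
Qed.

Lemma dqs_line K v e a b : (forall i j, differentiable (K i j) v) ->
  is_derive (0 : R) (1 : R) (fun s => qs K (v + s *: e) a b) (dqs K v e a b).
Proof.
move=> dK.
have E : v + (0 : R) *: e = v by rewrite scale0r addr0.
have := @dqs_curve K (fun s => v + s *: e) (fun=> a) (fun=> b) 0 e 0 0.
rewrite E => /(_ dK (line_derive _ _ _) (is_derive_cst _ _ _) (is_derive_cst _ _ _)).
have q0 u w : qs K v 0 w = 0 /\ qs K v u 0 = 0.
  by split; [rewrite -[0 in LHS](scale0r (0 : 'rV[R]_n)) qsZl mul0r |
             rewrite -[0 in LHS](scale0r (0 : 'rV[R]_n)) qsZr mul0r].
by rewrite (q0 a b).1 (q0 a b).2 !addr0.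
Qed.

Lemma dd_line (f : 'rV[R]_n -> R) v e : differentiable f v ->
  is_derive (0 : R) (1 : R) (fun s => f (v + s *: e)) (dd f v e).
Proof.
have E : v + (0 : R) *: e = v by rewrite scale0r addr0.
move=> df; have := @chain_curve R n R^o f (fun s => v + s *: e) 0 e.
by rewrite E => /(_ df (line_derive _ _ _)).
Qed.

Lemma is_derive_uniq (f : R -> R) (t a b : R) :
  is_derive t (1 : R) f a -> is_derive t (1 : R) f b -> a = b.
Proof. by move=> [_ <-] [_ <-]. Qed.

Lemma qs_diff K v a b : (forall i j, differentiable (K i j) v) ->
  is_diff v (fun x => qs K x a b) (fun e => dqs K v e a b).
Proof.
move=> dK.
have [Df DfE] : exists Df : 'rV[R]_n -> R, is_diff v (fun x => qs K x a b) Df.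
  exists (dd (fun x => qs K x a b) v); apply: ddP.
  have H (r : seq 'I_n) (f : 'I_n -> 'rV[R]_n -> R) :
      (forall i, differentiable (f i) v) -> differentiable (fun x => \sum_(i <- r) f i x) v.
    move=> df; elim: r => [|i r IH].
      rewrite (_ : (fun k => _) = cst 0); first exact: differentiable_cst.
      by apply/funext => k; rewrite big_nil.
    rewrite (_ : (fun k => _) = f i + fun k => \sum_(j <- r) f j k).
      exact: differentiableD.
    by apply/funext => k; rewrite big_cons.
  apply: (H) => i; apply: (H) => j.
  have dc (c : R) : differentiable (fun=> c) v by exact: differentiable_cst.
  exact: (differentiableM (differentiableM (dK i j) (dc _)) (dc _)).
have -> : (fun e => dqs K v e a b) = Df; last by [].
apply/funext => e; have df := is_diff_ex _ _ _ DfE.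
by apply: (is_derive_uniq (dqs_line e a b dK)); rewrite -(is_diff_dd _ _ _ _ DfE); exact: dd_line.
Qed.

(** Semidefiniteness has to suffice, because the form is also taken to be minus the curvature, which
    degenerates in the direction of the geodesic. *)
Lemma psd_cauchy (B : 'rV[R]_n -> 'rV[R]_n -> R) u w :
  (forall a a' b, B (a + a') b = B a b + B a' b) ->
  (forall k a b, B (k *: a) b = k * B a b) ->
  (forall a b, B a b = B b a) -> (forall a, 0 <= B a a) ->
  B u w ^+ 2 <= B u u * B w w.
Proof.
move=> BD BZ Bs Bp.
have E (k l : R) : B (k *: u + l *: w) (k *: u + l *: w) =
    k ^+ 2 * B u u + 2 * k * l * B u w + l ^+ 2 * B w w.
  rewrite BD !BZ ![B _ (_ + _)]Bs !BD !BZ [B w u]Bs; ring.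
have P k l : 0 <= k ^+ 2 * B u u + 2 * k * l * B u w + l ^+ 2 * B w w.
  by rewrite -E.
have [w0|wp] := eqVneq (B w w) 0; last first.
  have {}wp : 0 < B w w by rewrite lt_def wp Bp.
  have := P (B w w) (- B u w).
  rewrite (_ : _ + _ = B w w * (B u u * B w w - B u w ^+ 2)); last by ring.
  by rewrite pmulr_rge0// subr_ge0.
rewrite w0 mulr0; have [u0|up] := eqVneq (B u u) 0.
  have := P 1 (- B u w); rewrite w0 u0; nra.
have {}up : 0 < B u u by rewrite lt_def up Bp.
have := P (- B u w) (B u u).
rewrite (_ : _ + _ = B u u * (B u u * B w w - B u w ^+ 2)); last by ring.
by rewrite pmulr_rge0// subr_ge0 w0 mulr0.
Qed.

End BilinearFields.

Section RowFree2.
Context {R : realType} {n : nat}.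
Implicit Types u w : 'rV[R]_n.

Lemma row_free2 u w (a b : R) : row_free (col_mx u w) -> a *: u + b *: w = 0 ->
  a = 0 /\ b = 0.
Proof.
move=> fr ab.
have : mulmxr (col_mx u w) (row_mx a%:M b%:M) = mulmxr (col_mx u w) (0 : 'M[R]_(1, 1 + 1)).
  by rewrite /= mul0mx mul_row_col !mul_scalar_mx.
move=> /(row_free_inj fr); rewrite -row_mx0 => /eq_row_mx[/matrixP/(_ 0 0) + /matrixP/(_ 0 0)].
by rewrite !mxE !mulr1n.
Qed.

Lemma not_row_free2 u w : ~~ row_free (col_mx u w) ->
  w = 0 \/ exists k : R, u = k *: w.
Proof.
rewrite -kermx_eq0 => /rowV0Pn[x /sub_kermxP xk x0].
rewrite -[x]hsubmxK mul_row_col in xk.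
rewrite [lsubmx x]mx11_scalar [rsubmx x]mx11_scalar !mul_scalar_mx in xk.
set a := lsubmx x 0 0 in xk; set b := rsubmx x 0 0 in xk.
have [a0|a0] := eqVneq a 0; last first.
  right; exists (- a^-1 * b); rewrite -scalerA.
  have := congr1 (fun z => a^-1 *: z) xk; rewrite scalerDr scaler0 !scalerA mulVf// scale1r.
  by move/eqP; rewrite addr_eq0 mulNr scaleNr => /eqP.
left; move: xk; rewrite a0 scale0r add0r.
have [b0|b0] := eqVneq b 0; last first.
  by move/eqP; rewrite scaler_eq0 (negbTE b0) => /eqP.
exfalso; move/eqP: x0; apply.
rewrite -[x]hsubmxK [lsubmx x]mx11_scalar [rsubmx x]mx11_scalar -/a -/b a0 b0.
by rewrite !raddf0 row_mx0.
Qed.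

End RowFree2.

(** * Metric, connection and curvature in one chart *)

Section Chart.
Context {R : realType} {n : nat} {M : ptopologicalType} {X : manifold R n M}.
Variable g : riemannian_metric X.
Variable c : chart R n M.
Hypothesis cX : atlas X c.
Implicit Types (a b e f u v w : 'rV[R]_n).

Definition cdom := c @` dom c.

Lemma open_cdom : open cdom. Proof. exact: open_coor. Qed.

Definition gf (i j : 'I_n) v := gram g c v i j.

Lemma innerE v a b : inner g c v a b = qs gf v a b.
Proof.
rewrite /inner mxE /qs exchange_big; apply: eq_bigr => j _.
rewrite !mxE mulr_suml; apply: eq_bigr => i _; rewrite /gf; ring.
Qed.

Lemma gf_sym v i j : cdom v -> gf i j v = gf j i v.
Proof. by move=> Vv; rewrite /gf -{1}(gram_sym g cX Vv) mxE. Qed.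

Lemma inner_sym v a b : cdom v -> inner g c v a b = inner g c v b a.
Proof. by move=> Vv; rewrite !innerE; apply: qs_sym => i j; exact: gf_sym. Qed.

Lemma inner_gt0 v a : cdom v -> a != 0 -> 0 < inner g c v a a.
Proof. by move=> Vv a0; exact: gram_pos. Qed.

Lemma inner_ge0 v a : cdom v -> 0 <= inner g c v a a.
Proof.
move=> Vv; have [->|a0] := eqVneq a 0; last by rewrite ltW// inner_gt0.
by rewrite /inner mul0mx mul0mx mxE.
Qed.

Lemma innerDl v a a' b : inner g c v (a + a') b = inner g c v a b + inner g c v a' b.
Proof. by rewrite !innerE qsDl. Qed.

Lemma innerDr v a b b' : inner g c v a (b + b') = inner g c v a b + inner g c v a b'.
Proof. by rewrite !innerE qsDr. Qed.

Lemma innerZl v (k : R) a b : inner g c v (k *: a) b = k * inner g c v a b.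
Proof. by rewrite !innerE qsZl. Qed.

Lemma innerZr v (k : R) a b : inner g c v a (k *: b) = k * inner g c v a b.
Proof. by rewrite !innerE qsZr. Qed.

Lemma innerNl v a b : inner g c v (- a) b = - inner g c v a b.
Proof. by rewrite !innerE qsNl. Qed.

Lemma innerNr v a b : inner g c v a (- b) = - inner g c v a b.
Proof. by rewrite !innerE qsNr. Qed.

Lemma inner0l v b : inner g c v 0 b = 0.
Proof. by rewrite /inner !mul0mx mxE. Qed.

Lemma inner_nondeg v a : cdom v -> (forall b, inner g c v a b = 0) -> a = 0.
Proof.
move=> Vv H; apply/eqP/negPn/negP => a0.
by have := inner_gt0 Vv a0; rewrite H ltxx.
Qed.

Lemma inner_cauchy v a b : cdom v ->
  inner g c v a b ^+ 2 <= inner g c v a a * inner g c v b b.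
Proof.
move=> Vv; apply: (psd_cauchy (B := inner g c v)).
- by move=> *; exact: innerDl.
- by move=> *; exact: innerZl.
- by move=> *; exact: inner_sym.
- by move=> *; exact: inner_ge0.
Qed.

Lemma gf_C2 i j : C2 cdom (gf i j).
Proof. by apply: smooth_C2; [exact: open_cdom | exact: gram_smooth]. Qed.

Lemma gf_diff i j v : cdom v -> differentiable (gf i j) v.
Proof. by move=> Vv; have [H _] := gf_C2 i j; exact: C1_diff H Vv. Qed.

Lemma gram_unit v : cdom v -> gram g c v \in unitmx.
Proof.
move=> Vv; rewrite -row_free_unit -kermx_eq0; apply/eqP/row_matrixP => i.
rewrite row0; apply: (@inner_nondeg v) => // b.
have : row i (kermx (gram g c v)) *m gram g c v = 0.
  by rewrite -row_mul mulmx_ker row0.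
by rewrite /inner => ->; rewrite mul0mx mxE.
Qed.

Lemma partial_gram i j l v : cdom v ->
  partial i (gram g c) v j l = dd (gf j l) v (delta_mx 0 i).
Proof.
move=> Vv; have dG : differentiable (gram g c) v by exact: (gram_smooth g cX [::]).
by rewrite partial_dd// (is_diff_dd _ _ _ _ (entry_diff j l dG)).
Qed.

Lemma dgf_sym i j v e : cdom v -> dd (gf i j) v e = dd (gf j i) v e.
Proof.
move=> Vv; apply: (dd_eq_on (V := cdom)); [exact: open_cdom | by [] | | exact: gf_diff].
by move=> x; exact: gf_sym.
Qed.

Definition Gam v a b : 'rV[R]_n := \row_k qs (christoffel g c k) v a b.
Definition dGam v e a b : 'rV[R]_n := \row_k dqs (christoffel g c k) v e a b.

Lemma christoffelE k i j v : cdom v -> christoffel g c k i j v =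
  2^-1 * \sum_(l < n) invmx (gram g c v) k l *
    (dd (gf j l) v (delta_mx 0 i) + dd (gf i l) v (delta_mx 0 j)
     - dd (gf i j) v (delta_mx 0 l)).
Proof.
move=> Vv; rewrite /christoffel; congr (_ * _); apply: eq_bigr => l _.
by congr (_ * (_ + _ - _)); exact: partial_gram.
Qed.

Lemma christoffel_C1 k i j : C1 cdom (christoffel g c k i j).
Proof.
apply: (@C1_eq _ _ _ (fun v => 2^-1 * \sum_(l < n) invmx (gram g c v) k l *
    (dd (gf j l) v (delta_mx 0 i) + dd (gf i l) v (delta_mx 0 j)
     + (-1) * dd (gf i j) v (delta_mx 0 l)))).
- exact: open_cdom.
- apply: C1Z; apply: C1_sum => l; apply: C1M.
    apply: C1_invmx; first exact: open_cdom.
      by move=> i' j'; have [H _] := gf_C2 i' j'.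
    by move=> x; exact: gram_unit.
  apply: C1D; first apply: C1D.
  + by have [_ ] := gf_C2 j l; apply.
  + by have [_ ] := gf_C2 i l; apply.
  + by apply: C1Z; have [_ ] := gf_C2 i j; apply.
- by move=> v Vv; rewrite christoffelE//; congr (_ * _); apply: eq_bigr => l _; rewrite mulN1r.
Qed.

Lemma christoffel_diff k i j v : cdom v -> differentiable (christoffel g c k i j) v.
Proof. by move=> Vv; exact: C1_diff (christoffel_C1 k i j) Vv. Qed.

Lemma christoffel_sym k i j v : cdom v -> christoffel g c k i j v = christoffel g c k j i v.
Proof.
move=> Vv; rewrite (christoffelE k i j Vv) (christoffelE k j i Vv).
apply: (congr1 (fun z => 2^-1 * z)); apply: eq_bigr => l _.
apply: (congr1 (fun z => invmx (gram g c v) k l * z)).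
by rewrite (dgf_sym i j _ Vv) [X in X - _]addrC.
Qed.

Lemma dqs_gf_sym v e a b : cdom v -> dqs gf v e a b = dqs gf v e b a.
Proof.
move=> Vv; rewrite /dqs exchange_big; apply: eq_bigr => i _; apply: eq_bigr => j _.
by rewrite dgf_sym//; ring.
Qed.

(** Koszul's formula for constant coordinate fields. It cancels the inverse Gram matrix of the
    Christoffel symbols, so that metric compatibility and the change of charts follow from inner
    products alone. *)
Lemma koszul v a b w : cdom v -> 2 * inner g c v (Gam v a b) w =
  dqs gf v a b w + dqs gf v b a w - dqs gf v w a b.
Proof.
move=> Vv.
pose T : 'rV[R]_n := \row_l \sum_i \sum_j
    (dd (gf j l) v (delta_mx 0 i) + dd (gf i l) v (delta_mx 0 j)
     - dd (gf i j) v (delta_mx 0 l)) * a 0 i * b 0 j.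
have E : 2 *: Gam v a b = T *m invmx (gram g c v).
  apply/rowP => k; rewrite !mxE /qs mulr_sumr.
  under [RHS]eq_bigr do rewrite mxE mulr_suml; rewrite exchange_big /=.
  apply: eq_bigr => i _; rewrite mulr_sumr; under [RHS]eq_bigr do rewrite mulr_suml.
  rewrite exchange_big /=; apply: eq_bigr => j _.
  rewrite (christoffelE k i j Vv) !mulrA mulfV ?mul1r ?pnatr_eq0// !mulr_suml.
  apply: eq_bigr => l _.
  have -> : invmx (gram g c v) l k = invmx (gram g c v) k l.
    by rewrite -[in LHS](gram_sym g cX Vv) -trmx_inv mxE.
  ring.
rewrite -innerZl E /inner mulmxKV ?gram_unit//.
rewrite mxE; under eq_bigr do rewrite !mxE.
rewrite /dqs.
under eq_bigr => l _ do rewrite mulr_suml.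
under eq_bigr => l _ do under eq_bigr => i _ do rewrite mulr_suml.
have D (i j : 'I_n) e : dd (gf i j) v e = \sum_k e 0 k * dd (gf i j) v (delta_mx 0 k).
  by rewrite dd_coord.
under [X in _ = X + _ - _]eq_bigr => j _ do under eq_bigr => l _ do
  rewrite (D j l a) !mulr_suml.
under [X in _ = _ + X - _]eq_bigr => i _ do under eq_bigr => l _ do
  rewrite (D i l b) !mulr_suml.
under [X in _ = _ + _ - X]eq_bigr => i _ do under eq_bigr => j _ do
  rewrite (D i j w) !mulr_suml.
rewrite [X in _ = X + _ - _]exchange_big /=.
under [X in _ = X + _ - _]eq_bigr => l _ do rewrite exchange_big /=.
rewrite [X in _ = _ + X - _]exchange_big /=.
under [X in _ = _ + _ - X]eq_bigr => i _ do rewrite exchange_big /=.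
rewrite [X in _ = _ + _ - X]exchange_big /=.
rewrite -big_split -sumrB /=; apply: eq_bigr => l _.
rewrite -big_split -sumrB /=; apply: eq_bigr => i _.
rewrite -big_split -sumrB /=; apply: eq_bigr => j _; ring.
Qed.

Lemma GamC v a b : cdom v -> Gam v a b = Gam v b a.
Proof.
move=> Vv; apply/rowP => k; rewrite !mxE; apply: qs_sym => i j.
exact: christoffel_sym.
Qed.

Lemma dGamC v e a b : cdom v -> dGam v e a b = dGam v e b a.
Proof.
move=> Vv; apply/rowP => k; rewrite !mxE /dqs exchange_big.
apply: eq_bigr => i _; apply: eq_bigr => j _.
rewrite (dd_eq_on (V := cdom) (g := christoffel g c k i j) _ open_cdom Vv).
- by ring.
- by move=> x; exact: christoffel_sym.
- exact: christoffel_diff.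
Qed.

Lemma GamDl v a a' b : Gam v (a + a') b = Gam v a b + Gam v a' b.
Proof. by apply/rowP => k; rewrite !mxE qsDl. Qed.

Lemma GamDr v a b b' : Gam v a (b + b') = Gam v a b + Gam v a b'.
Proof. by apply/rowP => k; rewrite !mxE qsDr. Qed.

Lemma GamZl v (k : R) a b : Gam v (k *: a) b = k *: Gam v a b.
Proof. by apply/rowP => l; rewrite !mxE qsZl. Qed.

Lemma GamZr v (k : R) a b : Gam v a (k *: b) = k *: Gam v a b.
Proof. by apply/rowP => l; rewrite !mxE qsZr. Qed.

Lemma dGamZe v (k : R) e a b : dGam v (k *: e) a b = k *: dGam v e a b.
Proof.
apply/rowP => l; rewrite !mxE /dqs mulr_sumr; apply: eq_bigr => i _.
by rewrite mulr_sumr; apply: eq_bigr => j _; rewrite ddZ -[k *: dd _ _ _]/(k * dd _ _ _); ring.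
Qed.

Lemma dGamDe v e e' a b : dGam v (e + e') a b = dGam v e a b + dGam v e' a b.
Proof. apply/rowP => l; rewrite !mxE.
by have := dqs_lin (christoffel g c l) v 1 e e' a b; rewrite scale1r mul1r. Qed.

Lemma metric_compat v e a b : cdom v ->
  dqs gf v e a b = inner g c v (Gam v e a) b + inner g c v a (Gam v e b).
Proof.
move=> Vv; rewrite (inner_sym a _ Vv).
have := koszul e a b Vv; have := koszul e b a Vv.
by rewrite (dqs_gf_sym e b a Vv) => H1 H2; lra.
Qed.

(** R(a, b) w for constant coordinate fields, free of indices. *)
Definition Rm v a b w := dGam v a b w - dGam v b a w
  + Gam v a (Gam v b w) - Gam v b (Gam v a w).

Lemma sum_coord_dd (f : 'rV[R]_n -> R) v e :
  dd f v e = \sum_k dd f v (delta_mx 0 k) * e 0 k.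
Proof. by rewrite dd_coord; apply: eq_bigr => k _; rewrite mulrC. Qed.

Lemma curvatureE v u w : cdom v -> curvature g c v u w = Rm v u w w.
Proof.
move=> Vv; apply/rowP => l.
have P i j k m : partial i (christoffel g c k j m : _ -> R^o) v =
    dd (christoffel g c k j m) v (delta_mx 0 i).
  by rewrite partial_dd//; exact: christoffel_diff.
rewrite !mxE /qs /dqs.
under eq_bigr => k _ do under eq_bigr => i _ do under eq_bigr => j _ do
  rewrite /riemann !P !mulrDl.
under eq_bigr => k _ do under eq_bigr => i _ do rewrite !big_split /=.
under eq_bigr => k _ do rewrite !big_split /=.
rewrite !big_split /= -[RHS]addrA; congr (_ + _ + _).
- under eq_bigr => k _ do rewrite exchange_big /=.
  rewrite exchange_big /=; apply: eq_bigr => j _; apply: eq_bigr => k _.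
  rewrite [in RHS]sum_coord_dd !mulr_suml; apply: eq_bigr => i _; ring.
- rewrite -sumrN exchange_big /=; apply: eq_bigr => i _.
  rewrite -sumrN; apply: eq_bigr => k _.
  rewrite [in RHS]sum_coord_dd !mulr_suml -sumrN; apply: eq_bigr => j _; ring.
have E (x y z : 'rV[R]_n) : \sum_i \sum_j christoffel g c l i j v * x 0 i * Gam v y z 0 j =
   \sum_k \sum_i \sum_j \sum_m christoffel g c l i m v * christoffel g c m j k v
     * x 0 i * y 0 j * z 0 k.
  rewrite exchange_big /=.
  under eq_bigr => m _ do under eq_bigr => i _ do rewrite mxE /qs mulr_sumr.
  under eq_bigr => m _ do under eq_bigr => i _ do under eq_bigr => j _ do rewrite mulr_sumr.
  rewrite exchange_big /=.
  under [RHS]eq_bigr => k _ do under eq_bigr => i _ do rewrite exchange_big /=.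
  rewrite [RHS]exchange_big /=; apply: eq_bigr => i _.
  rewrite [RHS]exchange_big /=; apply: eq_bigr => m _.
  rewrite [RHS]exchange_big /=; apply: eq_bigr => j _.
  by apply: eq_bigr => k _; ring.
rewrite !E -sumrB; apply: eq_bigr => k _.
rewrite [X in _ = _ - X]exchange_big -sumrB; apply: eq_bigr => i _.
rewrite -sumrB; apply: eq_bigr => j _; rewrite -sumrB !mulr_suml; apply: eq_bigr => m _; ring.
Qed.

Lemma Gam_line v e a b : cdom v ->
  is_derive (0 : R) (1 : R) (fun s => Gam (v + s *: e) a b) (dGam v e a b).
Proof.
move=> Vv; apply/derive_row => k; rewrite mxE.
rewrite (_ : (fun s => _) = fun s => qs (christoffel g c k) (v + s *: e) a b).
  by apply: dqs_line => i j; exact: christoffel_diff.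
by apply/funext => s; rewrite mxE.
Qed.

Lemma near_line v e : cdom v -> \forall s \near (0 : R), cdom (v + s *: e).
Proof.
move=> Vv.
have c0 : (fun s : R => v + s *: e) @ nbhs (0 : R) --> v.
  have := @ex_derive _ _ _ _ _ _ _ (line_derive v e 0).
  move=> /derivable1_diffP/differentiable_continuous.
  by rewrite /prop_for/continuous_at/= scale0r addr0.
by apply: c0; apply: open_nbhs_nbhs; split => //; exact: open_cdom.
Qed.

Lemma inner_curve (x A B : R -> 'rV[R]_n) (t : R) x' A' B' : cdom (x t) ->
  is_derive t (1 : R) x x' -> is_derive t (1 : R) A A' -> is_derive t (1 : R) B B' ->
  is_derive t (1 : R) (fun s => inner g c (x s) (A s) (B s))
    (dqs gf (x t) x' (A t) (B t) + inner g c (x t) A' (B t) + inner g c (x t) (A t) B').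
Proof.
move=> Vx dx dA dB; rewrite !innerE.
rewrite (_ : (fun s => _) = fun s => qs gf (x s) (A s) (B s)).
  by apply: dqs_curve => // i j; exact: gf_diff.
by apply/funext => s; rewrite innerE.
Qed.

(* Differentiating metric compatibility once more, the second derivatives of the
   metric cancel by Schwarz. *)
Lemma Rm_skew v a b u w : cdom v ->
  inner g c v (Rm v a b u) w + inner g c v u (Rm v a b w) = 0.
Proof.
move=> Vv.
pose S f e := dqs gf v f (Gam v e u) w + inner g c v (dGam v f e u) w
  + (dqs gf v f u (Gam v e w) + inner g c v u (dGam v f e w)).
have H f e : dd (fun x => dqs gf x e u w) v f = S f e.
  have df : differentiable (fun x => dqs gf x e u w) v.
    have c1 : C1 cdom (fun x => dqs gf x e u w).
      apply: C1_sum => i; apply: C1_sum => j.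
      apply: C1M; last exact: C1_cst.
      apply: C1M; last exact: C1_cst.
      by have [_ ] := gf_C2 i j; apply.
    exact: C1_diff c1 Vv.
  have := dd_line f df => D1.
  have E0 : v + (0 : R) *: f = v by rewrite scale0r addr0.
  have V0 : cdom (v + (0 : R) *: f) by rewrite E0.
  have D2 := inner_curve V0 (line_derive v f 0) (Gam_line f e u Vv) (is_derive_cst w (0 : R) (1 : R)).
  have D3 := inner_curve V0 (line_derive v f 0) (is_derive_cst u (0 : R) (1 : R)) (Gam_line f e w Vv).
  rewrite E0 in D2 D3.
  have D4 := isdD _ _ _ _ _ D2 D3.
  rewrite (inner_sym _ 0 Vv) !inner0l addr0 in D4.
  have E : \forall s \near (0 : R), inner g c (v + s *: f) (Gam (v + s *: f) e u) w
      + inner g c (v + s *: f) u (Gam (v + s *: f) e w) = dqs gf (v + s *: f) e u w.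
    have := near_line f Vv; apply: filterS => s Vs.
    by rewrite metric_compat.
  have D5 : is_derive (0 : R) (1 : R) (fun s : R => dqs gf (v + s *: f) e u w) _ :=
    near_eq_is_derive E D4.
  by rewrite (is_derive_uniq D1 D5) /S addr0.
have Sym f e : S f e = S e f.
  rewrite -!H; have qd x h : cdom x ->
      is_diff x (fun x => qs gf x u w) (fun h => dqs gf x h u w).
    by move=> Vx; apply: qs_diff => i j; exact: gf_diff.
  apply: (@schwarz _ _ cdom (fun x => qs gf x u w)
    (fun x e => dqs gf x e u w)) => //; [exact: open_cdom | by move=> x Vx; exact: qd |].
  move=> h; have c1 : C1 cdom (fun x => dqs gf x h u w).
    apply: C1_sum => i; apply: C1_sum => j.
    apply: C1M; last exact: C1_cst.
    apply: C1M; last exact: C1_cst.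
    by have [_ ] := gf_C2 i j; apply.
  exact: C1_diff c1 Vv.
have := Sym a b; rewrite /S !metric_compat// /Rm.
rewrite !(innerDl, innerNl, innerDr, innerNr); lra.
Qed.

Lemma Rm_anti v a b u : Rm v a b u = - Rm v b a u.
Proof. by rewrite /Rm; apply/rowP => k; rewrite !mxE; ring. Qed.

Lemma Rm_bianchi v a b u : cdom v -> Rm v a b u + Rm v b u a + Rm v u a b = 0.
Proof.
move=> Vv; rewrite /Rm (dGamC a b u Vv) (dGamC b u a Vv) (dGamC u a b Vv).
rewrite (GamC b u Vv) (GamC a u Vv) (GamC a b Vv).
by apply/rowP => k; rewrite !mxE; ring.
Qed.

(** Self-adjointness of the Jacobi operator sending a to R(a, w) w. It is an instance of pair
    symmetry and follows by linear elimination from antisymmetry, skewness and the Bianchi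
    identity. *)
Lemma Rm_sym v w a b : cdom v ->
  inner g c v (Rm v a w w) b = inner g c v (Rm v b w w) a.
Proof.
move=> Vv.
pose r a b u w := inner g c v (Rm v a b u) w.
have A a' b' u' w' : r a' b' u' w' = - r b' a' u' w'.
  by rewrite /r [in LHS]Rm_anti innerNl.
have K a' b' u' w' : r a' b' u' w' = - r a' b' w' u'.
  have := Rm_skew a' b' u' w' Vv; rewrite (inner_sym u' _ Vv) -/(r _ _ _ _).
  by rewrite -[inner _ _ _ _ u']/(r _ _ _ _); lra.
have B a' b' u' w' : r a' b' u' w' + r b' u' a' w' + r u' a' b' w' = 0.
  by rewrite /r -!innerDl Rm_bianchi// inner0l.
rewrite -/(r a w w b) -/(r b w w a).
have := B a w w b; have := B w b a w; have := B b a w w.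
have := K b a w w; have := K w w a b; have := A w w a b.
have := K w b a w; have := A b w w a; have := A w w b a.
have := K a w w b; have := A w a w b; have := A w a b w; have := K w w b a.
have := A a w b w; have := A w b w a; have := K a w b w.
have := B a w b w; have := A a b w w; have := K a b w w; have := K b w w a.
have := A w b a w.
lra.
Qed.

Lemma RmDl v a a' w : Rm v (a + a') w w = Rm v a w w + Rm v a' w w.
Proof.
have D v' a1 a2 b1 b2 : dGam v' a1 (b1 + b2) a2 = dGam v' a1 b1 a2 + dGam v' a1 b2 a2.
  apply/rowP => l; rewrite !mxE /dqs -big_split; apply: eq_bigr => i _.
  by rewrite -big_split; apply: eq_bigr => j _; rewrite !mxE /=; ring.
rewrite /Rm dGamDe D GamDl (GamDl v a a' w) GamDr.
by apply/rowP => k; rewrite !mxE; ring.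
Qed.

Lemma RmZl v (k : R) a w : Rm v (k *: a) w w = k *: Rm v a w w.
Proof.
have D v' a1 a2 b1 : dGam v' a1 (k *: b1) a2 = k *: dGam v' a1 b1 a2.
  apply/rowP => l; rewrite !mxE /dqs mulr_sumr; apply: eq_bigr => i _.
  by rewrite mulr_sumr; apply: eq_bigr => j _; rewrite !mxE /=; ring.
rewrite /Rm dGamZe D !GamZl GamZr.
by apply/rowP => l; rewrite !mxE; ring.
Qed.

Lemma Rm_refl v w : Rm v w w w = 0.
Proof. by rewrite /Rm; apply/rowP => l; rewrite !mxE; ring. Qed.

Lemma Rm0 v a : Rm v a 0 0 = 0.
Proof.
have D v' a1 b1 : dGam v' a1 b1 0 = 0.
  apply/rowP => l; rewrite !mxE /dqs big1// => i _; rewrite big1// => j _.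
  by rewrite mxE mulr0.
have E v' b1 : Gam v' b1 0 = 0 by rewrite -[0 in LHS](scale0r (0 : 'rV[R]_n)) GamZr scale0r.
by rewrite /Rm !D !E; apply/rowP => l; rewrite !mxE; ring.
Qed.

Variable c_m : R.
Hypothesis c_m0 : 0 < c_m.
Hypothesis Hsec : sectional_bounds g (- c_m) 0.

(** For independent vectors the Gram determinant is positive and the denominator of the sectional
    curvature can be cleared; dropping the square in it weakens only the lower bound. For dependent
    vectors the form vanishes because R(w, w) w = 0. *)
Lemma Rm_bounds v u w : cdom v ->
  - c_m * (inner g c v u u * inner g c v w w) <= inner g c v (Rm v u w w) u <= 0.
Proof.
move=> Vv; have uu := inner_ge0 u Vv; have ww := inner_ge0 w Vv.
have [fr|nfr] := boolP (row_free (col_mx u w)).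
  have D0 : 0 < inner g c v u u * inner g c v w w - inner g c v u w ^+ 2.
    rewrite lt_def subr_ge0 inner_cauchy// andbT; apply/eqP => D0.
    (* Up to a factor, [z] is the part of [u] orthogonal to [w]; its squared norm is the Gram
       determinant times that of [w]. *)
    pose z := inner g c v w w *: u - inner g c v u w *: w.
    have zz : inner g c v z z = inner g c v w w *
        (inner g c v u u * inner g c v w w - inner g c v u w ^+ 2).
      rewrite /z !(innerDl, innerDr, innerNl, innerNr, innerZl, innerZr).
      by rewrite (inner_sym w u Vv); ring.
    have z0 : z = 0.
      by apply/eqP/negPn/negP => /(inner_gt0 Vv); rewrite zz D0 mulr0 ltxx.
    have [ww0 _] : inner g c v w w = 0 /\ - inner g c v u w = 0.
      by apply: (row_free2 fr); rewrite scaleNr.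
    have w0 : w = 0.
      by apply/eqP/negPn/negP => /(inner_gt0 Vv); rewrite ww0 ltxx.
    have [_ /eqP] : (0 : R) = 0 /\ (1 : R) = 0.
      by apply: (row_free2 fr); rewrite w0 scaler0 scale0r addr0.
    by rewrite oner_eq0.
  case: Vv => x dx xv; have := Hsec cX dx fr; rewrite xv /sectional.
  rewrite curvatureE; last by exists x.
  set q := inner g c v (Rm _ _ _ _) u; set D := _ - _ in D0 *.
  rewrite ler_pdivlMr// ler_pdivrMr// mul0r => /andP[q1 ->]; rewrite andbT.
  apply: le_trans q1; rewrite !mulNr lerN2; apply: ler_wpM2l; first exact: ltW.
  by rewrite /D lerBlDr lerDl sqr_ge0.
have z0 : inner g c v (Rm v u w w) u = 0.
  have [->|[k ->]] := not_row_free2 nfr; first by rewrite Rm0 inner0l.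
  by rewrite RmZl Rm_refl scaler0 inner0l.
by rewrite z0 lexx andbT mulNr oppr_le0 !mulr_ge0// ltW.
Qed.

(** Non-positive curvature makes the form semidefinite, so Cauchy-Schwarz turns the bounds on its
    diagonal values into a bound on the operator norm. *)
Lemma Rm_op_bound v a b w : cdom v ->
  inner g c v (Rm v a w w) b ^+ 2 <=
    (c_m * inner g c v w w) ^+ 2 * (inner g c v a a * inner g c v b b).
Proof.
move=> Vv.
have := @psd_cauchy _ _ (fun a b => - inner g c v (Rm v a w w) b) a b.
rewrite sqrrN => /(_ _ _ _ _)/le_trans; apply.
- by move=> x y z; rewrite RmDl innerDl opprD.
- by move=> k x y; rewrite RmZl innerZl mulrN.
- by move=> x y; rewrite Rm_sym.
- by move=> x; rewrite oppr_ge0; case/andP: (Rm_bounds x w Vv).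
rewrite mulrNN.
have /andP[la ua] := Rm_bounds a w Vv; have /andP[lb ub] := Rm_bounds b w Vv.
rewrite mulNr in la; rewrite mulNr in lb.
have ww := inner_ge0 w Vv; have aa := inner_ge0 a Vv; have bb := inner_ge0 b Vv.
rewrite -[X in X <= _]mulrNN.
rewrite (_ : _ * (inner g c v a a * _) = (c_m * (inner g c v a a * inner g c v w w)) *
  (c_m * (inner g c v b b * inner g c v w w))); last by ring.
by apply: ler_pM; rewrite ?oppr_ge0// lerNl.
Qed.

End Chart.

(** * Change of charts *)

Section ChartChange.
Context {R : realType} {n : nat} {M : ptopologicalType} {X : manifold R n M}.
Variable g : riemannian_metric X.
Variables c c' : chart R n M.
Hypothesis cX : atlas X c.
Hypothesis c'X : atlas X c'.
Implicit Types (a b e f u v w : 'rV[R]_n).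

Definition trans : 'rV[R]_n -> 'rV[R]_n := c' \o param c.
Definition tdom := c @` (dom c `&` dom c').

Lemma tdom_cdom v : tdom v -> cdom c v.
Proof. by move=> [x [dx _] <-]; exists x. Qed.

Lemma trans_cdom v : tdom v -> cdom c' (trans v).
Proof. by move=> [x [dx dx'] <-]; exists x => //; rewrite /trans /= coorK. Qed.

Lemma open_tdom : open tdom.
Proof.
rewrite openE => v [x [dx dx'] xv].
have Vv : cdom c v by exists x.
have h1 : nbhs v (cdom c) by apply: open_nbhs_nbhs; split => //; exact: open_cdom.
have h2 : nbhs v (param c @^-1` dom c').
  apply: (param_continuous Vv); rewrite -xv coorK//.
  by apply: open_nbhs_nbhs; split => //; exact: open_dom.
move: h1 h2; rewrite /interior /=; apply: filterS2 => u [y dy <-].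
by rewrite /= coorK// => dy'; exists y.
Qed.

Lemma trans_smooth : smooth_on tdom trans.
Proof. exact: (atlas_smooth cX c'X). Qed.

Lemma trans_C2 k : C2 tdom (fun v => trans v 0 k).
Proof. by apply: smooth_C2; [exact: open_tdom | exact: trans_smooth]. Qed.

Lemma trans_diff v : tdom v -> differentiable trans v.
Proof. by move=> Vv; exact: (trans_smooth [::] Vv). Qed.

Lemma dd_trans_coord v a k : tdom v -> dd trans v a 0 k = dd (fun v => trans v 0 k) v a.
Proof. by move=> Vv; rewrite (is_diff_dd _ _ _ _ (entry_diff 0 k (trans_diff Vv))). Qed.

Lemma inner_trans v a b : tdom v ->
  inner g c v a b = inner g c' (trans v) (dd trans v a) (dd trans v b).
Proof.
move=> [x [dx dx'] <-]; rewrite {1}/inner (gram_change g cX c'X dx dx').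
by rewrite /inner !dd_jacobian /trans /= coorK// trmx_mul !mulmxA.
Qed.

Definition hess v a b : 'rV[R]_n := \row_k dd (fun x => dd trans x a 0 k) v b.

Lemma dtrans_C1 a k : C1 tdom (fun x => dd trans x a 0 k).
Proof.
apply: (@C1_eq _ _ _ (fun x => dd (fun v => trans v 0 k) x a)).
- exact: open_tdom.
- by have [_ ] := trans_C2 k; apply.
- by move=> x Vx; rewrite dd_trans_coord.
Qed.

Lemma hess_sym v a b : tdom v -> hess v a b = hess v b a.
Proof.
move=> Vv; apply/rowP => k; rewrite !mxE.
have E x y : dd (fun x => dd trans x y 0 k) v x = dd (fun x => dd (fun v => trans v 0 k) x y) v x.
  apply: (dd_eq_on (V := tdom)) => //; first exact: open_tdom.
    by move=> z Vz; rewrite dd_trans_coord.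
  exact: C1_diff (dtrans_C1 y k) Vv.
by rewrite !E; apply: (C2_schwarz (V := tdom)) => //; [exact: open_tdom | exact: trans_C2].
Qed.

Lemma dtrans_line v e a : tdom v ->
  is_derive (0 : R) (1 : R) (fun s => dd trans (v + s *: e) a) (hess v a e).
Proof.
move=> Vv; apply/derive_row => k; rewrite mxE.
by apply: (dd_line (f := fun x => dd trans x a 0 k)); exact: C1_diff (dtrans_C1 a k) Vv.
Qed.

Lemma dtrans_surj v b : tdom v -> exists a, dd trans v a = b.
Proof.
move=> Vv; have u : jacobian trans v \in unitmx.
  rewrite -row_free_unit -kermx_eq0; apply/eqP/row_matrixP => i.
  rewrite row0; apply: (inner_nondeg (g := g) cX (v := v)); first exact: tdom_cdom.
  move=> a; rewrite inner_trans// dd_jacobian -row_mul mulmx_ker row0.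
  exact: inner0l.
exists (b *m invmx (jacobian trans v)).
by rewrite dd_jacobian mulmxKV.
Qed.

(* Koszul's formula in both charts, with [inner_trans] differentiated once. *)
Lemma Gam_trans v a b : tdom v -> dd trans v (Gam g c v a b) =
  hess v a b + Gam g c' (trans v) (dd trans v a) (dd trans v b).
Proof.
move=> Vv; have Vc := tdom_cdom Vv; have Vc' := trans_cdom Vv.
have D w x y : dqs (gf g c) v w x y = dqs (gf g c') (trans v) (dd trans v w) (dd trans v x) (dd trans v y)
   + inner g c' (trans v) (hess v x w) (dd trans v y)
   + inner g c' (trans v) (dd trans v x) (hess v y w).
  have E0 : v + (0 : R) *: w = v by rewrite scale0r addr0.
  have D1 := dqs_line w x y (fun i j => gf_diff g cX i j Vc).
  have dl : is_derive (0 : R) (1 : R) (trans \o (fun s : R => v + s *: w)) (dd trans v w).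
    rewrite -{2}E0; apply: chain_curve; last exact: line_derive.
    by rewrite E0; exact: trans_diff.
  have V0 : cdom c' ((trans \o (fun s : R => v + s *: w)) 0) by rewrite /= E0.
  have D2 := inner_curve g c'X V0 dl (dtrans_line w x Vv) (dtrans_line w y Vv).
  rewrite /= E0 in D2.
  have E : \forall s \near (0 : R), inner g c' (trans (v + s *: w)) (dd trans (v + s *: w) x)
     (dd trans (v + s *: w) y) = qs (gf g c) (v + s *: w) x y.
    have c0 : (fun s : R => v + s *: w) @ nbhs (0 : R) --> v.
      have := @ex_derive _ _ _ _ _ _ _ (line_derive v w 0).
      move=> /derivable1_diffP/differentiable_continuous.
      by rewrite /prop_for/continuous_at/= scale0r addr0.
    have : \forall s \near (0 : R), tdom (v + s *: w).
      by apply: c0; apply: open_nbhs_nbhs; split => //; exact: open_tdom.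
    by apply: filterS => s Vs; rewrite -innerE inner_trans.
  have D3 : is_derive (0 : R) (1 : R) (fun s : R => qs (gf g c) (v + s *: w) x y) _ :=
    near_eq_is_derive E D2.
  exact: (is_derive_uniq D1 D3).
have K w : 2 * inner g c v (Gam g c v a b) w = 2 * (
   inner g c' (trans v) (Gam g c' (trans v) (dd trans v a) (dd trans v b)) (dd trans v w)
   + inner g c' (trans v) (hess v a b) (dd trans v w)).
  rewrite mulrDr koszul// koszul// !D (hess_sym w a Vv) (hess_sym w b Vv) (hess_sym b a Vv).
  move: (dd trans v a) (dd trans v b) (dd trans v w) => da db dw.
  move: (hess v a b) (hess v a w) (hess v b w) (trans v) Vc' => hab haw hbw p Vp.
  rewrite (inner_sym g c'X db _ Vp) (inner_sym g c'X da _ Vp) (inner_sym g c'X _ db Vp).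
  by ring.
apply/eqP; rewrite -subr_eq0; apply/eqP; apply: (inner_nondeg (g := g) c'X Vc') => b'.
have [w <-] := dtrans_surj b' Vv.
rewrite innerDl innerNl innerDl -inner_trans//.
by have := K w; lra.
Qed.

End ChartChange.

Opaque christoffel.

(** * Geodesics in charts *)

Section RealCalculus.
Context {R : realType}.
Implicit Types (f : R -> R) (a b s t K : R).

Lemma isd_derivable f t a : is_derive t (1 : R) f a -> derivable f t 1.
Proof. by case. Qed.

Lemma isd_continuous f t a : is_derive t (1 : R) f a -> f @ nbhs t --> f t.
Proof. by move=> [/derivable1_diffP/differentiable_continuous]. Qed.

Lemma mvt_isd f df a b : a <= b -> (forall t, a <= t <= b -> is_derive t (1 : R) f (df t)) ->
  exists2 t, a <= t <= b & f b - f a = df t * (b - a).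
Proof.
move=> ab H.
have [||t] := @MVT_segment R f df a b ab.
- by move=> s; rewrite in_itv /= => /andP[s0 s1]; apply: H; rewrite !ltW.
- apply: derivable_within_continuous => s; rewrite in_itv /= => s01.
  exact: isd_derivable (H s s01).
by rewrite in_itv /= => t01 ->; exists t.
Qed.

Lemma isd0_const f a b : a <= b ->
  (forall t, a <= t <= b -> is_derive t (1 : R) f 0) -> f a = f b.
Proof.
move=> ab H; have [t _ /eqP] := mvt_isd ab H.
by rewrite mul0r subr_eq0 => /eqP.
Qed.

Lemma isd_expR K t : is_derive t (1 : R) (fun s => expR (K * s)) (K * expR (K * t)).
Proof.
have H := isdM _ _ _ _ _ (isd_cst K t) (isd_id t).
have := @is_derive1_comp R (@expR R) (fun s => K * s) t _ _ (is_derive_expR _) H.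
by move=> H'; apply: (isd_eq _ _ _ _ H'); ring.
Qed.

Lemma gronwall f df K a b : a <= b ->
  (forall t, a <= t <= b -> is_derive t (1 : R) f (df t)) ->
  (forall t, a <= t <= b -> df t <= K * f t) ->
  f b <= expR (K * (b - a)) * f a.
Proof.
move=> ab H Hle.
have H2 t : a <= t <= b -> is_derive t (1 : R) (fun s => f s * expR (- K * s))
    (df t * expR (- K * t) + f t * (- K * expR (- K * t))).
  by move=> tab; exact: isdM (H t tab) (isd_expR _ _).
have [t tab E] := mvt_isd ab H2.
have : f b * expR (- K * b) - f a * expR (- K * a) <= 0.
  rewrite E mulr_le0_ge0 ?subr_ge0//.
  rewrite (_ : _ + _ = (df t - K * f t) * expR (- K * t)); last by ring.
  by rewrite mulr_le0_ge0 ?expR_ge0// subr_le0 Hle.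
rewrite subr_le0 => h.
have e0 : 0 < expR (K * b) by exact: expR_gt0.
rewrite -(ler_pM2r e0) in h; move: h.
rewrite -!mulrA -!expRD (_ : - K * b + K * b = 0); last by ring.
by rewrite expR0 mulr1 mulrC (_ : - K * a + K * b = K * (b - a)) //; ring.
Qed.

Lemma lip_isd f df K a b : a <= b ->
  (forall t, a <= t <= b -> is_derive t (1 : R) f (df t)) ->
  (forall t, a <= t <= b -> `|df t| <= K) -> `|f b - f a| <= K * (b - a).
Proof.
move=> ab H HK; have [t tab ->] := mvt_isd ab H.
by rewrite normrM [X in _ * X]ger0_norm ?subr_ge0// ler_wpM2r ?subr_ge0// HK.
Qed.

End RealCalculus.

Section CvgForms.
Context {R : realType} {n : nat} {I : Type} {F : set_system I} {FF : Filter F}.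

Lemma cvg_qs (K : 'I_n -> 'I_n -> 'rV[R]_n -> R) (x a b : I -> 'rV[R]_n) x0 a0 b0 :
  (forall i j, K i j @ nbhs x0 --> K i j x0) ->
  x @ F --> x0 -> a @ F --> a0 -> b @ F --> b0 ->
  (fun k => qs K (x k) (a k) (b k)) @ F --> qs K x0 a0 b0.
Proof.
move=> cK cx /cvg_rowP ca /cvg_rowP cb.
apply: cvg_sumr => i; apply: cvg_sumr => j.
exact: (cvgM (cvgM (cvg_comp _ _ cx (cK i j)) (ca i)) (cb j)).
Qed.

Lemma qs_sub (K : 'I_n -> 'I_n -> 'rV[R]_n -> R) x y v w :
  qs K x v v - qs K y w w = qs (fun i j _ => K i j x - K i j y) y v v
     + (qs K y (v - w) v + qs K y w (v - w)).
Proof.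
rewrite /qs -!big_split -sumrB; apply: eq_bigr => i _.
rewrite -!big_split -sumrB; apply: eq_bigr => j _; rewrite !mxE /=; ring.
Qed.

Lemma norm_qs_le (K : 'I_n -> 'I_n -> 'rV[R]_n -> R) (B : R) x a b : 0 <= B ->
  (forall i j, `|K i j x| <= B) -> `|qs K x a b| <= n%:R ^+ 2 * B * `|a| * `|b|.
Proof.
move=> B0 KB; rewrite /qs.
apply: le_trans (ler_norm_sum _ _ _) _.
apply: (@le_trans _ _ (\sum_(i < n) \sum_(j < n) B * `|a| * `|b|)).
  apply: ler_sum => i _; apply: le_trans (ler_norm_sum _ _ _) _.
  apply: ler_sum => j _; rewrite !normrM.
  by apply: ler_pM; rewrite ?mulr_ge0//; [apply: ler_pM => // | ]; exact: coord_le_norm.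
rewrite !sumr_const !card_ord -mulrnA -[X in X <= _]mulr_natr natrM expr2.
by rewrite le_eqVlt; apply/orP; left; apply/eqP; ring.
Qed.

Lemma qs_lip (K : 'I_n -> 'I_n -> 'rV[R]_n -> R) (K2 Vb : R) x y v w : 0 <= K2 -> 0 <= Vb ->
  (forall i j, `|K i j x - K i j y| <= K2 * `|x - y|) -> (forall i j, `|K i j y| <= K2) ->
  `|v| <= Vb -> `|w| <= Vb ->
  `|qs K x v v - qs K y w w| <= n%:R ^+ 2 * K2 * (Vb * Vb + 2 * Vb) * (`|x - y| + `|v - w|).
Proof.
move=> K20 Vb0 HL HB v1 v2; rewrite qs_sub.
have Kxy : 0 <= K2 * `|x - y| by rewrite mulr_ge0.
have h1 := @norm_qs_le (fun i j _ => K i j x - K i j y) (K2 * `|x - y|) y v v Kxy HL.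
have h2 := @norm_qs_le K K2 y (v - w) v K20 HB.
have h3 := @norm_qs_le K K2 y w (v - w) K20 HB.
have [N N0 HN] : exists2 N : R, 0 <= N & n%:R ^+ 2 = N by exists (n%:R ^+ 2) => //; rewrite exprn_ge0.
rewrite HN in h1; rewrite HN in h2; rewrite HN in h3; rewrite HN.
have a0 := normr_ge0 (x - y); have b0 := normr_ge0 (v - w).
have NK : 0 <= N * K2 by rewrite mulr_ge0.
apply: le_trans (ler_normD _ _) _; apply: (@le_trans _ _ (N * K2 * (Vb * Vb) * `|x - y| +
    (N * K2 * Vb * `|v - w| + N * K2 * Vb * `|v - w|))).
  apply: lerD; last (apply: le_trans (ler_normD _ _) _; apply: lerD).
  - apply: le_trans h1 _.
    rewrite (_ : N * (K2 * `|x - y|) * `|v| * `|v| = N * K2 * `|x - y| * (`|v| * `|v|)); last by ring.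
    rewrite [leRHS](_ : _ = N * K2 * `|x - y| * (Vb * Vb)); last by ring.
    by apply: ler_wpM2l; [rewrite mulr_ge0 | apply: ler_pM].
  - apply: le_trans h2 _; rewrite [leRHS](_ : _ = N * K2 * `|v - w| * Vb); last by ring.
    by apply: ler_wpM2l; rewrite ?mulr_ge0.
  - by apply: le_trans h3 _; apply: ler_wpM2r => //; apply: ler_wpM2l.
have p1 : 0 <= N * K2 * Vb * `|x - y| by rewrite !mulr_ge0.
have p2 : 0 <= N * K2 * (Vb * Vb) * `|v - w| by rewrite !mulr_ge0.
by move: p1 p2; set q := N * K2; move: (`|x - y|) (`|v - w|) => a b; nra.
Qed.

Lemma energy_deriv_bound (dx dv A : 'rV[R]_n) (C E : R) : 0 <= C ->
  `|dx| ^+ 2 + `|dv| ^+ 2 <= E -> `|A| <= C * (`|dx| + `|dv|) ->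
  \sum_i (2 * dx 0 i * dv 0 i - 2 * dv 0 i * A 0 i) <= n%:R * (1 + 3 * C) * E.
Proof.
move=> C0 nE ad.
apply: (@le_trans _ _ (\sum_(i < n) ((1 + 3 * C) * E))); last first.
  by rewrite sumr_const card_ord -[X in X <= _]mulr_natl mulrA.
apply: ler_sum => i _.
have a1 := coord_le_norm dx i; have a2 := coord_le_norm dv i.
have a3 := le_trans (coord_le_norm A i) ad.
apply: (@le_trans _ _ (2 * (`|dx| * `|dv|) + 2 * (`|dv| * (C * (`|dx| + `|dv|))))).
  rewrite -!mulrA; apply: lerD.
    apply: ler_wpM2l => //; apply: le_trans (ler_norm _) _; rewrite normrM.
    exact: ler_pM.
  rewrite -mulrN; apply: ler_wpM2l => //; apply: le_trans (ler_norm _) _.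
  rewrite normrN normrM; exact: ler_pM.
have b1 : 0 <= (`|dx| - `|dv|) ^+ 2 by exact: sqr_ge0.
move: nE b1 (normr_ge0 dx) (normr_ge0 dv); move: (`|dx|) (`|dv|) => x y nE b1 x0 y0.
have c1 : C * (2 * (x * y) + 2 * y ^+ 2) <= C * (3 * E).
  by apply: ler_wpM2l => //; have := sqr_ge0 x; have := sqr_ge0 y; nra.
nra.
Qed.

Lemma energy_isd (x1 x2 v1 v2 : R -> 'rV[R]_n) (A1 A2 : 'rV[R]_n) (t : R) :
  is_derive t (1 : R) x1 (v1 t) -> is_derive t (1 : R) x2 (v2 t) ->
  is_derive t (1 : R) v1 (- A1) -> is_derive t (1 : R) v2 (- A2) ->
  is_derive t (1 : R) (fun z => \sum_i ((x1 z 0 i - x2 z 0 i) * (x1 z 0 i - x2 z 0 i)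
      + (v1 z 0 i - v2 z 0 i) * (v1 z 0 i - v2 z 0 i)))
    (\sum_i (2 * (x1 t - x2 t) 0 i * (v1 t - v2 t) 0 i - 2 * (v1 t - v2 t) 0 i * (A1 - A2) 0 i)).
Proof.
move=> /derive_row p1 /derive_row p2 /derive_row q1 /derive_row q2.
apply: isd_sum => i.
have D1 := isdD _ _ _ _ _ (p1 i) (isdN _ _ _ (p2 i)).
have D2 := isdD _ _ _ _ _ (q1 i) (isdN _ _ _ (q2 i)).
have D := isdD _ _ _ _ _ (isdM _ _ _ _ _ D1 D1) (isdM _ _ _ _ _ D2 D2).
by apply: (isd_eq _ _ _ _ D); rewrite !mxE; ring.
Qed.

Lemma sqr_norm_le_sum (u : 'rV[R]_n) : `|u| ^+ 2 <= \sum_i u 0 i ^+ 2.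
Proof.
have S0 : 0 <= \sum_i u 0 i ^+ 2 by rewrite sumr_ge0// => i _; exact: sqr_ge0.
rewrite -(sqr_sqrtr S0) lerXn2r ?nnegrE ?sqrtr_ge0//.
apply: norm_le_coord; first exact: sqrtr_ge0.
move=> i; rewrite -sqrtr_sqr ler_wsqrtr// (bigD1 i)//= lerDl sumr_ge0// => j _.
exact: sqr_ge0.
Qed.

Lemma sum_le_sqr_norm (u : 'rV[R]_n) : \sum_i u 0 i ^+ 2 <= n%:R * `|u| ^+ 2.
Proof.
apply: (@le_trans _ _ (\sum_(i < n) `|u| ^+ 2)).
  by apply: ler_sum => i _; rewrite -real_normK ?num_real// lerXn2r ?nnegrE// coord_le_norm.
by rewrite sumr_const card_ord mulr_natl.
Qed.

(** Gronwall's inequality is applied to the sum [E] of the squares of the coordinates in phase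
    space, because the maximum norm is not differentiable; going back to the norm costs the factor
    [n%:R]. *)
Lemma ode_gronwall (x1 x2 v1 v2 A1 A2 : R -> 'rV[R]_n) (C a b : R) : a <= b -> 0 <= C ->
  (forall t, a <= t <= b ->
    [/\ is_derive t (1 : R) x1 (v1 t), is_derive t (1 : R) x2 (v2 t),
      is_derive t (1 : R) v1 (- A1 t) & is_derive t (1 : R) v2 (- A2 t)]) ->
  (forall t, a <= t <= b -> `|A1 t - A2 t| <= C * (`|x1 t - x2 t| + `|v1 t - v2 t|)) ->
  `|x1 b - x2 b| + `|v1 b - v2 b| <= (2 * expR (n%:R * (1 + 3 * C) * (b - a)) * n%:R + 1) *
     (`|x1 a - x2 a| + `|v1 a - v2 a|).
Proof.
move=> ab C0 HD HA.
pose E z := \sum_i ((x1 z 0 i - x2 z 0 i) * (x1 z 0 i - x2 z 0 i)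
      + (v1 z 0 i - v2 z 0 i) * (v1 z 0 i - v2 z 0 i)).
have EE z : E z = \sum_i (x1 z - x2 z) 0 i ^+ 2 + \sum_i (v1 z - v2 z) 0 i ^+ 2.
  by rewrite -big_split; apply: eq_bigr => i _; rewrite !mxE.
have HE t : a <= t <= b -> is_derive t (1 : R) E
    (\sum_i (2 * (x1 t - x2 t) 0 i * (v1 t - v2 t) 0 i - 2 * (v1 t - v2 t) 0 i * (A1 t - A2 t) 0 i)).
  by move=> /HD[h1 h2 h3 h4]; exact: energy_isd.
have nE z : `|x1 z - x2 z| ^+ 2 + `|v1 z - v2 z| ^+ 2 <= E z.
  by rewrite EE; apply: lerD; apply: sqr_norm_le_sum.
have HdE t : a <= t <= b -> \sum_i (2 * (x1 t - x2 t) 0 i * (v1 t - v2 t) 0 i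
     - 2 * (v1 t - v2 t) 0 i * (A1 t - A2 t) 0 i) <= n%:R * (1 + 3 * C) * E t.
  by move=> tab; apply: energy_deriv_bound => //; exact: HA.
have G := gronwall ab HE HdE; move: G (nE b).
have F2 : E a <= n%:R * (`|x1 a - x2 a| ^+ 2 + `|v1 a - v2 a| ^+ 2).
  by rewrite EE mulrDr; apply: lerD; apply: sum_le_sqr_norm.
move: F2; move: (normr_ge0 (x1 a - x2 a)) (normr_ge0 (v1 a - v2 a)).
move: (normr_ge0 (x1 b - x2 b)) (normr_ge0 (v1 b - v2 b)).
have := expR_ge0 (n%:R * (1 + 3 * C) * (b - a)).
have : 0 <= n%:R :> R by [].
move: (expR (n%:R * (1 + 3 * C) * (b - a))).
move: (n%:R : R) (E a) (E b).
move: (`|x1 a - x2 a|) (`|v1 a - v2 a|) (`|x1 b - x2 b|) (`|v1 b - v2 b|).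
move=> xa va xb vb N Ea Eb e N0 e0 xb0 vb0 xa0 va0 F2 G G3.
rewrite -(@ler_pXn2r _ 2)// ?nnegrE ?addr_ge0// ?mulr_ge0 ?addr_ge0 ?mulr_ge0//.
have h1 : (xb + vb) ^+ 2 <= 2 * Eb by have := sqr_ge0 (xb - vb); nra.
have h2 : Eb <= e * (N * (xa ^+ 2 + va ^+ 2)) by apply: le_trans G _; exact: ler_wpM2l.
have h3 : xa ^+ 2 + va ^+ 2 <= (xa + va) ^+ 2 by have := mulr_ge0 xa0 va0; nra.
have eN : 0 <= e * N by rewrite mulr_ge0.
have h4 : e * N * (xa ^+ 2 + va ^+ 2) <= e * N * (xa + va) ^+ 2 by exact: ler_wpM2l.
apply: (@le_trans _ _ (2 * (e * N) * (xa + va) ^+ 2)); first by move: h1 h2 h4; rewrite !mulrA; lra.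
rewrite exprMn; apply: ler_wpM2r; first exact: sqr_ge0.
by rewrite -mulrA; nra.
Qed.

Lemma finite_choice_lip (J : finType) (H : J -> R -> R -> Prop) :
  (forall j r K r' K', H j r K -> r' <= r -> K <= K' -> H j r' K') ->
  (forall j, exists2 r, 0 < r & exists2 K, 0 < K & H j r K) ->
  exists2 r, 0 < r & exists2 K, 0 < K & forall j, H j r K.
Proof.
move=> Hm HJ.
have /choice[p Hp] : forall j, exists p : R * R, [/\ 0 < p.1, 0 < p.2 & H j p.1 p.2].
  by move=> j; have [r r0 [K K0 h]] := HJ j; exists (r, K).
exists (\big[Num.min/1]_j (p j).1).
  by apply/bigmin_gtP; split => // j _; have [] := Hp j.
exists (\sum_j (p j).2 + 1).
  by rewrite ltr_wpDl// sumr_ge0// => j _; have [_ /ltW] := Hp j.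
move=> j; have [_ _ h] := Hp j; apply: Hm h _ _; first exact: bigmin_le_cond.
rewrite (bigD1 j)//= -addrA lerDl addr_ge0// sumr_ge0// => k _.
by have [_ /ltW] := Hp k.
Qed.

End CvgForms.

(** * Local bounds on the metric and the connection *)

Section ChartEstimates.
Context {R : realType} {n : nat} {M : ptopologicalType} {X : manifold R n M}.
Variable g : riemannian_metric X.
Variable c : chart R n M.
Hypothesis cX : atlas X c.
Implicit Types (a b u v w : 'rV[R]_n).

Lemma gf_cont i j v : cdom c v -> gf g c i j @ nbhs v --> gf g c i j v.
Proof. by move=> Vv; have [H _] := gf_C2 g cX i j; exact: C1_cont H Vv. Qed.

(** The minimum over the unit sphere bounds the form at [v0] from below, and half of it survives a
    small change of the coefficients. *)
Lemma inner_lower v0 : cdom c v0 -> exists2 r, 0 < r & exists2 L, 0 < L &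
  forall v u, `|v - v0| < r -> `|u| ^+ 2 <= L * inner g c v u u.
Proof.
move=> Vv0.
have [l l0 Hl] : exists2 l, 0 < l & forall u, l * `|u| ^+ 2 <= inner g c v0 u u.
  pose S := [set u : 'rV[R]_n | `|u| = 1].
  (* The unit sphere is empty when [n] is 0; then every vector vanishes. *)
  have [[u0 Su0]|nS] := pselect (S !=set0); last first.
    exists 1 => // u; have [->|u0] := eqVneq u 0.
      by rewrite normr0 expr2 !mulr0 inner_ge0.
    exfalso; apply: nS; exists (`|u|^-1 *: u).
    by rewrite /S /= normrZ ger0_norm ?invr_ge0// mulVf// normr_eq0.
  have cS : compact S.
    apply: bounded_closed_compact.
      exists 1; split; first exact: num_real.
      by move=> K K1 u /= ->; exact: ltW.
    rewrite (_ : S = (fun u : 'rV[R]_n => `|u|) @^-1` [set x | x = 1])//.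
    by apply: closed_comp; [move=> u _; exact: norm_continuous | exact: closed_eq].
  have [||u1 Su1 Hu1] := @EVT_min_rV R n (fun u => inner g c v0 u u) S _ cS.
  - by exists u0.
  - apply: continuous_subspaceT => u.
    rewrite (_ : (fun u => _) = fun u => qs (gf g c) v0 u u); last first.
      by apply/funext => z; rewrite innerE.
    have FF := nbhs_filter u.
    apply: (@cvg_qs _ _ _ (nbhs u) FF _ (fun=> v0) id id v0 u u).
    + by move=> i j; exact: gf_cont.
    + exact: cvg_cst.
    + exact: cvg_id.
    + exact: cvg_id.
  exists (inner g c v0 u1 u1).
    apply: inner_gt0 => //; apply/eqP => z; move: Su1; rewrite inE /S /= z normr0.
    by move/esym/eqP; rewrite oner_eq0.
  move=> u; have [->|u0'] := eqVneq u 0.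
    by rewrite normr0 expr2 !mulr0 inner_ge0.
  have := Hu1 (`|u|^-1 *: u); rewrite inE /S /= normrZ ger0_norm ?invr_ge0//.
  rewrite mulVf ?normr_eq0// => /(_ erefl); rewrite innerZl innerZr mulrA.
  move=> h; rewrite -ler_pdivlMr ?exprn_gt0 ?normr_gt0//.
  by apply: le_trans h _; rewrite expr2 invfM mulrC.
pose N : R := n%:R ^+ 2 + 1.
have N0 : 0 < N by rewrite ltr_wpDl// exprn_ge0.
have [r r0 Hr] : exists2 r, 0 < r & forall v, `|v - v0| < r ->
    forall i j, `|gf g c i j v - gf g c i j v0| <= l / (2 * N).
  have e0 : 0 < l / (2 * N) by rewrite divr_gt0// mulr_gt0.
  have : \forall v \near v0, forall p : 'I_n * 'I_n,
      `|gf g c p.1 p.2 v - gf g c p.1 p.2 v0| <= l / (2 * N).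
    apply: (@filter_forall _ _ (fun p v => `|gf g c p.1 p.2 v - gf g c p.1 p.2 v0| <= l / (2 * N))
      (nbhs v0) (nbhs_filter v0)) => p.
    have /cvgrPdist_le/(_ _ e0) := gf_cont (i := p.1) (j := p.2) Vv0.
    by apply: filterS => v; rewrite distrC.
  move/nbhs_ballP => [s s0 sH]; exists s => // v vs i j.
  by have := sH v; rewrite -ball_normE /= distrC => /(_ vs (i, j)).
exists r => //; exists (2 / l); first by rewrite divr_gt0.
move=> v u vr.
have D : `|inner g c v u u - inner g c v0 u u| <= l / 2 * `|u| ^+ 2.
  rewrite !innerE.
  have -> : qs (gf g c) v u u - qs (gf g c) v0 u u =
     qs (fun i j _ => gf g c i j v - gf g c i j v0) v0 u u.
    rewrite /qs -sumrB; apply: eq_bigr => i _; rewrite -sumrB; apply: eq_bigr => j _; ring.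
  have e0 : 0 <= l / (2 * N) by rewrite ltW// divr_gt0// mulr_gt0.
  apply: le_trans (norm_qs_le u u e0 (fun i j => Hr v vr i j)) _.
  rewrite expr2 -mulrA ler_wpM2r ?mulr_ge0//.
  rewrite [leRHS](_ : _ = N * (l / (2 * N))); last by field; rewrite lt0r_neq0.
  by rewrite ler_wpM2r// /N lerDl.
have := Hl u; move: D; rewrite ler_norml => /andP[D _] Hlu.
have : l / 2 * `|u| ^+ 2 <= inner g c v u u by lra.
by rewrite -ler_pdivlMl ?divr_gt0// invf_div.
Qed.

Lemma christoffel_bounds v0 : cdom c v0 -> exists2 r, 0 < r & exists2 K, 0 < K &
  (forall v, `|v - v0| < r -> cdom c v) /\
  (forall k i j v, `|v - v0| < r -> `|christoffel g c k i j v| <= K) /\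
  (forall k i j v w, `|v - v0| < r -> `|w - v0| < r ->
     `|christoffel g c k i j v - christoffel g c k i j w| <= K * `|v - w|).
Proof.
move=> Vv0.
pose H (p : 'I_n * 'I_n * 'I_n) (r K : R) :=
  (forall v, `|v - v0| < r -> `|christoffel g c p.1.1 p.1.2 p.2 v| <= K) /\
  (forall v w, `|v - v0| < r -> `|w - v0| < r ->
     `|christoffel g c p.1.1 p.1.2 p.2 v - christoffel g c p.1.1 p.1.2 p.2 w| <= K * `|v - w|).
have [r0 r00 rV] := open_ballP _ _ (@open_cdom _ _ _ c) Vv0.
have [||r r1 [K K0 HK]] := @finite_choice_lip R _ H.
- move=> j r K r' K' [h1 h2] rr KK; split.
    by move=> v vr; apply: le_trans KK; apply: h1; exact: lt_le_trans rr.
  move=> v w vr wr; apply: le_trans (h2 v w _ _) _; try exact: lt_le_trans rr.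
  by rewrite ler_wpM2r.
- move=> [[k i] j].
  have [r r1 [K K0 HK]] := C1_lip _ _ _ (@open_cdom _ _ _ c) Vv0 (christoffel_C1 g cX k i j).
  exists r => //; exists (`|christoffel g c k i j v0| + K * r + K).
    by rewrite ltr_wpDl// addr_ge0// mulr_ge0// ltW.
  split=> [v vr|v w vr wr] /=.
    have v0r : `|v0 - v0| < r by rewrite subrr normr0.
    have [_ h] := HK v v0 vr v0r.
    apply: (@le_trans _ _ (`|christoffel g c k i j v0| + `|christoffel g c k i j v - christoffel g c k i j v0|)).
      by rewrite addrC -lerBlDr; exact: lerB_dist.
    have : K * `|v - v0| <= K * r by rewrite ler_wpM2l// ltW.
    by move: h; lra.
  have [_ h] := HK v w vr wr; apply: le_trans h _; rewrite ler_wpM2r// lerDr.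
  by rewrite addr_ge0// mulr_ge0// ltW.
exists (Num.min r r0); first by rewrite lt_min r1.
exists K => //; split; first by move=> v; rewrite lt_min => /andP[_ /rV].
split=> [k i j v|k i j v w]; rewrite !lt_min.
  by move=> /andP[vr _]; have [h _] := HK (k, i, j); exact: h.
by move=> /andP[vr _] /andP[wr _]; have [_ h] := HK (k, i, j); exact: h.
Qed.

End ChartEstimates.

(** * Geodesics: conserved speed and dependence on initial data *)

Section Geodesics.
Context {R : realType} {n : nat} {M : ptopologicalType} {X : manifold R n M}.
Variable g : riemannian_metric X.
Implicit Types (c : chart R n M) (a b u v w : 'rV[R]_n) (gam : R -> M) (s t : R).

Definition vel c gam t : 'rV[R]_n := derive1 (c \o gam) t.

Definition spd2 c gam t : R := inner g c (c (gam t)) (vel c gam t) (vel c gam t).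

Lemma geo_pos gam c t : geodesic g gam -> atlas X c -> dom c (gam t) ->
  is_derive t (1 : R) (fun s => c (gam s)) (vel c gam t).
Proof.
move=> [_ H] cX d; have [h1 _ _] := H c t cX d.
by rewrite /vel derive1E; exact: derivableP.
Qed.

Lemma geo_vel gam c t : geodesic g gam -> atlas X c -> dom c (gam t) ->
  is_derive t (1 : R) (vel c gam) (- Gam g c (c (gam t)) (vel c gam t) (vel c gam t)).
Proof.
move=> [_ H] cX d; have [_ h2 h3] := H c t cX d.
have -> : - Gam g c (c (gam t)) (vel c gam t) (vel c gam t) = 'D_1 (vel c gam) t.
  apply/rowP => k; have := h3 k; rewrite -derive1E !mxE /qs => /eqP.
  by rewrite addr_eq0 => /eqP ->.
exact: derivableP.
Qed.

Lemma geo_near gam c t : continuous gam -> dom c (gam t) ->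
  exists2 d, 0 < d & forall s, `|s - t| < d -> dom c (gam s).
Proof.
move=> cg d.
have : nbhs t (gam @^-1` dom c).
  by apply: cg; apply: open_nbhs_nbhs; split => //; exact: open_dom.
move=> /nbhs_ballP[e e0 H]; exists e => // s st; apply: H.
by rewrite -ball_normE /= distrC.
Qed.

Lemma near_geo gam c t : continuous gam -> dom c (gam t) ->
  \forall s \near t, dom c (gam s).
Proof.
move=> cg d; have : nbhs t (gam @^-1` dom c) by
  apply: cg; apply: open_nbhs_nbhs; split => //; exact: open_dom.
by [].
Qed.

Lemma vel_trans gam c c' t : geodesic g gam -> atlas X c -> atlas X c' ->
  dom c (gam t) -> dom c' (gam t) ->
  vel c' gam t = dd (trans c c') (c (gam t)) (vel c gam t).
Proof.
move=> gg cX c'X d d'; have Vt : tdom c c' (c (gam t)) by exists (gam t).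
have D := chain_curve (trans c c') (fun s => c (gam s)) t _ (trans_diff cX c'X Vt)
   (geo_pos gg cX d).
have E : \forall s \near t, (trans c c' \o (fun s => c (gam s))) s = c' (gam s).
  have := near_geo (proj1 gg) d; apply: filterS => s ds.
  by rewrite /trans /= coorK.
have D' := near_eq_is_derive E D.
have := geo_pos gg c'X d' => D''.
by case: D' D'' => [_ <-] [_ <-].
Qed.

Lemma spd2_trans gam c c' t : geodesic g gam -> atlas X c -> atlas X c' ->
  dom c (gam t) -> dom c' (gam t) -> spd2 c gam t = spd2 c' gam t.
Proof.
move=> gg cX c'X d d'; have Vt : tdom c c' (c (gam t)) by exists (gam t).
rewrite /spd2 (vel_trans gg cX c'X d d') (inner_trans g cX c'X _ _ Vt).
by rewrite /trans /= coorK.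
Qed.

Lemma spd2_deriv gam c t : geodesic g gam -> atlas X c -> dom c (gam t) ->
  is_derive t (1 : R) (spd2 c gam) 0.
Proof.
move=> gg cX d; have Vt : cdom c (c (gam t)) by exists (gam t).
have D := inner_curve g cX Vt (geo_pos gg cX d) (geo_vel gg cX d) (geo_vel gg cX d).
apply: (isd_eq _ _ _ _ D); rewrite metric_compat//.
by rewrite !(innerNl, innerNr); lra.
Qed.

(** Quantifying over both charts is what makes the relation transitive: at an intermediate time any
    chart around the point will do. *)
Lemma spd2_const gam s t c c' : geodesic g gam -> s <= t -> atlas X c -> atlas X c' ->
  dom c (gam s) -> dom c' (gam t) -> spd2 c gam s = spd2 c' gam t.
Proof.
move=> gg st.
pose Q s t := forall c c', atlas X c -> atlas X c' ->
  dom c (gam s) -> dom c' (gam t) -> spd2 c gam s = spd2 c' gam t.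
suff : Q s t by apply.
apply: (interval_ind s t Q st).
  move=> s1 t1 r1 _ _ _ _ H1 H2 c1 c2 c1X c2X d1 d2.
  have [c3 c3X d3] := atlas_cover X (gam t1).
  by rewrite (H1 c1 c3 c1X c3X d1 d3); exact: H2.
move=> r _; have [c0 c0X d0] := atlas_cover X (gam r).
have [d dd0 Hd] := geo_near (proj1 gg) d0.
have K (a b : R) : a <= b -> r - d < a -> b < r + d -> spd2 c0 gam a = spd2 c0 gam b.
  move=> ab ra bd; apply: isd0_const => // q /andP[aq qb].
  by apply: spd2_deriv => //; apply: Hd; rewrite ltr_norml; lra.
exists d; first exact: dd0.
move=> s1 _; split=> h1 h2 c1 c2 c1X c2X d1 d2.
  have ds : dom c0 (gam s1) by apply: Hd; rewrite ltr_norml; lra.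
  rewrite (spd2_trans gg c1X c0X d1 ds) (spd2_trans gg c2X c0X d2 d0).
  by apply: K => //; lra.
have ds : dom c0 (gam s1) by apply: Hd; rewrite ltr_norml; lra.
rewrite (spd2_trans gg c1X c0X d1 d0) (spd2_trans gg c2X c0X d2 ds).
by apply: K => //; lra.
Qed.

Definition spd2_le gam (S : R) := forall c t, atlas X c -> dom c (gam t) -> 0 <= t ->
  spd2 c gam t <= S.

Lemma chart_closed_ball c (x0 : 'rV[R]_n) (q : R) :
  (forall v, `|v - x0| <= q -> cdom c v) ->
  closed (param c @` [set v | `|v - x0| <= q]).
Proof.
move=> qV; apply: compact_closed; first exact: (manifold_hausdorff X).
apply: continuous_compact.
  move=> v; apply: (@continuous_in_subspaceT _ _ _ _ _ v) => w.
  by rewrite inE => /qV; exact: param_continuous.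
apply: bounded_closed_compact.
  exists (`|x0| + q); split; first exact: num_real.
  move=> K KK v /= vq; apply: ltW; apply: le_lt_trans KK.
  by rewrite -[v](subrK x0) addrC; apply: le_trans (ler_normD _ _) _; rewrite lerD2l.
rewrite (_ : [set v | _] = (fun v : 'rV[R]_n => `|v - x0|) @^-1` [set x | x <= q])//.
apply: closed_comp; last exact: closed_le.
move=> v _; apply: continuous_comp; last exact: norm_continuous.
exact: (cvgB (@cvg_id _ (nbhs v)) (cvg_cst x0)).
Qed.

Lemma curve_lip (x : R -> 'rV[R]_n) (dx : R -> 'rV[R]_n) (K a b : R) : 0 <= K -> a <= b ->
  (forall t, a <= t <= b -> is_derive t (1 : R) x (dx t)) ->
  (forall t, a <= t <= b -> `|dx t| <= K) -> `|x b - x a| <= K * (b - a).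
Proof.
move=> K0 ab H HK; apply: norm_le_coord; first by rewrite mulr_ge0 ?subr_ge0.
move=> i; rewrite !mxE; apply: (lip_isd (f := fun t => x t 0 i) (df := fun t => dx t 0 i)) => //.
  by move=> t tab; have /derive_row := H t tab; apply.
by move=> t tab; apply: le_trans (HK t tab); exact: coord_le_norm.
Qed.

(* The bounded coordinate speed prevents the geodesic from leaving the ball. *)
Lemma geo_stay c (x0 : 'rV[R]_n) (r K : R) : atlas X c -> 0 < r -> 0 < K ->
  (forall v, `|v - x0| < 2 * r -> cdom c v) ->
  forall gam s, geodesic g gam ->
  (forall t, s <= t -> dom c (gam t) -> `|c (gam t) - x0| < 2 * r -> `|vel c gam t| <= K) ->
  dom c (gam s) -> `|c (gam s) - x0| < r ->
  forall t, s <= t -> t <= s + r / (2 * K) -> dom c (gam t) /\ `|c (gam t) - x0| < 2 * r.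
Proof.
move=> cX r0 K0 rV gam s gg Hv ds xs.
have rK : 0 < r / (2 * K) by rewrite divr_gt0// mulr_gt0.
pose P t := dom c (gam t) /\ `|c (gam t) - c (gam s)| <= K * (t - s).
suff H : forall t, s <= t -> t <= s + r / (2 * K) -> P t.
  move=> t st tr; have [d h] := H t st tr; split => //.
  have e : K * (t - s) <= K * (r / (2 * K)) by rewrite ler_wpM2l ?(ltW K0)// lerBlDl.
  have e2 : K * (r / (2 * K)) = r / 2 by field; rewrite lt0r_neq0.
  have : `|c (gam t) - x0| <= `|c (gam t) - c (gam s)| + `|c (gam s) - x0|.
    by apply: le_trans (ler_normD _ _); rewrite addrA subrK.
  by rewrite e2 in e; lra.
have bnd t : s <= t -> t <= s + r / (2 * K) -> K * (t - s) <= r / 2.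
  move=> st tr; have : K * (t - s) <= K * (r / (2 * K)) by rewrite ler_wpM2l ?(ltW K0)// lerBlDl.
  by rewrite (_ : K * (r / (2 * K)) = r / 2)//; field; rewrite lt0r_neq0.
have tri t : `|c (gam t) - x0| <= `|c (gam t) - c (gam s)| + `|c (gam s) - x0|.
  by apply: le_trans (ler_normD _ _); rewrite addrA subrK.
apply: (real_ind s (s + r / (2 * K)) P).
- by rewrite lerDl ltW.
- by split => //; rewrite !subrr mulr0 normr0.
- move=> t st tr H; have [dt xt] := H t st (lexx t).
  have xt0 : `|c (gam t) - x0| < 2 * r.
    by have := bnd t st (ltW tr); have := tri t; lra.
  have [d1 d10 H1] := geo_near (proj1 gg) dt.
  have cc : (fun s => c (gam s)) @ nbhs t --> c (gam t).
    by have [/derivable1_diffP/differentiable_continuous] := geo_pos gg cX dt.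
  have e0 : 0 < 2 * r - `|c (gam t) - x0| by rewrite subr_gt0.
  have : \forall z \near t, `|c (gam z) - c (gam t)| < 2 * r - `|c (gam t) - x0|.
    exact: (cvg_near_dist _ _ _ cc e0).
  move/nbhs_ballP => [d2 d20 H2].
  exists (Num.min d1 d2); first by rewrite lt_min d10.
  move=> q tq; rewrite -ltrBlDl lt_min => /andP[q1 q2] qs.
  have near z : t <= z -> z <= q -> dom c (gam z) /\ `|c (gam z) - x0| < 2 * r.
    move=> tz zq; have zt : `|z - t| = z - t by rewrite ger0_norm// subr_ge0.
    split; first by apply: H1; rewrite zt; lra.
    have : ball t d2 z by rewrite -ball_normE /= distrC zt; lra.
    move=> /H2 /= h.
    have : `|c (gam z) - x0| <= `|c (gam z) - c (gam t)| + `|c (gam t) - x0|.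
      by apply: le_trans (ler_normD _ _); rewrite addrA subrK.
    lra.
  have [dq _] := near q (ltW tq) (lexx q); split => //.
  have : `|c (gam q) - c (gam t)| <= K * (q - t).
    apply: (curve_lip (x := fun s => c (gam s)) (dx := vel c gam) (ltW K0) (ltW tq)).
      by move=> z /andP[tz zq]; apply: geo_pos => //; have [] := near z tz zq.
    move=> z /andP[tz zq]; have [? ?] := near z tz zq.
    by apply: Hv => //; exact: le_trans tz.
  have : `|c (gam q) - c (gam s)| <= `|c (gam q) - c (gam t)| + `|c (gam t) - c (gam s)|.
    by apply: le_trans (ler_normD _ _); rewrite addrA subrK.
  by move: xt; lra.
move=> t st tr H.
(* It is not known beforehand that [gam t] lies in the domain of [c]. The image of a closed
   coordinate ball is compact, hence closed in the Hausdorff space [M], and it contains [gam z] for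
   all earlier [z]. *)
have cl : closed (param c @` [set v | `|v - x0| <= 3 / 2 * r]).
  by apply: chart_closed_ball => v vr; apply: rV; lra.
have inq z : s <= z -> z < t -> (param c @` [set v | `|v - x0| <= 3 / 2 * r]) (gam z).
  move=> sz zt; have [dz xz] := H z sz zt.
  exists (c (gam z)); last by rewrite coorK.
  by have := bnd z sz (le_trans (ltW zt) tr); have := tri z; rewrite /=; lra.
have : (param c @` [set v | `|v - x0| <= 3 / 2 * r]) (gam t).
  apply: cl => B nB.
  have /nbhs_ballP[d d0 Hd] : nbhs t (gam @^-1` B) by exact: (proj1 gg).
  pose z := Num.max s (t - d / 2).
  have zt : z < t by rewrite gt_max st ltrBlDr ltrDl divr_gt0.
  have sz : s <= z by rewrite le_max lexx.
  exists (gam z); split; first exact: inq.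
  apply: Hd; rewrite -ball_normE /= ger0_norm ?subr_ge0 ?(ltW zt)// .
  have : t - d / 2 <= z by rewrite le_max lexx orbT.
  by move: d0 => /=; lra.
move=> [v vr vt].
have Vv : cdom c v by apply: rV; move: vr => /=; lra.
have dt : dom c (gam t) by rewrite -vt; case: Vv => y dy <-; rewrite coorK.
split => //.
have cc : (fun s => c (gam s)) @ nbhs t --> c (gam t).
  by have [/derivable1_diffP/differentiable_continuous] := geo_pos gg cX dt.
apply/ler_addgt0Pr => e e0.
have : \forall z \near t, `|c (gam z) - c (gam t)| < e.
  exact: (cvg_near_dist _ _ _ cc e0).
move/nbhs_ballP => [d d0 Hd].
pose z := Num.max s (t - d / 2).
have zt : z < t by rewrite gt_max st ltrBlDr ltrDl divr_gt0.
have sz : s <= z by rewrite le_max lexx.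
have : ball t d z.
  rewrite -ball_normE /= ger0_norm ?subr_ge0 ?(ltW zt)// .
  have : t - d / 2 <= z by rewrite le_max lexx orbT.
  by move: d0 => /=; lra.
move=> /Hd /= h1; have [_ h2] := H z sz zt.
have : `|c (gam t) - c (gam s)| <= `|c (gam z) - c (gam t)| + `|c (gam z) - c (gam s)|.
  by rewrite [X in _ <= X + _]distrC; apply: le_trans (ler_normD _ _); rewrite addrA subrK.
have : K * (z - s) <= K * (t - s) by rewrite ler_wpM2l ?(ltW K0)// lerD2r ltW.
lra.
Qed.

Definition gdist c gam1 gam2 t : R :=
  `|c (gam1 t) - c (gam2 t)| + `|vel c gam1 t - vel c gam2 t|.

Definition acc c gam t : 'rV[R]_n := Gam g c (c (gam t)) (vel c gam t) (vel c gam t).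

Definition start c (x0 : 'rV[R]_n) (r S : R) gam s :=
  [/\ geodesic g gam, spd2_le gam S, 0 <= s, dom c (gam s) & `|c (gam s) - x0| < r].

(** A flow box: one time step [d] and one constant [K] for all geodesics of squared speed at most
    [S] that start near [x0]. The second half is Lipschitz dependence on the initial position and
    velocity. *)
Definition window c (x0 : 'rV[R]_n) (S r d K : R) :=
  (forall gam s, start c x0 r S gam s -> forall t, s <= t -> t <= s + d ->
    [/\ dom c (gam t), `|c (gam t) - x0| < 2 * r, `|vel c gam t| <= K & `|acc c gam t| <= K]) /\
  (forall gam1 gam2 s, start c x0 r S gam1 s -> start c x0 r S gam2 s ->
    forall t, s <= t -> t <= s + d -> gdist c gam1 gam2 t <= K * gdist c gam1 gam2 s /\
      `|acc c gam1 t - acc c gam2 t| <= K * gdist c gam1 gam2 s).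

(** The conserved speed bounds the coordinate velocity, so the ball cannot be left before time [d];
    on it the connection is bounded and Lipschitz, and Gronwall's inequality applies. *)
Lemma window_exists c (x0 : 'rV[R]_n) (S : R) : atlas X c -> cdom c x0 -> 0 <= S ->
  exists r d K : R, [/\ 0 < r, 0 < d, 0 < K & window c x0 S r d K].
Proof.
move=> cX Vx0 S0.
have [r1 r10 [L L0 HL]] := inner_lower g cX Vx0.
have [r2 r20 [K2 K20 [HV [HB HLip]]]] := christoffel_bounds g cX Vx0.
pose r := Num.min r1 r2 / 2.
have r0 : 0 < r by rewrite divr_gt0// lt_min r10.
have rr v : `|v - x0| < 2 * r -> `|v - x0| < r1 /\ `|v - x0| < r2.
  rewrite /r mulrCA mulfV ?pnatr_eq0// mulr1.
  by rewrite lt_min => /andP.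
(* The squared coordinate velocity is at most [L * S], hence at most the square of [Vb]. *)
pose Vb := L * S + 1.
have LS0 : 0 <= L * S by rewrite mulr_ge0// ltW.
have Vb0 : 0 < Vb by rewrite ltr_wpDl.
pose d := r / (2 * Vb).
have d0 : 0 < d by rewrite divr_gt0// mulr_gt0.
have [N N0 HN] : exists2 N : R, 0 <= N & n%:R ^+ 2 = N by exists (n%:R ^+ 2) => //; rewrite exprn_ge0.
pose B1 := N * K2 * Vb * Vb.
pose C := N * K2 * (Vb * Vb + 2 * Vb).
have C0 : 0 <= C by rewrite !mulr_ge0// ?(ltW K20)// addr_ge0// ?mulr_ge0// ltW.
have B10 : 0 <= B1 by rewrite !mulr_ge0// ltW.
pose Kg := n%:R * (1 + 3 * C).
pose K' := 2 * expR (Kg * d) * n%:R + 1.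
have K'0 : 0 < K' by rewrite ltr_wpDl// !mulr_ge0// expR_ge0.
pose K := Vb + B1 + K' + C * K'.
have velb gam t : geodesic g gam -> spd2_le gam S -> 0 <= t -> dom c (gam t) ->
    `|c (gam t) - x0| < 2 * r -> `|vel c gam t| <= Vb.
  move=> gg gS t0 dt /rr[xr _].
  have h1 := HL _ (vel c gam t) xr.
  have h2 : L * spd2 c gam t <= L * S by rewrite ler_wpM2l ?(ltW L0)//; exact: gS.
  have h3 : `|vel c gam t| ^+ 2 <= Vb ^+ 2.
    apply: le_trans (le_trans h1 h2) _.
    by rewrite /Vb; move: LS0; set z := L * S => z0; nra.
  by rewrite -(@ler_pXn2r _ 2)// ?nnegrE// ltW.
have stay gam s : start c x0 r S gam s -> forall t, s <= t -> t <= s + d ->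
    [/\ dom c (gam t), `|c (gam t) - x0| < 2 * r & `|vel c gam t| <= Vb].
  move=> [gg gS s0 ds xs] t st td.
  have [||dt xt] := @geo_stay c x0 r Vb cX r0 Vb0 _ gam s gg _ ds xs t st td.
    by move=> v /rr[_ /HV].
    by move=> q sq dq xq; apply: velb => //; exact: le_trans sq.
  by split => //; apply: velb => //; exact: le_trans st.
have accb gam t : dom c (gam t) -> `|c (gam t) - x0| < 2 * r -> `|vel c gam t| <= Vb ->
    `|acc c gam t| <= B1.
  move=> dt /rr[_ xr] vb; apply: norm_le_coord => // k; rewrite mxE.
  have h := @norm_qs_le _ _ (christoffel g c k) K2 (c (gam t)) (vel c gam t) (vel c gam t)
    (ltW K20) (fun i j => HB k i j _ xr).
  rewrite HN in h.
  apply: le_trans h _; apply: ler_pM => //; first by rewrite !mulr_ge0// ltW.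
  by apply: ler_pM => //; rewrite mulr_ge0// ltW.
have accd gam1 gam2 t : `|c (gam1 t) - x0| < 2 * r -> `|vel c gam1 t| <= Vb ->
    `|c (gam2 t) - x0| < 2 * r -> `|vel c gam2 t| <= Vb ->
    `|acc c gam1 t - acc c gam2 t| <= C * gdist c gam1 gam2 t.
  move=> /rr[_ x1] v1 /rr[_ x2] v2; apply: norm_le_coord.
    by apply: mulr_ge0 => //; apply: addr_ge0.
  move=> k; rewrite !mxE /gdist /C -HN.
  apply: qs_lip; [exact: ltW | exact: ltW | | | exact: v1 | exact: v2].
    by move=> i j; apply: HLip.
  by move=> i j; apply: HB.
have CK : 0 <= C * K' by apply: mulr_ge0 => //; exact: ltW.
have K0 : 0 < K by rewrite /K; lra.
have KV : Vb <= K by rewrite /K; lra.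
have KB : B1 <= K by rewrite /K; lra.
have KK' : K' <= K by rewrite /K; lra.
have KC : C * K' <= K by rewrite /K; lra.
exists r, d, K; split => //; split.
  move=> gam s st t s1 s2; have [dt xt vt] := stay gam s st t s1 s2; split => //.
    exact: le_trans KV.
  by apply: le_trans KB; exact: accb.
move=> gam1 gam2 s st1 st2 t s1 s2.
have [gg1 _ _ _ _] := st1; have [gg2 _ _ _ _] := st2.
have F3 : gdist c gam1 gam2 t <= K' * gdist c gam1 gam2 s.
  have h := @ode_gronwall _ _ (fun z => c (gam1 z)) (fun z => c (gam2 z)) (vel c gam1) (vel c gam2)
    (acc c gam1) (acc c gam2) C s t s1 C0.
  apply: (le_trans (h _ _)).
  - move=> z /andP[sz zt]; have zd : z <= s + d by exact: le_trans s2.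
    have [d1 _ _] := stay _ _ st1 _ sz zd; have [d2 _ _] := stay _ _ st2 _ sz zd.
    by split; [exact: geo_pos | exact: geo_pos | exact: geo_vel | exact: geo_vel].
  - move=> z /andP[sz zt]; have zd : z <= s + d by exact: le_trans s2.
    have [d1 x1 v1] := stay _ _ st1 _ sz zd; have [d2 x2 v2] := stay _ _ st2 _ sz zd.
    exact: accd.
  apply: ler_wpM2r; first exact: addr_ge0.
  rewrite /K' lerD2r; apply: ler_wpM2r; first by [].
  apply: ler_wpM2l; first by [].
  rewrite ler_expR; apply: ler_wpM2l; last by rewrite lerBlDl.
  by apply: mulr_ge0 => //; apply: addr_ge0 => //; apply: mulr_ge0.
have gs0 : 0 <= gdist c gam1 gam2 s by apply: addr_ge0.
split; first by apply: le_trans F3 _; exact: ler_wpM2r.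
have [d1 x1 v1] := stay _ _ st1 _ s1 s2; have [d2 x2 v2] := stay _ _ st2 _ s1 s2.
apply: le_trans (accd _ _ _ x1 v1 x2 v2) _.
apply: (@le_trans _ _ (C * (K' * gdist c gam1 gam2 s))); first exact: ler_wpM2l.
by rewrite mulrA; exact: ler_wpM2r.
Qed.

Lemma accE c gam t : acc c gam t = Gam g c (c (gam t)) (vel c gam t) (vel c gam t).
Proof. by []. Qed.

Lemma spd2E c gam t : spd2 c gam t = inner g c (c (gam t)) (vel c gam t) (vel c gam t).
Proof. by []. Qed.

End Geodesics.

#[global] Opaque vel acc spd2.

(** * Jacobi fields as limits of difference quotients *)

Section LimitLemmas.
Context {R : realType} {I : Type} {F : set_system I} {FF : ProperFilter F}.

Let FF0 : Filter F. Proof. exact: filter_filter. Qed.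

Lemma cvg_le_norm {W : normedModType R} (f : I -> W) l (w : W) (B : R) :
  f @ F --> l -> (\forall k \near F, `|f k - w| <= B) -> `|l - w| <= B.
Proof.
move=> fl H.
have c1 : (fun k => `|f k - w|) @ F --> `|l - w|.
  by apply: cvg_norm; apply: cvgB => //; exact: cvg_cst.
exact: (closed_cvg (fun x : R => x <= B) (@closed_le _ B) H _ c1).
Qed.

Lemma cvg_squeeze {W : normedModType R} (f : I -> W) l (q : I -> R) (K : R) :
  (\forall k \near F, `|f k - l| <= K * q k) -> q @ F --> (0 : R) -> f @ F --> l.
Proof.
move=> H q0; apply/cvgrPdist_lt => e e0.
have Kq : (fun k => K * q k) @ F --> (0 : R).
  by rewrite -[X in _ --> X](mulr0 K); apply: cvgM => //; exact: cvg_cst.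
have := cvg_near_dist (FF := FF0) _ _ _ Kq e0; apply: filterS2 H => k Hk.
rewrite subr0 distrC => h; apply: le_lt_trans Hk _.
by apply: le_lt_trans h; exact: ler_norm.
Qed.

Lemma cvg_le_norm2 {W : normedModType R} (f h : I -> W) l m (B : R) :
  f @ F --> l -> h @ F --> m -> (\forall k \near F, `|f k - h k| <= B) -> `|l - m| <= B.
Proof.
move=> fl hm H; rewrite -[l - m]subr0.
apply: (@cvg_le_norm _ (fun k => f k - h k)); first exact: (cvgB fl hm).
by apply: filterS H => k; rewrite subr0.
Qed.

Lemma curve_lip2 {n : nat} (x dx : R -> 'rV[R]_n) (B a b t : R) : 0 <= B -> a <= t -> t <= b ->
  (forall u, a <= u -> u <= b -> is_derive u (1 : R) x (dx u)) ->
  (forall u, a <= u -> u <= b -> `|dx u| <= B) ->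
  forall u, a <= u -> u <= b -> `|x u - x t| <= B * `|u - t|.
Proof.
move=> B0 at_ tb hx hB u au ub; have [tu|ut] := leP t u.
  rewrite [X in _ * X]ger0_norm ?subr_ge0//.
  apply: (@curve_lip _ _ x dx B t u B0 tu) => z /andP[z1 z2].
    exact: hx (le_trans at_ z1) (le_trans z2 ub).
  exact: hB (le_trans at_ z1) (le_trans z2 ub).
rewrite distrC [X in _ * X]distrC [X in _ * X]ger0_norm ?subr_ge0 ?(ltW ut)//.
apply: (@curve_lip _ _ x dx B u t B0 (ltW ut)) => z /andP[z1 z2].
  exact: hx (le_trans au z1) (le_trans z2 tb).
exact: hB (le_trans au z1) (le_trans z2 tb).
Qed.

Lemma limit_derive (z w : I -> R -> R) (Y : R -> R) (t l d : R) : 0 < d ->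
  (\forall k \near F, forall s, `|s - t| < d -> is_derive s (1 : R) (z k) (w k s)) ->
  (forall s, `|s - t| < d -> (fun k => z k s) @ F --> Y s) ->
  (fun p => w p.1 p.2) @ filter_prod F (nbhs t) --> l ->
  is_derive t (1 : R) Y l.
Proof.
move=> d0 Hz HY Hw.
suff C : (fun h => h^-1 *: (Y (h *: 1 + t) - Y t)) @ 0^' --> l.
  apply: DeriveDef; first by apply/cvg_ex; exists l.
  by apply: cvg_lim.
apply/cvgrPdist_le => e e0.
have /cvgrPdist_le/(_ e e0) [[A B] [FA nB] AB] := Hw.
have /nbhs_ballP[d' d'0 dB] := nB.
exists (Num.min d d'); first by rewrite /= lt_min d0.
move=> h /=; rewrite /ball_ /= sub0r normrN lt_min => /andP[hd hd'] h0.
rewrite distrC.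
have st : `|h *: 1 + t - t| < d by rewrite addrK [h *: 1]mulr1.
have tt : `|t - t| < d by rewrite subrr normr0.
have c1 : (fun k => h^-1 * (z k (h *: 1 + t) - z k t)) @ F --> h^-1 *: (Y (h *: 1 + t) - Y t).
  by apply: cvgM; [exact: cvg_cst | apply: cvgB; exact: HY].
apply: (cvg_le_norm c1).
apply: filterS2 FA Hz => k Ak Hk.
have hh : h *: 1 + t = t + h by rewrite [h *: 1]mulr1 addrC.
rewrite hh.
have seg x : `|x - t| <= `|h| -> `|x - t| < d /\ `|w k x - l| <= e.
  move=> xh; split; first exact: le_lt_trans hd.
  have := AB (k, x); rewrite /= distrC; apply; split => //=.
  by apply: dB; rewrite -ball_normE /= distrC; exact: le_lt_trans hd'.
have [hp|hn] := ltP 0 h.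
  have [||x /andP[x1 x2] E] := @mvt_isd R (z k) (w k) t (t + h).
  - by rewrite lerDl ltW.
  - move=> s /andP[s1 s2]; apply: Hk; have [] := seg s => //.
    by rewrite !ger0_norm ?(ltW hp) ?subr_ge0// lerBlDl.
  have -> : h^-1 * (z k (t + h) - z k t) = w k x.
    by rewrite E addrAC subrr add0r mulrCA mulVf ?mulr1// gt_eqF.
  have [] := seg x => //.
  by rewrite !ger0_norm ?(ltW hp) ?subr_ge0// lerBlDl.
have {}hn : h < 0 by rewrite lt_neqAle h0.
have [||x /andP[x1 x2] E] := @mvt_isd R (z k) (w k) (t + h) t.
- by rewrite gerDl ltW.
- move=> s /andP[s1 s2]; apply: Hk; have [] := seg s => //.
  by rewrite (ltr0_norm hn) ler0_norm ?subr_le0// opprB lerBlDl -lerBlDr opprK.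
have -> : h^-1 * (z k (t + h) - z k t) = w k x.
  have -> : z k (t + h) - z k t = w k x * h by rewrite -opprB E; ring.
  by rewrite mulrCA mulVf ?mulr1.
have [] := seg x => //.
by rewrite (ltr0_norm hn) ler0_norm ?subr_le0// opprB lerBlDl -lerBlDr opprK.
Qed.

(** Equi-Lipschitz bounds upgrade convergence at the single time [t] to the joint convergence that
    [limit_derive] asks for. *)
Lemma prod_cvg {n : nat} (x : I -> R -> 'rV[R]_n) (l : 'rV[R]_n) (t a b B : R) : 0 <= B -> a < t -> t < b ->
  (fun k => x k t) @ F --> l ->
  (\forall k \near F, forall s, a <= s -> s <= b -> `|x k s - x k t| <= B * `|s - t|) ->
  (fun p => x p.1 p.2) @ filter_prod F (nbhs t) --> l.
Proof.
move=> B0 at_ tb cx H; apply/cvgrPdist_lt => e e0.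
have e2 : 0 < e / 2 by rewrite divr_gt0.
have h1 := cvg_near_dist (FF := FF0) _ _ _ cx e2.
pose d := Num.min (Num.min (t - a) (b - t)) (e / (2 * (B + 1))).
have d0 : 0 < d.
  by rewrite !lt_min !subr_gt0 at_ tb /= divr_gt0// mulr_gt0// ltr_wpDl.
have nB : nbhs t (ball t d) by exact: nbhsx_ballx.
exists ([set k | `|x k t - l| < e / 2 /\
    forall s, a <= s -> s <= b -> `|x k s - x k t| <= B * `|s - t|], ball t d).
  by split => //=; apply: filterS2 h1 H.
move=> [k s] /= [[hk Hk]]; rewrite -ball_normE /= distrC => ts.
have := ts; rewrite !lt_min => /andP[/andP[t1 t2] t3].
have [as_ sb] : a <= s /\ s <= b by move: t1 t2; rewrite !ltr_norml; split; lra.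
have hs := Hk s as_ sb.
have : B * `|s - t| <= e / 2.
  apply: (@le_trans _ _ ((B + 1) * (e / (2 * (B + 1))))).
    apply: ler_pM => //; last exact: ltW.
    by rewrite lerDl.
  rewrite (_ : (B + 1) * (e / (2 * (B + 1))) = e / 2)//; field.
  by apply: lt0r_neq0; rewrite ltr_wpDl.
have tri : `|l - x k s| <= `|x k s - x k t| + `|x k t - l|.
  by rewrite distrC; apply: le_trans (ler_normD _ _); rewrite addrA subrK.
by move: hs hk tri; set p := B * _; lra.
Qed.

(** Linearization of the quadratic term of the geodesic equation: strict differentiability of the
    coefficients, and a discrete product rule for the velocities. *)
Lemma qs_strict {n : nat} V (K : 'I_n -> 'I_n -> 'rV[R]_n -> R) (x1 x2 v1 v2 : I -> 'rV[R]_n)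
    (eps : I -> R) x v Y W : open V -> V x -> (forall i j, C1 V (K i j)) ->
  x1 @ F --> x -> x2 @ F --> x -> v1 @ F --> v -> v2 @ F --> v ->
  (fun k => (eps k)^-1 *: (x2 k - x1 k)) @ F --> Y ->
  (fun k => (eps k)^-1 *: (v2 k - v1 k)) @ F --> W ->
  (fun k => (eps k)^-1 * (qs K (x2 k) (v2 k) (v2 k) - qs K (x1 k) (v1 k) (v1 k))) @ F -->
    dqs K x Y v v + (qs K x W v + qs K x v W).
Proof.
move=> oV Vx cK cx1 cx2 cv1 cv2 cY cW.
have -> : (fun k => (eps k)^-1 * (qs K (x2 k) (v2 k) (v2 k) - qs K (x1 k) (v1 k) (v1 k))) =
  (fun k => \sum_i \sum_j (eps k)^-1 * (K i j (x2 k) - K i j (x1 k)) * v2 k 0 i * v2 k 0 j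
     + (qs K (x1 k) ((eps k)^-1 *: (v2 k - v1 k)) (v2 k)
        + qs K (x1 k) (v1 k) ((eps k)^-1 *: (v2 k - v1 k)))).
  apply/funext => k; rewrite qs_sub qsZl qsZr 2!mulrDr; congr (_ + _).
  rewrite mulr_sumr; apply: eq_bigr => i _; rewrite mulr_sumr; apply: eq_bigr => j _.
  by rewrite !mulrA.
have Kc i j : K i j @ nbhs x --> K i j x by exact: C1_cont (cK i j) Vx.
apply: cvgD; last by apply: cvgD; apply: cvg_qs.
have /cvg_rowP cv2' := cv2.
apply: cvg_sumr => i; apply: cvg_sumr => j.
have h := C1_strict (FF := FF0) V (K i j) x1 x2 eps x Y oV Vx (cK i j) cx1 cx2 cY.
exact: (cvgM (cvgM h (cv2' i)) (cv2' j)).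
Qed.

End LimitLemmas.

Lemma diff_prod_split (R : comRingType) (e a1 a2 d1 d2 : R) :
  e * (a2 - a1) * d2 + a1 * (e * (d2 - d1)) = e * (a2 * d2 - a1 * d1).
Proof. ring. Qed.

Lemma neg_quot_coord {R : realType} {n : nat} {M : ptopologicalType} {X : manifold R n M}
    (g : riemannian_metric X) (c : chart R n M) (x y v w : 'rV[R]_n) (e : R) i :
  (e *: (- Gam g c x v v - - Gam g c y w w)) 0 i =
  - (e * (qs (christoffel g c i) x v v - qs (christoffel g c i) y w w)).
Proof. by rewrite !mxE; ring. Qed.

Lemma jacobi_coord {R : realType} {n : nat} {M : ptopologicalType} {X : manifold R n M}
    (g : riemannian_metric X) (c : chart R n M) (x y v w : 'rV[R]_n) i :
  atlas X c -> cdom c x -> (- (dGam g c x y v v + 2 *: Gam g c x v w)) 0 i =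
  - (dqs (christoffel g c i) x y v v
     + (qs (christoffel g c i) x w v + qs (christoffel g c i) x v w)).
Proof.
move=> cX Vx; have E : qs (christoffel g c i) x w v = qs (christoffel g c i) x v w.
  by apply: qs_sym => j l; exact: christoffel_sym.
by rewrite E !mxE -mulr2n -[X in _ = - (_ + X)]mulr_natl.
Qed.

(** * Limits of difference quotients of geodesics *)

Section JacobiLimit.
Context {R : realType} {n : nat} {M : ptopologicalType} {X : manifold R n M}.
Variable g : riemannian_metric X.
Context {I : Type} {F : set_system I} {UF : UltraFilter F}.
Variables (gam : R -> M) (g1 g2 : I -> R -> M) (eps : I -> R) (S : R).
Let FF0 : Filter F. Proof. exact: filter_filter. Qed.
Hypothesis gg : geodesic g gam.
Hypothesis gg1 : forall k, geodesic g (g1 k).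
Hypothesis gg2 : forall k, geodesic g (g2 k).
Hypothesis gS : spd2_le g gam S.
Hypothesis gS1 : forall k, spd2_le g (g1 k) S.
Hypothesis gS2 : forall k, spd2_le g (g2 k) S.
Hypothesis S0 : 0 <= S.
Implicit Types (c : chart R n M) (Y V : 'rV[R]_n) (s t : R).

(** The property that is propagated along [gam], chart by chart. [V] is a limit of coordinate
    velocities and not a tangent vector: a change of charts adds a Hessian term to it. *)
Definition good c t Y V : Prop :=
  [/\ dom c (gam t), \forall k \near F, dom c (g1 k t) /\ dom c (g2 k t),
    [/\ (fun k => c (g1 k t)) @ F --> c (gam t), (fun k => c (g2 k t)) @ F --> c (gam t),
      (fun k => vel c (g1 k) t) @ F --> vel c gam t &
      (fun k => vel c (g2 k) t) @ F --> vel c gam t],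
    (fun k => (eps k)^-1 *: (c (g2 k t) - c (g1 k t))) @ F --> Y &
    (fun k => (eps k)^-1 *: (vel c (g2 k) t - vel c (g1 k) t)) @ F --> V].

Lemma good_start c t Y V (x0 : 'rV[R]_n) (r : R) : good c t Y V -> 0 <= t ->
  `|c (gam t) - x0| < r ->
  start g c x0 r S gam t /\
  \forall k \near F, start g c x0 r S (g1 k) t /\ start g c x0 r S (g2 k) t.
Proof.
move=> [dg dk [c1 c2 v1 v2] _ _] t0 xr; split; first by split.
have e0 : 0 < r - `|c (gam t) - x0| by rewrite subr_gt0.
have n1 := cvg_near_dist (FF := FF0) _ _ _ c1 e0; have n2 := cvg_near_dist (FF := FF0) _ _ _ c2 e0.
have tri (y : 'rV[R]_n) : `|y - c (gam t)| < r - `|c (gam t) - x0| -> `|y - x0| < r.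
  rewrite ltrBrDr; apply: le_lt_trans.
  by apply: le_trans (ler_normD _ _); rewrite addrA subrK.
by apply: filterS3 dk n1 n2 => k [d1 d2] /tri h1 /tri h2; split; split.
Qed.

Lemma good_gdist c t Y V : good c t Y V ->
  (fun k => gdist c (g1 k) gam t) @ F --> (0 : R) /\
  (fun k => gdist c (g2 k) gam t) @ F --> (0 : R).
Proof.
move=> [_ _ [c1 c2 v1 v2] _ _].
have H (f h : I -> 'rV[R]_n) (x y : 'rV[R]_n) : f @ F --> x -> h @ F --> y ->
    (fun k => `|f k - x| + `|h k - y|) @ F --> (0 : R).
  move=> fx hy.
  have h1 : (fun k => `|f k - x| + `|h k - y|) @ F --> `|x - x| + `|y - y|.
    exact: (cvgD (cvg_norm (cvgB fx (cvg_cst x))) (cvg_norm (cvgB hy (cvg_cst y)))).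
  by move: h1; rewrite !subrr !normr0 addr0.
by split; exact: H.
Qed.

Lemma good_bound c t Y V : good c t Y V -> exists2 B, 0 <= B &
  \forall k \near F, `|(eps k)^-1| * gdist c (g2 k) (g1 k) t <= B.
Proof.
move=> [_ _ _ cY cV]; exists (`|Y| + 1 + (`|V| + 1)).
  by rewrite !addr_ge0.
have b1 := cvg_near_dist (FF := FF0) _ _ _ cY ltr01; have b2 := cvg_near_dist (FF := FF0) _ _ _ cV ltr01.
apply: filterS2 b1 b2 => k h1 h2.
rewrite /gdist mulrDr -!normrZ; apply: lerD.
  by rewrite -lerBlDl; apply: le_trans (ltW h1); exact: lerB_dist.
by rewrite -lerBlDl; apply: le_trans (ltW h2); exact: lerB_dist.
Qed.

(** Lipschitz dependence bounds the quotients at time [t] by [K] times those at time [s], and along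
    the ultrafilter bounded quotients converge. *)
Lemma good_window c (x0 : 'rV[R]_n) r d K s Y V t : window g c x0 S r d K -> 0 <= s ->
  `|c (gam s) - x0| < r -> good c s Y V -> s <= t -> t <= s + d ->
  exists Y' V', good c t Y' V'.
Proof.
move=> [W1 W2] s0 xr G st td.
have [st0 stk] := good_start G s0 xr.
have [q1 q2] := good_gdist G.
have [dg xg _ _] := W1 gam s st0 t st td.
have Ck (h : I -> R -> M) : (\forall k \near F, start g c x0 r S (h k) s) ->
    (fun k => gdist c (h k) gam s) @ F --> (0 : R) ->
    (fun k => c (h k t)) @ F --> c (gam t) /\ (fun k => vel c (h k) t) @ F --> vel c gam t.
  move=> sth qh.
  have Hh : \forall k \near F, gdist c (h k) gam t <= K * gdist c (h k) gam s.
    by apply: filterS sth => k stk'; have [] := W2 (h k) gam s stk' st0 t st td.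
  by split; apply: (cvg_squeeze _ qh); apply: filterS Hh => k; apply: le_trans;
    rewrite /gdist ?lerDl ?lerDr.
have [c1 v1] : (fun k => c (g1 k t)) @ F --> c (gam t) /\ (fun k => vel c (g1 k) t) @ F --> vel c gam t.
  by apply: Ck => //; apply: filterS stk => k [].
have [c2 v2] : (fun k => c (g2 k t)) @ F --> c (gam t) /\ (fun k => vel c (g2 k) t) @ F --> vel c gam t.
  by apply: Ck => //; apply: filterS stk => k [].
have [B B0 HB] := good_bound G.
have Hb : \forall k \near F, `|(eps k)^-1| * gdist c (g2 k) (g1 k) t <= K * B.
  apply: filterS2 HB stk => k hB [h1 h2].
  have [h _] := W2 (g2 k) (g1 k) s h2 h1 t st td.
  have K0 : 0 <= K by have [_ _ h3 _] := W1 gam s st0 t st td; exact: le_trans h3.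
  apply: (@le_trans _ _ (K * (`|(eps k)^-1| * gdist c (g2 k) (g1 k) s))).
    by rewrite mulrCA; apply: ler_wpM2l.
  exact: ler_wpM2l.
have [Y' [cY' _]] : exists Y', (fun k => (eps k)^-1 *: (c (g2 k t) - c (g1 k t))) @ F --> Y' /\ `|Y'| <= K * B.
  apply: row_ultra_cvg; apply: filterS Hb => k; apply: le_trans.
  by rewrite normrZ; apply: ler_wpM2l => //; rewrite /gdist lerDl.
have [V' [cV' _]] : exists Y', (fun k => (eps k)^-1 *: (vel c (g2 k) t - vel c (g1 k) t)) @ F --> Y' /\ `|Y'| <= K * B.
  apply: row_ultra_cvg; apply: filterS Hb => k; apply: le_trans.
  by rewrite normrZ; apply: ler_wpM2l => //; rewrite /gdist lerDr.
exists Y', V'; split => //.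
apply: filterS stk => k [h1 h2].
by have [? _ _ _] := W1 _ s h1 t st td; have [? _ _ _] := W1 _ s h2 t st td.
Qed.

(** Strict differentiability of the transition map handles the positions; for the velocities it is
    applied to the entries of its differential, after the splitting [diff_prod_split]. *)
Lemma good_trans c c' t Y V : atlas X c -> atlas X c' -> good c t Y V -> dom c' (gam t) ->
  good c' t (dd (trans c c') (c (gam t)) Y)
    (dd (trans c c') (c (gam t)) V + hess c c' (c (gam t)) (vel c gam t) Y).
Proof.
move=> cX c'X [dg dk [c1 c2 v1 v2] cY cV] d'.
have Vt : tdom c c' (c (gam t)) by exists (gam t).
have oV := @open_tdom R n M c c'.
have nearV (h : I -> R -> M) : (fun k => c (h k t)) @ F --> c (gam t) ->
    (\forall k \near F, dom c (h k t)) -> \forall k \near F, tdom c c' (c (h k t)) /\ dom c' (h k t).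
  move=> ch dh.
  have n1 : \forall k \near F, tdom c c' (c (h k t)).
    by apply: ch; apply: open_nbhs_nbhs.
  apply: filterS2 n1 dh => k [x [dx dx'] xh] dhk; split; first by exists x.
  by rewrite -(coorK dhk) -xh coorK.
have [e1 e2] : (\forall k \near F, dom c (g1 k t)) /\ (\forall k \near F, dom c (g2 k t)).
  by split; apply: filterS dk => k [].
have V1 := nearV g1 c1 e1; have V2 := nearV g2 c2 e2.
have trE x : dom c x -> trans c c' (c x) = c' x by move=> dx; rewrite /trans /= coorK.
have velE h : geodesic g h -> dom c (h t) -> dom c' (h t) ->
    vel c' h t = dd (trans c c') (c (h t)) (vel c h t).
  by move=> gh dh dh'; exact: (vel_trans gh cX c'X dh dh').
pose D i k : 'rV[R]_n -> R := fun x => dd (trans c c') x (delta_mx 0 i) 0 k.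
have DC1 i k : C1 (tdom c c') (D i k) by exact: (dtrans_C1 cX c'X).
have ddE x (a : 'rV[R]_n) k : dd (trans c c') x a 0 k = \sum_i a 0 i * D i k x.
  by rewrite dd_coord summxE; apply: eq_bigr => i _; rewrite mxE.
have ddc (y a : I -> 'rV[R]_n) x b : tdom c c' x -> y @ F --> x -> a @ F --> b ->
    (fun k => dd (trans c c') (y k) (a k)) @ F --> dd (trans c c') x b.
  move=> Vx cy /cvg_rowP ca; apply/cvg_rowP => l; rewrite ddE.
  rewrite (_ : (fun k => _) = fun k => \sum_i a k 0 i * D i l (y k)); last first.
    by apply/funext => k; rewrite ddE.
  apply: cvg_sumr => i; apply: cvgM => //.
  by apply: (cvg_comp _ _ cy); exact: (C1_cont _ _ _ (DC1 i l) Vx).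
have trc (y : I -> 'rV[R]_n) : y @ F --> c (gam t) ->
    (fun k => trans c c' (y k)) @ F --> trans c c' (c (gam t)).
  move=> cy; apply: (cvg_comp _ _ cy).
  exact: differentiable_continuous (trans_diff cX c'X Vt).
split; first exact: d'.
- by apply: filterS2 V1 V2 => k [_ ?] [_ ?].
- have K (h : I -> R -> M) : (forall k, geodesic g (h k)) -> (\forall k \near F, dom c (h k t)) ->
     (fun k => c (h k t)) @ F --> c (gam t) -> (fun k => vel c (h k) t) @ F --> vel c gam t ->
     (fun k => c' (h k t)) @ F --> c' (gam t) /\ (fun k => vel c' (h k) t) @ F --> vel c' gam t.
    move=> gh dh ch vh; have Vh := nearV h ch dh; split.
      rewrite -trE//; apply: cvg_trans (trc _ ch).
      by apply: near_eq_cvg; apply: filterS dh => k dk'; rewrite trE.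
    rewrite velE//; apply: cvg_trans (ddc _ _ _ _ Vt ch vh).
    by apply: near_eq_cvg; apply: filterS2 Vh dh => k [_ dk'] dk''; rewrite velE.
  have [? ?] := K g1 gg1 e1 c1 v1; have [? ?] := K g2 gg2 e2 c2 v2; by split.
- apply/cvg_rowP => l.
  have := C1_strict (FF := FF0) (tdom c c') (fun x => trans c c' x 0 l) (fun k => c (g1 k t))
    (fun k => c (g2 k t)) eps (c (gam t)) Y oV Vt (proj1 (trans_C2 cX c'X l)) c1 c2 cY.
  rewrite -(dd_trans_coord cX c'X _ _ Vt).
  apply: cvg_trans; apply: near_eq_cvg; apply: filterS dk => k [d1 d2].
  by rewrite !mxE !trE.
- apply/cvg_rowP => l.
  have -> : (dd (trans c c') (c (gam t)) V + hess c c' (c (gam t)) (vel c gam t) Y) 0 l =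
      \sum_i (V 0 i * D i l (c (gam t)) + vel c gam t 0 i * dd (D i l) (c (gam t)) Y).
    rewrite mxE ddE big_split /=; congr (_ + _); rewrite mxE.
    have df : differentiable (fun x => dd (trans c c') x (vel c gam t) 0 l) (c (gam t)).
      exact: C1_diff (dtrans_C1 cX c'X (vel c gam t) l) Vt.
    apply: (is_derive_uniq (dd_line Y df)).
    rewrite (_ : (fun s : R => _) = fun s : R => \sum_i vel c gam t 0 i * D i l (c (gam t) + s *: Y)).
      apply: isd_sum => i.
      have H := isdM _ _ _ _ _ (isd_cst (vel c gam t 0 i) 0) (dd_line Y (C1_diff _ _ _ (DC1 i l) Vt)).
      by apply: (isd_eq _ _ _ _ H); rewrite mul0r add0r.
    by apply/funext => s; rewrite ddE.
  apply: (@cvg_trans _ ((fun k => \sum_i (((eps k)^-1 *: (vel c (g2 k) t - vel c (g1 k) t)) 0 i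
        * D i l (c (g2 k t)) + vel c (g1 k) t 0 i *
          ((eps k)^-1 * (D i l (c (g2 k t)) - D i l (c (g1 k t)))))) @ F)).
    apply: near_eq_cvg; apply: filterS3 dk V1 V2 => k [d1 d2] [_ d1'] [_ d2'].
    rewrite (velE _ (gg1 k) d1 d1') (velE _ (gg2 k) d2 d2').
    rewrite [RHS]mxE [X in _ = _ * X]mxE [X in _ = _ * (_ + X)]mxE !ddE -sumrB mulr_sumr.
    apply: eq_bigr => i _; rewrite mxE [X in _ * X * _ + _]mxE [X in _ * (_ + X) * _ + _]mxE.
    exact: diff_prod_split.
  have /cvg_rowP cV' := cV; have /cvg_rowP v1' := v1.
  apply: cvg_sumr => i; apply: cvgD; apply: cvgM => //.
    by apply: (cvg_comp _ _ c2); exact: (C1_cont _ _ _ (DC1 i l) Vt).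
  exact: (C1_strict _ _ _ _ _ _ _ oV Vt (DC1 i l) c1 c2 cY).
Qed.

Definition goodex t := forall c, atlas X c -> dom c (gam t) -> exists Y V, good c t Y V.

Lemma goodexP c t Y V : atlas X c -> good c t Y V -> goodex t.
Proof.
move=> cX G c' c'X d'.
by do 2 eexists; exact: (good_trans cX c'X G d').
Qed.

(** The time step of a window depends on the chart, so the propagation goes through interval
    induction and not through steps of fixed length. *)
Lemma good_all t : 0 <= t -> goodex 0 -> goodex t.
Proof.
move=> t0; apply: (interval_ind 0 t (fun s t => goodex s -> goodex t)) => //.
  by move=> s u r _ _ _ _ h1 h2 /h1.
move=> u /andP[u0 ut]; have [c cX dc] := atlas_cover X (gam u).
have Vu : cdom c (c (gam u)) by exists (gam u).
have [r [d [K [r0 d0 K0 W]]]] := window_exists g cX Vu S0.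
have cc : (fun s => c (gam s)) @ nbhs u --> c (gam u).
  by have [/derivable1_diffP/differentiable_continuous] := geo_pos gg cX dc.
have : \forall s \near u, `|c (gam s) - c (gam u)| < r /\ dom c (gam s).
  have h1 : \forall s \near u, `|c (gam s) - c (gam u)| < r by exact: (cvg_near_dist _ _ _ cc r0).
  by have := near_geo (proj1 gg) dc; apply: filterS2 h1.
move=> /nbhs_ballP[e e0 H].
exists (Num.min d e); first by rewrite lt_min d0.
move=> s /andP[s0 st]; split.
  rewrite ltrBlDr => us su G.
  have /andP[h1 h2] : (u < s + d) && (u < s + e).
    by move: us; case: (ltP d e) => h us; lra.
  have [xs ds] : `|c (gam s) - c (gam u)| < r /\ dom c (gam s).
    by apply: H; rewrite -ball_normE /= ger0_norm ?subr_ge0// ltrBlDl.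
  have [Y [V GY]] := G c cX ds.
  have [Y' [V' GY']] := good_window W s0 xs GY su (ltW h1).
  exact: goodexP GY'.
move=> us su G.
have [Y [V GY]] := G c cX dc.
have xu : `|c (gam u) - c (gam u)| < r by rewrite subrr normr0.
have sd : s <= u + d.
  by move: su; case: (ltP d e) => h su; lra.
have [Y' [V' GY']] := good_window W u0 xu GY us sd.
exact: goodexP GY'.
Qed.

Definition jacY c t : 'rV[R]_n := lim ((fun k => (eps k)^-1 *: (c (g2 k t) - c (g1 k t))) @ F).
Definition jacV c t : 'rV[R]_n :=
  lim ((fun k => (eps k)^-1 *: (vel c (g2 k) t - vel c (g1 k) t)) @ F).

Lemma jacE c t Y V : good c t Y V -> jacY c t = Y /\ jacV c t = V.
Proof. by move=> [_ _ _ cY cV]; split; apply: cvg_lim. Qed.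

Lemma good_jac c t : goodex t -> atlas X c -> dom c (gam t) -> good c t (jacY c t) (jacV c t).
Proof. by move=> G cX d; have [Y [V GY]] := G c cX d; have [-> ->] := jacE GY. Qed.

Hypothesis G0 : goodex 0.

Lemma jac_good c t : 0 <= t -> atlas X c -> dom c (gam t) -> good c t (jacY c t) (jacV c t).
Proof. by move=> t0 cX d; apply: good_jac => //; exact: good_all. Qed.

Lemma jac_trans c c' t : 0 <= t -> atlas X c -> atlas X c' -> dom c (gam t) -> dom c' (gam t) ->
  jacY c' t = dd (trans c c') (c (gam t)) (jacY c t) /\
  jacV c' t = dd (trans c c') (c (gam t)) (jacV c t)
    + hess c c' (c (gam t)) (vel c gam t) (jacY c t).
Proof.
by move=> t0 cX c'X d d'; exact: jacE (good_trans cX c'X (jac_good t0 cX d) d').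
Qed.

(* Bounds uniform in [k] make the limit Lipschitz and let derivatives pass to the limit. *)
Lemma jac_window c u : 0 <= u -> atlas X c -> dom c (gam u) ->
  exists2 d, 0 < d & forall s, 0 <= s -> u - d < s -> s <= u -> exists2 B, 0 <= B &
  \forall k \near F, forall t, s <= t -> t <= u + d ->
  [/\ dom c (gam t), dom c (g1 k t), dom c (g2 k t) &
   [/\ `|vel c (g1 k) t| <= B, `|vel c (g2 k) t| <= B, `|acc g c (g1 k) t| <= B,
     `|acc g c (g2 k) t| <= B &
     `|(eps k)^-1 *: (vel c (g2 k) t - vel c (g1 k) t)| <= B /\
     `|(eps k)^-1 *: (acc g c (g2 k) t - acc g c (g1 k) t)| <= B]].
Proof.
move=> u0 cX du.
have Vu : cdom c (c (gam u)) by exists (gam u).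
have [r [dw [K [r0 dw0 K0 [W1 W2]]]]] := window_exists g cX Vu S0.
have cc : (fun s => c (gam s)) @ nbhs u --> c (gam u).
  by have [/derivable1_diffP/differentiable_continuous] := geo_pos gg cX du.
have : \forall s \near u, `|c (gam s) - c (gam u)| < r /\ dom c (gam s).
  have h1 : \forall s \near u, `|c (gam s) - c (gam u)| < r by exact: (cvg_near_dist _ _ _ cc r0).
  by have := near_geo (proj1 gg) du; apply: filterS2 h1.
move=> /nbhs_ballP[e e0 H].
exists (Num.min (dw / 2) e); first by rewrite lt_min divr_gt0.
move=> s s0 us su.
have [us1 us2] : u - dw / 2 < s /\ u - e < s.
  by move: us; case: (ltP (dw / 2) e) => h us; split; lra.
have dd2 : Num.min (dw / 2) e <= dw / 2 by rewrite ge_min lexx.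
set d := Num.min (dw / 2) e in us dd2 *.
have [xs ds] : `|c (gam s) - c (gam u)| < r /\ dom c (gam s).
  by apply: H; rewrite -ball_normE /= ger0_norm ?subr_ge0// ltrBlDl -ltrBlDr.
have G := jac_good s0 cX ds.
have [st0 stk] := good_start G s0 xs.
have [B B0 HB] := good_bound G.
exists (K + K * B); first by rewrite addr_ge0 ?mulr_ge0 ?(ltW K0).
apply: filterS2 stk HB => k [st1 st2] hB t t1 t2'.
have t2 : t <= s + dw by lra.
have [dt _ _ _] := W1 _ _ st0 t t1 t2.
have [d1 _ v1 a1] := W1 _ _ st1 t t1 t2.
have [d2 _ v2 a2] := W1 _ _ st2 t t1 t2.
have KB : 0 <= K * B by rewrite mulr_ge0// ltW.
have [gd ad] := W2 _ _ _ st2 st1 t t1 t2.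
have e1 : `|(eps k)^-1| * (K * gdist c (g2 k) (g1 k) s) <= K * B.
  by rewrite mulrCA; apply: ler_wpM2l => //; exact: ltW.
have KK x : x <= K -> x <= K + K * B by move=> xK; apply: le_trans xK _; rewrite lerDl.
split; [exact: dt | exact: d1 | exact: d2 |].
split; [exact: (KK _ v1) | exact: (KK _ v2) | exact: (KK _ a1) | exact: (KK _ a2) |].
split; rewrite normrZ.
  apply: (@le_trans _ _ (K * B)); last by rewrite lerDr ltW.
  apply: le_trans e1; apply: ler_wpM2l => //; apply: le_trans gd.
  by rewrite /gdist lerDr.
apply: (@le_trans _ _ (K * B)); last by rewrite lerDr ltW.
by apply: le_trans e1; exact: ler_wpM2l.
Qed.

Lemma quot_derive c k t : atlas X c -> dom c (g1 k t) -> dom c (g2 k t) ->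
  is_derive t (1 : R) (fun t => (eps k)^-1 *: (c (g2 k t) - c (g1 k t)))
    ((eps k)^-1 *: (vel c (g2 k) t - vel c (g1 k) t)) /\
  is_derive t (1 : R) (fun t => (eps k)^-1 *: (vel c (g2 k) t - vel c (g1 k) t))
    ((eps k)^-1 *: (- acc g c (g2 k) t - - acc g c (g1 k) t)).
Proof.
move=> cX d1 d2; split.
  have D := is_deriveB (geo_pos (gg2 k) cX d2) (geo_pos (gg1 k) cX d1).
  exact: (is_deriveZ (eps k)^-1 D).
have D := is_deriveB (geo_vel (gg2 k) cX d2) (geo_vel (gg1 k) cX d1).
exact: (is_deriveZ (eps k)^-1 D).
Qed.

(** Control is available for nonnegative times only, and derivatives for positive ones. At time 0
    this bound provides the limits from the right of [jacY] and [jacV]. *)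
Lemma jac_lip c s : 0 <= s -> atlas X c -> dom c (gam s) ->
  exists2 d, 0 < d & exists2 B, 0 <= B & forall t, s <= t -> t <= s + d ->
  [/\ dom c (gam t), `|jacY c t - jacY c s| <= B * (t - s) & `|jacV c t - jacV c s| <= B * (t - s)].
Proof.
move=> s0 cX ds; have [d d0 Hw] := jac_window s0 cX ds.
have [||B B0 H] := Hw s s0; [by rewrite ltrBlDr ltrDl | by [] | ].
exists d => //; exists B => // t st td.
have t0 : 0 <= t by exact: le_trans st.
have dt : dom c (gam t).
  by have [k Hk] := filter_ex H; have [? _ _ _] := Hk t st td.
have [_ _ _ cYt cVt] := jac_good t0 cX dt.
have [_ _ _ cYs cVs] := jac_good s0 cX ds.
have B' : B * `|t - s| = B * (t - s) by rewrite ger0_norm// subr_ge0.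
have sd : s <= s + d by exact: le_trans td.
rewrite -B'; split; first exact: dt.
  apply: (cvg_le_norm2 cYt cYs); apply: filterS H => k Hk.
  refine (@curve_lip2 _ _ (fun t => (eps k)^-1 *: (c (g2 k t) - c (g1 k t)))
     (fun t => (eps k)^-1 *: (vel c (g2 k) t - vel c (g1 k) t)) B s (s + d) s B0 (lexx s) sd _ _ t st td).
    by move=> u su ut; have [_ d1 d2 _] := Hk u su ut; have [? _] := quot_derive cX d1 d2.
  by move=> u su ut; have [_ _ _ [_ _ _ _ [h _]]] := Hk u su ut.
apply: (cvg_le_norm2 cVt cVs); apply: filterS H => k Hk.
refine (@curve_lip2 _ _ (fun t => (eps k)^-1 *: (vel c (g2 k) t - vel c (g1 k) t))
   (fun t => (eps k)^-1 *: (- acc g c (g2 k) t - - acc g c (g1 k) t)) B s (s + d) s B0 (lexx s) sd _ _ t st td).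
  by move=> u su ut; have [_ d1 d2 _] := Hk u su ut; have [_ ?] := quot_derive cX d1 d2.
by move=> u su ut; have [_ _ _ [_ _ _ _ [_ h]]] := Hk u su ut; rewrite -opprD scalerN normrN.
Qed.

(** The limit of the linearized geodesic equations. This is how solutions of the Jacobi equation
    come into existence: the linear differential equation is never solved directly. *)
Lemma jac_derive c t : 0 < t -> atlas X c -> dom c (gam t) ->
  is_derive t (1 : R) (jacY c) (jacV c t) /\
  is_derive t (1 : R) (jacV c) (- (dGam g c (c (gam t)) (jacY c t) (vel c gam t) (vel c gam t)
     + 2 *: Gam g c (c (gam t)) (vel c gam t) (jacV c t))).
Proof.
move=> t0 cX dt; have Vt : cdom c (c (gam t)) by exists (gam t).
have [d d0 Hw] := jac_window (ltW t0) cX dt.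
(* The window has to start before [t], so that [t] lies in its interior. *)
pose s := Num.max 0 (t - d / 2).
have st : s < t by rewrite gt_max t0 ltrBlDr ltrDl divr_gt0.
have s0 : 0 <= s by rewrite le_max lexx.
have [||B B0 H] := Hw s s0; [|exact: ltW|].
  rewrite lt_max; apply/orP; right; rewrite ltrD2l ltrN2.
  by rewrite ltr_pdivrMr // ltr_pMr // ltr1n.
have [_ _ [c1 c2 v1 v2] cY cV] := jac_good (ltW t0) cX dt.
pose e := Num.min (t - s) d.
have e0 : 0 < e by rewrite lt_min subr_gt0 st.
have eP u : `|u - t| < e -> s <= u /\ u <= t + d.
  by rewrite lt_min => /andP[]; rewrite !ltr_norml; split; lra.
have td : t < t + d by rewrite ltrDl.
have Lip := fun x dx => @curve_lip2 R n x dx B s (t + d) t B0 (ltW st) (ltW td).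
pose PF2 := filter_prod F (nbhs t).
have FP : ProperFilter PF2 by exact: filter_prod_proper.
have P1 : (fun p => c (g1 p.1 p.2)) @ PF2 --> c (gam t).
  apply: (prod_cvg (x := fun k u => c (g1 k u)) B0 st td c1); apply: filterS H => k Hk.
  apply: (Lip (fun u => c (g1 k u)) (vel c (g1 k))) => u u1 u2; have [_ h1 h2 [h3 _ _ _ _]] := Hk u u1 u2; last by [].
  exact: geo_pos.
have P2 : (fun p => c (g2 p.1 p.2)) @ PF2 --> c (gam t).
  apply: (prod_cvg (x := fun k u => c (g2 k u)) B0 st td c2); apply: filterS H => k Hk.
  apply: (Lip (fun u => c (g2 k u)) (vel c (g2 k))) => u u1 u2; have [_ h1 h2 [_ h3 _ _ _]] := Hk u u1 u2; last by [].
  exact: geo_pos.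
have Q1 : (fun p => vel c (g1 p.1) p.2) @ PF2 --> vel c gam t.
  apply: (prod_cvg (x := fun k u => vel c (g1 k) u) B0 st td v1); apply: filterS H => k Hk.
  apply: (Lip (fun u => vel c (g1 k) u) (fun u => - acc g c (g1 k) u)) => u u1 u2; have [_ h1 h2 [_ _ h3 _ _]] := Hk u u1 u2.
    exact: geo_vel.
  by rewrite normrN.
have Q2 : (fun p => vel c (g2 p.1) p.2) @ PF2 --> vel c gam t.
  apply: (prod_cvg (x := fun k u => vel c (g2 k) u) B0 st td v2); apply: filterS H => k Hk.
  apply: (Lip (fun u => vel c (g2 k) u) (fun u => - acc g c (g2 k) u)) => u u1 u2; have [_ h1 h2 [_ _ _ h3 _]] := Hk u u1 u2.
    exact: geo_vel.
  by rewrite normrN.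
have Z1 : (fun p => (eps p.1)^-1 *: (c (g2 p.1 p.2) - c (g1 p.1 p.2))) @ PF2 --> jacY c t.
  apply: (prod_cvg (x := fun k u => (eps k)^-1 *: (c (g2 k u) - c (g1 k u))) B0 st td cY).
  apply: filterS H => k Hk.
  apply: (Lip (fun u => (eps k)^-1 *: (c (g2 k u) - c (g1 k u)))
     (fun u => (eps k)^-1 *: (vel c (g2 k) u - vel c (g1 k) u))) => u u1 u2; have [_ h1 h2 [_ _ _ _ [h3 _]]] := Hk u u1 u2; last by [].
  by have [? _] := quot_derive cX h1 h2.
have Z2 : (fun p => (eps p.1)^-1 *: (vel c (g2 p.1) p.2 - vel c (g1 p.1) p.2)) @ PF2 --> jacV c t.
  apply: (prod_cvg (x := fun k u => (eps k)^-1 *: (vel c (g2 k) u - vel c (g1 k) u)) B0 st td cV).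
  apply: filterS H => k Hk.
  apply: (Lip (fun u => (eps k)^-1 *: (vel c (g2 k) u - vel c (g1 k) u))
     (fun u => (eps k)^-1 *: (- acc g c (g2 k) u - - acc g c (g1 k) u))) => u u1 u2; have [_ h1 h2 [_ _ _ _ [_ h3]]] := Hk u u1 u2.
    by have [_ ?] := quot_derive cX h1 h2.
  by rewrite -opprD scalerN normrN.
have nearT u : `|u - t| < e -> 0 <= u /\ dom c (gam u).
  move=> /eP[u1 u2]; split; first exact: le_trans u1.
  by have [k Hk] := filter_ex H; have [? _ _ _] := Hk u u1 u2.
split; apply/derive_row => i.
  have /cvg_rowP Z2i := Z2.
  apply: (@limit_derive _ _ F _ (fun k u => ((eps k)^-1 *: (c (g2 k u) - c (g1 k u))) 0 i)
     (fun k u => ((eps k)^-1 *: (vel c (g2 k) u - vel c (g1 k) u)) 0 i) _ _ _ e e0).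
  - apply: filterS H => k Hk u /eP[u1 u2]; have [_ h1 h2 _] := Hk u u1 u2.
    by have [/derive_row D _] := quot_derive cX h1 h2; exact: D.
  - move=> u ue; have [u0 du] := nearT u ue.
    by have [_ _ _ /cvg_rowP q _] := jac_good u0 cX du; exact: q.
  - exact: Z2i.
apply: (@limit_derive _ _ F _ (fun k u => ((eps k)^-1 *: (vel c (g2 k) u - vel c (g1 k) u)) 0 i)
   (fun k u => ((eps k)^-1 *: (- acc g c (g2 k) u - - acc g c (g1 k) u)) 0 i) _ _ _ e e0).
- apply: filterS H => k Hk u /eP[u1 u2]; have [_ h1 h2 _] := Hk u u1 u2.
  by have [_ /derive_row D] := quot_derive cX h1 h2; exact: D.
- move=> u ue; have [u0 du] := nearT u ue.
  by have [_ _ _ _ /cvg_rowP q] := jac_good u0 cX du; exact: q.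
have QS := @qs_strict R (I * R)%type PF2 FP n (cdom c) (christoffel g c i)
  (fun p => c (g1 p.1 p.2)) (fun p => c (g2 p.1 p.2)) (fun p => vel c (g1 p.1) p.2)
  (fun p => vel c (g2 p.1) p.2) (fun p => eps p.1) _ _ _ _ (@open_cdom _ _ _ c) Vt
  (fun j l => christoffel_C1 g cX i j l) P1 P2 Q1 Q2 Z1 Z2.
have -> : (- (dGam g c (c (gam t)) (jacY c t) (vel c gam t) (vel c gam t)
     + 2 *: Gam g c (c (gam t)) (vel c gam t) (jacV c t))) 0 i =
  - (dqs (christoffel g c i) (c (gam t)) (jacY c t) (vel c gam t) (vel c gam t)
     + (qs (christoffel g c i) (c (gam t)) (jacV c t) (vel c gam t)
        + qs (christoffel g c i) (c (gam t)) (vel c gam t) (jacV c t))).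
  exact: jacobi_coord cX Vt.
have E : (fun p => ((eps p.1)^-1 *: (- acc g c (g2 p.1) p.2 - - acc g c (g1 p.1) p.2)) 0 i) =
    (fun p => - ((eps p.1)^-1 * (qs (christoffel g c i) (c (g2 p.1 p.2)) (vel c (g2 p.1) p.2) (vel c (g2 p.1) p.2)
      - qs (christoffel g c i) (c (g1 p.1 p.2)) (vel c (g1 p.1) p.2) (vel c (g1 p.1) p.2)))).
  by apply/funext => p; rewrite !accE; exact: neg_quot_coord.
by rewrite E; exact: (cvgN QS).
Qed.

End JacobiLimit.

(** * Comparison for Jacobi fields *)

Section JacobiInequality.
Context {R : realType}.

(** A mean value inequality for functions that are differentiable at positive times and merely have
    a limit at 0 from the right. *)
Lemma from0 (f df : R -> R) (l L T : R) : 0 < T ->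
  (forall t : R, 0 < t -> t <= T -> is_derive t (1 : R) f (df t)) ->
  (forall t : R, 0 < t -> t <= T -> L <= df t) ->
  f s @[s --> 0^'+] --> l -> l + L * T <= f T.
Proof.
move=> T0 H HL fl.
have c1 : (fun s => f s + L * (T - s)) @ 0^'+ --> l + L * (T - 0).
  apply: (cvgD fl); apply: cvgM; first exact: cvg_cst.
  apply: cvgB; first exact: cvg_cst.
  by apply: cvg_at_right_filter; exact: cvg_id.
rewrite -[T in leLHS]subr0.
apply: (closed_cvg (fun x : R => x <= f T) (@closed_le _ (f T)) _ _ c1).
near=> s.
have sT : s <= T by near: s; exact: nbhs_right_le.
have s0 : 0 < s by [].
have [t /andP[t1 t2] E] := mvt_isd (f := f) (df := df) sT
  (fun (t : R) (h : s <= t <= T) => let: conj h1 h2 := andP h in H t (lt_le_trans s0 h1) h2).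
rewrite addrC -lerBrDr E; apply: ler_wpM2r; first by rewrite subr_ge0.
exact: HL (lt_le_trans s0 t1) t2.
Unshelve. all: by end_near. Qed.

Lemma isd_sqrt (f : R -> R) (t a : R) : 0 < f t -> is_derive t (1 : R) f a ->
  is_derive t (1 : R) (fun s => Num.sqrt (f s)) (a / (2 * Num.sqrt (f t))).
Proof.
move=> f0 fa; have := @is_derive1_comp R (@Num.sqrt R) f t _ _ (is_derive1_sqrt f0) fa.
by move=> H; apply: (isd_eq _ _ _ _ H); rewrite mulrC.
Qed.

Lemma isd_inv (f : R -> R) (t a : R) : f t != 0 -> is_derive t (1 : R) f a ->
  is_derive t (1 : R) (fun s => (f s)^-1) (- a / f t ^+ 2).
Proof.
move=> f0 fa; have H := is_deriveV f0 fa.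
by apply: (isd_eq _ _ _ _ H); rewrite -[_ *: _]/(_ * _) exprnN; ring.
Qed.

(** In the application [a], [m] and [b] are |Y|^2, <Y, Y'> and |Y'|^2 for a Jacobi field with Y(0) =
    0, Y' being the covariant derivative, and [W] is |Y'(0)|^2. [bdm] expresses non-positive
    curvature, and [dbK] the bound [K] on the norm of the Jacobi operator. *)
Variables (a b m dm db : R -> R) (K k W : R).
Hypothesis Da : forall t : R, 0 < t -> t <= 1 -> is_derive t (1 : R) a (2 * m t).
Hypothesis Dm : forall t : R, 0 < t -> t <= 1 -> is_derive t (1 : R) m (dm t).
Hypothesis Db : forall t : R, 0 < t -> t <= 1 -> is_derive t (1 : R) b (db t).
Hypothesis a0 : forall t : R, 0 < t -> t <= 1 -> 0 <= a t.
Hypothesis b0 : forall t : R, 0 < t -> t <= 1 -> 0 <= b t.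
Hypothesis mab : forall t : R, 0 < t -> t <= 1 -> m t ^+ 2 <= a t * b t.
Hypothesis bdm : forall t : R, 0 < t -> t <= 1 -> b t <= dm t.
Hypothesis dbK : forall t : R, 0 < t -> t <= 1 -> db t ^+ 2 <= (2 * K) ^+ 2 * (a t * b t).
Hypothesis k1 : 1 <= k.
Hypothesis K0 : 0 <= K.
Hypothesis kK : K <= k ^+ 2.
Hypothesis ca : a s @[s --> 0^'+] --> (0 : R).
Hypothesis cm : m s @[s --> 0^'+] --> (0 : R).
Hypothesis cb : b s @[s --> 0^'+] --> W.
Hypothesis W0 : 0 <= W.

Let gm_mean (x y z c : R) : 0 <= c -> 0 <= x -> 0 <= y -> z ^+ 2 <= c ^+ 2 * (x * y) ->
  forall d : R, 0 < d -> c <= d ^+ 2 -> z <= d * (x * d ^+ 2 + y) / 2.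
Proof.
move=> c0 x0 y0 zz d d0 cd.
have d20 : 0 < d ^+ 2 by rewrite exprn_gt0.
apply: le_trans (ler_norm _) _.
have p0 : 0 <= d * (x * d ^+ 2 + y) / 2.
  by rewrite divr_ge0// mulr_ge0 ?(ltW d0)// addr_ge0// mulr_ge0// ltW.
rewrite -(@ler_pXn2r _ 2)// ?nnegrE// real_normK ?num_real//.
apply: (le_trans zz).
apply: (@le_trans _ _ (d ^+ 2 * d ^+ 2 * (x * y))).
  by rewrite ler_wpM2r ?mulr_ge0// expr2 ler_pM.
have := sqr_ge0 (x * d ^+ 2 - y) => h.
rewrite (_ : (d * (x * d ^+ 2 + y) / 2) ^+ 2 = d ^+ 2 * ((x * d ^+ 2 - y) ^+ 2 / 4) + d ^+ 2 * d ^+ 2 * (x * y)).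
  by rewrite lerDr mulr_ge0 ?divr_ge0// ltW.
by field.
Qed.

(** The quantity k^2 a + b grows at most at the rate [4 * k]: by the arithmetic-geometric mean
    inequality each of the two terms of its derivative is at most [k] times it. It dominates [a]
    because [1 <= k]. *)
Lemma jacobi_ode_upper : a 1 <= expR (4 * k) * W.
Proof.
have k0 : 0 < k by exact: lt_le_trans k1.
pose e (t : R) := k ^+ 2 * a t + b t.
have De (t : R) : 0 < t -> t <= 1 -> is_derive t (1 : R) (fun s => e s * expR (- (4 * k) * s))
    ((k ^+ 2 * (2 * m t) + db t) * expR (- (4 * k) * t) + e t * (- (4 * k) * expR (- (4 * k) * t))).
  move=> t0 t1; apply: isdM; last exact: isd_expR.
  have D := isdD _ _ _ _ _ (isdM _ _ _ _ _ (isd_cst (k ^+ 2) t) (Da t0 t1)) (Db t0 t1).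
  by apply: (isd_eq _ _ _ _ D); ring.
have ce : (fun s => - (e s * expR (- (4 * k) * s))) @ 0^'+ --> - ((k ^+ 2 * 0 + W) * expR (- (4 * k) * 0)).
  apply: cvgN; apply: cvgM; first by apply: cvgD => //; apply: cvgM => //; exact: cvg_cst.
  apply: cvg_at_right_filter.
  exact: (isd_continuous (isd_expR _ _)).
have h := @from0 (fun s => - (e s * expR (- (4 * k) * s))) _ _ 0 1 ltr01
  (fun (t : R) t0 t1 => isdN _ _ _ (De t t0 t1)) _ ce.
have {h} : - ((k ^+ 2 * 0 + W) * expR (- (4 * k) * 0)) + 0 * 1 <= - (e 1 * expR (- (4 * k) * 1)).
  apply: h => t t0 t1.
  rewrite (_ : - _ = (4 * k * e t - (k ^+ 2 * (2 * m t) + db t)) * expR (- (4 * k) * t)); last by ring.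
  rewrite mulr_ge0 ?expR_ge0// subr_ge0.
  have A := a0 t0 t1; have B := b0 t0 t1.
  have h2 : db t / 2 <= k * (a t * k ^+ 2 + b t) / 2.
    apply: (gm_mean K0) => //; rewrite expr_div_n.
    rewrite ler_pdivrMr ?exprn_gt0//; apply: le_trans (dbK t0 t1) _.
    by rewrite le_eqVlt; apply/orP; left; apply/eqP; ring.
  rewrite (_ : a t * _ + b t = e t) in h2; last by rewrite /e mulrC.
  have h1' : m t <= (a t * k ^+ 2 + b t) / (2 * k).
    apply: le_trans (ler_norm _) _.
    have p0 : 0 <= (a t * k ^+ 2 + b t) / (2 * k).
      apply: divr_ge0; last by rewrite mulr_ge0// ltW.
      by apply: addr_ge0 => //; apply: mulr_ge0 => //; rewrite exprn_ge0// ltW.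
    rewrite -(@ler_pXn2r _ 2)// ?nnegrE// real_normK ?num_real//.
    apply: (le_trans (mab t0 t1)).
    rewrite -subr_ge0 (_ : _ - _ = ((a t * k ^+ 2 - b t) / (2 * k)) ^+ 2) ?sqr_ge0//.
    by field; rewrite gt_eqF.
  have h3 : k ^+ 2 * (2 * m t) <= k * e t.
    apply: (@le_trans _ _ (k ^+ 2 * (2 * ((a t * k ^+ 2 + b t) / (2 * k))))).
      by rewrite ler_wpM2l ?exprn_ge0 ?(ltW k0)// ler_wpM2l.
    by rewrite le_eqVlt; apply/orP; left; apply/eqP; rewrite /e; field; rewrite gt_eqF.
  have : 0 <= k * e t.
    by apply: mulr_ge0; [exact: ltW | apply: addr_ge0 => //; apply: mulr_ge0 => //; rewrite exprn_ge0// ltW].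
  by rewrite -[4 * k * e t]mulrA; move: h2 h3; set q := k * e t; set z := k ^+ 2 * _; lra.
rewrite mulr0 add0r !mulr0 expR0 mulr1 mul0r addr0 lerN2 mulr1 => h.
have E0 := expR_gt0 (4 * k).
have : e 1 <= expR (4 * k) * W.
  rewrite -(ler_pM2l E0) in h; move: h; rewrite mulrCA -expRD subrr expR0 mulr1; exact.
apply: le_trans; rewrite /e.
have A := a0 ltr01 (lexx 1); have B := b0 ltr01 (lexx 1).
have k21 : 1 <= k ^+ 2 by rewrite exprn_ege1.
by nra.
Qed.

(** Comparison with flat space. Cauchy-Schwarz and [bdm] make the derivative of |Y|, the square root
    of [a], non-decreasing; |Y| vanishes at 0, hence |Y(t)| <= t |Y(1)|, and near 0 |Y(t)|^2 is at
    least nearly W t^2. *)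
Lemma jacobi_ode_lower : W <= a 1.
Proof.
apply/ler_addgt0Pr => /= d d0.
have [|Wd] := leP W d.
  by move=> h; apply: le_trans h _; rewrite lerDr a0.
(* The loss [d] makes [b] at least [w] on a whole interval after 0. Integrating twice gives
   positivity of [a], needed to differentiate its square root. *)
pose w := W - d; have w0 : 0 < w by rewrite subr_gt0.
rewrite -lerBlDr -/w.
have [t0 t00 [t01 bw]] : exists2 t0 : R, 0 < t0 & t0 <= 1 /\ forall t : R, 0 < t -> t <= t0 -> w <= b t.
  have := cvg_near_dist (FF := at_right_proper_filter 0) _ _ _ cb d0.
  move=> [e e0 He]; exists (Num.min 1 (e / 2)); first by rewrite lt_min ltr01 divr_gt0.
  split; first by rewrite ge_min lexx.
  move=> t tp; rewrite le_min => /andP[t1 t2].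
  have := He t; rewrite /= sub0r normrN gtr0_norm// => /(_ _ tp).
  have te : t < e by move: e0 => /=; lra.
  by move=> /(_ te); rewrite /w ltr_norml; lra.
have mw (t : R) : 0 < t -> t <= t0 -> w * t <= m t.
  move=> tp tt; have tl1 : t <= 1 by exact: le_trans t01.
  have h := @from0 m dm 0 w t tp _ _ cm; rewrite add0r in h; apply: h => s s0 st.
    exact: Dm s0 (le_trans st tl1).
  apply: le_trans (bw _ s0 (le_trans st tt)) _; exact: bdm s0 (le_trans st tl1).
have aw (t : R) : 0 < t -> t <= t0 -> w * t ^+ 2 <= a t.
  move=> tp tt; have tl1 : t <= 1 by exact: le_trans t01.
  have c1 : (fun s => a s - w * (s * s)) @ 0^'+ --> 0 - w * (0 * 0).
    apply: cvgB => //; apply: cvgM; first exact: cvg_cst.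
    by apply: cvgM; apply: cvg_at_right_filter; exact: cvg_id.
  have D (s : R) : 0 < s -> s <= t -> is_derive s (1 : R) (fun s => a s - w * (s * s)) (2 * (m s - w * s)).
    move=> s0 st; have h := isdD _ _ _ _ _ (Da s0 (le_trans st tl1))
      (isdN _ _ _ (isdM _ _ _ _ _ (isd_cst w s) (isdM _ _ _ _ _ (isd_id s) (isd_id s)))).
    by apply: (isd_eq _ _ _ _ h); ring.
  have h := @from0 _ _ _ 0 t tp D _ c1.
  rewrite -subr_ge0; apply: le_trans (h _).
    by rewrite !mulr0 mul0r subrr addr0.
  by move=> s s0 st; rewrite mulr_ge0// subr_ge0 mw// (le_trans st).
have mpos (t : R) : 0 < t -> t <= 1 -> 0 < m t.
  move=> tp t1; have [tt|tt] := leP t t0.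
    by apply: lt_le_trans (mw _ tp tt); rewrite mulr_gt0.
  have [s /andP[s1 s2] E] := mvt_isd (f := m) (df := dm) (ltW tt)
    (fun (s : R) (h : t0 <= s <= t) => let: conj h1 h2 := andP h in Dm (lt_le_trans t00 h1) (le_trans h2 t1)).
  have : 0 <= m t - m t0.
    have sp : 0 < s by exact: lt_le_trans s1.
    have sl : s <= 1 by exact: le_trans t1.
    rewrite E mulr_ge0 ?subr_ge0 ?(ltW tt)//; apply: le_trans (bdm sp sl); exact: b0.
  rewrite subr_ge0; apply: lt_le_trans; apply: lt_le_trans (mw _ t00 (lexx _)).
  by rewrite mulr_gt0.
have apos (t : R) : 0 < t -> t <= 1 -> 0 < a t.
  move=> tp t1; have [tt|tt] := leP t t0.
    by apply: lt_le_trans (aw _ tp tt); rewrite mulr_gt0// exprn_gt0.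
  have [s /andP[s1 s2] E] := mvt_isd (f := a) (df := fun s => 2 * m s) (ltW tt)
    (fun (s : R) (h : t0 <= s <= t) => let: conj h1 h2 := andP h in Da (lt_le_trans t00 h1) (le_trans h2 t1)).
  have : 0 <= a t - a t0.
    have sp : 0 < s by exact: lt_le_trans s1.
    have sl : s <= 1 by exact: le_trans t1.
    by rewrite E mulr_ge0 ?subr_ge0 ?(ltW tt)// mulr_ge0// ltW// mpos.
  rewrite subr_ge0; apply: lt_le_trans; apply: lt_le_trans (aw _ t00 (lexx _)).
  by rewrite mulr_gt0// exprn_gt0.
pose p (t : R) := Num.sqrt (a t).
have pp (t : R) : 0 < t -> t <= 1 -> 0 < p t by move=> tp t1; rewrite sqrtr_gt0 apos.
pose v (t : R) := m t * (p t)^-1.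
have Dp (t : R) : 0 < t -> t <= 1 -> is_derive t (1 : R) p (v t).
  move=> tp t1; have h := isd_sqrt (apos _ tp t1) (Da tp t1).
  apply: (isd_eq _ _ _ _ h); rewrite -/(p t) /v; field.
  by rewrite gt_eqF// pp.
have Dv (t : R) : 0 < t -> t <= 1 -> is_derive t (1 : R) v (dm t * (p t)^-1 + m t * (- v t / p t ^+ 2)).
  move=> tp t1; apply: isdM; first exact: Dm.
  by apply: isd_inv; [rewrite gt_eqF// pp | exact: Dp].
have dv0 (t : R) : 0 < t -> t <= 1 -> 0 <= dm t * (p t)^-1 + m t * (- v t / p t ^+ 2).
  move=> tp t1; have p0 := pp _ tp t1.
  have pa : p t ^+ 2 = a t by rewrite sqr_sqrtr// ltW// apos.
  rewrite (_ : _ + _ = (dm t * p t ^+ 2 - m t ^+ 2) / p t ^+ 3).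
    rewrite divr_ge0 ?exprn_ge0 ?(ltW p0)// pa subr_ge0.
    by apply: le_trans (mab tp t1) _; rewrite mulrC ler_wpM2r ?bdm// ltW// apos.
  by rewrite /v; field; rewrite gt_eqF.
have vmono (s t : R) : 0 < s -> s <= t -> t <= 1 -> v s <= v t.
  move=> sp st t1; have [q /andP[q1 q2] E] := mvt_isd (f := v) (df := fun t => dm t * (p t)^-1 + m t * (- v t / p t ^+ 2)) st
    (fun (q : R) (h : s <= q <= t) => let: conj h1 h2 := andP h in Dv q (lt_le_trans sp h1) (le_trans h2 t1)).
  rewrite -subr_ge0 E mulr_ge0 ?subr_ge0// dv0//; [exact: lt_le_trans q1 | exact: le_trans t1].
have pv (t : R) : 0 < t -> t <= 1 -> p t <= v t * t.
  move=> tp t1.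
  have cp : (fun s => - p s) @ 0^'+ --> - Num.sqrt 0.
    by apply: cvgN; apply: (cvg_comp _ _ ca); exact: sqrt_continuous.
  have h := @from0 (fun s => - p s) _ _ (- v t) t tp
    (fun (s : R) s0 st => isdN _ _ _ (Dp s s0 (le_trans st t1))) _ cp.
  have {h} : - Num.sqrt 0 + - v t * t <= - p t.
    by apply: h => s s0 st; rewrite lerN2; exact: vmono.
  by rewrite sqrtr0 oppr0 add0r mulNr lerN2.
have [q /andP[q1 q2] E] := mvt_isd (f := p) t01
    (fun (q : R) (h : t0 <= q <= 1) => let: conj h1 h2 := andP h in Dp q (lt_le_trans t00 h1) h2).
have qv : v t0 <= v q by exact: vmono.
have h1 : p t0 <= v t0 * t0 by exact: pv.
have h2 : p t0 <= t0 * p 1.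
  have : v t0 * (1 - t0) <= p 1 - p t0 by rewrite E ler_wpM2r ?subr_ge0.
  have := pp _ t00 t01.
  by nra.
have a1 : p 1 ^+ 2 = a 1 by rewrite sqr_sqrtr// a0.
have a2 : p t0 ^+ 2 = a t0 by rewrite sqr_sqrtr// a0.
have h3 : a t0 <= t0 ^+ 2 * a 1.
  rewrite -a1 -a2 -exprMn lerXn2r// nnegrE ?mulr_ge0 ?sqrtr_ge0 ?(ltW t00)//.
have := aw _ t00 (lexx _) => h4.
have := le_trans h4 h3; rewrite [w * _]mulrC ler_pM2l// exprn_gt0//.
Qed.

End JacobiInequality.

(** * Jacobi fields along a geodesic *)

Section JacobiField.
Context {R : realType} {n : nat} {M : ptopologicalType} {X : manifold R n M}.
Variable g : riemannian_metric X.
Variables (gam : R -> M) (Y V : chart R n M -> R -> 'rV[R]_n) (c_m S : R).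
Implicit Types (c : chart R n M) (s t : R).
Hypothesis gg : geodesic g gam.
Hypothesis c_m0 : 0 < c_m.
Hypothesis Hsec : sectional_bounds g (- c_m) 0.
Hypothesis gS : spd2_le g gam S.
Hypothesis S0 : 0 <= S.
Hypothesis JT : forall c c' t, 0 <= t -> atlas X c -> atlas X c' ->
  dom c (gam t) -> dom c' (gam t) ->
  Y c' t = dd (trans c c') (c (gam t)) (Y c t) /\
  V c' t = dd (trans c c') (c (gam t)) (V c t) + hess c c' (c (gam t)) (vel c gam t) (Y c t).
Hypothesis JD : forall c t, 0 < t -> atlas X c -> dom c (gam t) ->
  is_derive t (1 : R) (Y c) (V c t) /\
  is_derive t (1 : R) (V c) (- (dGam g c (c (gam t)) (Y c t) (vel c gam t) (vel c gam t)
     + 2 *: Gam g c (c (gam t)) (vel c gam t) (V c t))).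
Hypothesis JL : forall c, atlas X c -> dom c (gam 0) ->
  exists2 d : R, 0 < d & exists2 B : R, 0 <= B & forall t, 0 <= t -> t <= 0 + d ->
  [/\ dom c (gam t), `|Y c t - Y c 0| <= B * (t - 0) & `|V c t - V c 0| <= B * (t - 0)].

(** The covariant derivative of [Y] along [gam]; unlike [V] it transforms as a tangent vector. *)
Definition covY c t : 'rV[R]_n := V c t + Gam g c (c (gam t)) (vel c gam t) (Y c t).

Lemma covY_trans c c' t : 0 <= t -> atlas X c -> atlas X c' -> dom c (gam t) -> dom c' (gam t) ->
  covY c' t = dd (trans c c') (c (gam t)) (covY c t).
Proof.
move=> t0 cX c'X d d'; have Vt : tdom c c' (c (gam t)) by exists (gam t).
have [YE VE] := JT t0 cX c'X d d'.
rewrite /covY ddD (Gam_trans g cX c'X _ _ Vt) -(vel_trans gg cX c'X d d') -YE VE.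
by rewrite /trans /= coorK// addrA.
Qed.

Lemma jacobi_inner_trans c c' t : 0 <= t -> atlas X c -> atlas X c' ->
  dom c (gam t) -> dom c' (gam t) ->
  [/\ inner g c' (c' (gam t)) (Y c' t) (Y c' t) = inner g c (c (gam t)) (Y c t) (Y c t),
   inner g c' (c' (gam t)) (Y c' t) (covY c' t) = inner g c (c (gam t)) (Y c t) (covY c t) &
   inner g c' (c' (gam t)) (covY c' t) (covY c' t) = inner g c (c (gam t)) (covY c t) (covY c t)].
Proof.
move=> t0 cX c'X d d'; have Vt : tdom c c' (c (gam t)) by exists (gam t).
have [YE _] := JT t0 cX c'X d d'.
rewrite (covY_trans t0 cX c'X d d') YE.
have E : c' (gam t) = trans c c' (c (gam t)) by rewrite /trans /= coorK.
by rewrite E; split; rewrite -(inner_trans g cX c'X _ _ Vt).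
Qed.

Lemma inner_cov c (A B : R -> 'rV[R]_n) (t : R) (A' B' : 'rV[R]_n) : atlas X c -> dom c (gam t) ->
  is_derive t (1 : R) A A' -> is_derive t (1 : R) B B' ->
  is_derive t (1 : R) (fun s => inner g c (c (gam s)) (A s) (B s))
    (inner g c (c (gam t)) (A' + Gam g c (c (gam t)) (vel c gam t) (A t)) (B t)
     + inner g c (c (gam t)) (A t) (B' + Gam g c (c (gam t)) (vel c gam t) (B t))).
Proof.
move=> cX d DA DB; have Vt : cdom c (c (gam t)) by exists (gam t).
have D := inner_curve g cX Vt (geo_pos gg cX d) DA DB.
apply: (isd_eq _ _ _ _ D); rewrite (metric_compat g cX _ _ _ Vt) innerDl innerDr.
move: (inner _ _ _ _ _) (inner _ _ _ _ _) (inner _ _ _ _ _) (inner _ _ _ _ _) => p q r s.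
ring.
Qed.

Lemma covY_derive c t : 0 < t -> atlas X c -> dom c (gam t) ->
  is_derive t (1 : R) (covY c)
    (- (dGam g c (c (gam t)) (Y c t) (vel c gam t) (vel c gam t)
       + 2 *: Gam g c (c (gam t)) (vel c gam t) (V c t))
     + (dGam g c (c (gam t)) (vel c gam t) (vel c gam t) (Y c t)
        + Gam g c (c (gam t)) (- Gam g c (c (gam t)) (vel c gam t) (vel c gam t)) (Y c t)
        + Gam g c (c (gam t)) (vel c gam t) (V c t))).
Proof.
move=> t0 cX d; have Vt : cdom c (c (gam t)) by exists (gam t).
have [DY DV] := JD t0 cX d.
apply: is_deriveD; apply/derive_row => k.
rewrite (_ : (fun s => _) = fun s => qs (christoffel g c k) (c (gam s)) (vel c gam s) (Y c s)).
  have D := dqs_curve (K := christoffel g c k) (fun i j => christoffel_diff g cX k i j Vt)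
    (geo_pos gg cX d) (geo_vel gg cX d) DY.
  by apply: (isd_eq _ _ _ _ D); rewrite [RHS]mxE [in RHS]mxE; congr (_ + _ + _); rewrite mxE.
by apply/funext => s; rewrite mxE.
Qed.

(** The Jacobi equation in its invariant form Y'' = - R(Y, gam') gam', recovered from the coordinate
    equation for [V]. *)
Lemma covY_cov c t : 0 < t -> atlas X c -> dom c (gam t) -> exists2 D,
  is_derive t (1 : R) (covY c) D &
  D + Gam g c (c (gam t)) (vel c gam t) (covY c t) =
    - Rm g c (c (gam t)) (Y c t) (vel c gam t) (vel c gam t).
Proof.
move=> t0 cX d; have Vt : cdom c (c (gam t)) by exists (gam t).
apply: ex_intro2 (covY_derive t0 cX d) _.
rewrite /covY; move: (c (gam t)) Vt (Y c t) (vel c gam t) (V c t) => x Vx y v w.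
rewrite /Rm GamDr (GamC g cX _ y Vx) (dGamC g cX _ _ y Vx).
rewrite (_ : Gam g c x y v = Gam g c x v y); last exact: GamC.
have -> : Gam g c x y (- Gam g c x v v) = - Gam g c x y (Gam g c x v v).
  by rewrite -scaleN1r GamZr scaleN1r.
apply/rowP => k.
move: (dGam _ _ _ _ _ _) (dGam _ _ _ _ _ _) (Gam _ _ _ _ (Gam _ _ _ _ _))
   (Gam _ _ _ _ (Gam _ _ _ _ _)) (Gam _ _ _ _ _) => p q r s u.
by rewrite !mxE; ring.
Qed.

Theorem jacobi_bounds c c1 : atlas X c -> dom c (gam 0) -> atlas X c1 -> dom c1 (gam 1) ->
  Y c 0 = 0 ->
  inner g c (c (gam 0)) (V c 0) (V c 0) <= inner g c1 (c1 (gam 1)) (Y c1 1) (Y c1 1) <=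
  expR (4 * (Num.sqrt (c_m * S) + 1)) * inner g c (c (gam 0)) (V c 0) (V c 0).
Proof.
move=> cX d0 c1X d1 Y0.
(* A chart is chosen at every point, so that [a], [m] and [b] become functions of time alone. By
   [jacobi_inner_trans] their values do not depend on this choice, and near a given time they can be
   differentiated in one fixed chart. *)
have chP x : exists c, atlas X c /\ dom c x by have [c' ? ?] := atlas_cover X x; exists c'.
pose ch x := sval (cid (chP x)).
have chX x : atlas X (ch x) by rewrite /ch; case: cid => ? [].
have chd x : dom (ch x) x by rewrite /ch; case: cid => ? [].
pose a t := inner g (ch (gam t)) (ch (gam t) (gam t)) (Y (ch (gam t)) t) (Y (ch (gam t)) t).
pose m t := inner g (ch (gam t)) (ch (gam t) (gam t)) (Y (ch (gam t)) t) (covY (ch (gam t)) t).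
pose b t := inner g (ch (gam t)) (ch (gam t) (gam t)) (covY (ch (gam t)) t) (covY (ch (gam t)) t).
pose Rf c t := Rm g c (c (gam t)) (Y c t) (vel c gam t) (vel c gam t).
pose dm t := let c := ch (gam t) in b t - inner g c (c (gam t)) (Y c t) (Rf c t).
pose db t := let c := ch (gam t) in - 2 * inner g c (c (gam t)) (Rf c t) (covY c t).
have E c' t : 0 <= t -> atlas X c' -> dom c' (gam t) ->
  [/\ a t = inner g c' (c' (gam t)) (Y c' t) (Y c' t),
    m t = inner g c' (c' (gam t)) (Y c' t) (covY c' t) &
    b t = inner g c' (c' (gam t)) (covY c' t) (covY c' t)].
  by move=> t0 c'X d'; exact: jacobi_inner_trans.
have cd c' t : dom c' (gam t) -> cdom c' (c' (gam t)) by exists (gam t).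
have near c' t : 0 < t -> atlas X c' -> dom c' (gam t) -> \forall s \near t,
  [/\ inner g c' (c' (gam s)) (Y c' s) (Y c' s) = a s,
    inner g c' (c' (gam s)) (Y c' s) (covY c' s) = m s &
    inner g c' (c' (gam s)) (covY c' s) (covY c' s) = b s].
  move=> t0 c'X d'; have h1 := near_geo (proj1 gg) d'.
  have h2 : \forall s \near t, 0 <= s.
    apply/nbhs_ballP; exists t => // s; rewrite -ball_normE /= ltr_norml => /andP[_].
    by rewrite gtrBl => /ltW.
  by apply: filterS2 h1 h2 => s ds s0; have [-> -> ->] := E c' s s0 c'X ds.
have Da t : 0 < t -> t <= 1 -> is_derive t (1 : R) a (2 * m t).
  move=> t0 _; have cX' := chX (gam t); have d' := chd (gam t).
  have [DY _] := JD t0 cX' d'.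
  have nr := near _ _ t0 cX' d'.
  have D := inner_cov cX' d' DY DY.
  have nr1 : \forall s \near t, inner g (ch (gam t)) (ch (gam t) (gam s)) (Y (ch (gam t)) s) (Y (ch (gam t)) s) = a s.
    by apply: filterS nr => s [].
  have D' := near_eq_is_derive nr1 D; apply: (isd_eq _ _ _ _ D').
  rewrite -/(covY _ _) (inner_sym g cX' (covY _ _) _ (cd _ _ d')) -/(m t).
  by rewrite mulr2n mulrDl mul1r.
have Dm t : 0 < t -> t <= 1 -> is_derive t (1 : R) m (dm t).
  move=> t0 _; have cX' := chX (gam t); have d' := chd (gam t).
  have [DY _] := JD t0 cX' d'.
  have [W DW WE] := covY_cov t0 cX' d'.
  have nr := near _ _ t0 cX' d'.
  have D := inner_cov cX' d' DY DW.
  have nr1 : \forall s \near t, inner g (ch (gam t)) (ch (gam t) (gam s)) (Y (ch (gam t)) s) (covY (ch (gam t)) s) = m s.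
    by apply: filterS nr => s [].
  have D' := near_eq_is_derive nr1 D; apply: (isd_eq _ _ _ _ D').
  by rewrite -/(covY _ _) WE innerNr.
have Db t : 0 < t -> t <= 1 -> is_derive t (1 : R) b (db t).
  move=> t0 _; have cX' := chX (gam t); have d' := chd (gam t).
  have [W DW WE] := covY_cov t0 cX' d'.
  have nr := near _ _ t0 cX' d'.
  have D := inner_cov cX' d' DW DW.
  have nr1 : \forall s \near t, inner g (ch (gam t)) (ch (gam t) (gam s)) (covY (ch (gam t)) s) (covY (ch (gam t)) s) = b s.
    by apply: filterS nr => s [].
  have D' := near_eq_is_derive nr1 D; apply: (isd_eq _ _ _ _ D').
  rewrite WE innerNl innerNr (inner_sym g cX' (covY _ _) _ (cd _ _ d')) -/(Rf _ _).
  by rewrite /db; move: (inner _ _ _ _ _) => p; ring.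
have a0 t : 0 < t -> t <= 1 -> 0 <= a t.
  by move=> _ _; rewrite /a; apply: inner_ge0; [exact: chX | exact: cd (chd _)].
have b0 t : 0 < t -> t <= 1 -> 0 <= b t.
  by move=> _ _; rewrite /b; apply: inner_ge0; [exact: chX | exact: cd (chd _)].
have mab t : 0 < t -> t <= 1 -> m t ^+ 2 <= a t * b t.
  by move=> _ _; rewrite /m /a /b; apply: inner_cauchy; [exact: chX | exact: cd (chd _)].
have bdm t : 0 < t -> t <= 1 -> b t <= dm t.
  move=> _ _; rewrite /dm lerDl oppr_ge0.
  rewrite (inner_sym g (chX _) _ _ (cd _ _ (chd _))).
  by have /andP[_] := Rm_bounds (chX (gam t)) c_m0 Hsec (Y (ch (gam t)) t) (vel (ch (gam t)) gam t) (cd _ _ (chd _)).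
have K0 : 0 <= c_m * S by rewrite mulr_ge0// ltW.
have dbK t : 0 < t -> t <= 1 -> db t ^+ 2 <= (2 * (c_m * S)) ^+ 2 * (a t * b t).
  move=> t0 t1.
  have h := Rm_op_bound (chX (gam t)) c_m0 Hsec (Y (ch (gam t)) t) (covY (ch (gam t)) t)
    (vel (ch (gam t)) gam t) (cd _ _ (chd _)).
  have v0 : 0 <= inner g (ch (gam t)) (ch (gam t) (gam t)) (vel (ch (gam t)) gam t) (vel (ch (gam t)) gam t).
    by apply: inner_ge0; [exact: chX | exact: cd (chd _)].
  have vS := gS (chX _) (chd (gam t)) (ltW t0); rewrite spd2E in vS.
  have ab : 0 <= a t * b t by exact: mulr_ge0 (a0 _ t0 t1) (b0 _ t0 t1).
  have {}h : inner g (ch (gam t)) (ch (gam t) (gam t)) (Rf (ch (gam t)) t) (covY (ch (gam t)) t) ^+ 2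
      <= (c_m * S) ^+ 2 * (a t * b t).
    apply: (le_trans h); apply: ler_wpM2r; first exact: ab.
    apply: ler_pM; [| |apply: ler_wpM2l|apply: ler_wpM2l] => //; try exact: ltW.
      by apply: mulr_ge0 => //; exact: ltW.
    by apply: mulr_ge0 => //; exact: ltW.
  move: h; rewrite /db; move: (inner _ _ _ _ _) (a t * b t) => z ab' h.
  rewrite (_ : (- 2 * z) ^+ 2 = 4 * z ^+ 2); last by ring.
  by rewrite (_ : (2 * _) ^+ 2 * _ = 4 * ((c_m * S) ^+ 2 * ab')); [rewrite ler_pM2l | ring].
pose k := Num.sqrt (c_m * S) + 1.
have k1 : 1 <= k by rewrite lerDr sqrtr_ge0.
have kK : c_m * S <= k ^+ 2.
  by rewrite -[leLHS]sqr_sqrtr// lerXn2r// ?nnegrE ?sqrtr_ge0 ?addr_ge0// ?sqrtr_ge0// lerDl.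
have W0 : covY c 0 = V c 0.
  by rewrite /covY Y0 -[X in Gam _ _ _ _ X](scale0r (0 : 'rV[R]_n)) GamZr scale0r addr0.
have [d dp [B B0 HL]] := JL cX d0.
have FF : ProperFilter (0^'+ : set_system R) := at_right_proper_filter 0.
have near0 : \forall t \near (0 : R)^'+, 0 <= t /\ t <= 0 + d.
  near=> t; split; first by apply: ltW.
  by rewrite add0r; near: t; exact: nbhs_right_le.
have Bt : (fun t : R => t - 0) @ 0^'+ --> (0 : R).
  under eq_fun do rewrite subr0.
  by apply: cvg_at_right_filter; exact: cvg_id.
have cY : Y c t @[t --> 0^'+] --> Y c 0.
  by apply: (cvg_squeeze (K := B) _ Bt); apply: filterS near0 => t [t0 td]; have [] := HL t t0 td.
have cV : V c t @[t --> 0^'+] --> V c 0.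
  by apply: (cvg_squeeze (K := B) _ Bt); apply: filterS near0 => t [t0 td]; have [] := HL t t0 td.
have Vc := cd _ _ d0.
have cg : c (gam t) @[t --> 0^'+] --> c (gam 0).
  apply: cvg_at_right_filter.
  by have [/derivable1_diffP/differentiable_continuous] := geo_pos gg cX d0.
have cv : vel c gam t @[t --> 0^'+] --> vel c gam 0.
  apply: cvg_at_right_filter.
  by have [/derivable1_diffP/differentiable_continuous] := geo_vel gg cX d0.
have cC : covY c t @[t --> 0^'+] --> V c 0.
  rewrite -[in X in _ --> X]W0; apply: cvgD; first exact: cV.
  apply/cvg_rowP => i; rewrite mxE.
  rewrite (_ : (fun t => _) = fun t => qs (christoffel g c i) (c (gam t)) (vel c gam t) (Y c t)); last first.
    by apply/funext => t; rewrite mxE.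
  apply: cvg_qs => // p q; exact: differentiable_continuous (christoffel_diff g cX i p q Vc).
have E0 : \forall t \near (0 : R)^'+,
  [/\ inner g c (c (gam t)) (Y c t) (Y c t) = a t,
    inner g c (c (gam t)) (Y c t) (covY c t) = m t &
    inner g c (c (gam t)) (covY c t) (covY c t) = b t].
  apply: filterS near0 => t [t0 td]; have [dt _ _] := HL t t0 td.
  by have [-> -> ->] := E c t t0 cX dt.
have ci (A A' : R -> 'rV[R]_n) l l' : A @ 0^'+ --> l -> A' @ 0^'+ --> l' ->
    (fun t => inner g c (c (gam t)) (A t) (A' t)) @ 0^'+ --> inner g c (c (gam 0)) l l'.
  move=> cA cA'; rewrite innerE.
  rewrite (_ : (fun t => _) = fun t => qs (gf g c) (c (gam t)) (A t) (A' t)); last first.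
    by apply/funext => t; rewrite innerE.
  by apply: cvg_qs => // p q; exact: gf_cont.
have tr (f f' : R -> R) l : (\forall t \near (0 : R)^'+, f t = f' t) -> f @ 0^'+ --> l -> f' @ 0^'+ --> l.
  by move=> ff fl; apply: cvg_trans fl; apply: near_eq_cvg.
have ca : a s @[s --> 0^'+] --> (0 : R).
  have := ci _ _ _ _ cY cY; rewrite Y0 inner0l; apply: tr.
  by apply: filterS E0 => t [].
have cm : m s @[s --> 0^'+] --> (0 : R).
  have := ci _ _ _ _ cY cC; rewrite Y0 inner0l; apply: tr.
  by apply: filterS E0 => t [].
have cb : b s @[s --> 0^'+] --> inner g c (c (gam 0)) (V c 0) (V c 0).
  have := ci _ _ _ _ cC cC; apply: tr.
  by apply: filterS E0 => t [].
have W00 : 0 <= inner g c (c (gam 0)) (V c 0) (V c 0) by exact: inner_ge0.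
have [<- _ _] := E c1 1 ler01 c1X d1.
apply/andP; split.
  exact: (jacobi_ode_lower Da Dm a0 b0 mab bdm ca cm cb).
exact: (jacobi_ode_upper Da Db a0 b0 mab dbK k1 K0 kK ca cb).
Unshelve. all: by end_near. Qed.

End JacobiField.

(** * The exponential map *)

Section JacobiSpace.
Context {R : realType} {n : nat} {M : ptopologicalType} {X : manifold R n M}.
Variable g : riemannian_metric X.
Variable gam : R -> M.
Implicit Types (c : chart R n M) (s t : R) (Y V : chart R n M -> R -> 'rV[R]_n).

(** Exactly the properties used by [jacobi_bounds]. Unlike limits of quotients taken along different
    families of geodesics, they are visibly stable under linear combinations. *)
Definition jfield Y V : Prop :=
  [/\ forall c c' t, 0 <= t -> atlas X c -> atlas X c' -> dom c (gam t) -> dom c' (gam t) ->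
        Y c' t = dd (trans c c') (c (gam t)) (Y c t) /\
        V c' t = dd (trans c c') (c (gam t)) (V c t) + hess c c' (c (gam t)) (vel c gam t) (Y c t),
      forall c t, 0 < t -> atlas X c -> dom c (gam t) ->
        is_derive t (1 : R) (Y c) (V c t) /\
        is_derive t (1 : R) (V c) (- (dGam g c (c (gam t)) (Y c t) (vel c gam t) (vel c gam t)
           + 2 *: Gam g c (c (gam t)) (vel c gam t) (V c t))) &
      forall c, atlas X c -> dom c (gam 0) ->
        exists2 d : R, 0 < d & exists2 B : R, 0 <= B & forall t, 0 <= t -> t <= 0 + d ->
        [/\ dom c (gam t), `|Y c t - Y c 0| <= B * (t - 0) & `|V c t - V c 0| <= B * (t - 0)]].

Lemma hess_lin c c' (v a b b' : 'rV[R]_n) (k : R) :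
  hess c c' v a (k *: b + b') = k *: hess c c' v a b + hess c c' v a b'.
Proof. by apply/rowP => i; rewrite !mxE ddD ddZ. Qed.

Lemma lin_lip (k B B' s : R) (a a0 b b0 : 'rV[R]_n) : `|a - a0| <= B * s -> `|b - b0| <= B' * s ->
  `|(k *: a + b) - (k *: a0 + b0)| <= (`|k| * B + B') * s.
Proof.
move=> h1 h2; rewrite opprD addrACA -scalerBr; apply: le_trans (ler_normD _ _) _.
by rewrite normrZ mulrDl -mulrA; apply: lerD => //; exact: ler_wpM2l.
Qed.

Lemma jfield_lin (k : R) Y V Y' V' : jfield Y V -> jfield Y' V' ->
  jfield (fun c t => k *: Y c t + Y' c t) (fun c t => k *: V c t + V' c t).
Proof.
move=> [T D L] [T' D' L']; split.
- move=> c c' t t0 cX c'X d d'.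
  have [h1 h2] := T c c' t t0 cX c'X d d'; have [h1' h2'] := T' c c' t t0 cX c'X d d'.
  split; first by rewrite ddD ddZ h1 h1'.
  by rewrite h2 h2' ddD ddZ hess_lin scalerDr addrACA.
- move=> c t t0 cX d.
  have [h1 h2] := D c t t0 cX d; have [h1' h2'] := D' c t t0 cX d.
  split; first exact: (is_deriveD (is_deriveZ k h1) h1').
  have H := is_deriveD (is_deriveZ k h2) h2'.
  apply: (is_derive_eq H).
  rewrite dGamDe dGamZe GamDr GamZr.
  move: (dGam _ _ _ _ _ _) (dGam _ _ _ _ _ _) (Gam _ _ _ _ _) (Gam _ _ _ _ _) => p q r u.
  rewrite scalerN -opprD !scalerDr [2 *: (k *: _)]scalerA [k *: (2 *: _)]scalerA [2 * k]mulrC.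
  by rewrite addrACA.
- move=> c cX d0.
  have [d dp [B B0 H]] := L c cX d0; have [d' d'p [B' B'0 H']] := L' c cX d0.
  exists (Num.min d d'); first by rewrite lt_min dp.
  exists (`|k| * B + B'); first by rewrite addr_ge0// mulr_ge0.
  move=> t t0; rewrite add0r le_min => /andP[td td'].
  rewrite -[d]add0r in td; rewrite -[d']add0r in td'.
  have [h1 h2 h3] := H t t0 td; have [_ h2' h3'] := H' t t0 td'.
  by split => //; exact: lin_lip.
Qed.

End JacobiSpace.

(** * Differentiability of the exponential map *)

Section Exponential.
Context {R : realType} {n : nat} {M : ptopologicalType} {X : manifold R n M}.
Variable g : riemannian_metric X.
Hypothesis gcomp : geodesically_complete g.
Variable c_m : R.
Hypothesis c_m0 : 0 < c_m.
Hypothesis Hsec : sectional_bounds g (- c_m) 0.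
Variables (c : chart R n M) (o : M).
Hypothesis cX : atlas X c.
Hypothesis co : dom c o.
Implicit Types (u v w : 'rV[R]_n).

Let Vo : cdom c (c o). Proof. by exists o. Qed.

Definition ino u w := inner g c (c o) u w.

Lemma exp_geodesic u : exists gam, geodesic_from g c o u gam /\ exp_map g c o u = gam 1.
Proof.
have [gam Hg] := gcomp u cX co.
have : [set gamma 1 | gamma in geodesic_from g c o u] (exp_map g c o u).
  by apply: xgetPex; exists (gam 1); exists gam.
by move=> [gam' Hg' E]; exists gam'.
Qed.

(** [exp_map] chooses the end point of some geodesic with initial velocity [u]; [egeo u] is a
    geodesic realizing that choice. *)
Definition egeo u : R -> M := sval (cid (exp_geodesic u)).

Lemma egeoP u : [/\ geodesic g (egeo u), egeo u 0 = o, vel c (egeo u) 0 = u &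
  exp_map g c o u = egeo u 1].
Proof. by rewrite /egeo; case: cid => gam [[? ? ?] ?]. Qed.

Lemma egeo_spd u : spd2_le g (egeo u) (ino u u).
Proof.
have [gg g0 v0 _] := egeoP u.
move=> c' t c'X d' t0; have d0 : dom c (egeo u 0) by rewrite g0.
by rewrite -(spd2_const gg t0 cX c'X d0 d') spd2E g0 v0.
Qed.

Lemma egeo_good {I : Type} {F : set_system I} {UF : UltraFilter F} (v1 v2 : I -> 'rV[R]_n)
    (eps : I -> R) u w :
  v1 @ F --> u -> v2 @ F --> u -> (fun k => (eps k)^-1 *: (v2 k - v1 k)) @ F --> w ->
  good (F := F) (egeo u) (fun k => egeo (v1 k)) (fun k => egeo (v2 k)) eps c 0 0 w.
Proof.
move=> c1 c2 cw; have [_ g0 vu _] := egeoP u.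
have z v : egeo v 0 = o by have [] := egeoP v.
have vz v : vel c (egeo v) 0 = v by have [] := egeoP v.
have FF0 : Filter F by exact: filter_filter.
split.
- by rewrite z.
- by apply: nearW => k; rewrite !z.
- rewrite vz; split.
  + by under eq_fun do rewrite z; rewrite z; exact: cvg_cst.
  + by under eq_fun do rewrite z; rewrite z; exact: cvg_cst.
  + by under eq_fun do rewrite vz.
  + by under eq_fun do rewrite vz.
- by under eq_fun do rewrite !z subrr scaler0; exact: cvg_cst.
- by under eq_fun do rewrite !vz.
Qed.

Lemma egeo_jfield {I : Type} {F : set_system I} {UF : UltraFilter F} (v1 v2 : I -> 'rV[R]_n)
    (eps : I -> R) u w (S : R) : 0 <= S -> ino u u <= S ->
  (forall k, ino (v1 k) (v1 k) <= S) -> (forall k, ino (v2 k) (v2 k) <= S) ->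
  v1 @ F --> u -> v2 @ F --> u -> (fun k => (eps k)^-1 *: (v2 k - v1 k)) @ F --> w ->
  exists Y V, [/\ jfield g (egeo u) Y V, Y c 0 = 0, V c 0 = w &
    forall c' t, 0 <= t -> atlas X c' -> dom c' (egeo u t) ->
    good (F := F) (egeo u) (fun k => egeo (v1 k)) (fun k => egeo (v2 k)) eps c' t (Y c' t) (V c' t)].
Proof.
move=> S0 uS vS1 vS2 c1 c2 cw.
have G := egeo_good (UF := UF) c1 c2 cw.
have [gg g0 _ _] := egeoP u.
have gg1 k : geodesic g (egeo (v1 k)) by have [] := egeoP (v1 k).
have gg2 k : geodesic g (egeo (v2 k)) by have [] := egeoP (v2 k).
have gS v : ino v v <= S -> spd2_le g (egeo v) S.
  by move=> vS c' t c'X d t0; apply: le_trans vS; exact: egeo_spd.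
have GE : @goodex R n M X I F (egeo u) (fun k => egeo (v1 k)) (fun k => egeo (v2 k)) eps 0.
  exact: (goodexP gg gg1 gg2 cX G).
have [jY jV] := jacE G.
have gSu := gS u uS; have gS1 k := gS _ (vS1 k); have gS2 k := gS _ (vS2 k).
exists (jacY (F := F) (fun k => egeo (v1 k)) (fun k => egeo (v2 k)) eps),
  (jacV (F := F) (fun k => egeo (v1 k)) (fun k => egeo (v2 k)) eps).
split; [|exact: jY|exact: jV|]; last first.
  by move=> c' t t0 c'X d'; exact: (jac_good (UF := UF) gg gg1 gg2 gSu gS1 gS2 S0 GE t0 c'X d').
split.
- by move=> c1' c2' t t0 h1 h2 h3 h4; exact: (jac_trans (UF := UF) gg gg1 gg2 gSu gS1 gS2 S0 GE t0 h1 h2 h3 h4).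
- by move=> c1' t t0 h1 h2; exact: (jac_derive (UF := UF) gg gg1 gg2 gSu gS1 gS2 S0 GE t0 h1 h2).
- by move=> c1' h1 h2; exact: (jac_lip (UF := UF) gg gg1 gg2 gSu gS1 gS2 S0 GE (lexx 0) h1 h2).
Qed.

Lemma ino_cont {I : Type} {F : set_system I} {FF : Filter F} (v w : I -> 'rV[R]_n) a b :
  v @ F --> a -> w @ F --> b -> (fun k => ino (v k) (w k)) @ F --> ino a b.
Proof.
move=> va wb; rewrite /ino innerE.
rewrite (_ : (fun k => _) = fun k => qs (gf g c) (c o) (v k) (w k)).
  by apply: (@cvg_qs _ _ _ F FF _ (fun=> c o)) => //; [move=> i j; exact: gf_cont | exact: cvg_cst].
by apply/funext => k; rewrite innerE.
Qed.

Let ultra_nat : exists F : set_system nat, UltraFilter F /\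
  forall f : nat -> R, f @ \oo --> (0 : R) -> f @ F --> (0 : R).
Proof.
have [F [UF FF]] := ultraFilterLemma (F := \oo%classic : set_system nat) _.
by exists F; split => // f f0 A hA; exact: FF (f0 A hA).
Qed.

Lemma jfield_ex u w : exists Y V, [/\ jfield g (egeo u) Y V, Y c 0 = 0 & V c 0 = w].
Proof.
have [F [UF HF]] := ultra_nat.
have FF0 : ProperFilter F by exact: ultra_proper.
pose eps (k : nat) : R := k.+1%:R^-1.
have e0 : eps @ F --> (0 : R) by apply: HF; exact: cvg_harmonic.
have eps0 k : eps k != 0 by rewrite invr_eq0 pnatr_eq0.
have c2 : (fun k => u + eps k *: w) @ F --> u.
  apply: (cvg_squeeze (K := `|w|) _ e0); apply: nearW => k.
  by rewrite addrAC subrr add0r normrZ mulrC ger0_norm// invr_ge0.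
(* The speed bound is required at every index. Velocities violating it are replaced by [u], which
   changes nothing eventually along [F]. *)
pose v2 k := if ino (u + eps k *: w) (u + eps k *: w) < ino u u + 1 then u + eps k *: w else u.
have nv : \forall k \near F, v2 k = u + eps k *: w.
  have h := ino_cont (FF := @filter_filter _ _ FF0) c2 c2.
  have := cvg_near_dist (FF := FF0) _ _ _ h ltr01; apply: filterS => k.
  by rewrite ltr_norml ltrBlDl /v2 => /andP[_ ->].
have c2' : v2 @ F --> u.
  apply: cvg_trans c2; apply: near_eq_cvg; by apply: filterS nv => k ->.
have cw : (fun k => (eps k)^-1 *: (v2 k - u)) @ F --> w.
  apply: cvg_trans (cvg_cst w (F := F)); apply: near_eq_cvg; apply: filterS nv => k ->.
  by rewrite addrAC subrr add0r scalerA mulVf// scale1r.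
have uu := inner_ge0 g cX u Vo.
have u1 : ino u u <= ino u u + 1 by rewrite lerDl.
have [Y [V [J Y0 V0 _]]] := egeo_jfield (S := ino u u + 1) (UF := UF) (addr_ge0 uu ler01) u1
  (fun=> u1) (v2 := v2) (v1 := fun=> u) (eps := eps)
  (fun k => ltac:(rewrite /v2; case: ifP => [/ltW//|_]; exact: u1)) (cvg_cst u) c2' cw.
by exists Y, V.
Qed.

Lemma jfield_bounds u Y V c1 : jfield g (egeo u) Y V -> Y c 0 = 0 -> atlas X c1 ->
  dom c1 (exp_map g c o u) ->
  let x := c1 (exp_map g c o u) in
  ino (V c 0) (V c 0) <= inner g c1 x (Y c1 1) (Y c1 1) <=
  expR (4 * (Num.sqrt (c_m * ino u u) + 1)) * ino (V c 0) (V c 0).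
Proof.
move=> [T D L] Y0 c1X; have [gg g0 _ ->] := egeoP u => d1 /=.
have d0 : dom c (egeo u 0) by rewrite g0.
have uu := inner_ge0 g cX u Vo.
have := jacobi_bounds gg c_m0 Hsec (@egeo_spd u) uu T D L cX d0 c1X d1 Y0.
by rewrite g0.
Qed.

(** The difference is a Jacobi field with vanishing initial data, and the upper bound of the
    comparison forces it to vanish at time 1. *)
Lemma jfield_uniq u Y V Y' V' c1 : jfield g (egeo u) Y V -> jfield g (egeo u) Y' V' ->
  Y c 0 = 0 -> Y' c 0 = 0 -> V c 0 = V' c 0 -> atlas X c1 -> dom c1 (exp_map g c o u) ->
  Y c1 1 = Y' c1 1.
Proof.
move=> J J' Y0 Y'0 VV c1X d1.
have JJ := jfield_lin (-1) J' J.
have := jfield_bounds JJ _ c1X d1; rewrite /= Y0 Y'0 scaler0 addr0 => /(_ erefl).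
rewrite VV scaleN1r addNr /ino inner0l mulr0 => /andP[_ h].
have [gg g0 _ E1] := egeoP u; rewrite E1 in h d1.
have V1 : cdom c1 (c1 (egeo u 1)) by exists (egeo u 1).
apply/eqP; rewrite -subr_eq0; apply/eqP; apply: contra_notP (_ : ~ 0 < 0 :> R) => [/eqP z|]; last by rewrite ltxx.
rewrite scaleN1r addrC in h.
by have := inner_gt0 g c1X V1 z; move=> /lt_le_trans; exact.
Qed.

(* [w *m A] is the value at time 1, in the chart [c1], of the Jacobi field with initial data
   [(0, w)] along the geodesic of [u]. *)
Theorem exp_diff u c1 : atlas X c1 -> dom c1 (exp_map g c o u) ->
  exists A : 'M[R]_n, [/\
    forall w, ino w w <= inner g c1 (c1 (exp_map g c o u)) (w *m A) (w *m A) <=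
      expR (4 * (Num.sqrt (c_m * ino u u) + 1)) * ino w w &
    forall e : R, 0 < e -> exists2 d : R, 0 < d & forall v1 v2,
      `|v1 - u| < d -> `|v2 - u| < d ->
      [/\ dom c1 (exp_map g c o v1), dom c1 (exp_map g c o v2) &
       `|c1 (exp_map g c o v2) - c1 (exp_map g c o v1) - (v2 - v1) *m A| <= e * `|v2 - v1|]].
Proof.
move=> c1X d1.
have /choice[D HD] : forall w, exists y, exists Y V,
    [/\ jfield g (egeo u) Y V, Y c 0 = 0, V c 0 = w & Y c1 1 = y].
  by move=> w; have [Y [V [h1 h2 h3]]] := jfield_ex u w; exists (Y c1 1), Y, V.
have DU w Y V : jfield g (egeo u) Y V -> Y c 0 = 0 -> V c 0 = w -> Y c1 1 = D w.
  move=> J Y0 V0; have [Y' [V' [J' Y'0 V'0 <-]]] := HD w.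
  by apply: (jfield_uniq J J') => //; rewrite V0.
have Dlin k w w' : D (k *: w + w') = k *: D w + D w'.
  have [Y [V [J Y0 V0 E]]] := HD w; have [Y' [V' [J' Y'0 V'0 E']]] := HD w'.
  have := DU (k *: w + w') _ _ (jfield_lin k J J').
  rewrite Y0 Y'0 V0 V'0 scaler0 addr0 => /(_ erefl erefl) <-.
  by rewrite E E'.
pose D' : {linear 'rV[R]_n -> 'rV[R]_n} := HB.pack D (GRing.isLinear.Build R _ _ *:%R D Dlin).
pose A : 'M[R]_n := \matrix_(i, j) D (delta_mx 0 i) 0 j.
have DA w : w *m A = D w.
  rewrite [D w](linear_coord D'); apply/rowP => j; rewrite !mxE summxE.
  by apply: eq_bigr => i _; rewrite !mxE.
exists A; split.
  move=> w; have [Y [V [J Y0 V0 E]]] := HD w.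
  by have := jfield_bounds J Y0 c1X d1; rewrite V0 E DA.
(* By contradiction: the normalized differences of pairs violating the estimate converge along an
   ultrafilter to some [w]. The quotients of the end points then converge to the value of a Jacobi
   field, which by uniqueness is [w *m A]. *)
move=> e e0; apply: contrapT => H.
have {}H (k : nat) : exists p : 'rV[R]_n * 'rV[R]_n,
    [/\ `|p.1 - u| < k.+1%:R^-1, `|p.2 - u| < k.+1%:R^-1 &
     ~ [/\ dom c1 (exp_map g c o p.1), dom c1 (exp_map g c o p.2) &
       `|c1 (exp_map g c o p.2) - c1 (exp_map g c o p.1) - (p.2 - p.1) *m A| <= e * `|p.2 - p.1|]].
  apply: contrapT => N; apply: H; exists k.+1%:R^-1; first by rewrite invr_gt0.
  move=> v1 v2 h1 h2; apply: contrapT => B; apply: N; exists (v1, v2); split => //.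
have /choice[p Hp] := H.
have [F [UF HF]] := ultra_nat.
have FF0 : ProperFilter F by exact: ultra_proper.
have e0F : (fun k : nat => k.+1%:R^-1 : R) @ F --> (0 : R) by apply: HF; exact: cvg_harmonic.
have p1 : (fun k => (p k).1) @ F --> u.
  apply: (cvg_squeeze (K := 1) _ e0F); apply: nearW => k; rewrite mul1r.
  by have [h _ _] := Hp k; exact: ltW.
have p2 : (fun k => (p k).2) @ F --> u.
  apply: (cvg_squeeze (K := 1) _ e0F); apply: nearW => k; rewrite mul1r.
  by have [_ h _] := Hp k; exact: ltW.
have uu := inner_ge0 g cX u Vo.
have u1 : ino u u <= ino u u + 1 by rewrite lerDl.
pose tr v := if ino v v < ino u u + 1 then v else u.
have trS v : ino (tr v) (tr v) <= ino u u + 1 by rewrite /tr; case: ifP => [/ltW|].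
have trn (v : nat -> 'rV[R]_n) : v @ F --> u -> \forall k \near F, v k = tr (v k).
  move=> vu; have h := ino_cont (FF := @filter_filter _ _ FF0) vu vu.
  have := cvg_near_dist (FF := FF0) _ _ _ h ltr01; apply: filterS => k.
  by rewrite ltr_norml ltrBlDl /tr => /andP[_ ->].
have n1 := trn _ p1; have n2 := trn _ p2.
pose eps k := `|(p k).2 - (p k).1|.
have [w [cw _]] : exists w, (fun k => (eps k)^-1 *: ((p k).2 - (p k).1)) @ F --> w /\ `|w| <= 1.
  apply: row_ultra_cvg; apply: nearW => k; rewrite normrZ /eps ger0_norm ?invr_ge0//.
  by have [->|z] := eqVneq `|(p k).2 - (p k).1| 0; rewrite ?mulr0// mulVf.
have p1' : (fun k => tr (p k).1) @ F --> u by apply: cvg_trans p1; exact: near_eq_cvg.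
have p2' : (fun k => tr (p k).2) @ F --> u by apply: cvg_trans p2; exact: near_eq_cvg.
have cw' : (fun k => (eps k)^-1 *: (tr (p k).2 - tr (p k).1)) @ F --> w.
  by apply: cvg_trans cw; apply: near_eq_cvg; apply: filterS2 n1 n2 => k <- <-.
have [Y [V [J Y0 V0 GY]]] := egeo_jfield (UF := UF) (addr_ge0 uu ler01) u1
  (fun k => trS (p k).1) (fun k => trS (p k).2) p1' p2' cw'.
have ex v : exp_map g c o v = egeo v 1 by have [] := egeoP v.
rewrite ex in d1.
have [_ dk _ cY _] := GY c1 1 ler01 c1X d1.
rewrite (DU w Y V J Y0 V0) in cY.
have cwA : (fun k => ((eps k)^-1 *: ((p k).2 - (p k).1)) *m A) @ F --> w *m A.
  apply/cvg_rowP => j; rewrite mxE.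
  rewrite (_ : (fun k => _) = fun k => \sum_i ((eps k)^-1 *: ((p k).2 - (p k).1)) 0 i * A i j); last first.
    by apply/funext => k; rewrite mxE.
  move/cvg_rowP : cw => cw; apply: cvg_sumr => i.
  by apply: cvgM; [exact: cw | exact: cvg_cst].
have cd : (fun k => (eps k)^-1 *: (c1 (egeo (tr (p k).2) 1) - c1 (egeo (tr (p k).1) 1)
    - ((p k).2 - (p k).1) *m A)) @ F --> (0 : 'rV[R]_n).
  have cB := cvgB (FF := @filter_filter _ _ FF0) cY cwA; rewrite DA subrr in cB.
  by under eq_fun do rewrite scalerBr scalemxAl; exact: cB.
have nn := cvg_near_dist (FF := FF0) _ _ _ cd e0.
have [k [[[E1 E2] [dk1 dk2]] hk]] := filter_ex (filterI (filterI (filterI n1 n2) dk) nn).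
have [_ _ N] := Hp k; apply: N.
rewrite -E1 -E2 in dk1 dk2 hk; rewrite !ex; split => //.
rewrite subr0 normrZ in hk.
have [z|z] := eqVneq (eps k) 0.
  have z' : (p k).2 - (p k).1 = 0 by apply/eqP; rewrite -normr_eq0; exact/eqP.
  have -> : (p k).1 = (p k).2 by apply/eqP; rewrite eq_sym -subr_eq0 z'.
  by rewrite !subrr mul0mx subr0 normr0 mulr0.
have ep : 0 < eps k by rewrite lt_neqAle eq_sym z normr_ge0.
move: hk; rewrite [`|(eps k)^-1|]gtr0_norm ?invr_gt0// [_^-1 * _]mulrC ltr_pdivrMr//.
exact: ltW.
Qed.

End Exponential.

(** * Homotopy lifting *)

Section Continuity.

Lemma pair_cont {T A B : topologicalType} (f : T -> A) (h : T -> B) x :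
  {for x, continuous f} -> {for x, continuous h} -> {for x, continuous (fun y => (f y, h y))}.
Proof. by move=> cf ch; exact: (cvg_pair cf ch). Qed.

Lemma comp_cont {T A B : topologicalType} (f : T -> A) (h : A -> B) x :
  {for x, continuous f} -> {for f x, continuous h} -> {for x, continuous (fun y => h (f y))}.
Proof. by move=> cf ch; exact: (continuous_comp cf ch). Qed.

Lemma near_comp {T A : topologicalType} (f : T -> A) x (Q : A -> Prop) :
  {for x, continuous f} -> (\forall y \near f x, Q y) -> \forall z \near x, Q (f z).
Proof. by move=> cf h; exact: cf _ h. Qed.

Lemma within_comp_cont {T S W : topologicalType} (A : set S) (f : S -> W) (h : T -> S) :
  {within A, continuous f} -> continuous h -> (forall x, A (h x)) -> continuous (f \o h).
Proof.
move=> cf ch Ah x U nU.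
have h1 : within A (nbhs (h x)) (f @^-1` U) by rewrite (nbhs_subspace_in (Ah x)); exact: cf nU.
have h2 : nbhs x (h @^-1` (fun y => A y -> U (f y))) by exact: ch x _ h1.
by apply: filterS h2 => y /=; apply; exact: Ah.
Qed.

End Continuity.

(** * Unique lifting for a local homeomorphism *)

Section Lifting.
Context {R : realType} {n : nat} {M : ptopologicalType}.
Variable E : 'rV[R]_n -> M.
Hypothesis E_cont : continuous E.
Hypothesis E_inj : forall u, exists2 d : R, 0 < d & forall v1 v2,
  `|v1 - u| < d -> `|v2 - u| < d -> E v1 = E v2 -> v1 = v2.
Hypothesis E_section : forall u, exists sg : M -> 'rV[R]_n, sg (E u) = u /\
  \forall x \near E u, E (sg x) = x /\ {for x, continuous sg}.

Lemma cvg_near_eq {T : Type} {F : set_system T} {FF : Filter F} (f h : T -> 'rV[R]_n) (u : 'rV[R]_n) :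
  f @ F --> u -> h @ F --> u -> (\forall k \near F, E (f k) = E (h k)) ->
  \forall k \near F, f k = h k.
Proof.
move=> fu hu H; have [d d0 inj] := E_inj u.
have h1 : \forall k \near F, `|f k - u| < d by exact: (cvg_near_dist _ _ _ fu d0).
have h2 : \forall k \near F, `|h k - u| < d by exact: (cvg_near_dist _ _ _ hu d0).
by apply: filterS3 H h1 h2 => k e a b; exact: inj.
Qed.

(** Local injectivity propagates equality around a time of agreement; around a time of disagreement,
    continuity keeps the lifts apart. *)
Lemma lift_uniq (L1 L2 : R -> 'rV[R]_n) (a b : R) : a <= b ->
  (forall t, a <= t <= b -> {for t, continuous L1}) ->
  (forall t, a <= t <= b -> {for t, continuous L2}) ->
  (forall t, a <= t <= b -> E (L1 t) = E (L2 t)) -> L1 a = L2 a ->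
  forall t, a <= t <= b -> L1 t = L2 t.
Proof.
move=> ab c1 c2 EE e0 t /andP[at_ tb].
suff : L1 a = L2 a -> L1 t = L2 t by apply.
apply: (interval_ind a t (fun s t => L1 s = L2 s -> L1 t = L2 t)) => //.
  by move=> s u r _ _ _ _ h1 h2 /h1/h2.
move=> u /andP[au ut].
have ub : u <= b by exact: le_trans tb.
have uab : a <= u <= b by rewrite au.
have H1 : L1 @ nbhs u --> L1 u by exact: c1.
have H2 : L2 @ nbhs u --> L2 u by exact: c2.
have [eu|nu] := eqVneq (L1 u) (L2 u).
  have [d d0 inj] := E_inj (L1 u).
  rewrite -eu in H2.
  have h1 : \forall k \near u, `|L1 k - L1 u| < d by exact: (cvg_near_dist _ _ _ H1 d0).
  have h2 : \forall k \near u, `|L2 k - L1 u| < d by exact: (cvg_near_dist _ _ _ H2 d0).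
  have hh : nbhs (u : R) [set k | `|L1 k - L1 u| < d /\ `|L2 k - L1 u| < d] by exact: filterI h1 h2.
  move/nbhs_ballP : hh => [r r0 Hr].
  exists r => // s /andP[as_ st]; split=> // h3 h4 _.
  have bs : ball u r s by rewrite -ball_normE /= ler0_norm ?subr_le0// opprB ltrBlDl.
  have [k1 k2] := Hr s bs.
  by apply: inj => //; apply: EE; rewrite as_ (le_trans st tb).
have d0 : 0 < `|L1 u - L2 u| / 2 by rewrite divr_gt0// normr_gt0 subr_eq0.
have h1 : \forall k \near u, `|L1 k - L1 u| < `|L1 u - L2 u| / 2 by exact: (cvg_near_dist _ _ _ H1 d0).
have h2 : \forall k \near u, `|L2 k - L2 u| < `|L1 u - L2 u| / 2 by exact: (cvg_near_dist _ _ _ H2 d0).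
have hh : nbhs (u : R) [set k | `|L1 k - L1 u| < `|L1 u - L2 u| / 2 /\ `|L2 k - L2 u| < `|L1 u - L2 u| / 2].
  by exact: filterI h1 h2.
move/nbhs_ballP : hh => [r r0 Hr].
exists r => // s /andP[as_ st]; split=> h3 h4 es; last by move/eqP : nu.
have bs : ball u r s by rewrite -ball_normE /= ger0_norm ?subr_ge0// ltrBlDl -ltrBlDr.
have [k1 k2] := Hr s bs.
exfalso; have : `|L1 u - L2 u| <= `|L1 s - L1 u| + `|L2 s - L2 u|.
  rewrite es [`|_ - L1 u|]distrC; apply: le_trans (ler_normD _ _).
  by rewrite addrA subrK.
by lra.
Qed.

Section Family.
Context {P : topologicalType}.
Variables (H : R -> P -> M) (p0 : P) (v0 : 'rV[R]_n).
Hypothesis H_cont : \forall p \near p0, forall t, 0 <= t <= 1 ->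
  {for (t, p), continuous (fun q : R * P => H q.1 q.2)}.
Hypothesis H0 : \forall p \near p0, H 0 p = E v0.

(** Lifts up to time [t] for all parameters near [p0], jointly continuous. The neighbourhood of [p0]
    may shrink each time the family is continued. *)
Definition family (t : R) (A : R -> P -> 'rV[R]_n) :=
  \forall p \near p0, A 0 p = v0 /\ forall s, 0 <= s <= t ->
    E (A s p) = H s p /\ {for (s, p), continuous (fun q : R * P => A q.1 q.2)}.

Lemma family0 : family 0 (fun _ _ => v0).
Proof.
apply: filterS H0 => p h; split=> [//|s /andP[s0 s1]].
have -> : s = 0 by apply/eqP; rewrite eq_le s0 s1.
by split; [rewrite h | exact: cst_continuous].
Qed.

Lemma slice_cont (A : R -> P -> 'rV[R]_n) (t : R) p :
  {for (t, p), continuous (fun q : R * P => A q.1 q.2)} ->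
  {for t, continuous (A ^~ p)} /\ {for p, continuous (A t)}.
Proof.
move=> h; split.
  apply: (@continuous_comp _ _ _ (fun s : R => (s, p)) (fun q : R * P => A q.1 q.2) t) => //.
  by apply: pair_cont; [exact: cvg_id | exact: cvg_cst].
apply: (@continuous_comp _ _ _ (fun q : P => (t, q)) (fun q : R * P => A q.1 q.2) p) => //.
by apply: pair_cont; [exact: cvg_cst | exact: cvg_id].
Qed.

(* The family is continued past [t] by means of a local section at [w]. *)
Lemma family_extend (t : R) w : 0 <= t <= 1 -> E w = H t p0 ->
  exists2 eta : R, 0 < eta & forall (t' : R) A, 0 <= t' <= t -> t - eta < t' -> family t' A ->
    `|A t' p0 - w| < eta -> forall t'' : R, t' <= t'' -> t'' < t + eta -> t'' <= 1 ->
    exists A', family t'' A'.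
Proof.
move=> t01 Ew; have [sg [sgw sgN]] := E_section w; have [d d0 inj] := E_inj w.
have Hc := nbhs_singleton H_cont t t01.
have sgc : {for E w, continuous sg} by have [] := nbhs_singleton sgN.
have sgn : \forall x \near E w, `|sg x - w| < d.
  have sgc' : sg @ nbhs (E w) --> w by rewrite -{2}sgw; exact: sgc.
  exact: (cvg_near_dist _ _ _ sgc' d0).
have HN : \forall q \near (t, p0), (E (sg (H q.1 q.2)) = H q.1 q.2 /\
    {for H q.1 q.2, continuous sg}) /\ `|sg (H q.1 q.2) - w| < d.
  have hN : \forall x \near E w, (E (sg x) = x /\ {for x, continuous sg}) /\ `|sg x - w| < d.
    by exact: filterI sgN sgn.
  by rewrite Ew in hN; exact: (@near_comp _ _ (fun q : R * P => H q.1 q.2) (t, p0) (fun x => (E (sg x) = x /\ {for x, continuous sg}) /\ `|sg x - w| < d) Hc hN).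
have [[U V] [/= nU nV] UV] := HN.
have /nbhs_ballP[r r0 Hr] := nU.
exists (Num.min r d); first by rewrite lt_min r0.
move=> t' A /andP[t'0 t't]; rewrite ltrBlDl -ltrBlDr => tt' FA Aw t'' t1 t2 t3.
have Aw' : `|A t' p0 - w| < d by apply: lt_le_trans Aw _; rewrite ge_min lexx orbT.
have tt'r : t - t' < r by apply: lt_le_trans tt' _; rewrite ge_min lexx.
have t2r : t'' - t < r by rewrite ltrBlDl; apply: lt_le_trans t2 _; rewrite lerD2l ge_min lexx.
have Ut s : t' <= s -> s <= t'' -> U s.
  move=> s1 s2; apply: Hr; rewrite -ball_normE /= ltr_norml; apply/andP; split; lra.
have nP : \forall p \near p0, forall s, t' <= s -> s <= t'' ->
    (E (sg (H s p)) = H s p /\ {for H s p, continuous sg}) /\ `|sg (H s p) - w| < d.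
  by apply: filterS nV => p Vp s s1 s2; apply: (UV (s, p)); split => //=; exact: Ut.
have t'01 : 0 <= t' <= 1 by rewrite t'0 (le_trans t1 t3).
have [A0 FA0] := nbhs_singleton FA.
have [EA cA] := FA0 t' (introT andP (conj t'0 (lexx _))).
have e0 : A t' p0 = sg (H t' p0).
  have [[h1 _] h2] := nbhs_singleton nP t' (lexx _) t1.
  by apply: inj => //; rewrite h1.
have Hct' : {for p0, continuous (H t')}.
  have h := nbhs_singleton H_cont t' t'01.
  apply: (@continuous_comp _ _ _ (fun q : P => (t', q)) (fun q : R * P => H q.1 q.2) p0) => //.
  by apply: pair_cont; [exact: cvg_cst | exact: cvg_id].
have nE : \forall p \near p0, A t' p = sg (H t' p).
  apply: (cvg_near_eq (u := A t' p0)).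
  - by have [_] := slice_cont cA.
  - rewrite e0; apply: (@continuous_comp _ _ _ (H t') sg p0); first exact: Hct'.
    by have [[_ h] _] := nbhs_singleton nP t' (lexx _) t1.
  - apply: filterS2 FA nP => p [_ h] /(_ t' (lexx _) t1)[[-> _] _].
    by have [] := h t' (introT andP (conj t'0 (lexx _))).
(* Pasting by a formula: for [s <= t'] the bracket vanishes, for [s >= t'] the first and the last
   term cancel, and each term is continuous by itself. *)
exists (fun s p => A (Num.min s t') p + (sg (H (Num.max t' (Num.min s t'')) p) - A t' p)).
apply: filterS2 FA (filterI nE (filterI nP H_cont)) => p [Ap HAp] [Ep [Np Hp]].
split; first by rewrite min_l// min_l ?(le_trans t'0 t1)// max_l// -Ep Ap subrr addr0.
move=> s /andP[s0 s1].
have m1 : 0 <= Num.min s t' <= t' by rewrite le_min s0 t'0 ge_min lexx orbT.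
have m2 : t' <= Num.max t' (Num.min s t'') <= t''.
  by rewrite le_max lexx ge_max t1 ge_min lexx orbT.
have m3 : 0 <= Num.max t' (Num.min s t'') <= 1.
  by have /andP[a b] := m2; rewrite (le_trans t'0 a) (le_trans b t3).
split.
  rewrite (min_l s1); have [st|ts] := leP s t'.
    by rewrite -Ep subrr addr0; have [] := HAp s (introT andP (conj s0 st)).
  rewrite addrC subrK; have [[-> _] _] := Np s (ltW ts) s1 => //.
have cm1 : {for (s, p), continuous (fun q : R * P => (Num.min q.1 t', q.2))}.
  apply: pair_cont; last exact: cvg_snd.
  by apply: (@continuous_min _ _ (fun q : R * P => q.1) (fun=> t')); [exact: cvg_fst | exact: cvg_cst].
have cm2 : {for (s, p), continuous (fun q : R * P => (Num.max t' (Num.min q.1 t''), q.2))}.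
  apply: pair_cont; last exact: cvg_snd.
  apply: (@continuous_max _ _ (fun=> t') (fun q : R * P => Num.min q.1 t'')); first exact: cvg_cst.
  by apply: (@continuous_min _ _ (fun q : R * P => q.1) (fun=> t'')); [exact: cvg_fst | exact: cvg_cst].
have [_ c1] := HAp _ m1.
have [_ c2] := HAp t' (introT andP (conj t'0 (lexx _))).
apply: cvgD.
  exact: (@continuous_comp _ _ _ (fun q : R * P => (Num.min q.1 t', q.2)) (fun q : R * P => A q.1 q.2) (s, p)).
apply: cvgB; last first.
  apply: (@continuous_comp _ _ _ (fun q : R * P => (t', q.2)) (fun q : R * P => A q.1 q.2) (s, p)) => //.
  by apply: pair_cont; [exact: cvg_cst | exact: cvg_snd].
apply: (@continuous_comp _ _ _ (fun q : R * P => H (Num.max t' (Num.min q.1 t'')) q.2) sg (s, p)).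
  apply: (@continuous_comp _ _ _ (fun q : R * P => (Num.max t' (Num.min q.1 t''), q.2)) (fun q : R * P => H q.1 q.2) (s, p)) => //.
  exact: Hp m3.
by have /andP[a b] := m2; have [[_ h] _] := Np _ a b.
Qed.

(** The given lift [L] at [p0] guides the continuation: at each time the local section is taken at
    [L t], which the family built so far reaches at [p0] by uniqueness. *)
Lemma family_lift (L : R -> 'rV[R]_n) : L 0 = v0 ->
  (forall t, 0 <= t <= 1 -> {for t, continuous L} /\ E (L t) = H t p0) ->
  exists A, family 1 A.
Proof.
move=> L0 HL.
suff : forall t : R, 0 <= t -> t <= 1 -> exists A, family t A by apply.
have AL t A : 0 <= t <= 1 -> family t A -> A t p0 = L t.
  move=> /andP[t0 t1] FA; have [A0 HA] := nbhs_singleton FA.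
  apply: (lift_uniq (L1 := A ^~ p0) (L2 := L) t0) => /=.
  - by move=> s /HA[_ /slice_cont[]].
  - by move=> s /andP[s0 s1]; have [] := HL s (introT andP (conj s0 (le_trans s1 t1))).
  - move=> s /[dup] /andP[s0 s1] /HA[-> _].
    by have [_ ->] := HL s (introT andP (conj s0 (le_trans s1 t1))).
  - by rewrite A0 L0.
  - by rewrite t0 lexx.
have close (t eta : R) : 0 <= t <= 1 -> 0 < eta -> exists2 d : R, 0 < d & forall s, `|s - t| < d -> `|L s - L t| < eta.
  move=> t01 e0; have [cL _] := HL t t01.
  have : \forall s \near t, `|L s - L t| < eta by exact: (cvg_near_dist _ _ _ cL e0).
  move/nbhs_ballP => [d d0 Hd]; exists d => // s st; apply: Hd.
  by rewrite -ball_normE /= distrC.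
apply: (real_ind 0 1 (fun t => exists A, family t A)) => //.
- by exists (fun _ _ => v0); exact: family0.
- move=> t t0 t1 Hs; have t01 : 0 <= t <= 1 by rewrite t0 ltW.
  have [cL EL] := HL t t01.
  have [eta e0 Hx] := family_extend t01 EL.
  have [A FA] := Hs t t0 (lexx t).
  exists eta => // s ts se s1.
  apply: (Hx t A) => //; [by rewrite t0 lexx | by rewrite ltrBlDr ltrDl | | exact: ltW].
  by rewrite (AL t A t01 FA) subrr normr0.
- move=> t t0 t1 Hs; have t01 : 0 <= t <= 1 by rewrite ltW.
  have [cL EL] := HL t t01.
  have [eta e0 Hx] := family_extend t01 EL.
  have [d d0 Hd] := close t eta t01 e0.
  pose s := Num.max 0 (t - Num.min eta d / 2).
  have m0 : 0 < Num.min eta d by rewrite lt_min e0.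
  have mm : Num.min eta d <= eta /\ Num.min eta d <= d by rewrite !ge_min !lexx orbT.
  have s0 : 0 <= s by rewrite le_max lexx.
  have st : s < t by rewrite gt_max t0 ltrBlDr ltrDl divr_gt0.
  have ts : t - Num.min eta d / 2 <= s by rewrite le_max lexx orbT.
  have [A FA] := Hs s s0 st.
  apply: (Hx s A) => //.
  + by rewrite s0 ltW.
  + by case: mm => ? ?; lra.
  + rewrite (AL s A _ FA); last by rewrite s0 (le_trans (ltW st) t1).
    by apply: Hd; rewrite ltr0_norm ?subr_lt0//; case: mm => ? ?; lra.
  + exact: ltW.
  + by rewrite ltrDl.
Qed.

End Family.

Definition lift_on (gam : R -> M) (v0 : 'rV[R]_n) (t : R) (L : R -> 'rV[R]_n) :=
  L 0 = v0 /\ forall s, 0 <= s <= t -> {for s, continuous L} /\ E (L s) = gam s.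

Lemma lift_on_uniq gam v0 t L L' : 0 <= t -> lift_on gam v0 t L -> lift_on gam v0 t L' ->
  forall s, 0 <= s <= t -> L s = L' s.
Proof.
move=> t0 [L0 H] [L'0 H']; apply: (lift_uniq t0).
- by move=> s st; have [h _] := H s st.
- by move=> s st; have [h _] := H' s st.
- by move=> s st; have [_ ->] := H s st; have [_ ->] := H' s st.
- by rewrite L0.
Qed.

Lemma lift_on_le gam v0 s t L : s <= t -> lift_on gam v0 t L -> lift_on gam v0 s L.
Proof.
by move=> st [L0 H]; split => // u /andP[u0 us]; apply: H; rewrite u0 (le_trans us st).
Qed.

Lemma lift_paste gam v0 (t' t'' : R) L (sg : M -> 'rV[R]_n) : 0 <= t' -> t' <= t'' ->
  (forall s, t' <= s <= t'' -> {for s, continuous gam} /\ E (sg (gam s)) = gam s /\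
     {for gam s, continuous sg}) ->
  lift_on gam v0 t' L -> sg (gam t') = L t' -> exists L', lift_on gam v0 t'' L'.
Proof.
move=> t'0 t12 Hs [L0 HL] e.
exists (fun s => L (Num.min s t') + (sg (gam (Num.max t' (Num.min s t''))) - L t')).
split; first by rewrite min_l// min_l ?(le_trans t'0)// max_l// e subrr addr0 L0.
move=> s /andP[s0 s1].
have m1 : 0 <= Num.min s t' <= t' by rewrite le_min s0 t'0 ge_min lexx orbT.
have m2 : t' <= Num.max t' (Num.min s t'') <= t''.
  by rewrite le_max lexx ge_max t12 ge_min lexx orbT.
split; last first.
  rewrite (min_l s1); have [st|ts] := leP s t'.
    by rewrite e subrr addr0; have [_] := HL s (introT andP (conj s0 st)).
  by rewrite addrC subrK; have [_ []] := Hs s (introT andP (conj (ltW ts) s1)).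
apply: cvgD.
  apply: (@continuous_comp _ _ _ (fun q : R => Num.min q t') L s).
    by apply: (@continuous_min _ _ id (fun=> t')); [exact: cvg_id | exact: cvg_cst].
  by have [] := HL _ m1.
apply: cvgB; last exact: cvg_cst.
have [h1 [_ h2]] := Hs _ m2.
apply: (@continuous_comp _ _ _ (fun q : R => gam (Num.max t' (Num.min q t''))) sg s) => //.
apply: (@continuous_comp _ _ _ (fun q : R => Num.max t' (Num.min q t'')) gam s) => //.
apply: (@continuous_max _ _ (fun=> t') (fun q : R => Num.min q t'')); first exact: cvg_cst.
by apply: (@continuous_min _ _ id (fun=> t'')); [exact: cvg_id | exact: cvg_cst].
Qed.

Lemma lift_extend gam v0 (t : R) w : 0 <= t -> {for t, continuous gam} ->
  (forall s, 0 <= s <= 1 -> {for s, continuous gam}) -> E w = gam t ->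
  exists2 eta : R, 0 < eta & forall (t' : R) L, 0 <= t' <= t -> t - eta < t' ->
    lift_on gam v0 t' L -> `|L t' - w| < eta -> forall t'' : R, t' <= t'' -> t'' < t + eta ->
    t'' <= 1 -> exists L', lift_on gam v0 t'' L'.
Proof.
move=> t0 cgt cg Ew; have [sg [sgw sgN]] := E_section w; have [d d0 inj] := E_inj w.
have sgc : {for E w, continuous sg} by have [] := nbhs_singleton sgN.
have sgn : \forall x \near E w, `|sg x - w| < d.
  have sgc' : sg @ nbhs (E w) --> w by rewrite -{2}sgw; exact: sgc.
  exact: (cvg_near_dist _ _ _ sgc' d0).
have HN : \forall s \near t, (E (sg (gam s)) = gam s /\
    {for gam s, continuous sg}) /\ `|sg (gam s) - w| < d.
  have hN : \forall x \near E w, (E (sg x) = x /\ {for x, continuous sg}) /\ `|sg x - w| < d.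
    by exact: filterI sgN sgn.
  by rewrite Ew in hN; exact: (@near_comp _ _ gam t (fun x => (E (sg x) = x /\ {for x, continuous sg}) /\ `|sg x - w| < d) cgt hN).
have /nbhs_ballP[r r0 Hr] := HN.
exists (Num.min r d); first by rewrite lt_min r0.
move=> t' L /andP[t'0 t't]; rewrite ltrBlDl -ltrBlDr => tt' FL Lw t'' t1 t2 t3.
have Lw' : `|L t' - w| < d by apply: lt_le_trans Lw _; rewrite ge_min lexx orbT.
have tt'r : t - t' < r by apply: lt_le_trans tt' _; rewrite ge_min lexx.
have t2r : t'' - t < r by rewrite ltrBlDl; apply: lt_le_trans t2 _; rewrite lerD2l ge_min lexx.
have Ut s : t' <= s -> s <= t'' -> (E (sg (gam s)) = gam s /\
    {for gam s, continuous sg}) /\ `|sg (gam s) - w| < d.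
  move=> s1 s2; apply: Hr; rewrite -ball_normE /= ltr_norml; apply/andP; split; lra.
apply: (lift_paste t'0 t1 _ FL (sg := sg)).
  move=> s /andP[s1 s2]; have [[h1 h2] _] := Ut s s1 s2; split => //.
  by apply: cg; rewrite (le_trans t'0 s1) (le_trans s2 t3).
have [[h1 _] h2] := Ut t' (lexx _) t1.
apply: inj => //; rewrite h1; have [_ HL] := FL.
by have [_ ->] := HL t' (introT andP (conj t'0 (lexx _))).
Qed.

(** One neighbourhood [U] serves every point of the fibre above it. This is as much of a covering
    map as the lifting of arbitrary continuous paths requires. *)
Hypothesis E_cover : forall x : M, exists2 U : set M, nbhs x U & forall v, U (E v) ->
  exists sg : M -> 'rV[R]_n, sg (E v) = v /\ forall y, U y -> E (sg y) = y /\ {for y, continuous sg}.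

Lemma path_lift (gam : R -> M) v0 : (forall s, 0 <= s <= 1 -> {for s, continuous gam}) ->
  E v0 = gam 0 -> exists L, lift_on gam v0 1 L.
Proof.
move=> cg E0; suff : forall t : R, 0 <= t -> t <= 1 -> exists L, lift_on gam v0 t L by apply.
have ext (t : R) : 0 <= t <= 1 -> exists2 eta : R, 0 < eta & forall (t' : R) L, 0 <= t' <= t -> t - eta < t' ->
    lift_on gam v0 t' L -> forall t'' : R, t' <= t'' -> t'' < t + eta ->
    t'' <= 1 -> exists L', lift_on gam v0 t'' L'.
  move=> t01; have [U nU HU] := E_cover (gam t).
  have /nbhs_ballP[r r0 Hr] : nbhs t (gam @^-1` U) by exact: cg.
  exists r => // t' L /andP[t'0 t't]; rewrite ltrBlDl -ltrBlDr => tt' FL t'' t1 t2 t3.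
  have Ut s : t' <= s -> s <= t'' -> U (gam s).
    move=> s1 s2; apply: (Hr s); rewrite -ball_normE /= ltr_norml; apply/andP; split; lra.
  have Et' : E (L t') = gam t'.
    by have [_ HL] := FL; have [_] := HL t' (introT andP (conj t'0 (lexx _))).
  have [|sg [e Hsg]] := HU (L t'); first by rewrite Et'; exact: Ut.
  apply: (lift_paste t'0 t1 _ FL (sg := sg)); last by rewrite -Et'.
  move=> s /andP[s1 s2]; have [h1 h2] := Hsg _ (Ut s s1 s2); split => //.
  by apply: cg; rewrite (le_trans t'0 s1) (le_trans s2 t3).
apply: (real_ind 0 1 (fun t => exists L, lift_on gam v0 t L)) => //.
- exists (fun=> v0); split=> [//|s /andP[s0 s1]].
  have -> : s = 0 by apply/eqP; rewrite eq_le s0 s1.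
  by split; first exact: cst_continuous.
- move=> t t0 t1 Hs; have t01 : 0 <= t <= 1 by rewrite t0 ltW.
  have [eta e0 Hx] := ext t t01; have [L FL] := Hs t t0 (lexx t).
  exists eta => // s ts se s1.
  apply: (Hx t L) => //; [by rewrite t0 lexx | by rewrite ltrBlDr ltrDl | exact: ltW].
- move=> t t0 t1 Hs; have t01 : 0 <= t <= 1 by rewrite ltW.
  have [eta e0 Hx] := ext t t01.
  pose s := Num.max 0 (t - eta / 2).
  have s0 : 0 <= s by rewrite le_max lexx.
  have st : s < t by rewrite gt_max t0 ltrBlDr ltrDl divr_gt0.
  have ts : t - eta / 2 <= s by rewrite le_max lexx orbT.
  have [L FL] := Hs s s0 st.
  apply: (Hx s L) => //; [by rewrite s0 ltW | lra | exact: ltW | by rewrite ltrDl].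
Qed.

Let cl (t : R) : R := Num.max 0 (Num.min 1 t).

Let cl_cont : continuous cl.
Proof.
move=> t; apply: (@continuous_max _ _ (fun=> 0) (fun q : R => Num.min 1 q)); first exact: cvg_cst.
by apply: (@continuous_min _ _ (fun=> 1) id); [exact: cvg_cst | exact: cvg_id].
Qed.

Let cl01 t : 0 <= cl t <= 1.
Proof. by rewrite /cl le_max lexx ge_max ler01 ge_min lexx. Qed.

Let clE t : 0 <= t <= 1 -> cl t = t.
Proof. by move=> /andP[t0 t1]; rewrite /cl min_r// max_r. Qed.

Hypothesis sc : simply_connected R M.

Lemma covering_surj x : exists v, E v = x.
Proof.
have [pth _] := sc; have [gam [cg g0 g1]] := pth (E 0) x.
have cg' : continuous (gam \o cl).
  by apply: within_comp_cont cg cl_cont _ => t; rewrite /= in_itv /=; exact: cl01.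
have [|L [L0 HL]] := @path_lift (gam \o cl) 0 (fun s _ => cg' s).
  by rewrite /= clE ?lexx ?ler01// g0.
exists (L 1); have [|_ ->] := HL 1; first by rewrite ler01 lexx.
by rewrite /= clE ?lexx ?ler01.
Qed.

(** The segment from [v1] to [v2] maps to a loop. Along a contraction of this loop the end points of
    the lifts stay in the fibre of [E v1], which is discrete, and vary continuously by
    [family_lift]; they are thus constant, equal to [v2] at one end and to [v1] at the other. *)
Lemma covering_inj v1 v2 : E v1 = E v2 -> v1 = v2.
Proof.
move=> EE; have [_ lp] := sc.
pose sgm (t : R) : 'rV[R]_n := v1 + t *: (v2 - v1).
have cs : continuous sgm.
  move=> t; apply: cvgD; first exact: cvg_cst.
  by apply: cvgZr_tmp; exact: cvg_id.
have cE : continuous (E \o sgm) by move=> t; apply: continuous_comp; [exact: cs | exact: E_cont].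
have [||H [cH HH]] := lp (E \o sgm).
- exact: continuous_subspaceT.
- by rewrite /= /sgm scale0r addr0 scale1r addrC subrK.
pose K (s p : R) := H (cl s, cl p).
have cK : continuous (fun q : R * R => K q.1 q.2).
  apply: (@within_comp_cont (R * R)%type (R * R)%type M _ H (fun q : R * R => (cl q.1, cl q.2)) cH).
    move=> ab; apply: (@pair_cont (R * R)%type R R (fun q => cl q.1) (fun q => cl q.2) ab).
      by apply: (@comp_cont (R * R)%type R R (fun q => q.1) cl); [exact: cvg_fst | exact: cl_cont].
    by apply: (@comp_cont (R * R)%type R R (fun q => q.2) cl); [exact: cvg_snd | exact: cl_cont].
  by move=> [a b]; split; rewrite /= in_itv /=; exact: cl01.
have sl0 : sgm 0 = v1 by rewrite /sgm scale0r addr0.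
have sl1 : sgm 1 = v2 by rewrite /sgm scale1r addrC subrK.
have i01 (s : R) : 0 <= s <= 1 -> s \in `[0, 1] by rewrite in_itv.
have K0 p : K 0 p = E v1.
  have [_ _ + _] := HH (cl p) (i01 _ (cl01 p)).
  by rewrite /K (clE (t := 0)) ?lexx ?ler01//= sl0.
have K1 p : K 1 p = E v1.
  have [_ _ _ +] := HH (cl p) (i01 _ (cl01 p)).
  by rewrite /K (clE (t := 1)) ?lexx ?ler01//= sl0.
have Kgam s : K s 0 = E (sgm (cl s)).
  have [+ _ _ _] := HH (cl s) (i01 _ (cl01 s)).
  by rewrite /K (clE (t := 0)) ?lexx ?ler01.
have Kc s : K s 1 = E v1.
  have [_ + _ _] := HH (cl s) (i01 _ (cl01 s)).
  by rewrite /K (clE (t := 1)) ?lexx ?ler01//= sl0.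
have cKs p : continuous (K ^~ p).
  move=> s; apply: (@comp_cont _ _ _ (fun s : R => (s, p)) (fun q : R * R => K q.1 q.2) s); last exact: cK.
  by apply: pair_cont; [exact: cvg_id | exact: cvg_cst].
have /choice[L HL] : forall p, exists L, lift_on (K ^~ p) v1 1 L.
  by move=> q; apply: path_lift => [s _|]; [exact: cKs | rewrite K0].
have one : 0 <= (1 : R) <= 1 by rewrite ler01 lexx.
have EL p : E (L p 1) = E v1 by have [_ h] := HL p; have [_ ->] := h 1 one; rewrite K1.
have L0 : L 0 1 = v2.
  rewrite -sl1; apply: (lift_on_uniq ler01 (HL 0) _ one).
  split=> [//|s s01]; split; first exact: cs.
  by rewrite Kgam clE.
have L1 : L 1 1 = v1.
  apply: (lift_on_uniq (L' := fun=> v1) ler01 (HL 1) _ one).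
  by split=> [//|s s01]; split; [exact: cst_continuous | rewrite Kc].
rewrite -L0 -L1; apply/esym.
apply: (interval_ind 0 1 (fun s t => L s 1 = L t 1)) => // [s t r _ _ _ _ -> //|p0 _].
have [h1 h2] := HL p0.
have nK : \forall p \near p0, forall t : R, 0 <= t <= 1 ->
    {for (t, p), continuous (fun q : R * R => K q.1 q.2)}.
  apply: (@filterS _ (nbhs p0) (nbhs_filter p0) setT) => [q _ t _|]; [exact: cK | exact: filterT].
have nK0 : \forall p \near p0, K 0 p = E v1.
  by apply: (@filterS _ (nbhs p0) (nbhs_filter p0) setT) => [q _|]; [exact: K0 | exact: filterT].
have [A FA] := @family_lift R K p0 v1 nK nK0 (L p0) h1 h2.
have nL : \forall p \near p0, A 1 p = L p 1.
  apply: filterS FA => p [A0 HA].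
  apply: (lift_on_uniq (L := A ^~ p) ler01 _ (HL p) one).
  by split; [exact: A0 | move=> s /HA[h3 hc]; have [hc1 _] := slice_cont hc; split; [exact: hc1 | exact: h3]].
have cA : A 1 @ nbhs p0 --> A 1 p0.
  have [_ HA] := nbhs_singleton FA; have [_ h] := HA 1 one.
  by have [_] := slice_cont h.
have eq1 : \forall p \near p0, A 1 p = A 1 p0.
  have eA := nbhs_singleton nL.
  apply: (cvg_near_eq cA (cvg_cst _)); apply: filterS nL => p ->.
  by rewrite eA !EL.
have : \forall p \near p0, L p 1 = L p0 1.
  by have eA := nbhs_singleton nL; apply: filterS2 nL eq1 => p <- ->.
move=> /nbhs_ballP[r r0 Hr]; exists r => // s _; split => h3 h4.
  by apply: Hr; rewrite -ball_normE /= ger0_norm ?subr_ge0// ltrBlDl -ltrBlDr.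
by apply/esym; apply: Hr; rewrite -ball_normE /= ler0_norm ?subr_le0// opprB ltrBlDl.
Qed.

End Lifting.

(** * Expanding maps *)

Section ChartNorm.
Context {R : realType} {n : nat} {M : ptopologicalType} {X : manifold R n M}.
Variable g : riemannian_metric X.
Implicit Types (c : chart R n M) (v w a b : 'rV[R]_n).

Definition gnorm c v w : R := Num.sqrt (inner g c v w w).

Lemma gnorm_ge0 c v w : 0 <= gnorm c v w.
Proof. exact: sqrtr_ge0. Qed.

Lemma gnorm_sqr c v w : atlas X c -> cdom c v -> gnorm c v w ^+ 2 = inner g c v w w.
Proof. by move=> cX Vv; rewrite sqr_sqrtr// inner_ge0. Qed.

Lemma gnormD c v a b : atlas X c -> cdom c v -> gnorm c v (a + b) <= gnorm c v a + gnorm c v b.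
Proof.
move=> cX Vv; have p0 : 0 <= gnorm c v a + gnorm c v b by rewrite addr_ge0// gnorm_ge0.
rewrite -(@ler_pXn2r _ 2)// ?nnegrE ?gnorm_ge0// sqrrD !gnorm_sqr//.
rewrite innerDl !innerDr (inner_sym g cX b a Vv).
suff : inner g c v a b <= gnorm c v a * gnorm c v b.
  by move: (inner _ _ _ a a) (inner _ _ _ b b) (inner _ _ _ a b) (_ * _) => p q r s; rewrite mulr2n; lra.
apply: le_trans (ler_norm _) _.
rewrite -(@ler_pXn2r _ 2)// ?nnegrE ?mulr_ge0 ?gnorm_ge0// real_normK ?num_real//.
by rewrite exprMn !gnorm_sqr//; exact: inner_cauchy.
Qed.

Lemma gnormZ c v (k : R) a : gnorm c v (k *: a) = `|k| * gnorm c v a.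
Proof.
rewrite /gnorm innerZl innerZr mulrA -expr2 sqrtrM ?sqr_ge0//.
by rewrite sqrtr_sqr.
Qed.

Lemma gnormN c v a : gnorm c v (- a) = gnorm c v a.
Proof. by rewrite -scaleN1r gnormZ normrN normr1 mul1r. Qed.

Lemma gnormB c v a b : gnorm c v (a - b) = gnorm c v (b - a).
Proof. by rewrite -gnormN opprB. Qed.

Lemma gnorm_equiv c v0 : atlas X c -> cdom c v0 -> exists2 r : R, 0 < r & exists2 K : R, 0 < K &
  forall v, `|v - v0| < r -> cdom c v /\ forall w, gnorm c v w <= K * `|w| /\ `|w| <= K * gnorm c v w.
Proof.
move=> cX Vv0; have [r1 r10 [L L0 HL]] := inner_lower g cX Vv0.
have nb : \forall v \near v0, cdom c v /\ forall p : 'I_n * 'I_n, `|gf g c p.1 p.2 v - gf g c p.1 p.2 v0| <= 1.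
  apply: filterI; first by apply: open_nbhs_nbhs; split => //; exact: open_cdom.
  apply: (@filter_forall _ _ (fun p v => `|gf g c p.1 p.2 v - gf g c p.1 p.2 v0| <= 1)
      (nbhs v0) (nbhs_filter v0)) => p.
  have /cvgrPdist_le/(_ _ ltr01) := gf_cont (g := g) cX (i := p.1) (j := p.2) Vv0.
  by apply: filterS => v; rewrite distrC.
move/nbhs_ballP : nb => [r2 r20 H2].
pose B := \sum_(p : 'I_n * 'I_n) `|gf g c p.1 p.2 v0| + 1.
have B0 : 0 <= B by rewrite addr_ge0// sumr_ge0.
pose K1 : R := n%:R ^+ 2 * B + 1.
have K10 : 0 < K1 by rewrite ltr_wpDl// mulr_ge0// exprn_ge0.
pose K := Num.sqrt K1 + Num.sqrt L.
exists (Num.min r1 r2); first by rewrite lt_min r10.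
have K0 : 0 < K by rewrite ltr_pwDr ?sqrtr_ge0// sqrtr_gt0.
exists K => // v; rewrite lt_min => /andP[vr1 vr2].
have bv : ball v0 r2 v by rewrite -ball_normE /= distrC.
have [Vv Hv] := H2 v bv; split => // w; split.
  rewrite -(@ler_pXn2r _ 2)// ?nnegrE ?gnorm_ge0 ?mulr_ge0 ?(ltW K0)//.
  rewrite gnorm_sqr// innerE; apply: le_trans (ler_norm _) _.
  have HB i j : `|gf g c i j v| <= B.
    have h := Hv (i, j); rewrite /= in h.
    have : `|gf g c i j v| <= `|gf g c i j v - gf g c i j v0| + `|gf g c i j v0|.
      by apply: le_trans (ler_normD _ _); rewrite subrK.
    have : `|gf g c i j v0| <= \sum_(p : 'I_n * 'I_n) `|gf g c p.1 p.2 v0|.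
      by rewrite (bigD1 (i, j))//= lerDl sumr_ge0.
    by rewrite /B; lra.
  have h := @norm_qs_le _ _ (gf g c) B v w w B0 HB.
  apply: (le_trans h); rewrite exprMn expr2 -mulrA -!expr2 ler_wpM2r ?sqr_ge0//.
  apply: (@le_trans _ _ K1); first by rewrite lerDl.
  rewrite -[leLHS]sqr_sqrtr ?(ltW K10)// lerXn2r ?nnegrE ?sqrtr_ge0// ?(ltW K0)//.
  by rewrite lerDl sqrtr_ge0.
rewrite -(@ler_pXn2r _ 2)// ?nnegrE ?mulr_ge0 ?gnorm_ge0 ?(ltW K0)//.
apply: (le_trans (HL v w vr1)); rewrite exprMn gnorm_sqr// ler_wpM2r ?inner_ge0//.
rewrite -[leLHS]sqr_sqrtr ?(ltW L0)// lerXn2r ?nnegrE ?sqrtr_ge0// ?(ltW K0)//.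
by rewrite lerDr sqrtr_ge0.
Qed.

End ChartNorm.

Lemma mulmx_bound {R : realType} {n : nat} (B : 'M[R]_n) : exists2 K : R, 0 < K &
  forall w : 'rV[R]_n, `|w *m B| <= K * `|w|.
Proof.
exists (\sum_i \sum_j `|B i j| + 1).
  by rewrite ltr_wpDl// sumr_ge0// => i _; rewrite sumr_ge0.
move=> w; apply: norm_le_coord.
  by rewrite mulr_ge0// addr_ge0// sumr_ge0// => i _; rewrite sumr_ge0.
move=> j; rewrite mxE; apply: le_trans (ler_norm_sum _ _ _) _.
apply: (@le_trans _ _ (\sum_i `|B i j| * `|w|)).
  by apply: ler_sum => i _; rewrite normrM mulrC ler_wpM2l// coord_le_norm.
rewrite -mulr_suml ler_wpM2r//; apply: (@le_trans _ _ (\sum_i \sum_j `|B i j|)).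
  by apply: ler_sum => i _; rewrite (bigD1 j)//= lerDl sumr_ge0.
by rewrite lerDl.
Qed.

Lemma zmod_subACA {V : zmodType} (x y z t : V) : x - y - (z - t) = x - z - (y - t).
Proof. by rewrite !opprB addrACA [RHS]addrACA [- z - y]addrC. Qed.

Lemma zmod_split {V : zmodType} (x y p : V) : x = p + (y - p) - (y - x).
Proof. by rewrite [p + _]addrC subrK opprB addrC subrK. Qed.

(** * Expanding maps lift curves and are bijective *)

Section ExpandingMap.
Context {R : realType} {n : nat} {M : ptopologicalType} {X : manifold R n M}.
Variable g : riemannian_metric X.
Variables (c : chart R n M) (o : M).
Hypothesis cX : atlas X c.
Hypothesis co : dom c o.
Variable E : 'rV[R]_n -> M.
Implicit Types (u v w : 'rV[R]_n).
Hypothesis HE : forall u c1, atlas X c1 -> dom c1 (E u) ->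
  exists A : 'M[R]_n, (forall w, gnorm g c (c o) w <= gnorm g c1 (c1 (E u)) (w *m A)) /\
    forall e : R, 0 < e -> exists2 d : R, 0 < d & forall v1 v2,
      `|v1 - u| < d -> `|v2 - u| < d ->
      [/\ dom c1 (E v1), dom c1 (E v2) &
       `|c1 (E v2) - c1 (E v1) - (v2 - v1) *m A| <= e * `|v2 - v1|].

Let Vo : cdom c (c o). Proof. by exists o. Qed.

(** The inverse function theorem for a strictly differentiable map. Expansion makes [A] invertible,
    and a point with image [y] is a fixed point of the Newton map [G], which halves distances and
    preserves a closed ball. *)
Lemma local_homeo u c1 : atlas X c1 -> dom c1 (E u) ->
  exists d C r : R, [/\ 0 < d, 0 < C, 0 < r &
   [/\ forall v, `|v - u| < d -> dom c1 (E v),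
      forall v1 v2, `|v1 - u| < d -> `|v2 - u| < d ->
        `|v2 - v1| <= C * `|c1 (E v2) - c1 (E v1)| /\ `|c1 (E v2) - c1 (E v1)| <= C * `|v2 - v1| &
      forall y : 'rV[R]_n, `|y - c1 (E u)| < r -> exists2 v, `|v - u| < d & c1 (E v) = y]].
Proof.
move=> c1X d1; have [A [HA HS]] := HE c1X d1.
have V1 : cdom c1 (c1 (E u)) by exists (E u).
have uA : A \in unitmx.
  rewrite -row_free_unit -kermx_eq0; apply/eqP/row_matrixP => i; rewrite row0.
  have z : row i (kermx A) *m A = 0 by rewrite -row_mul mulmx_ker row0.
  apply/eqP; apply: contraT => nz; have := HA (row i (kermx A)); rewrite z.
  have := inner_gt0 g cX Vo nz.
  rewrite /gnorm inner0l sqrtr0 -sqrtr_gt0 => h1 h2.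
  by have := lt_le_trans h1 h2; rewrite ltxx.
have [K K0 HK] := mulmx_bound (invmx A).
have [K' K'0 HK'] := mulmx_bound A.
have e0 : 0 < (2 * K)^-1 by rewrite invr_gt0 mulr_gt0.
have [d d0 Hd] := HS _ e0.
have dom1 v : `|v - u| < d -> dom c1 (E v).
  by move=> vd; have [] := Hd v v vd vd.
have half v1 v2 : `|v1 - u| < d -> `|v2 - u| < d ->
    `|(c1 (E v2) - c1 (E v1)) *m invmx A - (v2 - v1)| <= 2^-1 * `|v2 - v1|.
  move=> h1 h2; have [_ _ h] := Hd _ _ h1 h2.
  rewrite -{1}[v2 - v1](mulmxK uA) -mulmxBl; apply: le_trans (HK _) _.
  apply: (@le_trans _ _ (K * ((2 * K)^-1 * `|v2 - v1|))).
    by rewrite ler_wpM2l// ltW.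
  by rewrite mulrA invfM mulrCA mulrV ?unitfE ?gt_eqF// mulr1.
have lo v1 v2 : `|v1 - u| < d -> `|v2 - u| < d -> `|v2 - v1| <= 2 * K * `|c1 (E v2) - c1 (E v1)|.
  move=> h1 h2; have h := half _ _ h1 h2.
  have h3 : `|v2 - v1| <= `|(c1 (E v2) - c1 (E v1)) *m invmx A| +
      `|(c1 (E v2) - c1 (E v1)) *m invmx A - (v2 - v1)|.
    set z := _ *m invmx A; apply: le_trans (ler_normB z (z - (v2 - v1))).
    by rewrite opprB [z + _]addrC subrK.
  have h4 := HK (c1 (E v2) - c1 (E v1)).
  by rewrite -mulrA; move: h h3 h4; set p := K * _; lra.
have up v1 v2 : `|v1 - u| < d -> `|v2 - u| < d -> `|c1 (E v2) - c1 (E v1)| <= ((2 * K)^-1 + K') * `|v2 - v1|.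
  move=> h1 h2; have [_ _ h] := Hd _ _ h1 h2.
  have h3 : `|c1 (E v2) - c1 (E v1)| <= `|c1 (E v2) - c1 (E v1) - (v2 - v1) *m A| + `|(v2 - v1) *m A|.
    by apply: le_trans (ler_normD _ _); rewrite subrK.
  by rewrite mulrDl; apply: (le_trans h3); apply: lerD.
exists d, (2 * K + ((2 * K)^-1 + K')), (d / (4 * K)).
have K20 : 0 < 2 * K by rewrite mulr_gt0.
have eK : 0 < (2 * K)^-1 + K' by rewrite addr_gt0.
split; [exact: d0 | exact: addr_gt0 | by rewrite divr_gt0// mulr_gt0 |].
split; first exact: dom1.
  move=> v1 v2 h1 h2; split.
    by apply: le_trans (lo _ _ h1 h2) _; rewrite ler_wpM2r// lerDl ltW.
  by apply: le_trans (up _ _ h1 h2) _; rewrite ler_wpM2r// lerDr ltW.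
move=> y yr.
pose S := [set v : 'rV[R]_n | `|v - u| <= d / 2].
have Sd v : S v -> `|v - u| < d.
  by move=> h; apply: le_lt_trans h _; rewrite ltr_pdivrMr// ltr_pMr// ltr1n.
have cS : compact S.
  apply: bounded_closed_compact.
    exists (`|u| + d / 2); split; first exact: num_real.
    move=> B BB v /= vq; apply: ltW; apply: le_lt_trans BB.
    by rewrite -[v](subrK u) addrC; apply: le_trans (ler_normD _ _) _; rewrite lerD2l.
  rewrite (_ : S = (fun v : 'rV[R]_n => `|v - u|) @^-1` [set x | x <= d / 2])//.
  apply: closed_comp; last exact: closed_le.
  move=> v _; apply: (@comp_cont _ _ _ (fun v : 'rV[R]_n => v - u) (fun v => `|v|)); last exact: norm_continuous.
  exact: (cvgB (@cvg_id _ (nbhs v)) (cvg_cst u)).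
pose G v := v - (c1 (E v) - y) *m invmx A.
have GG v1 v2 : `|v1 - u| < d -> `|v2 - u| < d -> `|G v2 - G v1| <= 2^-1 * `|v2 - v1|.
  move=> h1 h2; have := half _ _ h1 h2; rewrite -normrN opprB.
  have -> : (c1 (E v2) - c1 (E v1)) *m invmx A =
      (c1 (E v2) - y) *m invmx A - (c1 (E v1) - y) *m invmx A.
    by rewrite -mulmxBl opprB addrA subrK.
  by rewrite /G zmod_subACA.
have GS v : S v -> S (G v).
  move=> Sv; rewrite /S /=.
  have uu : `|u - u| < d by rewrite subrr normr0.
  have h1 := GG u v uu (Sd v Sv).
  have h2 : `|G u - u| <= d / 4.
    rewrite /G addrAC subrr add0r normrN; apply: le_trans (HK _) _.
    rewrite distrC; apply: (@le_trans _ _ (K * (d / (4 * K)))).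
      by rewrite ler_wpM2l ?(ltW K0)// ltW.
    by rewrite le_eqVlt; apply/orP; left; apply/eqP; field; rewrite gt_eqF.
  have h3 : `|G v - u| <= `|G v - G u| + `|G u - u|.
    by apply: le_trans (ler_normD _ _); rewrite addrA subrK.
  by move: Sv; rewrite /S /=; lra.
pose ph v := `|v - G v|.
have phL v1 v2 : `|v1 - u| < d -> `|v2 - u| < d -> `|ph v2 - ph v1| <= 2 * `|v2 - v1|.
  move=> h1 h2; apply: le_trans (ler_dist_dist _ _) _.
  have -> : v2 - G v2 - (v1 - G v1) = (v2 - v1) - (G v2 - G v1).
    exact: zmod_subACA.
  apply: le_trans (ler_normB _ _) _; have := GG _ _ h1 h2; have := normr_ge0 (v2 - v1); lra.
have cph (v : 'rV[R]_n) : S v -> ph @ nbhs v --> ph v.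
  move=> Sv; have FF : ProperFilter (nbhs v) := nbhs_pfilter v.
  have nn : \forall w \near v, `|ph w - ph v| <= 2 * `|w - v|.
    apply/nbhs_ballP; exists (d / 2); first by rewrite /= divr_gt0.
    move=> v'; rewrite -ball_normE /= distrC => v'v; apply: phL; first exact: Sd.
    have : `|v' - u| <= `|v' - v| + `|v - u|.
      by apply: le_trans (ler_normD _ _); rewrite addrA subrK.
    by move: Sv; rewrite /S /=; lra.
  apply: (cvg_squeeze nn).
  rewrite -(normr0 'rV[R]_n) -(subrr v).
  by apply: cvg_norm; apply: cvgB; [exact: cvg_id | exact: cvg_cst].
(* The displacement under [G] attains its minimum on the compact ball; as [G] at least halves
   displacements, this minimum is 0. *)
have [||v Sv Hv] := @EVT_min_rV R n ph S _ cS.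
- by exists u; rewrite /S /= subrr normr0 divr_ge0// ltW.
- by apply: (@continuous_in_subspaceT _ _ S ph) => v /set_mem; exact: cph.
exists v; first exact: Sd (set_mem Sv).
have SG := GS _ (set_mem Sv).
have h1 := Hv (G v) (mem_set SG).
have h2 := GG _ _ (Sd _ (set_mem Sv)) (Sd _ SG).
have ph0 : ph v = 0.
  apply/eqP; rewrite eq_le normr_ge0 andbT.
  by move: h1 h2; rewrite /ph [`|v - G v|]distrC [`|G v - G (G v)|]distrC; lra.
move/normr0_eq0 : ph0; rewrite /G opprB addrC subrK => z.
apply/eqP; rewrite -subr_eq0; apply/eqP.
by rewrite -[LHS](mulmxKV uA) z mul0mx.
Qed.

Lemma expanding_cont : continuous E.
Proof.
move=> u; have [c1 c1X d1] := atlas_cover X (E u).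
have [d [C [r [d0 C0 r0 [D L _]]]]] := local_homeo c1X d1.
have cF : (fun v => c1 (E v)) @ nbhs u --> c1 (E u).
  apply/cvgrPdist_le => e ep; apply/nbhs_ballP; exists (Num.min d (e / C)).
    by rewrite /= lt_min d0 divr_gt0.
  move=> v; rewrite -ball_normE /= lt_min => /andP[h1 h2].
  have uu : `|u - u| < d by rewrite subrr normr0.
  have vd : `|v - u| < d by rewrite distrC.
  have [_ h] := L v u vd uu; apply: (le_trans h).
  by rewrite mulrC -ler_pdivlMr// ltW.
have cP : {for c1 (E u), continuous (param c1)} by apply: param_continuous; exists (E u).
have nD : \forall v \near u, dom c1 (E v).
  apply/nbhs_ballP; exists d => // v; rewrite -ball_normE /= distrC; exact: D.
have cPF := comp_cont cF cP.
have cP2 : (fun v => param c1 (c1 (E v))) @ nbhs u --> E u.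
  by move: (cPF : _ @ nbhs u --> param c1 (c1 (E u))); rewrite coorK.
have E2 : \forall v \near nbhs u, param c1 (c1 (E v)) = E v.
  by apply: filterS nD => v dv; rewrite coorK.
exact: cvg_trans (near_eq_cvg E2) cP2.
Qed.

Lemma expanding_inj u : exists2 d : R, 0 < d & forall v1 v2,
  `|v1 - u| < d -> `|v2 - u| < d -> E v1 = E v2 -> v1 = v2.
Proof.
have [c1 c1X d1] := atlas_cover X (E u).
have [d [C [r [d0 C0 r0 [D L _]]]]] := local_homeo c1X d1.
exists d => // v1 v2 h1 h2 e; have [h _] := L v1 v2 h1 h2.
move: h; rewrite e subrr normr0 mulr0 normr_le0 subr_eq0 => /eqP ->//.
Qed.

Lemma expanding_section u : exists sg : M -> 'rV[R]_n, sg (E u) = u /\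
  \forall x \near E u, E (sg x) = x /\ {for x, continuous sg}.
Proof.
have [c1 c1X d1] := atlas_cover X (E u).
have [d [C [r [d0 C0 r0 [D L Sj]]]]] := local_homeo c1X d1.
pose sg x := xget 0 [set v : 'rV[R]_n | `|v - u| < d /\ c1 (E v) = c1 x].
have sgP x : `|c1 x - c1 (E u)| < r -> `|sg x - u| < d /\ c1 (E (sg x)) = c1 x.
  move=> h; have [v h1 h2] := Sj _ h.
  suff : [set v : 'rV[R]_n | `|v - u| < d /\ c1 (E v) = c1 x] (sg x) by [].
  by apply: xgetPex; exists v.
have uu : `|u - u| < d by rewrite subrr normr0.
have cc x : dom c1 x -> {for x, continuous c1} by exact: coor_continuous.
have nr x : dom c1 x -> `|c1 x - c1 (E u)| < r ->
    \forall y \near x, dom c1 y /\ `|c1 y - c1 (E u)| < r.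
  move=> dx xr; apply: filterI.
    by apply: open_nbhs_nbhs; split => //; exact: open_dom.
  have e0 : 0 < r - `|c1 x - c1 (E u)| by rewrite subr_gt0.
  have := cvg_near_dist (FF := nbhs_filter x) _ _ _ (cc x dx) e0; apply: filterS => y h.
  have : `|c1 y - c1 (E u)| <= `|c1 y - c1 x| + `|c1 x - c1 (E u)|.
    by apply: le_trans (ler_normD _ _); rewrite addrA subrK.
  lra.
exists sg; split.
  have z : `|c1 (E u) - c1 (E u)| < r by rewrite subrr normr0.
  have [h1 h2] := sgP _ z; have [h _] := L (sg (E u)) u h1 uu.
  by move: h; rewrite h2 subrr normr0 mulr0 normr_le0 subr_eq0 => /eqP.
have z : `|c1 (E u) - c1 (E u)| < r by rewrite subrr normr0.
apply: filterS (nr _ d1 z) => x [dx xr]; have [h1 h2] := sgP _ xr; split.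
  by rewrite -[LHS](coorK (D _ h1)) h2 coorK.
apply: (cvg_squeeze (FF := nbhs_pfilter x) (K := C) (q := fun y => `|c1 y - c1 x|)).
  apply: filterS (nr _ dx xr) => y [dy yr]; have [h3 h4] := sgP _ yr.
  by have [+ _] := L _ _ h1 h3; rewrite h2 h4.
rewrite -(normr0 'rV[R]_n) -(subrr (c1 x)).
by apply: cvg_norm; apply: cvgB; [exact: cc | exact: cvg_cst].
Qed.

(* The differential of [E] is expanding; [l] stands for the length of [e], of which only a
   lower bound on its growth is needed. *)
Lemma lift_speed c1 (e e' L : R -> 'rV[R]_n) (l : R -> R) (a b : R) : a <= b -> atlas X c1 ->
  (forall t, a <= t <= b -> [/\ cdom c1 (e t), is_derive t (1 : R) e (e' t),
     {for t, continuous L} & E (L t) = param c1 (e t)]) ->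
  (forall s t, a <= s -> s <= t -> t <= b -> l s <= l t) ->
  (forall r eps : R, a <= r <= b -> 0 < eps -> exists2 d : R, 0 < d & forall s, a <= s <= b ->
     `|s - r| < d -> (gnorm g c1 (e r) (e' r) - eps) * `|s - r| <= `|l s - l r|) ->
  gnorm g c (c o) (L b - L a) <= l b - l a.
Proof.
move=> ab c1X H lm lH; apply/ler_addgt0Pr => eps0 eps00.
have [eps [ep0 epE]] : exists eps : R, 0 < eps /\ eps * (b - a) <= eps0.
  exists (eps0 / (b - a + 1)); rewrite divr_gt0// ?ltr_wpDl ?subr_ge0//; split => //.
  rewrite mulrAC ler_pdivrMr ?ltr_wpDl ?subr_ge0// ler_wpM2l ?(ltW eps00)//.
  by rewrite lerDl.
apply: (@le_trans _ _ (l b - l a + eps * (b - a))); last by rewrite lerD2l.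
pose Q s t := gnorm g c (c o) (L t - L s) <= l t - l s + eps * (t - s).
apply: (interval_ind a b Q ab).
  move=> s t r as_ st tr rb h1 h2; rewrite /Q.
  have -> : L r - L s = (L r - L t) + (L t - L s) by rewrite addrA subrK.
  have h := gnormD g (L r - L t) (L t - L s) cX Vo.
  move: h h1 h2; rewrite /Q; lra.
move=> r /[dup] rab /andP[ar rb]; have [Vr De cL EL] := H r rab.
have d1 : dom c1 (E (L r)).
  by rewrite EL; case: Vr => y dy <-; rewrite coorK.
have cE : c1 (E (L r)) = e r.
  by rewrite EL; case: Vr => y dy <-; rewrite coorK.
have [A [HA HS]] := HE c1X d1; rewrite cE in HA HS.
have [r1 r10 [K1 K10 HK1]] := gnorm_equiv g c1X Vr.
have [Vr' HK1r] := HK1 (e r) ltac:(by rewrite subrr normr0).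
have [r2 r20 [K2 K20 HK2]] := gnorm_equiv g cX Vo.
have [_ HK2o] := HK2 (c o) ltac:(by rewrite subrr normr0).
pose al := gnorm g c1 (e r) (e' r).
have al0 : 0 <= al by exact: gnorm_ge0.
(* Chosen so that (al + e1) / (1 - e1) = al + eps / 2. The factor 1 - e1 appears because the error
   in the strict differential is proportional to the increment of the lift, which is what has to be
   bounded. *)
pose e1 := eps / 2 / (1 + al + eps / 2).
have den : 0 < 1 + al + eps / 2 by move: al0 ep0; lra.
have e10 : 0 < e1 by rewrite divr_gt0// divr_gt0.
have e1E : e1 * (1 + al + eps / 2) = eps / 2 by rewrite /e1 divfK// gt_eqF.
have e1l : e1 < 1.
  by rewrite /e1 ltr_pdivrMr// mul1r; move: al0 ep0; lra.
have m1 : 0 < e1 / (K1 * K2) by rewrite divr_gt0// mulr_gt0.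
have [q1 q10 Hq1] := HS _ m1.
have m2 : 0 < e1 / K1 by rewrite divr_gt0.
have [De1 De2] := De.
have dl : (fun h : R => h^-1 *: (e (h *: 1 + r) - e r)) @ 0^' --> e' r.
  by rewrite -De2; exact: De1.
have /cvgrPdist_lt/(_ _ m2) := dl.
move=> /nbhs_ballP[q2 q20 Hq2].
have e20 : 0 < eps / 2 by rewrite divr_gt0.
have [q3 q30 Hq3] := lH r _ rab e20.
have nL : \forall s \near r, `|L s - L r| < q1 by exact: (cvg_near_dist _ _ _ cL q10).
move/nbhs_ballP : nL => [q4 q40 Hq4].
have q0 : 0 < Num.min (Num.min q2 q3) q4 by rewrite !lt_min q20 q30 q40.
have main s : a <= s <= b -> `|s - r| < Num.min (Num.min q2 q3) q4 ->
    gnorm g c (c o) (L s - L r) <= `|l s - l r| + eps * `|s - r|.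
  move=> sab; rewrite !lt_min => /andP[/andP[sr2 sr3] sr4].
  have [_ _ _ ELs] := H s sab.
  have Ls : `|L s - L r| < q1 by apply: Hq4; rewrite -ball_normE /= distrC.
  have Lr : `|L r - L r| < q1 by rewrite subrr normr0.
  have [_ d1s h1] := Hq1 _ _ Lr Ls.
  have cEs : c1 (E (L s)) = e s.
    have [Vs _ _ _] := H s sab.
    by rewrite ELs; case: Vs => y dy <-; rewrite coorK.
  rewrite cEs cE in h1.
  have h2 : `|e s - e r - (s - r) *: e' r| <= e1 / K1 * `|s - r|.
    have [->|sr] := eqVneq s r; first by rewrite !subrr scale0r subrr !normr0 mulr0.
    have b0 : ball (0 : R) q2 (s - r) by rewrite -ball_normE /= sub0r normrN.
    have n0 : s - r != 0 by rewrite subr_eq0.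
    have := Hq2 _ b0 n0; rewrite [(s - r) *: 1]mulr1 subrK => h.
    have -> : e s - e r - (s - r) *: e' r = - ((s - r) *: (e' r - (s - r)^-1 *: (e s - e r))).
      by rewrite scalerBr scalerA mulfV// scale1r opprB.
    by rewrite normrN normrZ mulrC ler_wpM2r// ltW.
  have g1 : gnorm g c1 (e r) ((L s - L r) *m A) <= al * `|s - r| + K1 * (e1 / K1 * `|s - r|)
      + K1 * (e1 / (K1 * K2) * `|L s - L r|).
    have -> : (L s - L r) *m A = ((s - r) *: e' r + (e s - e r - (s - r) *: e' r))
        - (e s - e r - (L s - L r) *m A).
      exact: zmod_split.
    apply: le_trans (gnormD _ _ _ c1X Vr) _; rewrite gnormN; apply: lerD.
      apply: le_trans (gnormD _ _ _ c1X Vr) _; apply: lerD.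
        by rewrite gnormZ mulrC.
      by have [h _] := HK1r (e s - e r - (s - r) *: e' r); apply: (le_trans h); rewrite ler_wpM2l// ltW.
    by have [h _] := HK1r (e s - e r - (L s - L r) *m A); apply: (le_trans h); rewrite ler_wpM2l// ltW.
  have g2 := HA (L s - L r).
  have [_ g3] := HK2o (L s - L r).
  have g4 := Hq3 s sab sr3; rewrite -/al in g4.
  have E1 : K1 * (e1 / K1 * `|s - r|) = e1 * `|s - r| by field; rewrite gt_eqF.
  have E2 : K1 * (e1 / (K1 * K2) * `|L s - L r|) <= e1 * gnorm g c (c o) (L s - L r).
    rewrite (_ : K1 * _ = e1 * (`|L s - L r| / K2)); last by field; rewrite !gt_eqF.
    by rewrite ler_wpM2l ?(ltW e10)// ler_pdivrMr// mulrC.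
  have := le_trans g2 g1; rewrite E1 => g5.
  have x0 := normr_ge0 (s - r).
  move: g4 g5 E2 x0 e1E e1l e10; move: (gnorm g c (c o) _) (K1 * _) (`|s - r|) (`|l s - l r|).
  move=> x z y w g4 g5 E2 y0 e1E e1l e10.
  have k1 : (1 - e1) * x <= (al + e1) * y by move: g4 g5 E2; clear; lra.
  have k2 : (al + e1) * y <= (1 - e1) * ((al + eps / 2) * y).
    rewrite mulrA ler_wpM2r// -subr_ge0.
    have -> : (1 - e1) * (al + eps / 2) - (al + e1) = eps / 2 - e1 * (1 + al + eps / 2) by ring.
    by rewrite e1E subrr.
  have k3 : x <= (al + eps / 2) * y.
    by rewrite -(@ler_pM2l _ (1 - e1)) ?subr_gt0//; exact: le_trans k2.
  move: k3 g4; clear; lra.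
exists (Num.min (Num.min q2 q3) q4) => // s sab; rewrite /Q; split => h1 h2.
  have sr : `|s - r| = r - s by rewrite ler0_norm ?subr_le0// opprB.
  have := main s sab; rewrite sr ltrBlDl -ltrBlDr => /(_ h1); rewrite gnormB.
  have /andP[as_ _] := sab.
  by rewrite [`|l s - _|]ler0_norm ?opprB// subr_le0 lm.
have sr : `|s - r| = s - r by rewrite ger0_norm ?subr_ge0.
have := main s sab; rewrite sr ltrBlDl => /(_ h2).
have /andP[_ sb] := sab.
by rewrite [`|l s - _|]ger0_norm// subr_ge0 lm.
Qed.

(** Expansion makes every partial lift Lipschitz with the same constant. At a limit time the lifts
    therefore stay bounded and have a limit in the domain of [E], which is the whole space; the
    local section there continues the lift. *)
Lemma arc_lift c1 (e e' : R -> 'rV[R]_n) v0 (C : R) : 0 <= C -> atlas X c1 ->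
  (forall t, 0 <= t <= 1 -> [/\ cdom c1 (e t), is_derive t (1 : R) e (e' t) &
     gnorm g c1 (e t) (e' t) <= C]) ->
  E v0 = param c1 (e 0) -> exists L, lift_on E (fun t => param c1 (e t)) v0 1 L.
Proof.
move=> C0 c1X H E0; pose gm t := param c1 (e t).
have cg (t : R) : 0 <= t <= 1 -> {for t, continuous gm}.
  move=> t01; have [Vt De _] := H t t01.
  have ce : {for t, continuous e} by have [/derivable1_diffP/differentiable_continuous] := De.
  by apply: (comp_cont ce); exact: param_continuous.
have [r2 r20 [K K0 HK]] := gnorm_equiv g cX Vo.
have [_ HKo] := HK (c o) ltac:(by rewrite subrr normr0).
have spd (q : R) L : q <= 1 -> lift_on E gm v0 q L ->
    forall s t : R, 0 <= s -> s <= t -> t <= q -> `|L t - L s| <= K * C * (t - s).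
  move=> q1 [L0 HL] s t s0 st tq.
  have h : gnorm g c (c o) (L t - L s) <= C * t - C * s.
    apply: (@lift_speed c1 e e' L (fun t => C * t) s t st c1X).
    - move=> u /andP[su ut]; have u0 := le_trans s0 su; have uq := le_trans ut tq.
      have [Vu Du _] := H u (introT andP (conj u0 (le_trans uq q1))).
      by have [cu Eu] := HL u (introT andP (conj u0 uq)).
    - by move=> a b _ ab _; rewrite ler_wpM2l.
    - move=> r eps /andP[sr rt] ep; exists 1 => // u _ _.
      have r01 : 0 <= r <= 1 by rewrite (le_trans s0 sr) (le_trans (le_trans rt tq) q1).
      have [_ _ hC] := H r r01.
      rewrite -mulrBr normrM (ger0_norm C0) ler_wpM2r//; lra.
  have [_ h2] := HKo (L t - L s); apply: (le_trans h2).
  by rewrite -mulrA ler_wpM2l ?(ltW K0)// mulrBr.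
suff : forall t : R, 0 <= t -> t <= 1 -> exists L, lift_on E gm v0 t L by apply.
have ext := @lift_extend R n M E expanding_inj expanding_section gm v0.
apply: (real_ind 0 1 (fun t => exists L, lift_on E gm v0 t L)) => //.
- exists (fun=> v0); split=> [//|s /andP[s0 s1]].
  have -> : s = 0 by apply/eqP; rewrite eq_le s0 s1.
  by split; first exact: cst_continuous.
- move=> t t0 t1 Hs; have t01 : 0 <= t <= 1 by rewrite t0 ltW.
  have [L FL] := Hs t t0 (lexx t).
  have [L0 HL] := FL; have [_ EL] := HL t (introT andP (conj t0 (lexx _))).
  have [eta e0 Hx] := ext t (L t) t0 (cg t t01) cg EL.
  exists eta => // s ts se s1.
  apply: (Hx t L _ _ FL) => //; [by rewrite t0 lexx | by rewrite ltrBlDr ltrDl | | exact: ltW].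
  by rewrite subrr normr0.
- move=> t t0 t1 Hs; have t01 : 0 <= t <= 1 by rewrite ltW.
  (* One lift for each time before [t]; by uniqueness they agree, so that [u q] is a single
     Lipschitz curve on all times before [t]. *)
  have /choice[LL HLL] : forall q : R, exists L, 0 <= q -> q < t -> lift_on E gm v0 q L.
    move=> q; have [q0|] := leP 0 q; last by exists (fun=> v0).
    have [qt|] := ltP q t; last by exists (fun=> v0).
    by have [L FL] := Hs q q0 qt; exists L.
  pose u q := LL q q.
  have uL (q p : R) : 0 <= q -> q <= p -> p < t -> LL p q = u q.
    move=> q0 qp pt; have qt := le_lt_trans qp pt.
    apply: (lift_on_uniq expanding_inj q0 (lift_on_le qp (HLL p (le_trans q0 qp) pt)) (HLL q q0 qt)).
    by rewrite q0 lexx.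
  have uLip (q p : R) : 0 <= q -> q <= p -> p < t -> `|u p - u q| <= K * C * (p - q).
    move=> q0 qp pt; rewrite -(uL q p q0 qp pt).
    by apply: (spd p (LL p) (le_trans (ltW pt) t1) (HLL p (le_trans q0 qp) pt)).
  have Eu (q : R) : 0 <= q -> q < t -> E (u q) = gm q.
    move=> q0 qt; have [_ h] := HLL q q0 qt.
    by have [_ ->] := h q (introT andP (conj q0 (lexx _))).
  pose q (k : nat) : R := t - t * k.+1%:R^-1.
  have k1 (k : nat) : 0 < (k.+1%:R^-1 : R) <= 1 by rewrite invr_gt0 ltr0n/= invf_le1 ?ltr0n// ler1n.
  have q0 k : 0 <= q k.
    by have /andP[_ h] := k1 k; rewrite subr_ge0 -[leRHS]mulr1 ler_wpM2l// ltW.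
  have qt k : q k < t by have /andP[h _] := k1 k; rewrite gtrBl mulr_gt0.
  have [F [UF FF]] := ultraFilterLemma (F := \oo%classic : set_system nat) _.
  have FF0 : ProperFilter F by exact: ultra_proper.
  have cq : q @ F --> t.
    have cq' : q @ \oo --> t - t * 0.
      by apply: cvgB; [exact: cvg_cst | apply: cvgM; [exact: cvg_cst | exact: cvg_harmonic]].
    by rewrite mulr0 subr0 in cq'; move=> A hA; exact: FF (cq' A hA).
  have KC0 : 0 <= K * C by rewrite mulr_ge0// ltW.
  have [w [cw _]] : exists w, (fun k => u (q k)) @ F --> w /\ `|w| <= `|v0| + K * C * t.
    apply: row_ultra_cvg; apply: nearW => k.
    have h := uLip 0 (q k) (lexx 0) (q0 k) (qt k).
    have u0 : u 0 = v0 by rewrite /u; have [-> _] := HLL 0 (lexx 0) t0.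
    rewrite u0 in h.
    have : `|u (q k)| <= `|v0| + `|u (q k) - v0|.
      by apply: le_trans (ler_normD _ _); rewrite addrC subrK.
    have : K * C * (q k - 0) <= K * C * t by rewrite ler_wpM2l// subr0 ltW.
    lra.
  have Ew : E w = gm t.
    have c1' : (fun k => E (u (q k))) @ F --> E w by apply: (cvg_comp _ _ cw); exact: expanding_cont.
    have c2' : (fun k => gm (q k)) @ F --> gm t by apply: (cvg_comp _ _ cq); exact: cg.
    have EE : (fun k => E (u (q k))) = (fun k => gm (q k)) by apply/funext => k; exact: Eu.
    rewrite EE in c1'.
    exact: (cvg_unique (manifold_hausdorff X) c1' c2').
  have [eta e0 Hx] := ext t w (ltW t0) (cg t t01) cg Ew.
  have n1 : \forall k \near F, `|q k - t| < eta by exact: (cvg_near_dist _ _ _ cq e0).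
  have n2 : \forall k \near F, `|u (q k) - w| < eta by exact: (cvg_near_dist _ _ _ cw e0).
  have [k [h1 h2]] := filter_ex (filterI n1 n2).
  apply: (Hx (q k) (LL (q k)) _ _ (HLL _ (q0 k) (qt k)) h2) => //.
  + by rewrite q0 ltW.
  + by move: h1; rewrite ltr0_norm ?subr_lt0// opprB ltrBlDr -ltrBlDl.
  + exact: ltW.
  + by rewrite ltrDl.
Qed.

(** The section over a coordinate ball is obtained by lifting the segments that issue from [E v].
    These lift whatever the point [v] of the fibre, so the ball does not depend on [v]; continuity
    in the end point comes from [family_lift]. *)
Lemma expanding_cover (x : M) : exists2 U : set M, nbhs x U & forall v, U (E v) ->
  exists sg : M -> 'rV[R]_n, sg (E v) = v /\ forall y, U y -> E (sg y) = y /\ {for y, continuous sg}.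
Proof.
have [c1 c1X dx] := atlas_cover X x.
have Vx : cdom c1 (c1 x) by exists x.
have [r r0 [K K0 HK]] := gnorm_equiv g c1X Vx.
have cc y : dom c1 y -> {for y, continuous c1} by exact: coor_continuous.
exists [set y | dom c1 y /\ `|c1 y - c1 x| < r].
  apply: filterI; first by apply: open_nbhs_nbhs; split => //; exact: open_dom.
  exact: (cvg_near_dist (FF := nbhs_filter x) _ _ _ (cc x dx) r0).
move=> v [dv vr]; pose a := c1 (E v).
pose e (p : 'rV[R]_n) (t : R) := a + t *: (p - a).
have conv (p : 'rV[R]_n) (t : R) : `|p - c1 x| < r -> 0 <= t <= 1 -> `|e p t - c1 x| < r.
  move=> pr /andP[t0 t1].
  have -> : e p t - c1 x = (1 - t) *: (a - c1 x) + t *: (p - c1 x).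
    rewrite /e !scalerBr !scalerBl !scale1r.
    by apply/rowP => i; rewrite !mxE; ring.
  apply: le_lt_trans (ler_normD _ _) _; rewrite !normrZ !ger0_norm ?subr_ge0//.
  have [->|tn] := eqVneq t 0; first by rewrite subr0 mul1r mul0r addr0.
  have tp : 0 < t by rewrite lt_neqAle eq_sym tn.
  have h1 : t * `|p - c1 x| < t * r by rewrite ltr_pM2l.
  have h2 : (1 - t) * `|a - c1 x| <= (1 - t) * r by rewrite ler_wpM2l ?subr_ge0// ltW.
  lra.
have /choice[L HL] : forall p : 'rV[R]_n, exists L, `|p - c1 x| < r ->
    lift_on E (fun t => param c1 (e p t)) v 1 L.
  move=> p; have [pr|] := ltP `|p - c1 x| r; last by exists (fun=> 0).
  have C0 : 0 <= K * `|p - a| by rewrite mulr_ge0// ltW.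
  have [||L HL] := @arc_lift c1 (e p) (fun=> p - a) v (K * `|p - a|) C0 c1X.
  - move=> t t01; have er := conv p t pr t01; have [Vt h] := HK _ er.
    split => //; last by have [] := h (p - a).
    exact: line_derive.
  - by rewrite /e scale0r addr0 coorK.
  - by exists L.
exists (fun y => L (c1 y) 1); split.
  have h := HL a vr; have one : 0 <= (1 : R) <= 1 by rewrite ler01 lexx.
  apply: (lift_on_uniq (L' := fun=> v) expanding_inj ler01 h _ one).
  split=> [//|s _]; split; first exact: cst_continuous.
  by rewrite /e subrr scaler0 addr0 coorK.
move=> y [dy yr]; have one : 0 <= (1 : R) <= 1 by rewrite ler01 lexx.
have [L0 HLy] := HL (c1 y) yr; split.
  have [_ ->] := HLy 1 one.
  by rewrite /e scale1r addrC subrK coorK.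
pose H (t : R) (p : 'rV[R]_n) := param c1 (e p t).
have np : \forall p \near c1 y, `|p - c1 x| < r.
  have y0 : 0 < r - `|c1 y - c1 x| by rewrite subr_gt0.
  apply/nbhs_ballP; exists (r - `|c1 y - c1 x|) => // p; rewrite -ball_normE /= distrC => h.
  have : `|p - c1 x| <= `|p - c1 y| + `|c1 y - c1 x|.
    by apply: le_trans (ler_normD _ _); rewrite addrA subrK.
  lra.
have Hc : \forall p \near c1 y, forall t : R, 0 <= t <= 1 ->
    {for (t, p), continuous (fun q : R * 'rV[R]_n => H q.1 q.2)}.
  apply: filterS np => p pr t t01.
  have er := conv p t pr t01; have [Vt _] := HK _ er.
  apply: (@comp_cont _ _ _ (fun q : R * 'rV[R]_n => e q.2 q.1) (param c1) (t, p)); last exact: param_continuous.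
  apply: cvgD; first exact: cvg_cst.
  apply: cvgZ; first exact: cvg_fst.
  by apply: cvgB; [exact: cvg_snd | exact: cvg_cst].
have H0 : \forall p \near c1 y, H 0 p = E v.
  by apply: filterS np => p _; rewrite /H /e scale0r addr0 coorK.
have [A FA] := @family_lift R n M E expanding_inj expanding_section _ H (c1 y) v Hc H0 (L (c1 y)) L0 HLy.
have nL : \forall p \near c1 y, A 1 p = L p 1.
  apply: filterS2 np FA => p pr [A0 HA].
  apply: (lift_on_uniq (L := A ^~ p) expanding_inj ler01 _ (HL p pr) one).
  by split; [exact: A0 | move=> s /HA[h3 hc]; have [hc1 _] := slice_cont hc; split; [exact: hc1 | exact: h3]].
have cA : A 1 @ nbhs (c1 y) --> A 1 (c1 y).
  have [_ HA] := nbhs_singleton FA; have [_ h] := HA 1 one.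
  by have [_] := slice_cont h.
have eA := nbhs_singleton nL.
have cL : (fun p => L p 1) @ nbhs (c1 y) --> L (c1 y) 1.
  rewrite -eA; apply: cvg_trans cA; apply: near_eq_cvg; exact: nL.
exact: (@comp_cont _ _ _ c1 (fun p => L p 1) y (cc y dy) cL).
Qed.

Hypothesis sc : simply_connected R M.

Lemma expanding_bij : (forall v1 v2, E v1 = E v2 -> v1 = v2) /\ forall x, exists v, E v = x.
Proof.
split.
  move=> v1 v2; exact: (@covering_inj R n M E expanding_cont expanding_inj expanding_section expanding_cover sc v1 v2).
exact: (covering_surj expanding_cover sc).
Qed.

End ExpandingMap.

(** * Distance and logarithm *)

Section WithinCvg.
Context {S W : topologicalType}.

Lemma within_cvg (A : set S) (f : S -> W) x : {within A, continuous f} -> A x ->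
  f @ within A (nbhs x) --> f x.
Proof. by move=> cf Ax; rewrite (nbhs_subspace_in Ax); exact: cf. Qed.

Lemma cvg_within_cont (A : set S) (f : S -> W) :
  (forall x, A x -> f @ within A (nbhs x) --> f x) -> {within A, continuous f}.
Proof.
move=> H x U nU; have [Ax|nAx] := pselect (A x).
  exact: (eq_ind _ (fun F : set_system S => F (f @^-1` U)) (H x Ax U nU) _ (nbhs_subspace_in Ax)).
apply: (eq_ind _ (fun F : set_system S => F (f @^-1` U)) _ _ (nbhs_subspace_out nAx)) => y ->.
exact: nbhs_singleton nU.
Qed.

End WithinCvg.

(** * Arc length as a primitive of the speed *)

Section UnitIntegral.
Context {R : realType}.
Variable f : R -> R.
Hypothesis cf : {within `[0, 1], continuous f}.
Let mu := @lebesgue_measure R.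

Definition prim (t : R) : R := \int[mu]_(s in `[0, t]) f s.

Lemma prim_diff s t : 0 <= s -> s <= t -> t <= 1 ->
  prim t - prim s = \int[mu]_(u in `[s, t]) f u.
Proof.
move=> s0 st t1; rewrite /prim.
have I (a b : R) : 0 <= a -> b <= 1 -> mu.-integrable `[a, b] (EFin \o f).
  move=> a0 b1; have cfab : {within `[a, b], continuous f}.
    apply: continuous_subspaceW cf => x /=; rewrite !in_itv/= => /andP[x0 x1].
    by rewrite (le_trans a0 x0) (le_trans x1 b1).
  exact: (continuous_compact_integrable (@segment_compact _ a b) cfab).
rewrite Rintegral_itvB ?bnd_simp//; last exact: I.
rewrite Rintegral_itv_obnd_cbnd//.
apply: integrableS (I s t s0 t1) => //.
by apply: subset_itvr; rewrite bnd_simp.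
Qed.

Lemma prim_ge (m : R) s t : 0 <= s -> s <= t -> t <= 1 ->
  (forall u, s <= u <= t -> m <= f u) -> m * (t - s) <= prim t - prim s.
Proof.
move=> s0 st t1 H; rewrite prim_diff//.
have I : mu.-integrable `[s, t] (EFin \o f).
  apply: (continuous_compact_integrable (@segment_compact _ s t)).
  apply: continuous_subspaceW cf => x /=; rewrite !in_itv/= => /andP[x0 x1].
  by rewrite (le_trans s0 x0) (le_trans x1 t1).
have Ic : mu.-integrable `[s, t] (EFin \o (fun=> m)).
  by apply: (continuous_compact_integrable (@segment_compact _ s t)); exact: cst_continuous.
have <- : \int[mu]_(u in `[s, t]) m = m * (t - s).
  rewrite Rintegral_cst//= lebesgue_measure_itv /= lte_fin.
  by have [->|n] := eqVneq s t; [rewrite ltxx subrr | rewrite lt_neqAle n st].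
by apply: le_Rintegral => // x /=; rewrite in_itv /= => /H.
Qed.

Lemma prim_le (m : R) s t : 0 <= s -> s <= t -> t <= 1 ->
  (forall u, s <= u <= t -> f u <= m) -> prim t - prim s <= m * (t - s).
Proof.
move=> s0 st t1 H; rewrite prim_diff//.
have I : mu.-integrable `[s, t] (EFin \o f).
  apply: (continuous_compact_integrable (@segment_compact _ s t)).
  apply: continuous_subspaceW cf => x /=; rewrite !in_itv/= => /andP[x0 x1].
  by rewrite (le_trans s0 x0) (le_trans x1 t1).
have Ic : mu.-integrable `[s, t] (EFin \o (fun=> m)).
  by apply: (continuous_compact_integrable (@segment_compact _ s t)); exact: cst_continuous.
have <- : \int[mu]_(u in `[s, t]) m = m * (t - s).
  rewrite Rintegral_cst//= lebesgue_measure_itv /= lte_fin.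
  by have [->|n] := eqVneq s t; [rewrite ltxx subrr | rewrite lt_neqAle n st].
by apply: le_Rintegral => // x /=; rewrite in_itv /= => /H.
Qed.

Lemma prim0 : prim 0 = 0.
Proof. by rewrite /prim set_itv1 Rintegral_set1. Qed.

Lemma within_close (r eps : R) : 0 <= r <= 1 -> 0 < eps ->
  exists2 d : R, 0 < d & forall u, 0 <= u <= 1 -> `|u - r| < d -> `|f u - f r| < eps.
Proof.
move=> r01 e0.
have c1 : f @ within `[0, 1] (nbhs r) --> f r.
  by apply: within_cvg => //=; rewrite in_itv.
have FF : Filter (within `[0, 1] (nbhs r)) by exact: within_filter.
have h : within `[0, 1] (nbhs r) [set u | `|f u - f r| < eps] by exact: (cvg_near_dist _ _ _ c1 e0).
move/nbhs_ballP : h => [d d0 Hd]; exists d => // u u01 ur.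
by apply: Hd; [rewrite -ball_normE /= distrC | rewrite /= in_itv].
Qed.

End UnitIntegral.

Section CurveSpeed.
Context {R : realType} {n : nat} {M : ptopologicalType} {X : manifold R n M}.
Variable g : riemannian_metric X.
Variables (c1 : chart R n M) (e : R -> 'rV[R]_n).
Hypothesis c1X : atlas X c1.
Hypothesis He : forall t, t \in `[0, 1] -> cdom c1 (e t) /\ derivable e t 1.
Hypothesis ce' : {within `[0, 1], continuous (derive1 e)}.

Lemma speed_cont : {within `[0, 1], continuous (fun t => gnorm g c1 (e t) (derive1 e t))}.
Proof.
apply: cvg_within_cont => r r01; have [Vr dr] := He r01.
have FF : Filter (within `[0, 1] (nbhs r)) by exact: within_filter.
have ce : e @ within `[0, 1] (nbhs r) --> e r.
  apply: (@cvg_trans _ (e @ nbhs r)); first by apply: cvg_app; exact: cvg_within.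
  by have /derivable1_diffP/differentiable_continuous := dr.
have cd : derive1 e @ within `[0, 1] (nbhs r) --> derive1 e r by exact: within_cvg.
have ci : (fun t => inner g c1 (e t) (derive1 e t) (derive1 e t)) @ within `[0, 1] (nbhs r) -->
    inner g c1 (e r) (derive1 e r) (derive1 e r).
  rewrite innerE (_ : (fun t => _) = fun t => qs (gf g c1) (e t) (derive1 e t) (derive1 e t)).
    by apply: (@cvg_qs _ _ _ _ FF) => // i j; exact: gf_cont.
  by apply/funext => t; rewrite innerE.
by apply: (cvg_comp _ _ ci); exact: sqrt_continuous.
Qed.

Lemma speed_bound : exists2 C : R, 0 <= C & forall t, 0 <= t <= 1 -> gnorm g c1 (e t) (derive1 e t) <= C.
Proof.
have [|s _ Hs] := @compact_EVT_max R R (fun t => gnorm g c1 (e t) (derive1 e t)) `[0, 1] _ (@segment_compact _ 0 1) speed_cont.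
  by exists 0; rewrite /= in_itv /= lexx ler01.
exists (gnorm g c1 (e s) (derive1 e s)); first exact: gnorm_ge0.
by move=> t t01; apply: Hs; rewrite inE /= in_itv.
Qed.

End CurveSpeed.

Lemma dist_arith {R : realFieldType} (D D' mx my p p' q q' e : R) :
  D <= p + mx -> mx <= D' + q' -> D' <= p' + my -> my <= D + q ->
  p < e / 2 /\ p' < e / 2 -> q < e / 2 /\ q' < e / 2 -> `|D - D'| < e.
Proof. by move=> h1 h2 h3 h4 [h5 h6] [h7 h8]; rewrite ltr_norml; apply/andP; split; lra. Qed.

(** * The geodesic distance *)

Section Distance.
Context {R : realType} {n : nat} {M : ptopologicalType} {X : manifold R n M}.
Variable g : riemannian_metric X.
Hypothesis sc : simply_connected R M.
Implicit Types x y z : M.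

Lemma arc_ge0 x y l : C1_arc g x y l -> 0 <= l.
Proof. by move=> [c [e [_ _ _ _ ->]]]; apply: Rintegral_ge0 => t _; exact: sqrtr_ge0. Qed.

Lemma curve_ge0 x y l : curve_length g x y l -> 0 <= l.
Proof. by elim=> // {}x {}y z l1 l2 /arc_ge0 h _ h2; exact: addr_ge0. Qed.

Lemma curve_cat x y z l l' : curve_length g x y l -> curve_length g y z l' ->
  curve_length g x z (l + l').
Proof.
elim=> [{}x|{}x y1 {}y l1 l2 h _ IH] H; first by rewrite add0r.
by rewrite -addrA; apply: curve_cons h (IH H).
Qed.

Lemma curve_arc x y l : C1_arc g x y l -> curve_length g x y l.
Proof. by move=> h; rewrite -[l]addr0; apply: curve_cons h (curve_nil _ _). Qed.

Lemma chart_arc (c1 : chart R n M) (v0 : 'rV[R]_n) : atlas X c1 -> cdom c1 v0 ->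
  exists2 r : R, 0 < r & exists2 K : R, 0 < K &
    (forall p, `|p - v0| < r -> cdom c1 p) /\
    forall p q, `|p - v0| < r -> `|q - v0| < r ->
      exists2 l, curve_length g (param c1 p) (param c1 q) l & l <= K * `|q - p|.
Proof.
move=> c1X Vv0; have [r r0 [K K0 HK]] := gnorm_equiv g c1X Vv0.
exists r => //; exists K => //; split=> [p /HK[]//|p q pr qr].
pose e (t : R) : 'rV[R]_n := p + t *: (q - p).
have De (t : R) : is_derive t (1 : R) e (q - p) by exact: line_derive.
have De1 : derive1 e = (fun=> q - p).
  by apply/funext => t; rewrite derive1E; have [_ ->] := De t.
have conv (t : R) : 0 <= t <= 1 -> `|e t - v0| < r.
  move=> /andP[t0 t1].
  have -> : e t - v0 = (1 - t) *: (p - v0) + t *: (q - v0).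
    by rewrite /e; apply/rowP => i; rewrite !mxE; ring.
  apply: le_lt_trans (ler_normD _ _) _; rewrite !normrZ !ger0_norm ?subr_ge0//.
  have [->|tn] := eqVneq t 0; first by rewrite subr0 mul1r mul0r addr0.
  have tp : 0 < t by rewrite lt_neqAle eq_sym tn.
  have h1 : t * `|q - v0| < t * r by rewrite ltr_pM2l.
  have h2 : (1 - t) * `|p - v0| <= (1 - t) * r by rewrite ler_wpM2l ?subr_ge0// ltW.
  lra.
have He t : t \in `[0, 1] -> cdom c1 (e t) /\ derivable e t 1.
  rewrite in_itv => t01; have [Vt _] := HK _ (conv t t01).
  by have [dt _] := De t.
have ce' : {within `[0, 1], continuous (derive1 e)}.
  by rewrite De1; exact: cst_continuous.
pose f t := gnorm g c1 (e t) (derive1 e t).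
have cf : {within `[0, 1], continuous f} by exact: speed_cont.
exists (prim f 1).
  apply: curve_arc; exists c1, e; split => //.
    by split; rewrite /e ?scale0r ?addr0// scale1r addrC subrK.
have := @prim_le R f cf (K * `|q - p|) 0 1 (lexx _) ler01 (lexx _).
rewrite prim0 !subr0 mulr1; apply => t t01.
have [_ h] := HK _ (conv t t01); rewrite /f De1.
by have [] := h (q - p).
Qed.

(** Stating both directions avoids reversing curves. *)
Lemma curve_near x (eps : R) : 0 < eps -> \forall y \near x,
  (exists2 l, curve_length g x y l & l < eps) /\ (exists2 l, curve_length g y x l & l < eps).
Proof.
move=> e0; have [c1 c1X dx] := atlas_cover X x.
have Vx : cdom c1 (c1 x) by exists x.
have [r r0 [K K0 [HV H]]] := chart_arc c1X Vx.
have cc : {for x, continuous c1} by exact: coor_continuous.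
have nd : \forall y \near x, dom c1 y by apply: open_nbhs_nbhs; split => //; exact: open_dom.
have nr : \forall y \near x, `|c1 y - c1 x| < Num.min r (eps / K).
  by apply: (cvg_near_dist (FF := nbhs_filter x) _ _ _ cc); rewrite lt_min r0 divr_gt0.
apply: filterS2 nd nr => y dy; rewrite lt_min => /andP[yr ye].
have xr : `|c1 x - c1 x| < r by rewrite subrr normr0.
have [l1 h1 e1] := H _ _ xr yr; have [l2 h2 e2] := H _ _ yr xr.
rewrite !coorK// in h1 h2; rewrite ltr_pdivlMr// mulrC in ye.
split; [exists l1 | exists l2] => //; first exact: le_lt_trans ye.
by rewrite distrC in e2; exact: le_lt_trans ye.
Qed.

(** It ensures that the infimum defining the distance is taken over a nonempty set; on the empty set
    [inf] has a default value, and lower bounds could not be transferred. *)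
Lemma curve_ex x y : exists l, curve_length g x y l.
Proof.
have [pth _] := sc; have [gam [cg <- <-]] := pth x y.
apply: (interval_ind 0 1 (fun s t => exists l, curve_length g (gam s) (gam t) l)) => //.
  by move=> s t r _ _ _ _ [l h] [l' h']; exists (l + l'); exact: curve_cat h h'.
move=> t t01; have cgt : gam @ within `[0, 1] (nbhs t) --> gam t.
  by apply: within_cvg => //=; rewrite in_itv.
have := cgt _ (curve_near (gam t) ltr01); move/nbhs_ballP => [d d0 Hd].
exists d => // s s01.
have H : `|s - t| < d -> (exists2 l, curve_length g (gam t) (gam s) l & l < 1) /\
    (exists2 l, curve_length g (gam s) (gam t) l & l < 1).
  by move=> st; apply: (Hd s); [rewrite -ball_normE /= distrC | rewrite /= in_itv].
split=> h1 h2.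
  have [|_ [l h _]] := H; last by exists l.
  by rewrite ler0_norm ?subr_le0// opprB ltrBlDl -ltrBlDr.
have [|[l h _] _] := H; last by exists l.
by rewrite ger0_norm ?subr_ge0// ltrBlDl.
Qed.

Lemma dist_le x y l : curve_length g x y l -> geodesic_dist g x y <= l.
Proof. by move=> h; apply: ge_inf => //; exists 0 => l' /curve_ge0. Qed.

Lemma dist_ge x y (b : R) : (forall l, curve_length g x y l -> b <= l) -> b <= geodesic_dist g x y.
Proof. by move=> H; apply: lb_le_inf => //; have [l] := curve_ex x y; exists l. Qed.

Lemma dist_ge0 x y : 0 <= geodesic_dist g x y.
Proof. by apply: dist_ge => l; exact: curve_ge0. Qed.

Lemma dist_triangle y x z : geodesic_dist g x z <= geodesic_dist g x y + geodesic_dist g y z.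
Proof.
rewrite -lerBlDr; apply: dist_ge => l h; rewrite lerBlDr addrC -lerBlDr.
apply: dist_ge => l' h'; rewrite lerBlDr addrC.
by apply: dist_le; exact: curve_cat h h'.
Qed.

Lemma dist_near x (eps : R) : 0 < eps -> \forall y \near x,
  geodesic_dist g x y < eps /\ geodesic_dist g y x < eps.
Proof.
move=> e0; apply: filterS (curve_near x e0) => y [[l h le] [l' h' le']].
by split; [exact: le_lt_trans (dist_le h) le | exact: le_lt_trans (dist_le h') le'].
Qed.

Lemma dist_cont : continuous (fun p : M * M => geodesic_dist g p.1 p.2).
Proof.
move=> [x y]; apply/cvgrPdist_lt => e e0 /=.
have e2 : 0 < e / 2 by rewrite divr_gt0.
have nx := dist_near x e2; have ny := dist_near y e2.
exists ([set x' | geodesic_dist g x x' < e / 2 /\ geodesic_dist g x' x < e / 2],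
        [set y' | geodesic_dist g y y' < e / 2 /\ geodesic_dist g y' y < e / 2]) => //.
move=> [x' y'] [h1 h2].
have t1 := dist_triangle x' x y; have t2 := dist_triangle y' x' y.
have t3 := dist_triangle x x' y'; have t4 := dist_triangle y x y'.
exact: dist_arith t1 t2 t3 t4 h1 h2.
Qed.

End Distance.

(** * The logarithm does not increase distances *)

Section LogMap.
Context {R : realType} {n : nat} {M : ptopologicalType} {X : manifold R n M}.
Variable g : riemannian_metric X.
Hypothesis gcomp : geodesically_complete g.
Hypothesis sc : simply_connected R M.
Variable c_m : R.
Hypothesis c_m0 : 0 < c_m.
Hypothesis Hsec : sectional_bounds g (- c_m) 0.
Variables (c : chart R n M) (o : M).
Hypothesis cX : atlas X c.
Hypothesis co : dom c o.

Lemma exp_expanding u c1 : atlas X c1 -> dom c1 (exp_map g c o u) ->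
  exists A : 'M[R]_n, (forall w, gnorm g c (c o) w <= gnorm g c1 (c1 (exp_map g c o u)) (w *m A)) /\
    forall e : R, 0 < e -> exists2 d : R, 0 < d & forall v1 v2,
      `|v1 - u| < d -> `|v2 - u| < d ->
      [/\ dom c1 (exp_map g c o v1), dom c1 (exp_map g c o v2) &
       `|c1 (exp_map g c o v2) - c1 (exp_map g c o v1) - (v2 - v1) *m A| <= e * `|v2 - v1|].
Proof.
move=> c1X d1; have [A [HA HS]] := exp_diff gcomp c_m0 Hsec cX co c1X d1.
exists A; split => // w; apply: ler_wsqrtr.
by have /andP[] := HA w.
Qed.

Lemma logK x : exp_map g c o (log_map g c o x) = x.
Proof.
have [_ /(_ x)[v Ev]] := expanding_bij cX co exp_expanding sc.
suff : [set u | exp_map g c o u = x] (log_map g c o x) by [].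
by apply: xgetPex; exists v.
Qed.

Lemma expK u : log_map g c o (exp_map g c o u) = u.
Proof. by have [inj _] := expanding_bij cX co exp_expanding sc; apply: inj; exact: logK. Qed.

Lemma exp_cont : continuous (exp_map g c o).
Proof. exact: (expanding_cont cX co exp_expanding). Qed.

Lemma log_cont : continuous (log_map g c o).
Proof.
move=> x; have [sg [sgx nsg]] := expanding_section cX co exp_expanding (log_map g c o x).
rewrite logK in sgx nsg; have [_ csg] := nbhs_singleton nsg.
have csg' : sg @ nbhs x --> log_map g c o x by rewrite -sgx; exact: csg.
apply: cvg_trans csg'; apply: near_eq_cvg; apply: filterS nsg => y [Ey _].
by rewrite -{2}Ey expK.
Qed.

(** The arc is lifted through the exponential map from the logarithm of [x]; by bijectivity the lift
    ends at the logarithm of [y], and [lift_speed] compares its displacement with the length of the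
    arc. *)
Lemma log_arc x y l : C1_arc g x y l ->
  gnorm g c (c o) (log_map g c o y - log_map g c o x) <= l.
Proof.
move=> [c1 [e [c1X He ce' [xE yE] lE]]].
pose f t := gnorm g c1 (e t) (derive1 e t).
have cf : {within `[0, 1], continuous f} by exact: speed_cont.
have [C C0 HC] := speed_bound g c1X He ce'.
have Hd t : 0 <= t <= 1 -> [/\ cdom c1 (e t), is_derive t (1 : R) e (derive1 e t) & f t <= C].
  move=> t01; have t01' : t \in `[0, 1] by rewrite in_itv.
  have [Vt dt] := He t t01'; split; [exact: Vt | | exact: HC].
  by rewrite derive1E; exact: derivableP.
have E0 : exp_map g c o (log_map g c o x) = param c1 (e 0) by rewrite logK.
have [L [L0 HL]] := arc_lift cX co exp_expanding C0 c1X Hd E0.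
have L1 : L 1 = log_map g c o y.
  have [|_ h] := HL 1; first by rewrite ler01 lexx.
  by rewrite yE -h expK.
rewrite -L0 -L1; have -> : l = prim f 1 - prim f 0 by rewrite prim0 subr0 lE.
apply: (lift_speed cX co exp_expanding ler01 c1X (e := e) (e' := derive1 e)).
- move=> t t01; have [Vt dt _] := Hd t t01; have [cL EL] := HL t t01; split => //.
- move=> s t s0 st t1; have := prim_ge cf s0 st t1 (m := 0) (fun u _ => gnorm_ge0 _ _ _ _).
  by rewrite mul0r subr_ge0.
- move=> r eps r01 ep; have [d d0 Hc] := within_close cf r01 ep.
  exists d => // s s01 sr.
  have /andP[r0 r1] := r01; have /andP[s0 s1] := s01.
  have key (a b : R) : 0 <= a -> a <= b -> b <= 1 -> (forall u, a <= u <= b -> `|u - r| < d) ->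
      (f r - eps) * (b - a) <= `|prim f b - prim f a|.
    move=> a0 ab b1 H; apply: le_trans (ler_norm _); apply: prim_ge => // u /andP[au ub].
    have u01 : 0 <= u <= 1 by rewrite (le_trans a0 au) (le_trans ub b1).
    have := Hc u u01 (H u (introT andP (conj au ub))).
    by rewrite ltr_norml ltrBrDl => /andP[h _]; exact: ltW.
  have [rs|sr'] := leP r s.
    rewrite [X in _ * X]ger0_norm ?subr_ge0//; apply: key => // u /andP[u1 u2].
    by move: sr; rewrite !ger0_norm ?subr_ge0//; lra.
  rewrite [X in _ * X]ltr0_norm ?subr_lt0// opprB [leRHS]distrC; apply: key => //; first exact: ltW.
  move=> u /andP[u1 u2]; move: sr; rewrite [X in X < _ -> _]ltr0_norm ?subr_lt0// ler0_norm ?subr_le0//; lra.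
Qed.

Lemma log_curve x y l : curve_length g x y l ->
  gnorm g c (c o) (log_map g c o y - log_map g c o x) <= l.
Proof.
have Vo : cdom c (c o) by exists o.
elim=> [{}x|{}x {}y z l1 l2 h _ IH]; first by rewrite subrr /gnorm inner0l sqrtr0.
rewrite -[log_map g c o z](subrK (log_map g c o y)) -addrA.
apply: le_trans (gnormD _ _ _ cX Vo) _; rewrite [leRHS]addrC.
by apply: lerD; [exact: IH | exact: log_arc h].
Qed.

Lemma log_dist x y : gnorm g c (c o) (log_map g c o y - log_map g c o x) <= geodesic_dist g x y.
Proof. by apply: (dist_ge sc) => l; exact: log_curve. Qed.

End LogMap.

(** * Volumes in coordinates *)

Section IntegralRV.
Context {R : realType}.

(** The integral of a nonnegative function is a supremum over the simple functions below it, so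
    monotonicity holds for arbitrary integrands; the inner integrals of [integral_rV] can be
    compared without discussing their measurability. *)
Lemma ge0_le_integralT d (T : measurableType d) (mu : {measure set T -> \bar R})
    (f g : T -> \bar R) : (forall x, 0 <= f x)%E -> (forall x, f x <= g x)%E ->
  (\int[mu]_x f x <= \int[mu]_x g x)%E.
Proof.
move=> f0 fg; have g0 x : (0 <= g x)%E by exact: le_trans (fg x).
rewrite !ge0_integralTE//; apply: le_ereal_sup => _ [h hf <-].
by exists h => // x; exact: le_trans (fg x).
Qed.

Lemma integral_rV_ge0 n (f : 'rV[R]_n -> \bar R) : (forall v, 0 <= f v)%E -> (0 <= integral_rV f)%E.
Proof.
elim: n f => [|m IH] f f0 /=; first exact: f0.
by apply: integral_ge0 => t _; exact: IH.
Qed.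

Lemma integral_rV_mono n (f g : 'rV[R]_n -> \bar R) : (forall v, 0 <= f v)%E ->
  (forall v, f v <= g v)%E -> (integral_rV f <= integral_rV g)%E.
Proof.
elim: n f g => [|m IH] f g f0 fg /=; first exact: fg.
apply: ge0_le_integralT => t; first exact: integral_rV_ge0.
exact: IH.
Qed.

Definition qf n (G : 'M[R]_n) (z : 'rV[R]_n) : R := (z *m G *m z^T) 0 0.

Lemma integral_itv_cst (z k r : R) : 0 <= k -> 0 <= r ->
  (\int[@lebesgue_measure R]_t (k * (if `|t - z| <= r then 1 else 0))%:E = (k * (2 * r))%:E)%E.
Proof.
move=> k0 r0; rewrite (_ : (fun t => _) = fun t => (k%:E * (\1_`[z - r, z + r] t)%:E)%E); last first.
  apply/funext => t; rewrite -EFinM indicE mem_setE in_itv /= ler_distl.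
  by case: ifP.
rewrite ge0_integralZl//; last by apply/measurable_EFinP; exact: measurable_indic.
rewrite integral_indic//= setIT lebesgue_measure_itv /= lte_fin EFinM; congr (_ * _)%E.
have [->|rn] := eqVneq r 0; first by rewrite subr0 addr0 ltxx mulr0.
have rp : 0 < r by rewrite lt_neqAle eq_sym rn.
by rewrite ifT; [rewrite -EFinB; congr EFin; ring | lra].
Qed.

Lemma schur m (a : 'M[R]_1) (b : 'rV[R]_m) (D : 'M[R]_m) : D^T = D -> D \in unitmx ->
  let s := a - b *m invmx D *m b^T in
  let P := block_mx 1%:M (b *m invmx D) 0 1%:M in
  block_mx a b b^T D = P *m block_mx s 0 0 D *m P^T.
Proof.
move=> sD uD /=; rewrite tr_block_mx !trmx0 !trmx1 !mulmx_block.
rewrite !mul0mx !mulmx0 !mul1mx !mulmx1 !add0r !addr0.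
have iD : (invmx D)^T = invmx D by rewrite trmx_inv sD.
rewrite !mulmxKV// trmx_mul iD -!mulmxA mulKVmx//.
by rewrite mulmxA subrK.
Qed.

Lemma qf1 (t s : 'M[R]_1) : (t *m s *m t^T) 0 0 = t 0 0 ^+ 2 * s 0 0.
Proof. by rewrite !mxE big_ord1 !mxE big_ord1; ring. Qed.

Lemma qf_block m (a : 'M[R]_1) (b : 'rV[R]_m) (b' : 'cV[R]_m) (D : 'M[R]_m) u :
  qf (block_mx a b b' D) (row_mx 0 u) = qf D u.
Proof.
by rewrite /qf mul_row_block !mul0mx !add0r tr_row_mx mul_row_col trmx0 mulmx0 add0r.
Qed.

Lemma row_mxB m (a : 'M[R]_(1,1)) (b : 'M[R]_(1,m)) (z : 'M[R]_(1,1+m)) :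
  row_mx a b - z = row_mx (a - lsubmx z) (b - rsubmx z).
Proof. by rewrite -{1}[z]hsubmxK opp_row_mx add_row_mx. Qed.

Lemma ellipsoid_volume n (G : 'M[R]_n) : G^T = G -> (forall u : 'rV[R]_n, u != 0 -> 0 < qf G u) ->
  0 < \det G /\ forall (z : 'rV[R]_n) (r k : R), 0 <= r -> 0 <= k ->
  (integral_rV (fun v => (k * (if qf G (v - z) <= r ^+ 2 then 1 else 0))%:E)
    <= (k * ((2 * r) ^+ n / Num.sqrt (\det G)))%:E)%E.
Proof.
elim: n G => [|m IH] G sG pG.
  rewrite det_mx00; split => // z r k r0 k0 /=; rewrite sqrtr1 expr0 divr1 mulr1 lee_fin.
  by case: ifP; rewrite ?mulr1 ?mulr0.
pose a := ulsubmx (G : 'M[R]_(1 + m)); pose b := ursubmx (G : 'M[R]_(1 + m)).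
pose D := drsubmx (G : 'M[R]_(1 + m)).
have GE : (G : 'M[R]_(1 + m)) = block_mx a b b^T D.
  by rewrite /b trmx_ursub (sG : (G : 'M[R]_(1 + m))^T = G) submxK.
have sD : D^T = D by rewrite /D trmx_drsub sG.
have qD u : qf D u = qf G (row_mx (0 : 'rV[R]_1) u).
  by rewrite -(qf_block a b b^T); congr (qf _ (row_mx 0 u)).
have pD (u : 'rV[R]_m) : u != 0 -> 0 < qf D u.
  move=> u0; rewrite qD; apply: pG; apply: contra u0 => /eqP e.
  by rewrite -[u](row_mxKr (0 : 'rV[R]_1)) [row_mx _ _]e linear0.
have [dD ID] := IH D sD pD.
have uD : D \in unitmx by rewrite unitmxE unitfE gt_eqF.
have SE := schur a b sD uD; rewrite /= in SE.
set s := a - _ in SE; set P := block_mx 1%:M _ _ _ in SE.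
pose be := b *m invmx D.
have dG : \det G = s 0 0 * \det D.
  rewrite [\det G](congr1 (fun A : 'M[R]_(1 + m) => \det A) GE) SE !det_mulmx det_tr.
  by rewrite det_ublock !det1 det_ublock det_mx11; ring.
have qG (t : 'rV[R]_1) (v : 'rV[R]_m) : qf G (row_mx t v) = t 0 0 ^+ 2 * s 0 0 + qf D (v + t *m be).
  rewrite /qf (congr1 (fun A : 'M[R]_(1 + m) => (row_mx t v *m A *m (row_mx t v)^T) 0 0) (etrans GE SE)).
  have rP : row_mx t v *m P = row_mx t (v + t *m be).
    by rewrite mul_row_block mulmx1 mulmx0 addr0 mulmx1 addrC.
  rewrite !mulmxA rP -!mulmxA -trmx_mul rP mulmxA mul_row_block !mulmx0 addr0 add0r.
  rewrite tr_row_mx mul_row_col mxE; congr (_ + _); last by rewrite mulmxA.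
  exact: qf1.
have s0 : 0 < s 0 0.
  have := pG (row_mx (1 : 'rV[R]_1) (- (1 *m be))); rewrite qG addNr /qf mul0mx mul0mx.
  rewrite [X in _ -> 0 < _ + X]mxE addr0 [X in _ -> 0 < X ^+ 2 * _]mxE expr1n mul1r; apply.
  apply/eqP => e; have := congr1 (fun A : 'M[R]_(1, 1 + m) => lsubmx A 0 0) e.
  rewrite row_mxKl !mxE => /eqP; rewrite oner_eq0//.
have sq0 : 0 < Num.sqrt (s 0 0) by rewrite sqrtr_gt0.
split; first by rewrite dG mulr_gt0.
move=> z r k r0 k0 /=.
pose z1 := lsubmx (z : 'M[R]_(1, 1 + m)); pose z2 := rsubmx (z : 'M[R]_(1, 1 + m)).
pose c := (2 * r) ^+ m / Num.sqrt (\det D).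
have c0 : 0 <= c by rewrite divr_ge0 ?sqrtr_ge0// exprn_ge0// mulr_ge0.
apply: (@le_trans _ _ (\int[lebesgue_measure]_t
    ((k * c) * (if `|t - z1 0 0| <= r / Num.sqrt (s 0 0) then 1 else 0))%:E)%E); last first.
  have p1 : 0 <= k * c by exact: mulr_ge0.
  have p2 : 0 <= r / Num.sqrt (s 0 0) by rewrite divr_ge0 ?sqrtr_ge0.
  rewrite (integral_itv_cst _ p1 p2) lee_fin.
  rewrite dG sqrtrM ?(ltW s0)// /c exprS invfM.
  by rewrite le_eqVlt; apply/orP; left; apply/eqP; ring.
apply: ge0_le_integralT => t.
  by apply: integral_rV_ge0 => v; rewrite lee_fin mulr_ge0//; case: ifP.
pose t1 : 'rV[R]_1 := const_mx t - z1.
have rowB (v : 'rV[R]_m) : qf G (row_mx (const_mx t : 'rV[R]_1) v - z) =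
    t1 0 0 ^+ 2 * s 0 0 + qf D (v - z2 + t1 *m be).
  by rewrite -qG; congr qf; exact: row_mxB.
have t1E : t1 0 0 = t - z1 0 0 by rewrite !mxE.
have [tr|tr] := boolP (`|t - z1 0 0| <= r / Num.sqrt (s 0 0)).
  rewrite mulr1; apply: le_trans (ID (z2 - t1 *m be) r k r0 k0).
  apply: integral_rV_mono => v.
    by rewrite lee_fin mulr_ge0//; case: ifP.
  rewrite lee_fin ler_wpM2l// rowB opprB addrA addrAC.
  case: ifP => h; last by case: ifP.
  rewrite ifT//.
  by apply: le_trans h; rewrite lerDr mulr_ge0 ?sqr_ge0// ltW.
rewrite mulr0; apply: (@le_trans _ _ (integral_rV (fun v : 'rV[R]_m => 0%E : \bar R))); last first.
  have z0 q : integral_rV (fun v : 'rV[R]_q => 0%E : \bar R) = 0%E.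
    by elim: q => [//|q IHq] /=; under eq_integral do rewrite IHq; rewrite integral0.
  by rewrite z0.
apply: integral_rV_mono => v.
  by rewrite lee_fin mulr_ge0//; case: ifP.
rewrite lee_fin rowB.
case: ifP => h; last by rewrite mulr0.
exfalso; move: tr; rewrite -t1E => /negP; apply.
rewrite -(@ler_pXn2r _ 2)// ?nnegrE ?divr_ge0 ?sqrtr_ge0// real_normK ?num_real//.
rewrite expr_div_n sqr_sqrtr ?(ltW s0)// ler_pdivlMr//.
apply: le_trans h; rewrite lerDl /qf.
have [->|nz] := eqVneq (v - z2 + t1 *m be) 0; first by rewrite !mul0mx mxE.
by rewrite ltW// pD.
Qed.

Lemma row_mx_close m (t : R) (v : 'rV[R]_m) (z : 'M[R]_(1, 1 + m)) (r : R) :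
  `|t - z 0 0| <= r -> (forall j, `|v 0 j - rsubmx z 0 j| <= r) ->
  forall i : 'I_(1 + m), `|row_mx (const_mx t : 'rV[R]_1) v 0 i - z 0 i| <= r.
Proof.
move=> ht Hv i; case: (split_ordP i) => j ->.
  by rewrite row_mxEl mxE (ord1 j) (_ : lshift m 0 = 0)//; exact/val_inj.
by rewrite row_mxEr; have := Hv j; rewrite mxE.
Qed.

Lemma integral_rV_cube n (f : 'rV[R]_n -> \bar R) (z : 'rV[R]_n) (r k : R) : 0 <= r -> 0 <= k ->
  (forall v, 0 <= f v)%E ->
  (forall v : 'rV[R]_n, (forall i, `|v 0 i - z 0 i| <= r) -> (k%:E <= f v)%E) ->
  ((k * (2 * r) ^+ n)%:E <= integral_rV f)%E.
Proof.
move=> r0; elim: n f z k => [|m IH] f z k k0 f0 H /=.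
  by rewrite expr0 mulr1; apply: H => -[].
rewrite exprSr mulrA -(integral_itv_cst (z 0 0))//; last by rewrite mulr_ge0// exprn_ge0// mulr_ge0.
apply: ge0_le_integralT => t.
  by rewrite lee_fin mulr_ge0 ?mulr_ge0 ?exprn_ge0 ?mulr_ge0//; case: ifP.
case: ifP => ht; last by rewrite mulr0; apply: integral_rV_ge0.
rewrite mulr1; apply: (IH _ (rsubmx (z : 'M[R]_(1, 1 + m)))) => // v Hv; apply: H => i.
exact: (@row_mx_close m t v z r).
Qed.

End IntegralRV.

(** * Volume growth *)

Lemma measure_cover d (T : measurableType d) (R : realType) (mu : {measure set T -> \bar R})
    (I : eqType) (s : seq I) (F : I -> set T) (A : set T) (b : R) :
  measurable A -> (forall i, measurable (F i)) -> (forall i, mu (F i) <= b%:E)%E ->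
  A `<=` [set x | exists2 i, i \in s & F i x] -> (mu A <= (b *+ size s)%:E)%E.
Proof.
move=> mA mF bF sA; pose U := \big[setU/set0]_(i <- s) F i.
have mU (r : seq I) : measurable (\big[setU/set0]_(i <- r) F i) by exact: bigsetU_measurable.
have UE (r : seq I) x : (exists2 i, i \in r & F i x) -> (\big[setU/set0]_(i <- r) F i) x.
  elim: r => [[i]|j r IH [i]]; first by rewrite in_nil.
  rewrite in_cons big_cons => /orP[/eqP -> Fx|ir Fx]; first by left.
  by right; apply: IH; exists i.
apply: (@le_trans _ _ (mu U)).
  by apply: le_measure; rewrite ?inE//; [exact: mU | move=> x /sA /UE].
rewrite /U; elim: s {sA U} => [|i r IH]; first by rewrite big_nil measure0.
rewrite big_cons /= mulrS EFinD; apply: le_trans (measureU2 _ _ _) _ => //.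
by apply: leeD; [exact: bF | exact: IH].
Qed.

Definition subcenter {R : realType} {n : nat} (v : 'rV[R]_n) (r : R) (e : {ffun 'I_n -> bool}) : 'rV[R]_n :=
  v + (r / 2) *: \row_i (if e i then 1 else -1).

Lemma half_cube {R : realType} {n : nat} (v w : 'rV[R]_n) (r : R) : `|w - v| <= r ->
  exists e : {ffun 'I_n -> bool}, `|w - subcenter v r e| <= r / 2.
Proof.
move=> wr; have r0 : 0 <= r := le_trans (normr_ge0 _) wr.
exists [ffun i => v 0 i <= w 0 i]; apply: norm_le_coord => [|i]; first by rewrite divr_ge0.
have := le_trans (coord_le_norm (w - v) i) wr; rewrite !mxE ffunE.
case: (leP (v 0 i)) => vw; rewrite !ler_norml => /andP[h1 h2]; apply/andP; split; lra.
Qed.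

Lemma half_cube_center {R : realType} {n : nat} (v : 'rV[R]_n) (r : R) (e : {ffun 'I_n -> bool}) :
  0 <= r -> `|subcenter v r e - v| <= r / 2.
Proof.
move=> r0; rewrite /subcenter addrC addKr; apply: norm_le_coord => [|i]; first by rewrite divr_ge0.
by rewrite !mxE; case: (e i); rewrite ?mulr1 ?mulrN1 ?normrN ger0_norm// divr_ge0.
Qed.

Section NestedCubes.
Context {R : realType} {n : nat}.

Lemma nested_cubes (v : nat -> 'rV[R]_n) (r : R) : 0 <= r ->
  (forall k, `|v k.+1 - v k| <= r / 2 ^+ k.+1) ->
  exists u, forall k, `|u - v k| <= r / 2 ^+ k.
Proof.
move=> r0 Hv; pose q k := r / 2 ^+ k.
have q0 k : 0 <= q k by rewrite divr_ge0// exprn_ge0.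
have qS k : q k = q k.+1 + q k.+1.
  by rewrite /q exprS; field; rewrite expf_neq0 ?pnatr_eq0.
have mono i k j : v k 0 i - q k <= v (k + j)%N 0 i - q (k + j)%N /\
    v (k + j)%N 0 i + q (k + j)%N <= v k 0 i + q k.
  elim: j => [|j [h1 h2]]; first by rewrite addn0.
  have := le_trans (coord_le_norm _ i) (Hv (k + j)%N); rewrite !mxE -/(q _) addnS.
  by have := qS (k + j)%N; rewrite ler_norml => E /andP[h3 h4]; split; lra.
have ub i k m : v k 0 i - q k <= v m 0 i + q m.
  have [h1 _] := mono i k m; have [_ h2] := mono i m k; rewrite addnC in h2.
  by have := q0 (k + m)%N; lra.
exists (\row_i sup [set v k 0 i - q k | k in setT]) => k.
apply: norm_le_coord => [|i]; first exact: q0.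
rewrite !mxE ler_distl; apply/andP; split.
  by apply: ub_le_sup; [exists (v 0%N 0 i + q 0%N) => _ [m _ <-]; exact: ub | exists k].
by apply: ge_sup; [exists (v 0%N 0 i - q 0%N), 0%N | move=> _ [m _ <-]; exact: ub].
Qed.

End NestedCubes.

(** * Volume of cubes in logarithmic coordinates *)

Section VolumeGrowth.
Context {R : realType} {n : nat} {M : ptopologicalType} {X : manifold R n M}.
Variable g : riemannian_metric X.
Variable vol : {sigma_finite_measure set (borel M) -> \bar R}.
Hypothesis gcomp : geodesically_complete g.
Hypothesis sc : simply_connected R M.
Hypothesis Hvol : riemannian_volume g vol.
Variable c_m : R.
Hypothesis c_m0 : 0 < c_m.
Hypothesis Hsec : sectional_bounds g (- c_m) 0.
Variables (c : chart R n M) (o : M).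
Hypothesis cX : atlas X c.
Hypothesis co : dom c o.

Local Notation E := (exp_map g c o).
Local Notation lg := (log_map g c o).

Lemma open_borel (A : set M) : open A -> measurable (A : set (borel M)).
Proof. by move=> oA; exact: sub_sigma_algebra. Qed.

Lemma closed_borel (A : set M) : closed A -> measurable (A : set (borel M)).
Proof.
move=> cA; rewrite -[A]setCK; apply: measurableC; apply: open_borel.
by rewrite openC.
Qed.

Definition logball (v : 'rV[R]_n) (r : R) : set (borel M) := [set x | `|lg x - v| <= r].

Lemma logball_measurable v r : measurable (logball v r).
Proof.
apply: closed_borel; rewrite (_ : logball v r = (fun x => `|lg x - v|) @^-1` [set t | t <= r])//.
apply: (closed_comp (fun=> _)); last exact: closed_le.
move=> x _; apply: continuous_comp; last exact: norm_continuous.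
by apply: cvgB; [exact: (log_cont gcomp sc c_m0 Hsec cX co) | exact: cvg_cst].
Qed.

(** Around [u0] the strict differential of the exponential map sends a small cube into an ellipsoid
    of the metric frozen at the image of [u0]. The constant depends on [u0] only through the
    dilatation bound of the Jacobi fields. *)
Lemma logball_local : exists2 K : R, 0 < K & forall u0, exists2 d : R, 0 < d &
  forall v s, 0 <= s -> s < d -> `|v - u0| < d ->
    (vol (logball v s) <= (2 * (K * expR (K * `|u0|) * s) ^+ n)%:E)%E.
Proof.
have Vo : cdom c (c o) by exists o.
have [ro ro0 [Ko Ko0 HKo]] := gnorm_equiv g cX Vo.
have gn w : gnorm g c (c o) w <= Ko * `|w|.
  by have [|_ /(_ w)[]] := HKo (c o); rewrite // subrr normr0.
pose kp := Num.sqrt c_m * Ko.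
have kp0 : 0 <= kp by rewrite mulr_ge0 ?sqrtr_ge0// ltW.
(* The square root of the factor in [exp_diff], together with the constant [Ko] that compares the
   metric at [o] with the maximum norm. *)
pose Lam (u : 'rV[R]_n) := Ko * expR (2 * (kp * `|u| + 1)).
(* Both terms are read off from 4 Lam(u0) = 4 Ko e^2 e^(2 kp |u0|). *)
exists (4 * Ko * expR 2 + 2 * kp).
  by apply: ltr_pwDl; [apply: mulr_gt0; [exact: mulr_gt0 | exact: expR_gt0] | rewrite mulr_ge0].
move=> u0; have Lam0 : 0 < Lam u0 by rewrite mulr_gt0 ?expR_gt0.
have [c1 c1X d1] := atlas_cover X (E u0); set p0 := c1 (E u0).
have V1 : cdom c1 p0 by exists (E u0).
have [A [HA HS]] := exp_diff gcomp c_m0 Hsec cX co c1X d1.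
have [r1 r10 [K1 K10 HK1]] := gnorm_equiv g c1X V1.
have gA w : gnorm g c1 p0 (w *m A) <= Lam u0 * `|w|.
  have /andP[_ h] := HA w; have h' := ler_wsqrtr h.
  apply: (le_trans h'); rewrite sqrtrM ?expR_ge0// /Lam mulrC -mulrA [X in _ <= _ * X]mulrC mulrA.
  apply: ler_pM; rewrite ?sqrtr_ge0//; first exact: gn.
  rewrite -[leRHS](@ger0_norm _ (expR _)) ?expR_ge0// -sqrtr_sqr; apply: ler_wsqrtr.
  rewrite expr2 -expRD ler_expR -mulrDl -[in leRHS]natrD ler_pM2l ?ltr0n// lerD2r.
  rewrite sqrtrM ?(ltW c_m0)// /kp -mulrA ler_wpM2l ?sqrtr_ge0//.
  exact: gn.
have e0 : 0 < Lam u0 / K1 by rewrite divr_gt0.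
have [d d0 Hd] := HS _ e0.
have G0 : (gram g c1 p0)^T = gram g c1 p0 by exact: gram_sym.
have P0 u : u != 0 -> 0 < qf (gram g c1 p0) u by exact: gram_pos.
have [D0 EV] := ellipsoid_volume G0 P0.
pose sd v := Num.sqrt (\det (gram g c1 v)).
have csd : {for p0, continuous sd}.
  apply: (comp_cont (f := fun v => \det (gram g c1 v)) (h := Num.sqrt)); last exact: sqrt_continuous.
  have H : C1 (cdom c1) (fun v => \det (gram g c1 v)).
    by apply: C1_det => i j; have [] := gf_C2 g c1X i j.
  exact: C1_cont H V1.
have sd0 : 0 < sd p0 by rewrite sqrtr_gt0.
have cE : {for u0, continuous (fun w => sd (c1 (E w)))}.
  apply: (comp_cont (f := fun w => c1 (E w))); last exact: csd.
  apply: comp_cont; last exact: coor_continuous.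
  have ce : continuous E by exact: (exp_cont gcomp c_m0 Hsec cX co).
  exact: ce.
have : \forall w \near u0, sd (c1 (E w)) < 2 * sd p0.
  apply: (near_comp (Q := fun t => t < 2 * sd p0) cE).
  by apply: open_nbhs_nbhs; split; [exact: open_lt | rewrite /= ltr_pMl// ltr1n].
move=> /nbhs_ballP[d2 /= d20 Hd2].
pose m := Num.min d d2.
have m0 : 0 < m by rewrite lt_min d0.
exists (m / 2); first by rewrite divr_gt0.
move=> v s s0 sm vm.
have near_u w : `|w - v| <= s -> `|w - u0| < d /\ `|w - u0| < d2.
  move=> ws; suff : `|w - u0| < m by rewrite lt_min => /andP.
  by apply: le_lt_trans (ler_distD v _ _) _; lra.
have nv : `|v - u0| < d by have [] := near_u v; rewrite // subrr normr0.
have domB w : `|w - v| <= s -> dom c1 (E w).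
  by move=> ws; have [h _] := near_u w ws; have [] := Hd w w h h.
have p1 : 0 <= 2 * Lam u0 * s.
  by apply: mulr_ge0 => //; apply: mulr_ge0 => //; exact: ltW.
have mB := logball_measurable v s.
have sB : logball v s `<=` dom c1 by move=> x /domB; rewrite (logK gcomp sc c_m0 Hsec cX co).
rewrite (Hvol c1X mB sB).
(* The radius is [2 * Lam u0 * s]: one half for the linear image of the cube, the other for the
   error of strict differentiability. The factor 2 in front allows for the variation of the volume
   density. *)
apply: (@le_trans _ _ (integral_rV (fun z => (2 * sd p0 *
    (if qf (gram g c1 p0) (z - c1 (E v)) <= (2 * Lam u0 * s) ^+ 2 then 1 else 0))%:E))).
  apply: integral_rV_mono => z; first by rewrite lee_fin mulr_ge0// sqrtr_ge0.
  rewrite indicE; case: (boolP (z \in _)) => [|_]; last first.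
    by rewrite mul0r lee_fin; case: ifP => _; rewrite ?mulr1 ?mulr0// mulr_ge0// ltW.
  rewrite inE => -[x Bx zE]; rewrite mul1r lee_fin.
  have [n1 n2] := near_u _ Bx; have xE : E (lg x) = x := logK gcomp sc c_m0 Hsec cX co x.
  rewrite ifT; last first.
    have [_ _ Hs] := Hd v (lg x) nv n1; rewrite xE zE in Hs.
    rewrite -[qf _ _]/(inner g c1 p0 (z - c1 (E v)) (z - c1 (E v))) -gnorm_sqr//.
    apply: lerXn2r; rewrite ?nnegrE ?gnorm_ge0//.
    rewrite -[z - _](subrK ((lg x - v) *m A)); apply: le_trans (gnormD _ _ _ c1X V1) _.
    have hA := le_trans (gA (lg x - v)) (ler_wpM2l (ltW Lam0) Bx).
    have [|_ /(_ (z - c1 (E v) - (lg x - v) *m A))[hB _]] := HK1 p0; first by rewrite subrr normr0.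
    have hC := le_trans hB (ler_wpM2l (ltW K10) Hs).
    rewrite mulrA [K1 * _]mulrC divfK ?gt_eqF// in hC.
    have hD := le_trans hC (ler_wpM2l (ltW Lam0) Bx).
    by rewrite -mulrA mulr_natl mulr2n; exact: lerD.
  by rewrite mulr1 -zE -xE ltW//; apply: Hd2; rewrite -ball_normE /= distrC.
have p2 : 0 <= 2 * sd p0 by rewrite mulr_ge0 ?ltW.
apply: (le_trans (EV (c1 (E v)) _ _ p1 p2)).
rewrite lee_fin -/(sd p0) -[2 * sd p0 * _]mulrA ler_wpM2l// mulrC divfK ?gt_eqF//.
have p3 : 0 <= 4 * Ko * expR 2 + 2 * kp.
  apply: addr_ge0; last exact: mulr_ge0.
  by apply: mulr_ge0; [apply: mulr_ge0 => //; exact: ltW | exact: expR_ge0].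
apply: lerXn2r; rewrite ?nnegrE; first exact: mulr_ge0.
  by apply: mulr_ge0 => //; apply: mulr_ge0 => //; exact: expR_ge0.
rewrite mulrA ler_wpM2r// /Lam mulrDr mulr1 expRD.
have e1 : expR (2 * (kp * `|u0|)) <= expR ((4 * Ko * expR 2 + 2 * kp) * `|u0|).
  rewrite ler_expR mulrA ler_wpM2r// lerDr !mulr_ge0 ?expR_ge0//; exact: ltW.
apply: (@le_trans _ _ (4 * Ko * expR 2 * expR (2 * (kp * `|u0|)))).
  by rewrite le_eqVlt; apply/orP; left; apply/eqP; ring.
apply: ler_pM; rewrite ?mulr_ge0 ?expR_ge0 ?(ltW Ko0)//.
by rewrite lerDl mulr_ge0.
Qed.

(** By bisection. If the bound with the fixed constant [be] fails on a cube, it fails on one of its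
    2^n halves, since their bounds add up to that of the cube. The nested bad cubes shrink to a
    point [u] with |u| <= |v| + r, where [logball_local] contradicts them. *)
Lemma logball_growth : exists2 K : R, 0 < K & forall v r, 0 <= r ->
  (vol (logball v r) <= (2 * (K * expR (K * (`|v| + r)) * r) ^+ n)%:E)%E.
Proof.
have [K K0 HK] := logball_local; exists K => // v r.
rewrite le_eqVlt => /orP[/eqP <-|r0].
  have [d d0 Hd] := HK v; have := Hd v 0 (lexx _) d0; rewrite subrr normr0 mulr0 => /(_ d0) h.
  by rewrite mulr0.
pose be := 2 * (K * expR (K * (`|v| + r))) ^+ n.
have -> : 2 * (K * expR (K * (`|v| + r)) * r) ^+ n = be * r ^+ n by rewrite exprMn mulrA.
have be0 : 0 <= be by rewrite mulr_ge0// exprn_ge0// mulr_ge0 ?expR_ge0// ltW.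
rewrite leNgt; apply/negP => bad.
pose Bad (p : 'rV[R]_n * R) := ((be * p.2 ^+ n)%:E < vol (logball p.1 p.2))%E : Prop.
have step : forall p : 'rV[R]_n * R, exists w, 0 < p.2 -> `|w - p.1| <= p.2 / 2 /\ (Bad p -> Bad (w, p.2 / 2)).
  move=> [w s]; have [s0|s0] := ltP 0 s; last by exists w.
  have [nB|B] := pselect (Bad (w, s)); last first.
    by exists w => _; split => //; rewrite subrr normr0 divr_ge0// ltW.
  apply: contrapT => H; move: nB; rewrite /Bad /= ltNge => /negP; apply.
  have h2 (e : {ffun 'I_n -> bool}) : (vol (logball (subcenter w s e) (s / 2)) <=
      (be * (s / 2) ^+ n)%:E)%E.
    rewrite leNgt; apply/negP => hB; apply: H.
    exists (subcenter w s e) => _; split; last by move=> _.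
    by apply: half_cube_center; exact: ltW.
  apply: (le_trans (measure_cover (s := enum {ffun 'I_n -> bool}) (logball_measurable _ _)
     (fun e => logball_measurable _ _) h2 _)).
    by move=> x /half_cube[e He]; exists e => //; rewrite mem_enum.
  rewrite -cardE card_ffun card_bool card_ord lee_fin.
  rewrite -[leLHS]mulr_natr natrX -mulrA -exprMn mulfVK ?pnatr_eq0//.
have /choice[f Hf] := step.
pose q := fix q k : 'rV[R]_n * R := if k is k'.+1 then (f (q k'), (q k').2 / 2) else (v, r).
have qr k : (q k).2 = r / 2 ^+ k.
  by elim: k => [|k IH] /=; rewrite ?expr0 ?divr1// IH exprSr invfM mulrA.
have q0 k : 0 < (q k).2 by rewrite qr divr_gt0// exprn_gt0.
have qB k : Bad (q k) by elim: k => [//|k IH] /=; have [_] := Hf (q k) (q0 k); exact.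
have [|k|u Hu] := nested_cubes (v := fun k => (q k).1) (r := r); first exact: ltW.
  by have [h _] := Hf (q k) (q0 k); rewrite -qr.
have [d d0 Hd] := HK u.
have [k kd] : exists k, r / 2 ^+ k < d.
  have := @cvg_geometric R r 2^-1; rewrite ger0_norm// invf_lt1// ltr1n => /(_ isT).
  move=> /cvgrPdist_lt /(_ _ d0)[k _ /(_ k (leqnn k))] /=.
  by rewrite sub0r normrN /geometric /= exprVn ger0_norm; [exists k | rewrite divr_ge0 ?exprn_ge0// ltW].
have sd0 : 0 <= (q k).2 by exact: ltW.
have : (vol (logball (q k).1 (q k).2) <= (2 * (K * expR (K * `|u|) * (q k).2) ^+ n)%:E)%E.
  by apply: Hd => //; [rewrite qr | rewrite distrC; apply: le_lt_trans (Hu k) kd].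
apply/negP; rewrite -ltNge; apply: le_lt_trans (qB k).
rewrite lee_fin exprMn mulrA ler_wpM2r ?exprn_ge0// /be ler_wpM2l//.
rewrite lerXn2r ?nnegrE ?mulr_ge0 ?expR_ge0 ?(ltW K0)//.
rewrite ler_wpM2l ?(ltW K0)// ler_expR ler_wpM2l ?(ltW K0)//.
have := Hu 0%N; rewrite /= expr0 divr1 => h.
by rewrite -[u](subrK v) addrC; apply: le_trans (ler_normD _ _) _; rewrite lerD2l.
Qed.

End VolumeGrowth.

(** * Ultralimits of densities *)

Section RealIntegral.
Context d (S : measurableType d) (R : realType) (m : {measure set S -> \bar R}).
Implicit Types F G : S -> R.

Definition itg F := m.-integrable setT (EFin \o F).
Definition ri F : R := \int[m]_x F x.

Lemma itg_meas F : itg F -> measurable_fun setT F.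
Proof. by move=> /measurable_int/measurable_EFinP. Qed.

Lemma riE F : itg F -> (\int[m]_x (F x)%:E = (ri F)%:E)%E.
Proof. by move=> iF; rewrite /ri /Rintegral fineK//; exact: integrable_fin_num. Qed.

Lemma itg_fin F : measurable_fun setT F -> (forall x, 0 <= F x) ->
  (\int[m]_x (F x)%:E < +oo)%E -> itg F.
Proof.
move=> mF F0 fF; apply/integrableP; split; first exact/measurable_EFinP.
by under eq_integral do rewrite /= ger0_norm//.
Qed.

Lemma itg_dom F G : measurable_fun setT F -> itg G -> (forall x, `|F x| <= G x) -> itg F.
Proof.
move=> mF iG FG; apply: (le_integrable _ _ _ iG) => //; first exact/measurable_EFinP.
by move=> x _ /=; rewrite lee_fin (le_trans (FG x))// ler_norm.
Qed.

Lemma itgD F G : itg F -> itg G -> itg (fun x => F x + G x).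
Proof. by move=> iF iG; exact: (integrableD measurableT iF iG). Qed.

Lemma itgZ k F : itg F -> itg (fun x => k * F x).
Proof. by move=> iF; exact: (integrableZl measurableT k iF). Qed.

Lemma itgN F : itg F -> itg (fun x => - F x).
Proof. by move=> iF; exact: (integrableN iF). Qed.

Lemma itgB F G : itg F -> itg G -> itg (fun x => F x - G x).
Proof. by move=> iF iG; apply: itgD => //; exact: itgN. Qed.

Lemma itg0 : itg (fun=> 0).
Proof. exact: (integrable0 m setT). Qed.

Lemma itg_sum (I : Type) (s : seq I) (F : I -> S -> R) : (forall i, itg (F i)) ->
  itg (fun x => \sum_(i <- s) F i x).
Proof.
move=> iF; elim: s => [|i s IH].
  by under [X in itg X]eq_fun do rewrite big_nil; exact: itg0.
by under [X in itg X]eq_fun do rewrite big_cons; exact: itgD.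
Qed.

Lemma itg_bM (k : R) F G : measurable_fun setT F -> (forall x, `|F x| <= k) -> itg G ->
  itg (fun x => F x * G x).
Proof.
move=> mF Fk iG; apply: (@itg_dom _ (fun x => k * `|G x|)).
- by apply: measurable_funM => //; exact: itg_meas.
- by apply: itgZ; exact: integrable_norm.
- by move=> x; rewrite normrM ler_wpM2r.
Qed.

Lemma riD F G : itg F -> itg G -> ri (fun x => F x + G x) = ri F + ri G.
Proof. by move=> iF iG; rewrite /ri RintegralD. Qed.

Lemma riB F G : itg F -> itg G -> ri (fun x => F x - G x) = ri F - ri G.
Proof. by move=> iF iG; rewrite /ri RintegralB. Qed.

Lemma riZ k F : itg F -> ri (fun x => k * F x) = k * ri F.
Proof. by move=> iF; rewrite /ri RintegralZl. Qed.

Lemma ri0 : ri (fun=> 0) = 0.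
Proof. by rewrite /ri /Rintegral integral0. Qed.

Lemma ri_sum (I : Type) (s : seq I) (F : I -> S -> R) : (forall i, itg (F i)) ->
  ri (fun x => \sum_(i <- s) F i x) = \sum_(i <- s) ri (F i).
Proof.
move=> iF; elim: s => [|i s IH].
  by rewrite big_nil; under [X in ri X]eq_fun do rewrite big_nil; exact: ri0.
rewrite big_cons; under [X in ri X]eq_fun do rewrite big_cons.
by rewrite riD ?IH//; exact: itg_sum.
Qed.

Lemma ri_le F G : itg F -> itg G -> (forall x, F x <= G x) -> ri F <= ri G.
Proof. by move=> iF iG FG; apply: le_Rintegral. Qed.

Lemma ri_ge0 F : (forall x, 0 <= F x) -> 0 <= ri F.
Proof. by move=> F0; apply: Rintegral_ge0. Qed.

Lemma ri_norm F : itg F -> `|ri F| <= ri (fun x => `|F x|).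
Proof. by move=> iF; exact: le_normr_Rintegral. Qed.

Lemma ri_le_ext F (b : R) : itg F -> (\int[m]_x (F x)%:E <= b%:E)%E -> ri F <= b.
Proof. by move=> iF; rewrite riE// lee_fin. Qed.

(** Fatou's lemma, for truncations that at each point are eventually equal to the limit. *)
Lemma itg_lim (F_ : nat -> S -> R) F (b : R) : measurable_fun setT F -> (forall x, 0 <= F x) ->
  (forall N x, 0 <= F_ N x) -> (forall N, itg (F_ N)) ->
  (forall x, exists N0, forall N, (N0 <= N)%N -> F_ N x = F x) ->
  (forall e : R, 0 < e -> exists N0, forall N, (N0 <= N)%N -> ri (F_ N) <= b + e) ->
  itg F /\ ri F <= b.
Proof.
move=> mF F0 F_0 iF H Hb.
have : (\int[m]_x (F x)%:E <= b%:E)%E.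
  apply/lee_addgt0Pr => e e0; have [N0 HN0] := Hb e e0.
  have fat := fatou m measurableT (f := fun N x => (F_ (N0 + N)%N x)%:E)
    (fun N => measurable_int _ (iF (N0 + N)%N)) (fun N x _ => F_0 (N0 + N)%N x).
  have E x : (limn_einf (fun N => (F_ (N0 + N)%N x)%:E) = (F x)%:E)%E.
    apply: (cvg_limn_einf_sup _).1.
    have [N1 HN1] := H x; apply: cvg_near_cst; exists N1 => // N /= N1N.
    by rewrite HN1// (leq_trans N1N)// leq_addl.
  rewrite (eq_integral (fun x => limn_einf (fun N => (F_ (N0 + N)%N x)%:E))); last by move=> x _; rewrite E.
  apply: (le_trans fat); rewrite -EFinD limn_einf_lim.
  apply: lime_le; first exact: is_cvg_einfs.
  apply: nearW => N; apply: (@le_trans _ _ (\int[m]_x (F_ (N0 + N)%N x)%:E)%E).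
    by apply: ereal_inf_lbound; exists N => /=.
  by rewrite riE// lee_fin HN0// leq_addr.
move=> h; have iF' : itg F by apply: itg_fin => //; apply: le_lt_trans h _; rewrite ltry.
by split => //; exact: ri_le_ext.
Qed.

Lemma itg_cvg0 (g_ : nat -> S -> R) F : (forall N, measurable_fun setT (g_ N)) ->
  (forall N x, 0 <= g_ N x <= 1) -> (forall x, exists N0, forall N, (N0 <= N)%N -> g_ N x = 0) ->
  (forall x, 0 <= F x) -> itg F -> ri (fun x => g_ N x * F x) @[N --> \oo] --> (0 : R).
Proof.
move=> mg g01 g0 F0 iF.
have ig N : itg (fun x => g_ N x * F x).
  apply: (itg_bM (k := 1)) => // x.
  by have /andP[h1 h2] := g01 N x; rewrite ger0_norm.
have H : (\int[m]_x (g_ N x * F x)%:E)%E @[N --> \oo] --> (\int[m]_x (0 : \bar R))%E.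
  apply: (@dominated_cvg _ S R m setT measurableT _ _ (EFin \o F)) => //.
  - by move=> N; exact: measurable_int (ig N).
  - move=> x _; have [N0 HN0] := g0 x; apply: cvg_near_cst; exists N0 => // N /= N0N.
    by rewrite HN0// mul0r.
  - move=> N x _ /=; rewrite lee_fin normrM (ger0_norm (F0 x)) ler_piMl//.
    by have /andP[h1 h2] := g01 N x; rewrite ger0_norm.
rewrite integral0 in H; exact: (fine_cvg H).
Qed.

End RealIntegral.

Lemma real_ultra_cvg {R : realType} {I : Type} {U : set_system I} {UF : UltraFilter U}
    (f : I -> R) (K : R) : (forall k, `|f k| <= K) -> exists v : R, f @ U --> v.
Proof.
move=> fK; have [|v [cv _]] := @row_ultra_cvg R 1 I U UF (fun k => const_mx (f k)) K.
  apply: (@filterS _ _ _ setT); last exact: filterT.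
  by move=> k _; apply: norm_le_coord => [|i]; rewrite ?mxE//; exact: le_trans (fK k).
exists (v 0 0); move/cvg_rowP : cv => /(_ 0); apply: cvg_trans.
by apply: near_eq_cvg; apply: (@filterS _ _ _ setT); [move=> k _; rewrite mxE | exact: filterT].
Qed.

(** * The limit along an ultrafilter as a measure *)

Section LimitMeasure.
Context d (S : measurableType d) (R : realType) (m : {measure set S -> \bar R}).
Variables (F_ : nat -> S -> R) (q : S -> R).
Hypothesis F0 : forall k x, 0 <= F_ k x.
Hypothesis iF : forall k, itg m (F_ k).
Hypothesis F1 : forall k, ri m (F_ k) = 1.
Hypothesis q0 : forall x, 0 <= q x.
Hypothesis iq : itg m q.
Hypothesis ui : forall e : R, 0 < e -> exists2 K : R, 0 <= K & forall k (g : S -> R),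
  measurable_fun setT g -> (forall x, 0 <= g x <= 1) ->
  ri m (fun x => g x * F_ k x) <= K * ri m (fun x => g x * q x) + e.
Variable U : set_system nat.
Hypothesis UF : UltraFilter U.

Lemma ind01 (A : set S) x : 0 <= (\1_A x : R) <= 1.
Proof. by rewrite indicE; case: (_ \in _); rewrite ?lexx ?ler01. Qed.

Lemma itg_ind (G : S -> R) (A : set S) : itg m G -> measurable A -> itg m (fun x => \1_A x * G x).
Proof.
move=> iG mA; apply: (itg_bM (k := 1)) => //.
by move=> x; have /andP[h1 h2] := ind01 A x; rewrite ger0_norm.
Qed.

Lemma ri_ind_bound k (A : set S) : 0 <= ri m (fun x => \1_A x * F_ k x) <= 1.
Proof.
have nn x : 0 <= \1_A x * F_ k x by rewrite mulr_ge0//; have /andP[] := ind01 A x.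
rewrite ri_ge0//= -lee_fin /ri /Rintegral.
have h : (\int[m]_x (\1_A x * F_ k x)%:E <= 1)%E.
  rewrite -[leRHS](_ : (\int[m]_x (F_ k x)%:E = 1)%E); last by rewrite riE// F1.
  apply: ge0_le_integralT => x; rewrite lee_fin//.
  by have /andP[h1 h2] := ind01 A x; rewrite ler_piMl.
rewrite fineK// ge0_fin_numE ?(le_lt_trans h) ?ltry//.
by apply: integral_ge0 => x _; rewrite lee_fin.
Qed.

Lemma lim_ind_ex : exists lam : set S -> R, forall A,
  ri m (fun x => \1_A x * F_ k x) @[k --> U] --> lam A.
Proof.
suff /choice[lam H] : forall A : set S, exists l : R, ri m (fun x => \1_A x * F_ k x) @[k --> U] --> l by exists lam.
move=> A.
apply: (@real_ultra_cvg _ _ _ _ _ 1) => k.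
by have /andP[h1 h2] := ri_ind_bound k A; rewrite ger0_norm.
Qed.

(** Finite additivity passes to the limit for free. Countable additivity comes from [ui]: the mass
    of the remaining sets is dominated by their integral against [q], which tends to 0, up to an
    arbitrary [e]. *)
Lemma limit_measure : exists nu : {finite_measure set S -> \bar R}, exists2 lam : set S -> R,
  (forall A, nu A = (lam A)%:E) &
  (forall A, measurable A -> ri m (fun x => \1_A x * F_ k x) @[k --> U] --> lam A).
Proof.
have [lam Hlam] := lim_ind_ex.
have lam0 : lam set0 = 0.
  apply: (cvg_unique _ (Hlam set0)) => //.
  rewrite (_ : (fun k => _) = fun=> 0); first exact: cvg_cst.
  apply/funext => k; rewrite -[RHS](ri0 m); congr ri; apply/funext => x.
  by rewrite indic0 mul0r.
have lam_ge0 A : 0 <= lam A.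
  by apply: (cvgr_to_ge (Hlam A)); apply: nearW => k; have /andP[] := ri_ind_bound k A.
pose nu A := (lam A)%:E.
have nu0 : nu set0 = 0%E by rewrite /nu lam0.
have nu_ge0 A : (0 <= nu A)%E by rewrite lee_fin.
have nuS : semi_sigma_additive nu.
  (* The sets being disjoint, [g N] is the indicator of the union of those from index [N] on. *)
  move=> A mA tA mU; pose g N x : R := \1_(\bigcup_i A i) x - \sum_(i < N) \1_(A i) x.
  have gE x : (forall N, g N x = 0) \/ exists j, forall N, g N x = 1 - (j < N)%:R.
    have [[j _ Ajx]|nAx] := pselect ((\bigcup_i A i) x); last first.
      left=> N; rewrite /g indicE memNset// big1 ?subrr// => i _.
      by rewrite indicE memNset// => Aix; apply: nAx; exists i.
    right; exists j => N; rewrite /g indicE mem_set; last by exists j.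
    congr (1 - _); have nj i : i != j -> \1_(A i) x = 0 :> R.
      move=> ij; rewrite indicE memNset// => Aix; move/eqP: ij; apply.
      by apply: tA => //; exists x.
    have [jN|Nj] := ltnP j N.
      rewrite (bigD1 (Ordinal jN))//= indicE mem_set// big1 ?addr0// => i ij.
      by apply: nj; apply: contra ij => /eqP ij; apply/eqP/val_inj.
    by rewrite big1// => i _; apply: nj; rewrite neq_ltn (leq_trans (ltn_ord i) Nj).
  have g01 N x : 0 <= g N x <= 1.
    have [->|[j ->]] := gE x; first by rewrite lexx ler01.
    by case: (j < N)%N; rewrite ?subrr ?subr0 ?lexx ?ler01.
  have mg N : measurable_fun setT (g N).
    apply: measurable_funB; first exact: measurable_indic.
    by apply: measurable_sum => i; exact: measurable_indic.
  have gz x : exists N0, forall N, (N0 <= N)%N -> g N x = 0.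
    have [gx|[j gj]] := gE x; first by exists 0%N => N _; exact: gx.
    by exists j.+1 => N jN; rewrite gj jN subrr.
  have gq := itg_cvg0 mg g01 gz q0 iq.
  have E N : (ri m (fun x => g N x * F_ k x) @[k --> U] --> lam (\bigcup_i A i) - \sum_(i < N) lam (A i)).
    rewrite (_ : (fun k => _) = fun k => ri m (fun x => \1_(\bigcup_i A i) x * F_ k x) -
       \sum_(i < N) ri m (fun x => \1_(A i) x * F_ k x)).
      by apply: cvgB => //; apply: cvg_sumr => i; exact: Hlam.
    apply/funext => k; rewrite -ri_sum; last by move=> i; exact: itg_ind.
    rewrite -riB; [|exact: itg_ind|by apply: itg_sum => i; exact: itg_ind].
    by congr ri; apply/funext => x; rewrite /g mulrBl mulr_suml.
  have cv : (\sum_(0 <= i < N) lam (A i)) @[N --> \oo] --> lam (\bigcup_i A i).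
    apply/cvgrPdist_le => e e0; have e2 : 0 < e / 2 by rewrite divr_gt0.
    have [K K0 HK] := ui e2; have K1 : 0 < K + 1 by rewrite ltr_wpDl.
    have /cvgrPdist_le/(_ (e / 2 / (K + 1)))  := gq.
    rewrite divr_gt0// => /(_ isT); apply: filterS => N; rewrite sub0r normrN => hN.
    rewrite big_mkord ger0_norm; last first.
      apply: (cvgr_to_ge (E N)); apply: nearW => k; apply: ri_ge0 => x.
      by rewrite mulr_ge0//; have /andP[] := g01 N x.
    apply: (cvgr_to_le (E N)); apply: nearW => k; apply: le_trans (HK k _ (mg N) (g01 N)) _.
    rewrite [leRHS](splitr e) lerD2r.
    have h0 : 0 <= ri m (fun x => g N x * q x).
      by apply: ri_ge0 => x; rewrite mulr_ge0//; have /andP[] := g01 N x.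
    apply: (@le_trans _ _ ((K + 1) * ri m (fun x => g N x * q x))); first by rewrite ler_wpM2r// lerDl.
    by rewrite mulrC -ler_pdivlMr//; apply: le_trans hN; exact: ler_norm.
  rewrite (_ : (fun n => _) = EFin \o (fun N => \sum_(0 <= i < N) lam (A i))); last first.
    by apply/funext => N; rewrite /= sumEFin.
  by apply: cvg_EFin; [exact: nearW | exact: cv].
pose muM := HB.pack_for {measure set S -> \bar R} nu (isMeasure.Build d S R nu nu0 nu_ge0 nuS).
have fin : fin_num_fun muM by move=> A mA; rewrite /=.
pose muF := HB.pack_for {finite_measure set S -> \bar R} (Measure.sort muM) (Measure_isFinite.Build d S R muM fin).
by exists muF; exists lam => // A _; exact: Hlam.
Qed.

End LimitMeasure.

(** * From sets to bounded test functions *)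

Section TestFunctions.
Context d (S : measurableType d) (R : realType) (m : {measure set S -> \bar R}).
Variables (F_ : nat -> S -> R) (F : S -> R).
Hypothesis F_0 : forall k x, 0 <= F_ k x.
Hypothesis iF_ : forall k, itg m (F_ k).
Hypothesis F_1 : forall k, ri m (F_ k) = 1.
Hypothesis F0 : forall x, 0 <= F x.
Hypothesis iF : itg m F.
Hypothesis F1 : ri m F = 1.
Variable U : set_system nat.
Hypothesis UF : Filter U.
Hypothesis HA : forall A, measurable A ->
  ri m (fun x => \1_A x * F_ k x) @[k --> U] --> ri m (fun x => \1_A x * F x).

(** Staircase approximation: [s] counts the multiples of 1/J that lie below [t], up to the [N]-th.
    For [N = J] it approximates a value in [0, 1] to within 1/J. *)
Lemma count_le (t : R) (J N : nat) : (0 < J)%N -> 0 <= t ->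
  let s := \sum_(j < N) J%:R^-1 * (j.+1%:R / J%:R <= t)%R%:R in
  (N%:R / J%:R <= t /\ s = N%:R / J%:R) \/ (t < N%:R / J%:R /\ s <= t <= s + J%:R^-1).
Proof.
move=> J0 t0 /=; have Jp : 0 < J%:R :> R by rewrite ltr0n.
elim: N => [|N IH]; first by left; rewrite big_ord0 mul0r.
rewrite big_ord_recr /=; have E : N.+1%:R / J%:R = N%:R / J%:R + J%:R^-1 :> R.
  by rewrite -natr1 mulrDl mul1r.
have Ji : 0 < J%:R^-1 :> R by rewrite invr_gt0.
case: IH => [[h1 h2]|[h1 /andP[h2 h3]]].
  rewrite h2; case: (leP (N.+1%:R / J%:R) t) => h; [left | right]; rewrite ?mulr1 ?mulr0.
    by rewrite -E.
  by split=> //; rewrite addr0 h1 /= -E ltW.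
have h : t < N.+1%:R / J%:R by rewrite E ltr_wpDr// ltW.
by right; rewrite (lt_geF h) mulr0 addr0 h2 h3.
Qed.

Lemma test_bounded (phi : S -> R) (N : R) : measurable_fun setT phi -> (forall x, `|phi x| <= N) ->
  ri m (fun x => phi x * F_ k x) @[k --> U] --> ri m (fun x => phi x * F x).
Proof.
suff key : forall psi : S -> R, measurable_fun setT psi -> (forall x, 0 <= psi x <= 1) ->
    ri m (fun x => psi x * F_ k x) @[k --> U] --> ri m (fun x => psi x * F x).
  move=> mphi phiN.
  pose N1 := `|N| + 1; have N10 : 0 < N1 by rewrite ltr_wpDl.
  pose psi x := (phi x + N1) / (2 * N1).
  have psi01 x : 0 <= psi x <= 1.
    have := le_trans (phiN x) (ler_norm N); rewrite ler_norml => /andP[h1 h2].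
    rewrite /psi divr_ge0 ?mulr_ge0 ?(ltW N10)//=; last by rewrite /N1; lra.
    by rewrite ler_pdivrMr ?mulr_gt0// mul1r /N1; lra.
  have mpsi : measurable_fun setT psi.
    by apply: measurable_funM => //; exact: measurable_funD.
  have E (G : S -> R) : itg m G -> ri m G = 1 ->
      ri m (fun x => phi x * G x) = 2 * N1 * ri m (fun x => psi x * G x) - N1.
    move=> iG G1.
    transitivity (2 * N1 * ri m (fun x => psi x * G x) - N1 * ri m G); last by rewrite G1 mulr1.
    rewrite -!riZ//; last first.
      apply: (itg_bM (k := 1)) => // x.
      by have /andP[h1 h2] := psi01 x; rewrite ger0_norm.
    rewrite -riB; [|apply: itgZ|exact: itgZ].
      congr ri; apply/funext => x; rewrite /psi.
      by field; rewrite gt_eqF.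
    apply: (itg_bM (k := 1)) => // x.
    by have /andP[h1 h2] := psi01 x; rewrite ger0_norm.
  rewrite E// (_ : (fun k => _) = fun k => 2 * N1 * ri m (fun x => psi x * F_ k x) - N1); last first.
    by apply/funext => k; rewrite E.
  by apply: cvgB; [apply: cvgMr; exact: key | exact: cvg_cst].
move=> psi mpsi psi01; apply/cvgrPdist_le => e e0.
pose J := (Num.truncn (4 / e)).+1.
have J0 : 0 < J%:R :> R by rewrite ltr0n.
have Je : J%:R^-1 <= e / 4.
  rewrite -[leRHS]invrK lef_pV2 ?posrE ?invr_gt0 ?divr_gt0// invf_div.
  by apply/ltW; rewrite truncnS_gt.
pose A (j : nat) := [set x | j.+1%:R / J%:R <= psi x].
have mA j : measurable (A j).
  rewrite -[A j]setTI (_ : A j = psi @^-1` `[j.+1%:R / J%:R, +oo[).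
    by apply: mpsi.
  by apply/seteqP; split => x; rewrite /A /= in_itv /= andbT.
pose s x : R := \sum_(j < J) J%:R^-1 * \1_(A j) x.
have sE x : s x <= psi x <= s x + J%:R^-1.
  have /andP[p0 p1] := psi01 x; have := count_le J (isT : (0 < J)%N) p0.
  rewrite /= (_ : \sum_(j < J) _ = s x); last first.
    apply: eq_bigr => j _; rewrite indicE; congr (_ * (_ : bool)%:R).
    by apply/idP/idP => [h|]; [apply/mem_set | rewrite inE].
  case=> [[h1 ->]|[_ //]]; rewrite divff ?gt_eqF// in h1 *.
  by rewrite (le_anti (introT andP (conj p1 h1))) lexx lerDl invr_ge0 ltW.
have ms : measurable_fun setT s.
  by apply: measurable_sum => j; apply: measurable_funM => //; exact: measurable_indic.
have close (G : S -> R) : itg m G -> (forall x, 0 <= G x) -> ri m G = 1 ->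
    ri m (fun x => s x * G x) = \sum_(j < J) J%:R^-1 * ri m (fun x => \1_(A j) x * G x) /\
    ri m (fun x => s x * G x) <= ri m (fun x => psi x * G x) <= ri m (fun x => s x * G x) + e / 4.
  move=> iG G0 G1.
  have isG : itg m (fun x => s x * G x).
    rewrite (_ : (fun x => _) = fun x => \sum_(j < J) J%:R^-1 * (\1_(A j) x * G x)).
      by apply: itg_sum => j; apply: itgZ; exact: itg_ind.
    by apply/funext => x; rewrite mulr_suml; apply: eq_bigr => j _; rewrite mulrA.
  have ipG : itg m (fun x => psi x * G x).
    by apply: (itg_bM (k := 1)) => // x; have /andP[h1 h2] := psi01 x; rewrite ger0_norm.
  split.
    rewrite (_ : (fun x => _) = fun x => \sum_(j < J) J%:R^-1 * (\1_(A j) x * G x)); last first.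
      by apply/funext => x; rewrite mulr_suml; apply: eq_bigr => j _; rewrite mulrA.
    rewrite ri_sum; last by move=> j; apply: itgZ; exact: itg_ind.
    by apply: eq_bigr => j _; rewrite riZ//; exact: itg_ind.
  apply/andP; split.
    by apply: ri_le => // x; rewrite ler_wpM2r//; have /andP[] := sE x.
  rewrite (_ : _ + e / 4 = ri m (fun x => s x * G x) + e / 4 * ri m G); last by rewrite G1 mulr1.
  rewrite -riZ// -riD//; last exact: itgZ.
  apply: ri_le => //; first by apply: itgD => //; exact: itgZ.
  move=> x; rewrite -mulrDl ler_wpM2r//; have /andP[_ h] := sE x.
  by apply: le_trans h _; rewrite lerD2l.
have cs : ri m (fun x => s x * F_ k x) @[k --> U] --> ri m (fun x => s x * F x).
  have [-> _] := close F iF F0 F1.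
  rewrite (_ : (fun k => _) = fun k => \sum_(j < J) J%:R^-1 * ri m (fun x => \1_(A j) x * F_ k x)); last first.
    by apply/funext => k; have [-> _] := close (F_ k) (iF_ k) (F_0 k) (F_1 k).
  by apply: cvg_sumr => j; apply: cvgMr; exact: HA.
have e4 : 0 < e / 4 by rewrite divr_gt0.
have /cvgrPdist_le/(_ _ e4) := cs; apply: filterS => k.
have [_ /andP[]] := close F iF F0 F1; have [_ /andP[]] := close (F_ k) (iF_ k) (F_0 k) (F_1 k).
move: (ri m _) (ri m _) (ri m _) (ri m _) => a b c' d' h1 h2 h3 h4.
by rewrite !ler_norml => /andP[h5 h6]; apply/andP; split; lra.
Qed.

End TestFunctions.

(** * Compactness of densities and of their products *)

Section Densities.
Context d (T : measurableType d) (R : realType) (mu : {sigma_finite_measure set T -> \bar R}).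
Implicit Types (f phi psi q : T -> R).
Local Notation mu2 := (mu \x mu)%E.

Definition dens f := [/\ itg mu f, forall x, 0 <= f x & ri mu f = 1].

Lemma meas1 phi : measurable_fun setT phi -> measurable_fun setT (fun z : T * T => phi z.1).
Proof. by move=> mp; exact: (measurableT_comp mp measurable_fst). Qed.

Lemma meas2 phi : measurable_fun setT phi -> measurable_fun setT (fun z : T * T => phi z.2).
Proof. by move=> mp; exact: (measurableT_comp mp measurable_snd). Qed.

Lemma meas_sec (k : T * T -> R) y : measurable_fun setT k -> measurable_fun setT (fun x => k (x, y)).
Proof. by move=> mk; apply: (measurableT_comp mk); exact: measurable_pair2. Qed.

Lemma itg_kernel (k : T * T -> R) psi (s : R) : measurable_fun setT k -> (forall z, 0 <= k z) ->
  (forall y, \int[mu]_x (k (x, y))%:E <= s%:E)%E -> itg mu psi -> (forall y, 0 <= psi y) ->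
  itg mu2 (fun z => k z * psi z.2) /\ ri mu2 (fun z => k z * psi z.2) <= s * ri mu psi.
Proof.
move=> mk k0 ks ip p0.
have mp := itg_meas ip; have m2 := meas2 mp.
have mkp : measurable_fun setT (fun z : T * T => k z * psi z.2) by exact: measurable_funM.
have kp0 (z : T * T) : 0 <= k z * psi z.2 by rewrite mulr_ge0.
have h : (\int[mu2]_z (k z * psi z.2)%:E <= (s * ri mu psi)%:E)%E.
  rewrite fubini_tonelli2; [|exact/measurable_EFinP|by move=> z; rewrite lee_fin].
  rewrite /fubini_G /= EFinM -riE//.
  have s0 : 0 <= s.
    rewrite -lee_fin; apply: le_trans (ks point); apply: integral_ge0 => x _.
    by rewrite lee_fin.
  rewrite -ge0_integralZl//; [|exact/measurable_EFinP|by move=> x _; rewrite lee_fin].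
  apply: ge0_le_integralT => y; first by apply: integral_ge0 => x _; rewrite lee_fin.
  under eq_integral do rewrite mulrC EFinM.
  rewrite ge0_integralZl//; first by rewrite muleC; apply: lee_wpmul2r => //; rewrite lee_fin p0.
    by apply/measurable_EFinP; exact: meas_sec.
    by move=> x _; rewrite lee_fin.
  by rewrite lee_fin p0.
have i : itg mu2 (fun z => k z * psi z.2) by apply: itg_fin => //; rewrite (le_lt_trans h)// ltry.
by split => //; exact: ri_le_ext.
Qed.

Lemma itg_prod phi psi : itg mu phi -> itg mu psi ->
  itg mu2 (fun z => phi z.1 * psi z.2) /\ ri mu2 (fun z => phi z.1 * psi z.2) = ri mu phi * ri mu psi.
Proof.
move=> ip iq; have mp := itg_meas ip; have mq := itg_meas iq.
have i : itg mu2 (fun z => phi z.1 * psi z.2).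
  apply: (@itg_dom _ _ _ _ _ (fun z => `|phi z.1| * `|psi z.2|)); last by move=> z; rewrite normrM.
    by apply: measurable_funM; [exact: (meas1 mp) | exact: (meas2 mq)].
  have [|||||h _] := @itg_kernel (fun z => `|phi z.1|) (fun y => `|psi y|) (ri mu (fun x => `|phi x|)); last exact: h.
  - by apply: measurableT_comp => //; exact: meas1.
  - by [].
  - by move=> y; rewrite riE//; exact: integrable_norm.
  - exact: integrable_norm.
  - by [].
split => //; apply: EFin_inj; rewrite -riE// -integral12_prod_meas1//.
rewrite /fubini_F /= EFinM -(riE ip) -integralZr//.
apply: eq_integral => x _; under eq_integral do rewrite EFinM.
by rewrite integralZl// riE.
Qed.

Lemma dens_prod f : dens f -> [/\ itg mu2 (fun z => f z.1 * f z.2),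
  forall z : T * T, 0 <= f z.1 * f z.2 & ri mu2 (fun z => f z.1 * f z.2) = 1].
Proof.
move=> [i f0 f1]; have [h1 h2] := itg_prod i i; split => //.
  by move=> z; rewrite mulr_ge0.
by rewrite h2 f1 mulr1.
Qed.

Section Compactness.
Variables (f_ : nat -> T -> R) (q : T -> R).
Hypothesis df : forall k, dens (f_ k).
Hypothesis q0 : forall x, 0 <= q x.
Hypothesis iq : itg mu q.
(** Uniform integrability is measured against the integrable weight [q] because [mu] may be
    infinite: a small excess prevents both concentration and escape of mass to infinity. *)
Definition excess (K : R) f x := Num.max (f x - K * q x) 0.
Hypothesis ui : forall e : R, 0 < e -> exists2 K : R, 0 <= K & forall k, ri mu (excess K (f_ k)) <= e.
Variable U : set_system nat.
Hypothesis UF : UltraFilter U.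

Lemma excess_ge0 K f x : 0 <= excess K f x.
Proof. by rewrite le_max lexx orbT. Qed.

Lemma excess_ge K f x : f x <= K * q x + excess K f x.
Proof. by rewrite -lerBlDl le_max lexx. Qed.

Lemma excess_le K f x : 0 <= K -> 0 <= f x -> excess K f x <= f x.
Proof. by move=> K0 f0; rewrite ge_max f0 gerBl mulr_ge0. Qed.

Lemma itg_excess K f : 0 <= K -> dens f -> itg mu (excess K f).
Proof.
move=> K0 [fi f0 _]; apply: (itg_dom _ fi) => [|x].
  apply: measurable_maxr => //; apply: measurable_funB; first exact: itg_meas fi.
  by apply: measurable_funM => //; exact: itg_meas iq.
by rewrite ger0_norm ?excess_ge0// excess_le.
Qed.

(** Transfers the uniform integrability of [f] relative to [q] to its tensor square relative to that
    of [q]. *)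
Lemma excess_prod K f x y : 0 <= K -> (forall x, 0 <= f x) ->
  f x * f y <= K ^+ 2 * (q x * q y) + (f x * excess K f y + excess K f x * f y).
Proof.
move=> K0 f0; have hx := excess_ge K f x; have hy := excess_ge K f y.
have rx := excess_ge0 K f x; have ry := excess_ge0 K f y.
have lx := excess_le K0 (f0 x); have ly := excess_le K0 (f0 y).
have px : 0 <= K * q x by rewrite mulr_ge0.
have py : 0 <= K * q y by rewrite mulr_ge0.
rewrite expr2 mulrACA; move: hx hy rx ry lx ly px py (f0 x) (f0 y).
move: (excess K f x) (excess K f y) (K * q x) (K * q y) (f x) (f y) => r s a b u v.
move=> hx hy r0 s0 lr ls a0 b0 u0 v0.
have -> : u * v = r * v + (u - r) * (v - s) + (u - r) * s by ring.
have h1 : (u - r) * (v - s) <= a * b by apply: ler_pM; lra.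
have h2 : (u - r) * s <= u * s by rewrite ler_wpM2r//; lra.
lra.
Qed.

Lemma itg_w01 d' (S : measurableType d') (m : {measure set S -> \bar R}) (g F : S -> R) :
  measurable_fun setT g -> (forall x, 0 <= g x <= 1) -> itg m F -> itg m (fun x => g x * F x).
Proof.
move=> mg g01 iF; apply: (itg_bM (k := 1)) => // x.
by have /andP[h1 h2] := g01 x; rewrite ger0_norm.
Qed.

Lemma dens_ui1 (e : R) : 0 < e -> exists2 K : R, 0 <= K & forall k (g : T -> R),
  measurable_fun setT g -> (forall x, 0 <= g x <= 1) ->
  ri mu (fun x => g x * f_ k x) <= K * ri mu (fun x => g x * q x) + e.
Proof.
move=> e0; have [K K0 HK] := ui e0; exists K => // k g mg g01.
have [fi f0 _] := df k; have ie := itg_excess K0 (df k).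
have iw (F : T -> R) : itg mu F -> itg mu (fun x => g x * F x) by exact: itg_w01.
apply: le_trans (lerD (lexx _) (HK k)); rewrite -riZ ?iw// -riD ?itgZ ?iw//.
apply: ri_le; [exact: iw | by apply: itgD => //; exact/itgZ/iw | move=> x].
have /andP[g0 g1] := g01 x.
apply: le_trans (ler_wpM2l g0 (excess_ge K (f_ k) x)) _.
by rewrite mulrDr mulrCA lerD2l ler_piMl ?excess_ge0.
Qed.

Lemma dens_ui2 (e : R) : 0 < e -> exists2 K : R, 0 <= K & forall k (g : T * T -> R),
  measurable_fun setT g -> (forall x, 0 <= g x <= 1) ->
  ri mu2 (fun x => g x * (f_ k x.1 * f_ k x.2)) <= K * ri mu2 (fun x => g x * (q x.1 * q x.2)) + e.
Proof.
move=> e0; have e2 : 0 < e / 2 by rewrite divr_gt0.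
have [K K0 HK] := ui e2; exists (K ^+ 2); first by rewrite exprn_ge0.
move=> k g mg g01; have [fi f0 f1] := df k; have ie := itg_excess K0 (df k).
have iw (F : T * T -> R) : itg mu2 F -> itg mu2 (fun x => g x * F x) by exact: itg_w01.
have [i1 _ _] := dens_prod (df k); have [i2 _] := itg_prod iq iq.
have [i3 e3] := itg_prod fi ie; have [i4 e4] := itg_prod ie fi.
apply: (@le_trans _ _ (K ^+ 2 * ri mu2 (fun x => g x * (q x.1 * q x.2)) +
  (ri mu2 (fun z => f_ k z.1 * excess K (f_ k) z.2) + ri mu2 (fun z => excess K (f_ k) z.1 * f_ k z.2)))).
  rewrite -riZ ?iw// -(riD i3 i4) -riD ?itgZ ?iw//; last exact: itgD.
  apply: ri_le; [exact: iw | apply: itgD; [exact/itgZ/iw | exact: itgD] | move=> x].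
  have /andP[g0 g1] := g01 x.
  apply: le_trans (ler_wpM2l g0 (excess_prod x.1 x.2 K0 f0)) _.
  rewrite mulrDr mulrCA lerD2l ler_piMl// addr_ge0// mulr_ge0 ?excess_ge0//.
by rewrite lerD2l e3 e4 f1 mul1r mulr1 [leRHS](splitr e) lerD.
Qed.

(** The limits are first taken as measures, on the space and on its square separately. Null sets of
    [mu] stay null in the limit, so Radon-Nikodym provides [rho]; the limit on the square is then
    identified as a product measure. *)
Theorem dens_compact : exists rho, [/\ dens rho,
  forall phi (N : R), measurable_fun setT phi -> (forall x, `|phi x| <= N) ->
    ri mu (fun x => phi x * f_ k x) @[k --> U] --> ri mu (fun x => phi x * rho x) &
  forall (k : T * T -> R) (N : R), measurable_fun setT k -> (forall x, `|k x| <= N) ->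
    ri mu2 (fun z => k z * (f_ j z.1 * f_ j z.2)) @[j --> U] --> ri mu2 (fun z => k z * (rho z.1 * rho z.2))].
Proof.
have F0 k x : 0 <= f_ k x by have [] := df k.
have iF k : itg mu (f_ k) by have [] := df k.
have F1 k : ri mu (f_ k) = 1 by have [] := df k.
have F0' k (z : T * T) : 0 <= f_ k z.1 * f_ k z.2 by rewrite mulr_ge0.
have iF' k : itg mu2 (fun z => f_ k z.1 * f_ k z.2) by have [] := dens_prod (df k).
have F1' k : ri mu2 (fun z => f_ k z.1 * f_ k z.2) = 1 by have [] := dens_prod (df k).
have q0' (z : T * T) : 0 <= q z.1 * q z.2 by rewrite mulr_ge0.
have [iq' _] := itg_prod iq iq.
have [nu [lam nuE Hlam]] := limit_measure F0 iF F1 q0 iq dens_ui1 UF.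
have [nu2 [lam2 nu2E Hlam2]] := limit_measure F0' iF' F1' q0' iq' dens_ui2 UF.
have numu : nu `<< mu.
  apply/null_content_dominatesP => A mA A0; rewrite nuE; congr EFin.
  apply: (cvg_unique _ (Hlam A mA)) => //.
  rewrite (_ : (fun k => _) = fun=> 0); first exact: cvg_cst.
  apply/funext => k; rewrite /ri /Rintegral.
  rewrite (_ : (\int[mu]_x _)%E = (\int[mu]_(x in A) (f_ k x)%:E)%E); last first.
    rewrite [RHS]integral_mkcond; apply: eq_integral => x _; rewrite patchE indicE.
    by case: (x \in A); rewrite ?mul1r ?mul0r.
  rewrite (null_set_integral (mu := mu) (N := A) (f := fun x => (f_ k x)%:E))//.
  by apply: measurable_funTS; exact: measurable_int (iF k).
pose rn := Radon_Nikodym_SigmaFinite.f nu mu.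
pose rho x := fine (rn x).
have rnE x : rn x = (rho x)%:E by rewrite fineK//; exact: Radon_Nikodym_SigmaFinite.f_fin_num.
have rho0 x : 0 <= rho x by apply: fine_ge0; exact: Radon_Nikodym_SigmaFinite.f_ge0.
have irho : itg mu rho.
  by rewrite /itg (_ : EFin \o rho = rn); [exact: Radon_Nikodym_SigmaFinite.f_integrable | apply/funext].
have HA A : measurable A -> ri mu (fun x => \1_A x * rho x) = lam A.
  move=> mA; apply: EFin_inj; rewrite -nuE (Radon_Nikodym_SigmaFinite.f_integral numu mA).
  rewrite -riE; last exact: itg_ind.
  rewrite [RHS]integral_mkcond; apply: eq_integral => x _; rewrite patchE indicE.
  by case: (x \in A); rewrite ?mul1r ?mul0r//= rnE.
have rho1 : ri mu rho = 1.
  have := Hlam setT measurableT; rewrite -HA// => h; rewrite -[LHS](_ : ri mu (fun x => \1_setT x * rho x) = _); last first.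
    by congr ri; apply/funext => x; rewrite indicT mul1r.
  apply: (cvg_unique _ h) => //; rewrite (_ : (fun k => _) = fun=> 1); first exact: cvg_cst.
  by apply/funext => k; rewrite -(F1 k); congr ri; apply/funext => x; rewrite indicT mul1r.
have drho : dens rho by [].
have [irho' _ rho1'] := dens_prod drho.
(* On rectangles the limit of the products is the product of the limits, and a measure with these
   values is the product measure. *)
have HA2 A : measurable A -> ri mu2 (fun z => \1_A z * (rho z.1 * rho z.2)) = lam2 A.
  move=> mA; apply: EFin_inj; rewrite -nu2E -(@product_measure_unique _ _ _ _ _ nu nu nu2)//; last first.
    move=> B C mB mC; transitivity ((lam2 (B `*` C))%:E); first exact: nu2E.
    transitivity ((lam B)%:E * (lam C)%:E)%E; last by congr (_ * _)%E; exact/esym/nuE.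
    rewrite -EFinM; congr EFin.
    apply: (cvg_unique _ (Hlam2 _ (measurableX mB mC))) => //.
    rewrite (_ : (fun k => _) = fun k => ri mu (fun x => \1_B x * f_ k x) * ri mu (fun x => \1_C x * f_ k x)).
      by apply: cvgM; exact: Hlam.
    apply/funext => k; have [_ <-] := itg_prod (itg_ind (iF k) mB) (itg_ind (iF k) mC).
    congr ri; apply/funext => z; rewrite mulrACA; congr (_ * _).
    by rewrite !indicE in_setX -natrM mulnb.
  rewrite -riE; last exact: itg_ind.
  have mz : measurable_fun setT (fun z : T * T => (\1_A z * (rho z.1 * rho z.2))%:E).
    by apply/measurable_EFinP; exact: itg_meas (itg_ind irho' mA).
  rewrite fubini_tonelli1//; last first.
    by move=> z; rewrite lee_fin mulr_ge0 ?mulr_ge0.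
  rewrite /= /product_measure1 -(Radon_Nikodym_SigmaFinite.change_of_variables numu)//; last exact: measurable_fun_xsection.
  apply: eq_integral => x _; rewrite /fubini_F /= (Radon_Nikodym_SigmaFinite.f_integral numu); last exact: measurable_xsection.
  rewrite -/rn rnE -[RHS]muleC.
  rewrite [X in (_ * X)%E]integral_mkcond -ge0_integralZl//.
  - apply: eq_integral => y _; rewrite patchE indicE mem_xsection -/rn rnE.
    by case: (_ \in _); rewrite ?mul1r ?mul0r ?mule0// EFinM.
  - apply/(measurable_restrictT _ _).1; first exact: measurable_xsection.
    apply: measurable_funTS; rewrite (_ : rn = EFin \o rho); last exact/funext.
    by apply/measurable_EFinP; exact: itg_meas irho.
  - by move=> y _; rewrite patchE; case: ifP => // _; exact: Radon_Nikodym_SigmaFinite.f_ge0.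
  - by rewrite lee_fin.
exists rho; split => //.
  move=> phi N mphi phiN; apply: (test_bounded F0 iF F1 rho0 irho rho1) mphi phiN => A mA.
  by rewrite HA//; exact: Hlam.
move=> k N mk kN; apply: (test_bounded F0' iF' F1' _ irho' rho1') mk kN => [z|A mA].
  by rewrite mulr_ge0.
by rewrite HA2//; exact: Hlam2.
Qed.

End Compactness.
End Densities.

(** * The variational problem *)

Lemma ln_le (R : realType) (x y : R) : 0 < x -> x <= y -> ln x <= ln y.
Proof. by move=> x0 xy; rewrite ler_ln ?posrE// (lt_le_trans x0). Qed.

Lemma clamp_close (R : realType) (u v r : R) : 0 <= r -> `|u| <= v ->
  `|u - Num.max (- r) (Num.min r u)| <= Num.max (v - r) 0.
Proof.
move=> r0; rewrite ler_norml => /andP[h1 h2]; have [h3|h3] := leP r u.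
  have h4 : - r <= r by lra.
  by rewrite (max_idPr h4) ger0_norm ?subr_ge0// le_max lerD2r h2.
have [h4|h4] := leP (- r) u; first by rewrite subrr normr0 le_max lexx orbT.
by rewrite ltr0_norm ?subr_lt0// le_max; apply/orP; left; lra.
Qed.

(** * Young's inequality and conventions on infinite integrals *)

Section ExtendedIntegrals.
Context d (S : measurableType d) (R : realType) (m : {measure set S -> \bar R}).
Implicit Types F : S -> R.

(** The convex conjugate of the exponential is s ln s - s. Every estimate of the entropy below is an
    instance of this inequality for a suitable [F]. *)
Lemma xlogx_young (s F : R) : 0 <= s -> s * F - expR F <= s * ln s - s.
Proof.
rewrite le_eqVlt => /orP[/eqP <-|s0].
  by rewrite !mul0r subr0 sub0r oppr_le0 expR_ge0.
have := expR_ge1Dx (F - ln s); rewrite expRD expRN lnK ?posrE// => h.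
have : s * (1 + (F - ln s)) <= s * (expR F / s) by rewrite ler_wpM2l// ltW.
by rewrite [s * (_ / s)]mulrC divfK ?gt_eqF//; lra.
Qed.

(** The value 0 cannot arise from an infinite positive or negative part. The centering condition
    therefore contains the integrability of the moments. *)
Lemma integral_zero_itg F : measurable_fun setT F -> (\int[m]_x (F x)%:E = 0)%E ->
  itg m F /\ ri m F = 0.
Proof.
move=> mF F0; split; last by rewrite /ri /Rintegral F0.
have mE : measurable_fun setT (EFin \o F) by exact/measurable_EFinP.
have pos0 : (0 <= \int[m]_x (EFin \o F)^\+ x)%E by exact: integral_ge0.
have neg0 : (0 <= \int[m]_x (EFin \o F)^\- x)%E by exact: integral_ge0.
have : (\int[m]_x (EFin \o F)^\+ x < +oo /\ \int[m]_x (EFin \o F)^\- x < +oo)%E.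
  move: F0; rewrite integralE; move: pos0 neg0.
  case: (\int[m]_x _)%E => [p| |]; case: (\int[m]_x _)%E => [q| |] //= _ _; rewrite ?ltry//.
move=> [hp hn]; apply/integrableP; split => //.
rewrite (eq_integral (fun x => (EFin \o F)^\+ x + (EFin \o F)^\- x)%E); last first.
  by move=> x _; rewrite -[LHS]/((abse \o (EFin \o F)) x) fune_abse.
rewrite ge0_integralD//; first exact: lte_add_pinfty.
- exact: measurable_funepos.
- exact: measurable_funeneg.
Qed.

Lemma integral_dE_itg F : itg m F -> integral_dE m (EFin \o F) = (ri m F)%:E.
Proof.
move=> iF; rewrite /integral_dE -riE// [in RHS]integralE.
have := integrable_pos_fin_num measurableT iF; have := integrable_neg_fin_num measurableT iF.
by move=> /fineK <- /fineK <-.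
Qed.

Lemma integral_dE_lty F : measurable_fun setT F -> (integral_dE m (EFin \o F) < +oo)%E ->
  itg m (fun x => Num.max (F x) 0).
Proof.
move=> mF; rewrite /integral_dE.
have pos0 : (0 <= \int[m]_x (EFin \o F)^\+ x)%E by exact: integral_ge0.
have neg0 : (0 <= \int[m]_x (EFin \o F)^\- x)%E by exact: integral_ge0.
move=> h; apply: itg_fin => [|x|]; first exact: measurable_maxr.
  by rewrite le_max lexx orbT.
have : (\int[m]_x (EFin \o F)^\+ x < +oo)%E.
  move: pos0 neg0 h; case: (\int[m]_x _)%E => [p| |]; case: (\int[m]_x _)%E => [q| |] //= _ _; rewrite ?ltry//.
apply: le_lt_trans; rewrite le_eqVlt; apply/orP; left; apply/eqP.
by apply: eq_integral => x _; rewrite funeposE /= EFin_max.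
Qed.

End ExtendedIntegrals.

(** * The abstract variational problem *)

Section Variational.
Context d (T : measurableType d) (R : realType) (mu : {sigma_finite_measure set T -> \bar R}).
Local Notation mu2 := (mu \x mu)%E.
(** The geometry enters through these data alone: [l] stands for the coordinates of the logarithm
    and [K] for the interaction kernel. [HV] is its superlinear growth, and [HS] the exponential
    integrability of its negative part with an exponent above 1/2, the weight [a] offsetting volume
    growth. *)
Variables (n : nat) (l : 'I_n -> T -> R) (K : T * T -> R) (a t s : R).
Hypothesis ml : forall i, measurable_fun setT (l i).
Hypothesis mK : measurable_fun setT K.
Definition absl x := \sum_i `|l i x|.
Local Notation w := absl.
Definition vari (z : T * T) := \sum_i `|l i z.1 - l i z.2|.
Definition Kp z := Num.max (K z) 0.
Definition Km z := Num.max (- K z) 0.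
Hypothesis HV : forall eta : R, 0 < eta -> exists2 r : R, 0 <= r & forall z, vari z <= r + eta * Kp z.
Hypothesis a0 : 0 <= a.
Hypothesis t2 : 2^-1 < t.
Hypothesis HS : forall y, (\int[mu]_x (expR (t * Km (x, y) - a * w x))%:E <= s%:E)%E.

Implicit Types f : T -> R.

Definition admissible f := dens mu f /\ forall i, (\int[mu]_x (l i x * f x)%:E = 0)%E.

Definition functional f : \bar R :=
  (integral_dE mu (fun x => (f x * ln (f x))%:E) +
   (2^-1)%:E * integral_dE mu2 (fun z => (K z * (f z.1 * f z.2))%:E))%dE.

(** Every part of the energy is finite separately, so that it can be handled in real arithmetic. *)
Definition finite_energy f := [/\ dens mu f,
  itg mu (fun x => f x * ln (f x)),
  itg mu2 (fun z => Kp z * (f z.1 * f z.2)),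
  itg mu2 (fun z => Km z * (f z.1 * f z.2)) &
  forall i, itg mu (fun x => l i x * f x) /\ ri mu (fun x => l i x * f x) = 0].

Definition ent f := ri mu (fun x => f x * ln (f x)).
Definition epos f := ri mu2 (fun z => Kp z * (f z.1 * f z.2)).
Definition eneg f := ri mu2 (fun z => Km z * (f z.1 * f z.2)).
Definition mom f := ri mu (fun x => w x * f x).

Lemma Kp0 z : 0 <= Kp z. Proof. by rewrite le_max lexx orbT. Qed.
Lemma Km0 z : 0 <= Km z. Proof. by rewrite le_max lexx orbT. Qed.
Lemma KE z : K z = Kp z - Km z.
Proof.
rewrite /Kp /Km; have [h|h] := leP 0 (K z).
  have h' : - K z <= 0 by rewrite oppr_le0.
  by rewrite (max_idPr h') subr0.
have h' : 0 <= - K z by rewrite oppr_ge0 ltW.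
by rewrite (max_idPl h') opprK add0r.
Qed.
Lemma w0 x : 0 <= w x. Proof. exact: sumr_ge0. Qed.

Lemma mw : measurable_fun setT w.
Proof. by apply: measurable_sum => i; apply: measurableT_comp. Qed.

Lemma mKp : measurable_fun setT Kp. Proof. exact: measurable_maxr. Qed.
Lemma mKm : measurable_fun setT Km.
Proof. by apply: measurable_maxr => //; exact: measurableT_comp. Qed.

Definition kern (z : T * T) := expR (t * Km z - a * w z.1).
Definition q x := expR (- (a * w x)).

Lemma mkern : measurable_fun setT kern.
Proof.
apply: measurableT_comp => //; apply: measurable_funB.
  by apply: measurable_funM => //; exact: mKm.
by apply: measurable_funM => //; exact: meas1 mw.
Qed.

Lemma mq : measurable_fun setT q.
Proof.
apply: measurableT_comp => //; apply: measurableT_comp => //.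
by apply: measurable_funM => //; exact: mw.
Qed.

Lemma t_gt0 : 0 < t. Proof. by apply: lt_trans t2; rewrite invr_gt0. Qed.

Lemma itg_q : itg mu q /\ ri mu q <= s.
Proof.
have h : (\int[mu]_x (q x)%:E <= s%:E)%E.
  apply: le_trans (HS point); apply: ge0_le_integralT => x; rewrite lee_fin ?expR_ge0//.
  by rewrite ler_expR lerDr mulr_ge0 ?Km0// ltW// t_gt0.
have i : itg mu q.
  apply: itg_fin; [exact: mq | by move=> x; exact: expR_ge0 | exact: le_lt_trans h (ltry _)].
by split => //; exact: ri_le_ext.
Qed.

Lemma itg_kern f : dens mu f -> itg mu2 (fun z => kern z * f z.2) /\ ri mu2 (fun z => kern z * f z.2) <= s.
Proof.
move=> [fi f0 f1]; have [h1 h2] := itg_kernel mkern (fun z => expR_ge0 _) HS fi f0.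
by split => //; rewrite -[s]mulr1 -f1.
Qed.

Lemma itg_w f : (forall i, itg mu (fun x => l i x * f x)) -> (forall x, 0 <= f x) ->
  itg mu (fun x => w x * f x).
Proof.
move=> h f0; rewrite (_ : (fun x => _) = fun x => \sum_i `|l i x * f x|).
  by apply: itg_sum => i; exact: integrable_norm (h i).
apply/funext => x; rewrite mulr_suml; apply: eq_bigr => i _.
by rewrite normrM (ger0_norm (f0 x)).
Qed.

Lemma good_w f : finite_energy f -> itg mu (fun x => w x * f x).
Proof. by move=> [[_ f0 _] _ _ _ hl]; apply: itg_w => // i; have [] := hl i. Qed.

(** The density of the entropy relative to the weight [q], that is f ln (f / q) - f. *)
Definition relent f x := f x * ln (f x) + a * (w x * f x) - f x.

Lemma itg_relent f : dens mu f -> itg mu (fun x => f x * ln (f x)) -> itg mu (fun x => w x * f x) ->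
  itg mu (relent f) /\ ri mu (relent f) = ent f + a * mom f - 1.
Proof.
move=> [fi _ f1] fe fw; split; first by apply: itgB => //; apply: itgD => //; exact: itgZ.
rewrite /relent riB//; last by apply: itgD => //; exact: itgZ.
by rewrite riD ?riZ ?f1//; exact: itgZ.
Qed.

(** Young's inequality in [x] with dual variable t Km(x, y) - a w(x), multiplied by [f y].
    Integrated, it takes the place of Jensen's inequality. *)
Lemma km_young f x y : (forall x, 0 <= f x) ->
  t * (Km (x, y) * (f x * f y)) <= relent f x * f y + kern (x, y) * f y.
Proof.
move=> f0; have := xlogx_young (t * Km (x, y) - a * w x) (f0 x); rewrite -/(kern (x, y)) => h.
rewrite -mulrDl (_ : t * _ = t * Km (x, y) * f x * f y); last by ring.
by apply: ler_wpM2r => //; rewrite /relent; lra.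
Qed.

(** Because +oo - oo counts as +oo, both positive parts are integrable. The negative part of the
    entropy is then dominated through the first moment and the weight [q], that of the interaction
    through [km_young]. *)
Lemma finite_energy_of f : admissible f -> (functional f < +oo)%E -> finite_energy f.
Proof.
move=> [df Hl] Hlt; have [fi f0 f1] := df; have mf := itg_meas fi.
have hl i : itg mu (fun x => l i x * f x) /\ ri mu (fun x => l i x * f x) = 0.
  by apply: integral_zero_itg => //; exact: measurable_funM.
have fw : itg mu (fun x => w x * f x) by apply: itg_w => // i; have [] := hl i.
have mfl : measurable_fun setT (fun x => f x * ln (f x)).
  by apply: measurable_funM => //; apply: measurableT_comp.
have mff : measurable_fun setT (fun z : T * T => f z.1 * f z.2).
  by apply: measurable_funM; [exact: meas1 | exact: meas2].
have ff0 (z : T * T) : 0 <= f z.1 * f z.2 by rewrite mulr_ge0.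
have mKff : measurable_fun setT (fun z : T * T => K z * (f z.1 * f z.2)) by exact: measurable_funM.
have [h1 h2] : (integral_dE mu (EFin \o (fun x => (f x * ln (f x))%R)) < +oo)%E /\
    (integral_dE mu2 (EFin \o (fun z => (K z * (f z.1 * f z.2))%R)) < +oo)%E.
  move: Hlt; rewrite /functional -[fun x => (f x * _)%:E]/(EFin \o (fun x => f x * ln (f x))).
  rewrite -[fun z => (K z * _)%:E]/(EFin \o (fun z => K z * (f z.1 * f z.2))).
  case: (integral_dE mu _) => [p| |]; case: (integral_dE mu2 _) => [r| |] //=; rewrite ?ltry//=.
  - by rewrite gt0_muley ?lte_fin ?invr_gt0.
  - by rewrite gt0_muley ?lte_fin ?invr_gt0.
have [iq _] := itg_q.
have fe : itg mu (fun x => f x * ln (f x)).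
  apply: (itg_dom mfl (itgD (integral_dE_lty mfl h1) (itgD (itgZ a fw) iq))) => x.
  have h := xlogx_young (- (a * w x)) (f0 x); rewrite -/(q x) in h.
  have g1 : 0 <= a * (w x * f x) by rewrite !mulr_ge0// w0.
  have := expR_ge0 (- (a * w x)); rewrite -/(q x) => g2; have g3 := f0 x.
  rewrite ler_norml; case: (leP (f x * ln (f x)) 0) => g4; apply/andP; split; lra.
have ip : itg mu2 (fun z => Kp z * (f z.1 * f z.2)).
  have := integral_dE_lty mKff h2; congr itg; apply/funext => z.
  by rewrite maxr_pMl// mul0r.
have [ir _] := itg_relent df fe fw.
have [ik _] := itg_kern df; have [irf _] := itg_prod ir fi.
split => //; apply: (itg_dom _ (itgZ t^-1 (itgD irf ik))).
  by apply: measurable_funM => //; exact: mKm.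
move=> [x y] /=; rewrite ger0_norm ?mulr_ge0 ?Km0//.
by rewrite ler_pdivlMl ?t_gt0//; exact: km_young.
Qed.

Lemma functional_finite_energy f : finite_energy f -> functional f = (ent f + 2^-1 * (epos f - eneg f))%:E.
Proof.
move=> [df fe ip im hl]; rewrite /functional.
have E : (fun z => K z * (f z.1 * f z.2)) = (fun z => Kp z * (f z.1 * f z.2) - Km z * (f z.1 * f z.2)).
  by apply/funext => z; rewrite KE mulrBl.
have iK : itg mu2 (fun z => K z * (f z.1 * f z.2)) by rewrite E; exact: itgB.
rewrite (integral_dE_itg fe) (integral_dE_itg iK) -/(ent f) {1}E riB//.
Qed.

Lemma eneg_bound f : finite_energy f -> t * eneg f <= ent f + a * mom f - 1 + s.
Proof.
move=> gf; have [df fe ip im hl] := gf; have [fi f0 f1] := df.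
have [ir re] := itg_relent df fe (good_w gf); have [ik ks] := itg_kern df.
have [irf erf] := itg_prod ir fi.
rewrite -riZ//; apply: le_trans (ri_le (itgZ t im) (itgD irf ik) _) _.
  by move=> [x y]; exact: km_young.
by rewrite riD// erf re f1 mulr1 lerD2l.
Qed.

Lemma eneg_ge0 f : (forall x, 0 <= f x) -> 0 <= eneg f.
Proof. by move=> f0; apply: ri_ge0 => z; rewrite mulr_ge0 ?Km0 ?mulr_ge0. Qed.

Lemma epos_ge0 f : (forall x, 0 <= f x) -> 0 <= epos f.
Proof. by move=> f0; apply: ri_ge0 => z; rewrite mulr_ge0 ?Kp0 ?mulr_ge0. Qed.

(** The place where centering is used: [l i x] is the mean of [l i x - l i y] over [y]. *)
Lemma w_le_vari f x : finite_energy f -> itg mu (fun y => vari (x, y) * f y) /\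
  w x <= ri mu (fun y => vari (x, y) * f y).
Proof.
move=> [[fi f0 f1] _ _ _ hl].
have il i : itg mu (fun y => l i x * f y - l i y * f y).
  by apply: itgB; [exact: itgZ | have [] := hl i].
have E : (fun y => vari (x, y) * f y) = fun y => \sum_i `|l i x * f y - l i y * f y|.
  apply/funext => y; rewrite mulr_suml; apply: eq_bigr => i _.
  by rewrite -mulrBl normrM (ger0_norm (f0 y)).
have iln i : itg mu (fun y => `|l i x * f y - l i y * f y|) by exact: integrable_norm (il i).
rewrite E; split; first exact: itg_sum.
rewrite ri_sum//; apply: ler_sum => i _; apply: le_trans (ri_norm (il i)).
have [i1 i2] := hl i.
by rewrite riB ?riZ ?f1 ?i2 ?subr0 ?mulr1//; exact: itgZ.
Qed.

Lemma itg_wtail f (r : R) : finite_energy f -> 0 <= r -> itg mu (fun x => Num.max (w x - r) 0 * f x).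
Proof.
move=> gf r0; have [[fi f0 f1] _ _ _ _] := gf; apply: (itg_dom _ (good_w gf)).
  apply: measurable_funM; last exact: itg_meas fi.
  by apply: measurable_maxr => //; apply: measurable_funB => //; exact: mw.
move=> x; rewrite ger0_norm ?mulr_ge0//; last by rewrite le_max lexx orbT.
by apply: ler_wpM2r => //; rewrite ge_max w0 gerBl r0.
Qed.

(** The first moment beyond [r] is a small multiple of the positive interaction. Besides bounding
    the moment, this makes it uniformly integrable along a minimizing sequence, so that the
    centering survives in the limit. *)
Lemma tail_bound (eta : R) : 0 < eta -> exists2 r : R, 0 <= r & forall f, finite_energy f ->
  ri mu (fun x => Num.max (w x - r) 0 * f x) <= eta * epos f.
Proof.
move=> e0; have [r r0 Hr] := HV e0; exists r => // f gf.
have [[fi f0 f1] _ ip _ _] := gf; have mf := itg_meas fi.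
apply: ri_le_ext; first exact: itg_wtail.
rewrite -riZ// -riE; last exact: itgZ.
have pf (z : T * T) : 0 <= eta * (Kp z * (f z.1 * f z.2)).
  by rewrite mulr_ge0 ?(ltW e0)// mulr_ge0 ?Kp0 ?mulr_ge0.
rewrite fubini_tonelli1; last by move=> z; rewrite lee_fin.
  apply: ge0_le_integralT => x.
    by rewrite lee_fin mulr_ge0// le_max lexx orbT.
  rewrite /fubini_F /=.
  have mKx : measurable_fun setT (fun y => Kp (x, y)).
    by apply: (measurableT_comp mKp); exact: measurable_pair1.
  rewrite (_ : (fun y => _) = fun y => ((f x)%:E * (eta * Kp (x, y) * f y)%:E)%E); last first.
    by apply/funext => y; rewrite -EFinM; congr EFin; ring.
  have gy y : 0 <= eta * Kp (x, y) * f y by rewrite mulr_ge0 ?mulr_ge0 ?Kp0 ?(ltW e0).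
  rewrite ge0_integralZl ?lee_fin//; first 1 last.
  - by apply/measurable_EFinP; apply: measurable_funM => //; exact: measurable_funM.
  - by move=> y _; rewrite lee_fin.
  rewrite EFinM muleC; apply: lee_wpmul2l; rewrite ?lee_fin//.
  have [iv wv] := w_le_vari x gf.
  have iv' : itg mu (fun y => Num.max (vari (x, y) - r) 0 * f y).
    apply: (itg_dom _ iv).
      apply: measurable_funM => //; apply: measurable_maxr => //; apply: measurable_funB => //.
      apply: measurable_sum => i; apply: measurableT_comp => //=.
      exact: measurable_funB.
    have v0 y : 0 <= vari (x, y) by exact: sumr_ge0.
    move=> y; rewrite ger0_norm ?mulr_ge0//; last by rewrite le_max lexx orbT.
    by apply: ler_wpM2r => //; rewrite ge_max v0 gerBl r0.
  apply: (@le_trans _ _ (\int[mu]_y (Num.max (vari (x, y) - r) 0 * f y)%:E)%E).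
    rewrite riE// lee_fin ge_max ri_ge0 ?andbT; last first.
      by move=> y; rewrite mulr_ge0// le_max lexx orbT.
    rewrite lerBlDr; apply: (le_trans wv).
    rewrite -[X in _ <= _ + X]mulr1 -f1 -riZ// -riD//; last exact: itgZ.
    apply: ri_le => //; first by apply: itgD => //; exact: itgZ.
    move=> y; rewrite -mulrDl ler_wpM2r// -lerBlDr le_max lexx//.
  apply: ge0_le_integralT => y; rewrite lee_fin.
    by rewrite mulr_ge0// le_max lexx orbT.
  rewrite ler_wpM2r// ge_max mulr_ge0 ?Kp0 ?(ltW e0)// andbT.
  by rewrite lerBlDl.
by apply/measurable_EFinP/measurable_funM => //; exact: itg_meas ip.
Qed.

Lemma mom_bound (eta : R) : 0 < eta -> exists2 r : R, 0 <= r & forall f, finite_energy f ->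
  mom f <= r + eta * epos f.
Proof.
move=> e0; have [r r0 Hr] := tail_bound e0; exists r => // f gf.
have [[fi f0 f1] _ _ _ _] := gf.
apply: le_trans (lerD (lexx _) (Hr f gf)); rewrite -[r in r + _]mulr1 -f1 -riZ// -riD ?itgZ//; last exact: itg_wtail.
apply: ri_le; [exact: good_w | by apply: itgD; [exact: itgZ | exact: itg_wtail] | move=> x].
by rewrite -mulrDl ler_wpM2r// -lerBlDl le_max lexx.
Qed.

(** As [t] exceeds 1/2, half of the negative interaction costs only a fraction 1/(2 t) of the
    relative entropy. Completing the entropy by the moment in turn costs a quarter of the positive
    interaction. *)
Lemma coercive : exists2 C : R, 0 <= C & forall f (B : R), finite_energy f ->
  ent f + 2^-1 * (epos f - eneg f) <= B -> 0 <= B ->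
  [/\ ent f + a * mom f <= C * (B + 1), epos f <= C * (B + 1) & eneg f <= C * (B + 1)].
Proof.
(* With this [eta] in [mom_bound], [a] times the moment is at most a constant plus [epos f / 4]. *)
have a1 : 0 < (4 * (a + 1))^-1 by rewrite invr_gt0 mulr_gt0// ltr_wpDl.
have [r r0 Hr] := mom_bound a1.
have t0 := t_gt0; have s0 : 0 <= s.
  rewrite -lee_fin; apply: le_trans (HS point); apply: integral_ge0 => x _.
  by rewrite lee_fin expR_ge0.
(* (1 - theta) (ent + a mom) + epos / 4 <= B + a r + theta s, with theta = 1 / (2 t) *)
pose th := (2 * t)^-1.
have th0 : 0 < th by rewrite invr_gt0 mulr_gt0.
have th1 : th < 1 by rewrite invf_lt1 ?mulr_gt0// -ltr_pdivrMl// mulr1.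
have [D DE] : exists D, D = a * r + s + 1 by exists (a * r + s + 1).
have D0 : 0 <= D by rewrite DE !addr_ge0// mulr_ge0.
pose C1 := (D + 1) / (1 - th) + s.
have C10 : 0 <= C1.
  by apply: addr_ge0 => //; apply: divr_ge0; [exact: addr_ge0 | rewrite subr_ge0; exact: ltW].
exists (C1 + 4 * (D + 1 + s + 1) + (C1 + s) / t).
  apply: addr_ge0; [apply: addr_ge0 => // | apply: divr_ge0; [exact: addr_ge0 | exact: ltW]].
  by rewrite mulr_ge0// !addr_ge0.
move=> f B gf HB B0; have [[fi f0 f1] _ _ _ _] := gf.
have hn := eneg_bound gf; have n0 := eneg_ge0 f0; have p0 := epos_ge0 f0.
have hm := Hr f gf.
set e := ent f in HB hn *; set m := mom f in hm hn *; set P := epos f in HB hm p0 *.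
set N := eneg f in HB hn n0 *.
have ham : a * m <= a * r + P / 4.
  apply: le_trans (ler_wpM2l a0 hm) _; rewrite mulrDr lerD2l mulrA.
  rewrite mulrC ler_wpM2l// invfM mulrCA -[leRHS]mulr1 ler_wpM2l// ler_pdivrMr ?mul1r ?lerDl//.
  by rewrite ltr_wpDl.
have hN : 2^-1 * N <= th * (e + a * m - 1 + s).
  by rewrite /th invfM -mulrA ler_wpM2l// ler_pdivlMl.
have x0 : 0 <= t * N by rewrite mulr_ge0// ltW.
have x1 : 1 - s <= e + a * m by lra.
have hths : th * s <= s by rewrite ler_piMl// ltW.
have key : (1 - th) * (e + a * m) + P / 4 <= B + D.
  have : th * (e + a * m - 1 + s) = th * (e + a * m) - th + th * s by ring.
  by rewrite DE; lra.
have th1' : 0 < 1 - th by rewrite subr_gt0.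
have lo : - s <= (1 - th) * (e + a * m).
  have := ler_wpM2l (ltW th1') x1; have : 0 <= (1 - th) * 1 by rewrite mulr1 ltW.
  have : (1 - th) * s <= s by rewrite ler_piMl// gerBl ltW.
  lra.
have r1 : e + a * m <= C1 * (B + 1).
  apply: (@le_trans _ _ ((B + D) / (1 - th))).
    by rewrite ler_pdivlMr// mulrC; lra.
  apply: (@le_trans _ _ ((D + 1) / (1 - th) * (B + 1))).
    rewrite mulrAC ler_wpM2r ?invr_ge0 ?(ltW th1')//.
    have : 0 <= D * B by rewrite mulr_ge0.
    lra.
  by apply: ler_wpM2r; rewrite ?addr_ge0// lerDl.
have B1 : 1 <= B + 1 by rewrite lerDr.
have g1 : 0 <= C1 * (B + 1) by rewrite mulr_ge0// addr_ge0.
clearbody C1; set C2 := (C1 + s) / t.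
have C20 : 0 <= C2 by apply: divr_ge0; [exact: addr_ge0 | exact: ltW].
have g4 : 0 <= D * B by rewrite mulr_ge0.
have g5 : 0 <= s * B by rewrite mulr_ge0.
have g3 : P <= 4 * (D + 1 + s + 1) * (B + 1) by lra.
have g6 : N <= C2 * (B + 1).
  by rewrite /C2 mulrAC ler_pdivlMr// mulrC; apply: (le_trans hn); lra.
have g7 : 0 <= 4 * (D + 1 + s + 1) * (B + 1) by rewrite !mulr_ge0 ?addr_ge0.
have g2 : 0 <= C2 * (B + 1) by rewrite mulr_ge0 ?addr_ge0.
have -> : (C1 + 4 * (D + 1 + s + 1) + C2) * (B + 1) =
  C1 * (B + 1) + 4 * (D + 1 + s + 1) * (B + 1) + C2 * (B + 1) by ring.
move: g1 g2 g3 g6 g7 r1; move: (C1 * _) (C2 * _) (4 * _ * _) => u v w' g1 g2 g3 g6 g7 r1.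
by split; move: g1 g2 g3 g6 g7 r1; clear; lra.
Qed.

(** Where f > M q the relative entropy density is at least (ln M - 1) f; elsewhere Young's
    inequality bounds it below by - q, whose integral is at least - s. *)
Lemma excess_bound f (M : R) : finite_energy f -> 1 < ln M -> 0 < M ->
  ri mu (excess q M f) * (ln M - 1) <= ent f + a * mom f - 1 + s.
Proof.
move=> gf M1 M0; have [df fe ip im hl] := gf; have [fi f0 f1] := df.
have [iq qs] := itg_q; have [ir re] := itg_relent df fe (good_w gf).
have ie : itg mu (excess q M f).
  by apply: itg_excess => //; [move=> x; exact: expR_ge0 | exact: ltW].
rewrite -re mulrC -riZ//; apply: le_trans (lerD (lexx _) qs); rewrite -riD//.
apply: ri_le; [exact: itgZ | exact: itgD | move=> x].
have h := xlogx_young (- (a * w x)) (f0 x); rewrite -/(q x) in h.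
rewrite /relent /excess; have q0 : 0 < q x by exact: expR_gt0.
have [c1|c1] := leP (f x - M * q x) 0.
  by rewrite mulr0; move: h; lra.
have Mq : 0 < M * q x by rewrite mulr_gt0.
have fM : M * q x < f x by rewrite -subr_gt0.
have lf : ln M - a * w x <= ln (f x).
  have -> : ln M - a * w x = ln (M * q x) by rewrite lnM ?posrE// /q expRK.
  by apply: ln_le => //; exact: ltW.
have fp : 0 <= f x by [].
have := ler_wpM2l fp lf; have : 0 <= (ln M - 1) * (M * q x) by rewrite mulr_ge0 ?ltW// subr_gt0.
by nra.
Qed.

Lemma uniform_excess (C e : R) : 0 < e -> exists2 M : R, 0 <= M &
  forall f, finite_energy f -> ent f + a * mom f <= C -> ri mu (excess q M f) <= e.
Proof.
move=> e0; pose X := (`|C| + `|s| + 1) / e.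
have X0 : 0 < X by rewrite divr_gt0// ltr_wpDl// addr_ge0.
exists (expR (1 + X)); first exact: expR_ge0.
move=> f gf fC; have := @excess_bound f (expR (1 + X)) gf; rewrite expRK ltrDl X0 expR_gt0 => /(_ isT isT).
rewrite (_ : 1 + X - 1 = X); last by ring.
rewrite /X mulrA ler_pdivrMr// mulrC => h.
have n0 : 0 < `|C| + `|s| + 1 by rewrite ltr_wpDl// addr_ge0.
rewrite -(ler_pM2l n0); apply: (le_trans h); rewrite ler_pM2r//.
have := ler_norm C; have := ler_norm s; lra.
Qed.

(** * Lower semicontinuity along the ultrafilter *)

Section Limit.
Variables (f_ : nat -> T -> R) (C e0 : R).
Hypothesis gf : forall k, finite_energy (f_ k).
Hypothesis bpos : forall k, epos (f_ k) <= C.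
Hypothesis bneg : forall k, eneg (f_ k) <= C.
Variable U : set_system nat.
Hypothesis UF : UltraFilter U.
Hypothesis He0 : forall e : R, 0 < e -> \forall k \near U,
  ent (f_ k) + 2^-1 * (epos (f_ k) - eneg (f_ k)) <= e0 + e.

Variable rho : T -> R.
Hypothesis drho : dens mu rho.
Hypothesis lim1 : forall (phi : T -> R) (N : R), measurable_fun setT phi -> (forall x, `|phi x| <= N) ->
  ri mu (fun x => phi x * f_ k x) @[k --> U] --> ri mu (fun x => phi x * rho x).
Hypothesis lim2 : forall (k : T * T -> R) (N : R), measurable_fun setT k -> (forall x, `|k x| <= N) ->
  ri mu2 (fun z => k z * (f_ j z.1 * f_ j z.2)) @[j --> U] --> ri mu2 (fun z => k z * (rho z.1 * rho z.2)).

Let f0 k x : 0 <= f_ k x. Proof. by have [[]] := gf k. Qed.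
Let rho0 x : 0 <= rho x. Proof. by have [] := drho. Qed.
Let irho : itg mu rho. Proof. by have [] := drho. Qed.
Let rho1 : ri mu rho = 1. Proof. by have [] := drho. Qed.
Let C0 : 0 <= C. Proof. exact: le_trans (epos_ge0 (f0 0%N)) (bpos 0%N). Qed.

Lemma nat_above (x : R) : exists N0 : nat, forall N, (N0 <= N)%N -> x <= N%:R.
Proof.
exists (Num.truncn `|x|).+1 => N hN; apply: le_trans (ler_norm x) _.
by apply: le_trans (ltW (truncnS_gt `|x|)) _; rewrite ler_nat.
Qed.

Lemma trunc_norm (x : R) (N : nat) : 0 <= x -> `|Num.min x N%:R| <= N%:R.
Proof. by move=> x0; rewrite ger0_norm ?le_min ?x0//= ge_min lexx orbT. Qed.

(** The truncations of [k] are bounded test functions; letting the level of truncation grow gives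
    both the integrability of the limit and the bound. *)
Lemma lsc_nonneg d' (S : measurableType d') (m : {measure set S -> \bar R})
    (F_ : nat -> S -> R) (F : S -> R) (k : S -> R) (b : R) :
  measurable_fun setT k -> (forall x, 0 <= k x) -> (forall x, 0 <= F x) -> itg m F ->
  (forall j x, 0 <= F_ j x) -> (forall j, itg m (F_ j)) ->
  (forall (phi : S -> R) (N : R), measurable_fun setT phi -> (forall x, `|phi x| <= N) ->
    ri m (fun x => phi x * F_ j x) @[j --> U] --> ri m (fun x => phi x * F x)) ->
  (forall j, itg m (fun x => k x * F_ j x)) -> (forall j, ri m (fun x => k x * F_ j x) <= b) ->
  itg m (fun x => k x * F x) /\ ri m (fun x => k x * F x) <= b.
Proof.
move=> mk k0 F0 iF F_0 iF_ lim ik kb.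
have mt (N : nat) : measurable_fun setT (fun x => Num.min (k x) N%:R) by exact: measurable_minr.
apply: (@itg_lim _ _ _ _ (fun N x => Num.min (k x) N%:R * F x)).
- by apply: measurable_funM => //; exact: itg_meas iF.
- by move=> x; rewrite mulr_ge0.
- by move=> N x; rewrite mulr_ge0// le_min k0/=.
- by move=> N; apply: (itg_bM (k := N%:R)) => // x; exact: trunc_norm.
- move=> x; have [N0 HN0] := nat_above (k x); exists N0 => N /HN0 h.
  by congr (_ * _); apply/min_idPl.
- move=> e ep; exists 0%N => N _; rewrite -[leLHS]addr0; apply: lerD; last exact: ltW.
  apply: (cvgr_to_le (lim _ N%:R (mt N) (fun x => trunc_norm N (k0 x)))).
  apply: nearW => j; apply: le_trans (kb j).
  apply: ri_le => //; first by apply: (itg_bM (k := N%:R)) => // x; exact: trunc_norm.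
  by move=> x; rewrite ler_wpM2r// ge_min lexx.
Qed.

Let ff0 j (z : T * T) : 0 <= f_ j z.1 * f_ j z.2. Proof. by rewrite mulr_ge0. Qed.
Let iff j : itg mu2 (fun z => f_ j z.1 * f_ j z.2).
Proof. by have [dj _ _ _ _] := gf j; have [] := dens_prod dj. Qed.

Lemma limit_pos : itg mu2 (fun z => Kp z * (rho z.1 * rho z.2)) /\ epos rho <= C.
Proof.
have [i1 i2 _] := dens_prod drho.
by apply: (lsc_nonneg mKp Kp0 i2 i1 ff0 iff lim2) => // j; have [] := gf j.
Qed.

Lemma limit_neg : itg mu2 (fun z => Km z * (rho z.1 * rho z.2)) /\ eneg rho <= C.
Proof.
have [i1 i2 _] := dens_prod drho.
by apply: (lsc_nonneg mKm Km0 i2 i1 ff0 iff lim2) => // j; have [] := gf j.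
Qed.

Lemma limit_mom : itg mu (fun x => w x * rho x).
Proof.
have [r r0 Hr] := mom_bound ltr01.
have [|j|j|] := lsc_nonneg (b := r + C) mw w0 rho0 irho f0 _ lim1 => //.
- by move=> j; have [[]] := gf j.
- exact: good_w.
- by apply: le_trans (Hr _ (gf j)) _; rewrite mul1r lerD2l.
Qed.

(** Clamped at a level [r], the function is a bounded test function. What is cut off is small
    uniformly in [k] by [tail_bound], and then also for [rho] by lower semicontinuity. *)
Lemma limit_moment (phi : T -> R) : measurable_fun setT phi -> (forall x, `|phi x| <= w x) ->
  ri mu (fun x => phi x * f_ k x) @[k --> U] --> ri mu (fun x => phi x * rho x).
Proof.
move=> mp pw; apply/cvgrPdist_le => e ep.
have eta0 : 0 < e / 4 / (C + 1) by rewrite !divr_gt0// ltr_wpDl.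
have [r r0 Hr] := tail_bound eta0.
pose tl x := Num.max (w x - r) 0; pose ps x := Num.max (- r) (Num.min r (phi x)).
have mtl : measurable_fun setT tl.
  by apply: measurable_maxr => //; apply: measurable_funB => //; exact: mw.
have mps : measurable_fun setT ps by apply: measurable_maxr => //; exact: measurable_minr.
have psr x : `|ps x| <= r.
  rewrite ler_norml le_max lexx /= ge_max ge_min lexx /= andbT.
  by rewrite (le_trans _ r0)// oppr_le0.
have tl0 x : 0 <= tl x by rewrite le_max lexx orbT.
have tb k : ri mu (fun x => tl x * f_ k x) <= e / 4.
  apply: le_trans (Hr _ (gf k)) _; apply: le_trans (ler_wpM2l (ltW eta0) (bpos k)) _.
  rewrite mulrAC ler_pdivrMr; last by rewrite ltr_wpDl.
  by rewrite ler_wpM2l ?lerDl// ltW// divr_gt0.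
have [it tr] : itg mu (fun x => tl x * rho x) /\ ri mu (fun x => tl x * rho x) <= e / 4.
  apply: (lsc_nonneg mtl tl0 rho0 irho f0 _ lim1) => // j; first by have [[]] := gf j.
  exact: itg_wtail.
have pt x : `|phi x - ps x| <= tl x.
  exact: clamp_close.
have close (g : T -> R) : (forall x, 0 <= g x) -> itg mu g -> itg mu (fun x => w x * g x) ->
    itg mu (fun x => tl x * g x) -> ri mu (fun x => tl x * g x) <= e / 4 ->
    `|ri mu (fun x => phi x * g x) - ri mu (fun x => ps x * g x)| <= e / 4.
  move=> g0 ig iw itl hb.
  have ip : itg mu (fun x => phi x * g x).
    apply: (itg_dom _ iw); first by apply: measurable_funM => //; exact: itg_meas ig.
    by move=> x; rewrite normrM (ger0_norm (g0 x)) ler_wpM2r.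
  have ips : itg mu (fun x => ps x * g x) by apply: (itg_bM (k := r)).
  rewrite -riB//; apply: le_trans (ri_norm (itgB ip ips)) _; apply: le_trans hb.
  apply: ri_le => //; first exact: integrable_norm (itgB ip ips).
  by move=> x; rewrite -mulrBl normrM (ger0_norm (g0 x)) ler_wpM2r.
have c1 := close rho rho0 irho limit_mom it tr.
have e4 : 0 < e / 4 by rewrite divr_gt0.
have /cvgrPdist_le/(_ _ e4) := lim1 mps psr; apply: filterS => k c2.
have c3 := close (f_ k) (f0 k) (let: And3 i _ _ := let: And5 d' _ _ _ _ := gf k in d' in i)
  (good_w (gf k)) (itg_wtail (gf k) r0) (tb k).
move: c1 c2 c3; move: (ri mu _) (ri mu _) (ri mu _) (ri mu _) => p q' r' t'.
rewrite !ler_norml => /andP[? ?] /andP[? ?] /andP[? ?]; apply/andP; split; lra.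
Qed.

Lemma limit_centered i : itg mu (fun x => l i x * rho x) /\ ri mu (fun x => l i x * rho x) = 0.
Proof.
have lw x : `|l i x| <= w x by rewrite /absl (bigD1 i)//= lerDl sumr_ge0.
split.
  apply: (itg_dom _ limit_mom); first by apply: measurable_funM => //; exact: itg_meas irho.
  by move=> x; rewrite normrM (ger0_norm (rho0 x)) ler_wpM2r.
apply: (cvg_unique _ (limit_moment (ml i) lw)) => //.
rewrite (_ : (fun k => _) = fun=> 0); first exact: cvg_cst.
by apply/funext => k; have [_ _ _ _ /(_ i)[]] := gf k.
Qed.

(** For the entropy relative to [base], the optimal dual variable in Young's inequality at [rho] is
    the logarithm of rho / base, which is [ratio]. It depends on both points through [K]. [dual N]
    confines it to [-N, N], making it a bounded test function. *)
Definition ratio z := rho z.1 * expR (2^-1 * K z + a * w z.1).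
Definition dual (N : nat) z := Num.min N%:R (ln (Num.max (ratio z) (expR (- N%:R)))).
Definition base z := expR (- (2^-1 * K z + a * w z.1)).

Lemma mexpo : measurable_fun setT (fun z : T * T => 2^-1 * K z + a * w z.1).
Proof.
apply: measurable_funD; first exact: measurable_funM.
by apply: measurable_funM => //; exact: meas1 mw.
Qed.

Lemma mdual N : measurable_fun setT (dual N).
Proof.
apply: measurable_minr => //; apply: measurableT_comp => //; apply: measurable_maxr => //.
apply: measurable_funM; first exact: meas1 (itg_meas irho).
by apply: measurableT_comp => //; exact: mexpo.
Qed.

Lemma mbase : measurable_fun setT base.
Proof. by apply: measurableT_comp => //; apply: measurableT_comp => //; exact: mexpo. Qed.

Lemma base_kern z : base z <= kern z.
Proof.
rewrite ler_expR opprD lerD2r KE; have h1 := Kp0 z; have h2 := Km0 z.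
by have := ler_wpM2r h2 (ltW t2); lra.
Qed.

Lemma base_int y : (\int[mu]_x (base (x, y))%:E <= s%:E)%E.
Proof.
apply: le_trans (HS y); apply: ge0_le_integralT => x; first by rewrite lee_fin expR_ge0.
by rewrite lee_fin; exact: base_kern.
Qed.

Lemma itg_base f : dens mu f -> itg mu2 (fun z => base z * f z.2) /\ ri mu2 (fun z => base z * f z.2) <= s.
Proof.
move=> [fi f0' f1]; have [h1 h2] := itg_kernel mbase (fun z => expR_ge0 _) base_int fi f0'.
by split => //; rewrite -[s]mulr1 -f1.
Qed.

Lemma ratioE z : ratio z * base z = rho z.1.
Proof. by rewrite /ratio /base -mulrA -expRD subrr expR0 mulr1. Qed.

Lemma dual_norm N z : `|dual N z| <= N%:R.
Proof.
rewrite ler_norml ge_min lexx /= andbT le_min; apply/andP; split.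
  by apply: (@le_trans _ _ 0); rewrite ?oppr_le0.
rewrite -[leLHS]expRK; apply: ln_le; first exact: expR_gt0.
by rewrite le_max lexx orbT.
Qed.

Lemma dual_base N z : expR (dual N z) * base z <= rho z.1 + expR (- N%:R) * base z.
Proof.
rewrite -ratioE -mulrDl ler_wpM2r ?expR_ge0//.
have p : 0 < Num.max (ratio z) (expR (- N%:R)) by rewrite lt_max expR_gt0 orbT.
apply: (@le_trans _ _ (Num.max (ratio z) (expR (- N%:R)))).
  by rewrite -[leRHS]lnK ?posrE// ler_expR ge_min lexx orbT.
have r0 : 0 <= ratio z by rewrite mulr_ge0 ?expR_ge0.
by rewrite ge_max lerDl expR_ge0 lerDr.
Qed.

(** An integrable lower bound uniform in [N], for Fatou's lemma. *)
Lemma dual_lower N z : - base z <= dual N z * rho z.1.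
Proof.
rewrite -ratioE mulrA -[- base z]mulN1r ler_wpM2r ?expR_ge0//.
have r0 : 0 <= ratio z by rewrite mulr_ge0 ?expR_ge0.
have [d0|d0] := leP 0 (dual N z); first by apply: (@le_trans _ _ 0); rewrite ?oppr_le0 ?mulr_ge0.
have [->|rn] := eqVneq (ratio z) 0; first by rewrite mulr0.
have rp : 0 < ratio z by rewrite lt_neqAle eq_sym rn.
have : ln (ratio z) <= dual N z.
  rewrite le_min; apply/andP; split; last by apply: ln_le => //; rewrite le_max lexx.
  have : dual N z < N%:R by apply: lt_le_trans d0 _.
  rewrite /dual gt_min ltxx /= => h; apply: le_trans (ltW h).
  by apply: ln_le => //; rewrite le_max lexx.
move=> h; have := ler_wpM2l r0 h; have := xlogx_young 0 r0; rewrite mulr0 expR0 sub0r.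
by rewrite [dual N z * _]mulrC; lra.
Qed.

Lemma dual_eventually z : exists N0, forall N, (N0 <= N)%N ->
  dual N z * rho z.1 = (ln (rho z.1) + (2^-1 * K z + a * w z.1)) * rho z.1.
Proof.
have [->|rn] := eqVneq (rho z.1) 0; first by exists 0%N => N _; rewrite !mulr0.
have rp : 0 < rho z.1 by rewrite lt_neqAle eq_sym rn; exact: rho0.
have lr : ln (ratio z) = ln (rho z.1) + (2^-1 * K z + a * w z.1).
  by rewrite lnM ?posrE ?expR_gt0// expRK.
have rr : 0 < ratio z by rewrite mulr_gt0 ?expR_gt0.
have [N0 HN0] := nat_above `|ln (ratio z)|; exists N0 => N /HN0.
rewrite ler_norml => /andP[h1 h2]; congr (_ * _); rewrite -lr /dual.
rewrite (max_idPl _); first exact/min_idPr.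
by rewrite -[leRHS]lnK ?posrE// ler_expR.
Qed.

(** Young's inequality for [f_ k] with the dual variable of the limit [rho]. All terms of the lower
    bound converge along [U], and at [rho] the exponential term is at most 1 up to the truncation
    error. *)
Lemma dual_limit N : ri mu2 (fun z => dual N z * (rho z.1 * rho z.2)) <=
  e0 + a * mom rho + expR (- N%:R) * s.
Proof.
pose c z := expR (dual N z) * base z.
have mc : measurable_fun setT c.
  by apply: measurable_funM; [apply: measurableT_comp => //; exact: mdual | exact: mbase].
have c0 z : 0 <= c z by rewrite mulr_ge0 ?expR_ge0.
pose B := expR N%:R * s.
have cB y : (\int[mu]_x (c (x, y))%:E <= B%:E)%E.
  apply: (@le_trans _ _ (\int[mu]_x ((expR N%:R)%:E * (base (x, y))%:E))%E).
    apply: ge0_le_integralT => x; first by rewrite lee_fin.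
    rewrite -EFinM lee_fin ler_wpM2r ?expR_ge0// ler_expR.
    by have := dual_norm N (x, y); rewrite ler_norml => /andP[].
  rewrite ge0_integralZl//; first by rewrite EFinM lee_wpmul2l ?lee_fin ?expR_ge0// base_int.
  - by apply/measurable_EFinP; exact: meas_sec mbase.
  - by move=> x _; rewrite lee_fin expR_ge0.
(* [c] may be unbounded, but its integral in [x] is a bounded function of [y], to which the
   convergence of single densities applies. *)
pose Bf y := fine (\int[mu]_x (c (x, y))%:E).
have BfE y : (\int[mu]_x (c (x, y))%:E = (Bf y)%:E)%E.
  rewrite fineK// ge0_fin_numE; first exact: le_lt_trans (cB y) (ltry _).
  by apply: integral_ge0 => x _; rewrite lee_fin.
have Bf0 y : 0 <= Bf y by apply: fine_ge0; apply: integral_ge0 => x _; rewrite lee_fin.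
have Bfb y : `|Bf y| <= B by rewrite ger0_norm// -lee_fin -BfE.
have mBf : measurable_fun setT Bf.
  apply/measurable_EFinP; rewrite (_ : EFin \o Bf = fubini_G mu (EFin \o c)).
    by apply: measurable_fun_fubini_tonelli_G => [|z]; [exact/measurable_EFinP | rewrite lee_fin].
  by apply/funext => y; rewrite /= -BfE.
have cE f : dens mu f -> itg mu2 (fun z => c z * f z.2) /\
    ri mu2 (fun z => c z * f z.2) = ri mu (fun y => Bf y * f y).
  move=> [fi f0' f1]; have [i1 _] := itg_kernel mc c0 cB fi f0'; split => //.
  apply: EFin_inj; rewrite -riE// fubini_tonelli2.
  - rewrite -riE; last by apply: (itg_bM (k := B)).
    apply: eq_integral => y _; rewrite /fubini_G EFinM -BfE muleC.
    under eq_integral do rewrite mulrC EFinM.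
    rewrite /= ge0_integralZl ?lee_fin//; first by apply/measurable_EFinP; exact: meas_sec.
    by move=> x _; rewrite lee_fin.
  - by apply/measurable_EFinP; exact: itg_meas i1.
  - by move=> z; rewrite lee_fin mulr_ge0.
have md := mdual N; have dn := dual_norm N.
have ineq k : ri mu2 (fun z => dual N z * (f_ k z.1 * f_ k z.2)) + 1 - ri mu (fun y => Bf y * f_ k y) <=
    ent (f_ k) + 2^-1 * (epos (f_ k) - eneg (f_ k)) + a * mom (f_ k).
  have [dk fe ip im hl] := gf k; have [fi fk0 f1] := dk.
  have [ic <-] := cE _ dk; have [iff' _ ff1] := dens_prod dk.
  have idf : itg mu2 (fun z => dual N z * (f_ k z.1 * f_ k z.2)) by apply: (itg_bM (k := N%:R)).
  have [ie ee] := itg_prod fe fi; have [iw ew] := itg_prod (good_w (gf k)) fi.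
  rewrite -[X in _ + X - _]ff1 -riD// -riB//; last exact: itgD.
  have -> : ent (f_ k) + 2^-1 * (epos (f_ k) - eneg (f_ k)) + a * mom (f_ k) =
      ri mu2 (fun z => f_ k z.1 * ln (f_ k z.1) * f_ k z.2 +
        2^-1 * (Kp z * (f_ k z.1 * f_ k z.2) - Km z * (f_ k z.1 * f_ k z.2)) + a * (w z.1 * f_ k z.1 * f_ k z.2)).
    rewrite riD; [|by apply: itgD => //; apply: itgZ; exact: itgB|exact: itgZ].
    rewrite riD//; last by apply: itgZ; exact: itgB.
    rewrite (riZ 2^-1 (itgB ip im)).
    by rewrite riB// riZ// ee ew f1 !mulr1.
  apply: ri_le.
  - by apply: itgB => //; exact: itgD.
  - by apply: itgD; [apply: itgD => //; apply: itgZ; exact: itgB | exact: itgZ].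
  - move=> z; have h := xlogx_young (dual N z - (2^-1 * K z + a * w z.1)) (fk0 z.1).
    rewrite expRD -/(base z) -/(c z) in h; have := ler_wpM2r (fk0 z.2) h.
    by rewrite KE; lra.
have L1 := lim2 md dn; have L2 := lim1 mBf Bfb.
have L3 := limit_moment mw (fun x => _ : `|w x| <= w x).
have {}L3 : mom (f_ k) @[k --> U] --> mom rho by apply: L3 => x; rewrite ger0_norm ?w0.
have [icr cr] := cE _ drho; have [ib bs] := itg_base drho; have [irr rr0 rr1] := dens_prod drho.
have b1 : ri mu2 (fun z => c z * rho z.2) <= 1 + expR (- N%:R) * s.
  apply: le_trans (lerD (lexx _) (ler_wpM2l (expR_ge0 _) bs)); rewrite -[X in _ <= X + _]rr1 -riZ// -riD//; last exact: itgZ.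
  apply: ri_le => //; first by apply: itgD => //; exact: itgZ.
  move=> z; rewrite mulrA -mulrDl ler_wpM2r//; exact: dual_base.
have L : ri mu2 (fun z => dual N z * (f_ k z.1 * f_ k z.2)) + 1 - ri mu (fun y => Bf y * f_ k y) - a * mom (f_ k)
   @[k --> U] --> ri mu2 (fun z => dual N z * (rho z.1 * rho z.2)) + 1 - ri mu (fun y => Bf y * rho y) - a * mom rho.
  by apply: cvgB; [apply: cvgB => //; apply: cvgD => //; exact: cvg_cst | exact: cvgMr].
suff : ri mu2 (fun z => dual N z * (rho z.1 * rho z.2)) + 1 - ri mu (fun y => Bf y * rho y) - a * mom rho <= e0.
  by rewrite -cr; lra.
apply/ler_addgt0Pr => e ep; apply: (cvgr_to_le L); apply: filterS (He0 ep) => k hk.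
by have := ineq k; lra.
Qed.

(** [N] tends to infinity in [dual_limit], after adding the integral of [base] to make the
    integrands nonnegative. Convergence of the moments, already known, removes the weight. *)
Theorem limit_good : finite_energy rho /\ ent rho + 2^-1 * (epos rho - eneg rho) <= e0.
Proof.
have [ip _] := limit_pos; have [im _] := limit_neg; have iw := limit_mom.
have [ib bs] := itg_base drho; have [irr rr0 rr1] := dens_prod drho.
have [iwr ewr] := itg_prod iw irho.
have mr := itg_meas irho.
pose F z := (ln (rho z.1) + (2^-1 * K z + a * w z.1)) * rho z.1 * rho z.2 + base z * rho z.2.
have idr N : itg mu2 (fun z => dual N z * (rho z.1 * rho z.2)).
  by apply: (itg_bM (k := N%:R)); [exact: mdual | exact: dual_norm | exact: irr].
have [] := @itg_lim _ _ _ mu2 (fun N z => dual N z * (rho z.1 * rho z.2) + base z * rho z.2) F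
  (e0 + a * mom rho + ri mu2 (fun z => base z * rho z.2)).
- apply: measurable_funD; last exact: itg_meas ib.
  apply: measurable_funM; last exact: meas2.
  apply: measurable_funM; last exact: meas1.
  apply: measurable_funD; last exact: mexpo.
  by apply: (meas1 (phi := fun x => ln (rho x))); exact: measurableT_comp.
- move=> z; rewrite /F; have [N0 /(_ N0 (leqnn _)) <-] := dual_eventually z.
  by rewrite -mulrDl mulr_ge0// -lerBlDr sub0r dual_lower.
- by move=> N z; rewrite mulrA -mulrDl mulr_ge0// -lerBlDr sub0r dual_lower.
- by move=> N; exact: itgD.
- move=> z; have [N0 HN0] := dual_eventually z; exists N0 => N /HN0 h.
  by rewrite mulrA h.
- move=> e ep; have [N0 HN0] := nat_above (`|s| / e); exists N0 => N /HN0 hN.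
  rewrite riD// [leRHS]addrAC lerD2r; apply: le_trans (dual_limit N) _; rewrite lerD2l.
  have [N1|N1] := leP N%:R (0 : R).
    have s0 : `|s| / e <= 0 := le_trans hN N1.
    have : `|s| <= 0 by rewrite -(pmulr_lle0 _ (_ : 0 < e^-1)) ?invr_gt0// mulrC.
    by rewrite normr_le0 => /eqP ->; rewrite mulr0 ltW.
  rewrite ler_pdivrMr// in hN; apply: le_trans (ler_wpM2l (expR_ge0 _) (ler_norm s)) _.
  rewrite expRN mulrC ler_pdivrMr ?expR_gt0//; apply: (le_trans hN); rewrite mulrC ler_wpM2l ?(ltW ep)//.
  by apply: le_trans (expR_ge1Dx _); rewrite lerDr.
move=> iF Fb.
(* Subtracting the integrable terms isolates rho(x) ln rho(x) rho(y); its integrability on the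
   square gives that of the entropy by Fubini. *)
pose G z := F z - base z * rho z.2 - 2^-1 * (Kp z * (rho z.1 * rho z.2) - Km z * (rho z.1 * rho z.2)) -
  a * (w z.1 * rho z.1 * rho z.2).
have GE : G = fun z => rho z.1 * ln (rho z.1) * rho z.2.
  by apply/funext => z; rewrite /G /F KE; ring.
have iP : itg mu2 (fun z => 2^-1 * (Kp z * (rho z.1 * rho z.2) - Km z * (rho z.1 * rho z.2))).
  by apply: itgZ; exact: itgB.
have iFb : itg mu2 (fun z => F z - base z * rho z.2) by exact: itgB.
have iFP : itg mu2 (fun z => F z - base z * rho z.2 - 2^-1 * (Kp z * (rho z.1 * rho z.2) - Km z * (rho z.1 * rho z.2))).
  exact: itgB.
have iaw : itg mu2 (fun z => a * (w z.1 * rho z.1 * rho z.2)) by exact: itgZ.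
have iG : itg mu2 G by exact: itgB.
have mrl : measurable_fun setT (fun x => rho x * ln (rho x)).
  by apply: measurable_funM => //; exact: measurableT_comp.
have ie : itg mu (fun x => rho x * ln (rho x)).
  have mG : measurable_fun setT (EFin \o G) by exact: measurable_int iG.
  have [/(_ iG) h _] : mu2.-integrable setT (EFin \o G) <->
    (\int[mu]_x \int[mu]_y `|(EFin \o G) (x, y)| < +oo)%E by exact: integrable12ltyP.
  apply/integrableP; split; first exact/measurable_EFinP.
  apply: le_lt_trans h; apply: ge0_le_integralT => x //=.
  rewrite -[leLHS]mule1 -[1%E](_ : \int[mu]_y (rho y)%:E = 1)%E; last by rewrite riE// rho1.
  rewrite -ge0_integralZl//; first 1 last.
  - exact/measurable_EFinP.
  - by move=> y _; rewrite lee_fin.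
  apply: ge0_le_integralT => y; first by rewrite mule_ge0// lee_fin.
  rewrite (_ : G (x, y) = rho x * ln (rho x) * rho y); last by rewrite GE.
  by rewrite [X in (_ <= X%:E)%E]normrM (ger0_norm (rho0 y)) EFinM.
have grho : finite_energy rho by split => // i; exact: limit_centered.
split => //; have [_ eG] := itg_prod ie irho.
have : ri mu2 G = ent rho by rewrite GE eG rho1 mulr1.
rewrite /G riB// riB// riB// (riZ 2^-1 (itgB ip im)).
rewrite riB// riZ// ewr rho1 mulr1 -/(epos rho) -/(eneg rho) -/(mom rho).
by move: Fb; lra.
Qed.

End Limit.

(** The first alternative is that of no density with finite energy; minimizing sequences exist only
    in the second. *)
Theorem minimizer : (forall f, admissible f -> functional f = +oo%E) \/
  exists rho, finite_energy rho /\ forall f, admissible f -> (functional rho <= functional f)%E.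
Proof.
pose J f := ent f + 2^-1 * (epos f - eneg f).
have [[f1 gf1]|none] := pselect (exists f, finite_energy f); last first.
  left=> f af; apply/eqP; rewrite -leye_eq leNgt; apply/negP => h.
  by apply: none; exists f; exact: finite_energy_of.
right; have [C C0 HC] := coercive; have [r r0 Hr] := mom_bound ltr01.
have lowb f : finite_energy f -> - (a * (r + C) + s + C + 1) <= J f.
  move=> gf; have [Jf|Jf] := leP (J f) 0; last first.
    apply: le_trans (ltW Jf); rewrite oppr_le0.
    have s0 : 0 <= s by rewrite (le_trans _ (itg_q).2)//; apply: ri_ge0 => x; exact: expR_ge0.
    by rewrite !addr_ge0// mulr_ge0// addr_ge0.
  have [h1 h2 h3] := HC f 0 gf Jf (lexx _); rewrite add0r mulr1 in h1 h2 h3.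
  have h4 := eneg_bound gf; have h5 := Hr _ gf; rewrite mul1r in h5.
  have [[_ f0 _] _ _ _ _] := gf; have p0 := epos_ge0 f0; have n0 := eneg_ge0 f0.
  have h6 : 0 <= t * eneg f by rewrite mulr_ge0// ltW// t_gt0.
  have h7 : a * mom f <= a * (r + C) by rewrite ler_wpM2l//; lra.
  by rewrite /J; lra.
pose A := [set J f | f in finite_energy].
have hA : has_inf A.
  split; first by exists (J f1), f1.
  by exists (- (a * (r + C) + s + C + 1)) => _ [f gf <-]; exact: lowb.
have seq (k : nat) : exists f, finite_energy f /\ J f < inf A + k.+1%:R^-1.
  have e0 : 0 < k.+1%:R^-1 :> R by rewrite invr_gt0.
  by have [_ [f gf <-] h] := inf_adherent e0 hA; exists f.
have /choice[f_ Hf] := seq.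
have gf k : finite_energy (f_ k) by have [] := Hf k.
pose B := `|inf A| + 1; have B0 : 0 <= B by rewrite addr_ge0.
have JB k : J (f_ k) <= B.
  have [_ h] := Hf k; apply: (le_trans (ltW h)); apply: lerD; first exact: ler_norm.
  by rewrite invf_le1 ?ltr0n// ler1n.
have [U [UF sU]] := ultraFilterLemma (_ : ProperFilter (\oo : set_system nat)).
have bpos k : epos (f_ k) <= C * (B + 1) by have [] := HC _ _ (gf k) (JB k) B0.
have bneg k : eneg (f_ k) <= C * (B + 1) by have [] := HC _ _ (gf k) (JB k) B0.
have df k : dens mu (f_ k) by have [] := gf k.
have ui (e : R) : 0 < e -> exists2 M : R, 0 <= M & forall k, ri mu (excess q M (f_ k)) <= e.
  by move=> e0; have [M M0 HM] := uniform_excess (C * (B + 1)) e0; exists M => // k; apply: HM => //; have [] := HC _ _ (gf k) (JB k) B0.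
have [rho [drho lim1 lim2]] := dens_compact df (fun x => expR_ge0 _) (itg_q).1 ui UF.
have He0 (e : R) : 0 < e -> \forall k \near U, ent (f_ k) + 2^-1 * (epos (f_ k) - eneg (f_ k)) <= inf A + e.
  move=> e0; apply: sU; have [N0 HN0] := nat_above e^-1; exists N0 => // k /= hk.
  have [_ h] := Hf k; apply: (le_trans (ltW h)); rewrite lerD2l.
  rewrite -[leRHS]invrK lef_pV2 ?posrE ?ltr0n ?invr_gt0//.
  by apply: le_trans (HN0 _ hk) _; rewrite ler_nat.
have [grho Jrho] := limit_good gf bpos bneg UF He0 drho lim1 lim2.
exists rho; split => // f af; rewrite functional_finite_energy//.
have [h|h] := pselect ((functional f < +oo)%E); last first.
  by move/negP: h; rewrite -leNgt leye_eq => /eqP ->; exact: leey.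
have gff := finite_energy_of af h; rewrite functional_finite_energy// lee_fin.
by apply: le_trans Jrho _; apply: ge_inf; [exact: hA.2 | exists f].
Qed.

End Variational.

(** * Singular kernels and centered densities *)

Section Shells.
Context d (T : measurableType d) (R : realType) (mu : {measure set T -> \bar R}).

Lemma nneseries_geometric (u : nat -> \bar R) (C r : R) : 0 <= C -> 0 <= r < 1 ->
  (forall k, 0 <= u k)%E -> (forall k, u k <= (C * r ^+ k)%:E)%E ->
  (\sum_(0 <= k <oo) u k <= (C / (1 - r))%:E)%E.
Proof.
move=> C0 /andP[r0 r1] u0 uC; apply: lime_le; first by apply: is_cvg_nneseries => k _ _; exact: u0.
apply: nearW => N; apply: (@le_trans _ _ (\sum_(0 <= k < N) (C * r ^+ k)%:E)%E).
  by apply: lee_sum => k _; exact: uC.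
rewrite sumEFin lee_fin ler_pdivlMr ?subr_gt0// big_mkord -mulr_sumr -mulrA.
rewrite -[leRHS]mulr1 ler_wpM2l//.
have : (\sum_(i < N) r ^+ i) * (1 - r) = 1 - r ^+ N.
  elim: N => [|N IH]; first by rewrite big_ord0 mul0r expr0 subrr.
  by rewrite big_ord_recr /= mulrDl IH exprS; ring.
by move=> ->; rewrite gerBl exprn_ge0.
Qed.

Lemma shell_series (A : nat -> set T) (b : nat -> R) (C r : R) : 0 <= C -> 0 <= r < 1 ->
  (forall k, measurable (A k)) -> (forall k, 0 <= b k) ->
  (forall k, (b k)%:E * mu (A k) <= (C * r ^+ k)%:E)%E ->
  let s x := (\sum_(0 <= k <oo) (b k * \1_(A k) x)%:E)%E in
  [/\ measurable_fun setT s, forall x, (0 <= s x)%E, forall k x, A k x -> ((b k)%:E <= s x)%E &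
      (\int[mu]_x s x <= (C / (1 - r))%:E)%E].
Proof.
move=> C0 r01 mA b0 H /=.
have mb k : measurable_fun setT (fun x => (b k * \1_(A k) x)%:E).
  by apply/measurable_EFinP; apply: measurable_funM => //; exact: measurable_indic.
have t0 k x : (0 <= (b k * \1_(A k) x)%:E)%E.
  by rewrite lee_fin mulr_ge0//; have /andP[] := ind01 R (A k) x.
split.
- apply: (@ge0_emeasurable_sum _ _ _ _ (fun k x => (b k * \1_(A k) x)%:E) xpredT); by move=> *.
- by move=> x; apply: nneseries_ge0.
- move=> k x Akx; apply: le_trans (nneseries_lim_ge k.+1 _); last by move=> j _ _.
  rewrite big_mkord big_ord_recr /= indicE mem_set// mulr1 leeDr// sume_ge0//.
- rewrite integral_nneseries//; apply: nneseries_geometric => // k; first exact: integral_ge0.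
  apply: le_trans (H k); under eq_integral do rewrite EFinM.
  rewrite ge0_integralZl//; first by rewrite integral_indic// setIT.
  + by apply/measurable_EFinP; exact: measurable_indic.
  + by rewrite lee_fin.
Qed.

(** Two families of sets, one going to infinity and one shrinking to the singularity. On each set
    the bound on [f] times the measure decays geometrically. *)
Lemma shell_bound (A A' : nat -> set T) (b b' : nat -> R) (C C' r r' : R) (f : T -> R) :
  0 <= C -> 0 <= r < 1 -> 0 <= C' -> 0 <= r' < 1 ->
  (forall k, measurable (A k)) -> (forall k, 0 <= b k) ->
  (forall k, (b k)%:E * mu (A k) <= (C * r ^+ k)%:E)%E ->
  (forall k, measurable (A' k)) -> (forall k, 0 <= b' k) ->
  (forall k, (b' k)%:E * mu (A' k) <= (C' * r' ^+ k)%:E)%E ->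
  (forall x, 0 <= f x) ->
  (forall x, (exists k, A k x /\ f x <= b k) \/ (exists k, A' k x /\ f x <= b' k)) ->
  (\int[mu]_x (f x)%:E <= (C / (1 - r) + C' / (1 - r'))%:E)%E.
Proof.
move=> C0 r01 C0' r01' mA b0 H mA' b0' H' f0 cov.
have [m1 p1 g1 i1] := shell_series C0 r01 mA b0 H.
have [m2 p2 g2 i2] := shell_series C0' r01' mA' b0' H'.
rewrite EFinD; apply: le_trans (leeD i1 i2); rewrite -ge0_integralD//.
apply: ge0_le_integralT => x; first by rewrite lee_fin.
have [[k [Ax fx]]|[k [Ax fx]]] := cov x.
  apply: (@le_trans _ _ (b k)%:E); first by rewrite lee_fin.
  by apply: le_trans (g1 k x Ax) _; rewrite leeDl.
apply: (@le_trans _ _ (b' k)%:E); first by rewrite lee_fin.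
by apply: le_trans (g2 k x Ax) _; rewrite leeDr.
Qed.

End Shells.

Lemma measurable_preimage_gt d (T : measurableType d) (R : realType) (f : T -> R) :
  (forall a : R, measurable (f @^-1` [set t | a < t])) -> measurable_fun setT f.
Proof.
move=> H; apply: (measurability _ (RGenOInfty.measurableE R)).
move=> /= _ [_ [a ->]] <-; rewrite setTI (_ : _ @^-1` _ = f @^-1` [set t | a < t])//.
by apply/seteqP; split => x /=; rewrite in_itv /= andbT.
Qed.

(** * Borel measurability on the manifold and its square *)

Section Borel.
Context {R : realType} {M : ptopologicalType}.

Lemma continuous_borel (f : M -> R) : continuous f -> measurable_fun setT (f : borel M -> R).
Proof.
move=> cf; apply: measurable_preimage_gt => a; apply: open_borel.
apply: open_comp; last exact: open_gt.
by move=> x _; exact: cf.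
Qed.

(** Measurability refers to the product of the Borel sigma-algebras. Second countability writes an
    open subset of the square as a countable union of open rectangles, which belong to it. *)
Lemma continuous_borel2 (f : M * M -> R) : @second_countable M -> continuous f ->
  measurable_fun setT (f : borel M * borel M -> R).
Proof.
move=> [B cB [oB bB]] cf; apply: measurable_preimage_gt => a.
set O := _ @^-1` _.
have oO : open (O : set (M * M)) by apply: open_comp; [move=> x _; exact: cf | exact: open_gt].
pose I := [set p : set M * set M | [/\ B p.1, B p.2 & p.1 `*` p.2 `<=` O]].
rewrite (_ : O = \bigcup_(p in I) (p.1 `*` p.2)); last first.
  apply/seteqP; split => [[x y] Oxy|z [p [_ _ pO] /pO]//].
  have [[P Q] /= [Px Qy] PQ] : nbhs (x, y) (O : set (M * M)) by exact: open_nbhs_nbhs.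
  have [U [BU Ux] UP] := bB x _ Px; have [V [BV Vy] VQ] := bB y _ Qy.
  exists (U, V) => //; split => // -[x' y'] [/= Ux' Vy']; apply: PQ; split => /=.
    exact: UP.
  exact: VQ.
have cI : countable I.
  by apply: (sub_countable _ (countableX cB cB)); apply: subset_card_le => p [].
have /countable_injP[fn fnI] := cI.
rewrite (_ : \bigcup_(p in I) _ = \bigcup_k \bigcup_(p in [set p | I p /\ fn p = k]) (p.1 `*` p.2)); last first.
  by apply/seteqP; split => [z [p Ip pz]|z [k _ [p [Ip _] pz]]]; [exists (fn p) => //; exists p | exists p].
apply: bigcupT_measurable => k.
have [[p [Ip pk]]|none] := pselect (exists p, I p /\ fn p = k); last first.
  rewrite (_ : \bigcup_(p in _) _ = set0)//; apply/seteqP; split => // z [p Hp _].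
  by apply: none; exists p.
rewrite (_ : \bigcup_(p in _) _ = p.1 `*` p.2); last first.
  apply/seteqP; split => [z [p' [Ip' p'k]]|z pz]; last by exists p.
  by rewrite (_ : p' = p)//; apply: fnI; rewrite ?inE// p'k.
have [B1 B2 _] := Ip; apply: measurableX; apply: open_borel; exact: oB.
Qed.

End Borel.

(** * Integrability of the singular kernel; existence of centered densities *)

Section VolumeConsequences.
Context {R : realType} {n : nat} {M : ptopologicalType} {X : manifold R n M}.
Variable g : riemannian_metric X.
Variable vol : {sigma_finite_measure set (borel M) -> \bar R}.
Hypothesis gcomp : geodesically_complete g.
Hypothesis sc : simply_connected R M.
Hypothesis Hvol : riemannian_volume g vol.
Variable c_m : R.
Hypothesis c_m0 : 0 < c_m.
Hypothesis Hsec : sectional_bounds g (- c_m) 0.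
Variables (c : chart R n M) (o : M).
Hypothesis cX : atlas X c.
Hypothesis co : dom c o.
Hypothesis n0 : (0 < n)%N.

Local Notation E := (exp_map g c o).
Local Notation lg := (log_map g c o).
Local Notation dist := (geodesic_dist g).
Local Notation ball := (@logball _ _ _ _ g c o).

Lemma log_coord_cont i : continuous (fun x : M => lg x 0 i).
Proof.
move=> x; apply: (comp_cont (f := lg) (h := fun v : 'rV[R]_n => v 0 i)).
  exact: (log_cont gcomp sc c_m0 Hsec cX co).
exact: coord_continuous.
Qed.

Lemma log_coord_meas i : measurable_fun setT (fun x : borel M => lg x 0 i).
Proof. by apply: continuous_borel; exact: log_coord_cont. Qed.

Lemma dist_meas : measurable_fun setT (fun z : borel M * borel M => dist z.1 z.2).
Proof.
apply: (continuous_borel2 (manifold_second_countable X)).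
exact: dist_cont.
Qed.

Lemma log_lipschitz : exists2 L : R, 0 < L & forall x y, `|lg x - lg y| <= L * dist x y.
Proof.
have Vo : cdom c (c o) by exists o.
have [ro ro0 [Ko Ko0 HKo]] := gnorm_equiv g cX Vo.
exists Ko => // x y; have [|_ /(_ (lg y - lg x))[_ h]] := HKo (c o); first by rewrite subrr normr0.
rewrite distrC; apply: (le_trans h); rewrite ler_wpM2l ?(ltW Ko0)//.
exact: (log_dist gcomp sc c_m0 Hsec cX co).
Qed.

Lemma logball_fin v r : 0 <= r -> (vol (ball v r) < +oo)%E.
Proof.
move=> r0; have [K _ HK] := logball_growth gcomp sc Hvol c_m0 Hsec cX co.
exact: le_lt_trans (HK v r r0) (ltry _).
Qed.

Lemma logball0 v : vol (ball v 0) = 0%E.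
Proof.
have [K _ HK] := logball_growth gcomp sc Hvol c_m0 Hsec cX co.
by have := HK v 0 (lexx _); rewrite mulr0 expr0n eqn0Ngt n0 mulr0 measure_le0 => /eqP.
Qed.

Lemma vol_open (O : set M) x : open O -> O x -> (0 < vol (O : set (borel M)))%E.
Proof.
move=> oO Ox; have [c1 c1X d1] := atlas_cover X x.
have oA : open (O `&` dom c1) by apply: openI => //; exact: open_dom.
apply: (@lt_le_trans _ _ (vol (O `&` dom c1))); last first.
  by apply: le_measure; rewrite ?inE; [exact: open_borel | exact: open_borel | move=> y []].
rewrite (Hvol c1X (open_borel oA))//.
have V1 : cdom c1 (c1 x) by exists x.
pose sd v := Num.sqrt (\det (gram g c1 v)).
have csd : {for c1 x, continuous sd}.
  apply: (comp_cont (f := fun v => \det (gram g c1 v)) (h := Num.sqrt)); last exact: sqrt_continuous.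
  have H : C1 (cdom c1) (fun v => \det (gram g c1 v)).
    by apply: C1_det => i j; have [] := gf_C2 g c1X i j.
  exact: C1_cont H V1.
have sd0 : 0 < sd (c1 x).
  rewrite sqrtr_gt0; have G0 : (gram g c1 (c1 x))^T = gram g c1 (c1 x) by exact: gram_sym.
  have P0 u : u != 0 -> 0 < qf (gram g c1 (c1 x)) u by exact: gram_pos.
  by have [] := ellipsoid_volume G0 P0.
have near1 : \forall v \near c1 x, sd (c1 x) / 2 < sd v.
  apply: (near_comp (Q := fun t => sd (c1 x) / 2 < t) csd).
  by apply: open_nbhs_nbhs; split; [exact: open_gt | rewrite /= ltr_pdivrMr// ltr_pMr// ltr1n].
have near2 : \forall v \near c1 x, O (param c1 v).
  apply: (near_comp (Q := O) (f := param c1)); first exact: param_continuous.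
  by apply: open_nbhs_nbhs; split => //; rewrite coorK.
have near3 : \forall v \near c1 x, cdom c1 v.
  by apply: open_nbhs_nbhs; split => //; exact: open_cdom.
have /nbhs_ballP[e /= e0 He] : nbhs (c1 x) [set v | sd (c1 x) / 2 < sd v /\ (O (param c1 v) /\ cdom c1 v)].
  exact: (filterI near1 (filterI near2 near3)).
have e2 : 0 <= e / 2 by rewrite divr_ge0// ltW.
have k0 : 0 <= sd (c1 x) / 2 by rewrite divr_ge0// ltW.
apply: lt_le_trans (integral_rV_cube (z := c1 x) e2 k0 _ _).
- by rewrite lte_fin mulr_gt0 ?divr_gt0// exprn_gt0// mulr_gt0// divr_gt0.
- by move=> v; rewrite lee_fin mulr_ge0// sqrtr_ge0.
- move=> v Hv; have [|h1 [h2 h3]] := He v.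
    rewrite -ball_normE /= distrC; apply: (@le_lt_trans _ _ (e / 2)); last by rewrite ltr_pdivrMr// ltr_pMr// ltr1n.
    by apply: norm_le_coord => // i; rewrite !mxE; exact: Hv.
  rewrite lee_fin indicE mem_set ?mul1r ?ltW//.
  by have [y d2 yE] := h3; exists y => //; split => //; rewrite -(coorK d2) yE.
Qed.

Lemma logball_pos v r : 0 < r -> (0 < vol (ball v r))%E.
Proof.
move=> r0; pose O := [set x : M | `|lg x - v| < r].
have cl : continuous (fun x : M => `|lg x - v|).
  move=> x; apply: continuous_comp; last exact: norm_continuous.
  by apply: cvgB; [exact: (log_cont gcomp sc c_m0 Hsec cX co) | exact: cvg_cst].
have oO : open O.
  rewrite (_ : O = (fun x => `|lg x - v|) @^-1` [set t | t < r])//.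
  by apply: open_comp; [move=> x _; exact: cl | exact: open_lt].
have Ov : O (E v) by rewrite /O /= (expK gcomp sc c_m0 Hsec cX co) subrr normr0.
apply: lt_le_trans (vol_open oO Ov) _; apply: le_measure; rewrite ?inE.
- exact: open_borel.
- exact: (logball_measurable gcomp sc c_m0 Hsec cX co).
- by move=> x; exact: ltW.
Qed.

Lemma dist_bounded v r : exists K : R, forall x, ball v r x -> dist x o <= K.
Proof.
pose A := [set u : 'rV[R]_n | `|v - u| <= r].
have cA : compact A.
  apply: bounded_closed_compact.
    exists (r + `|v|); split; first exact: num_real.
    move=> K rK u Au; apply: le_trans (ltW rK); rewrite -[u](subrK v).
    by apply: le_trans (ler_normD _ _) _; rewrite lerD2r distrC.
  exact: closed_closed_ball_.
pose f u : R := dist (E u) o.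
have cf : continuous f.
  move=> u; apply: (comp_cont (f := fun u => (E u, o)) (h := fun p : M * M => dist p.1 p.2)).
    have co' : continuous (fun _ : 'rV[R]_n => o) by exact: cst_continuous.
    apply: pair_cont; last exact: co'.
    have ce : continuous E by exact: (exp_cont gcomp c_m0 Hsec cX co).
    exact: ce.
  exact: (dist_cont sc).
have cfA : compact (f @` A).
  by apply: continuous_compact => //; exact: continuous_subspaceT.
have [K [_ HK]] := compact_bounded cfA.
exists (K + 1) => x Bx.
have := HK (K + 1) _ (f (lg x)); rewrite ltrDl => /(_ ltr01) h.
apply: le_trans (ler_norm _) _; rewrite -[x](logK gcomp sc c_m0 Hsec cX co); apply: h.
by exists (lg x) => //; rewrite /A /= distrC.
Qed.

Lemma norm_le_l1 (v : 'rV[R]_n) : `|v| <= \sum_i `|v 0 i|.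
Proof.
apply: norm_le_coord => [|i]; first exact: sumr_ge0.
by rewrite (bigD1 i)//= lerDl sumr_ge0.
Qed.

(** Near [y] the integrand is at most of order d^(- t A1), with t A1 < n, against balls of volume of
    order r^n; far away the weight [a] beats the exponential volume growth. *)
Lemma kernel_integral (Kn : M * M -> R) (A1 C0 : R) : 0 < A1 -> A1 < 2 * n%:R -> 0 <= C0 ->
  (forall x y, Kn (x, y) <= C0 - A1 * Num.min (ln (dist x y)) 0) ->
  exists a t s : R, [/\ 0 <= a, 2^-1 < t & forall y,
    (\int[vol]_x (expR (t * Kn (x, y) - a * \sum_i `|lg x 0 i|))%:E <= s%:E)%E].
Proof.
move=> A10 A1n C00 HK.
have [L L0 HL] := log_lipschitz.
have [K K0 HG] := logball_growth gcomp sc Hvol c_m0 Hsec cX co.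
have np : 0 < n%:R :> R by rewrite ltr0n.
(* The midpoint between 1/2 and n / A1, an interval that is nonempty because [A1 < 2 * n%:R]. *)
pose t := (2^-1 + n%:R / A1) / 2.
have nA : 2^-1 < n%:R / A1 by rewrite ltr_pdivlMr// ltr_pdivrMl.
have t2 : 2^-1 < t by rewrite /t; lra.
have t0 : 0 < t by apply: lt_trans t2; rewrite invr_gt0.
pose be := t * A1.
have ben : be < n%:R.
  have -> : be = (A1 / 2 + n%:R) / 2 by rewrite /be /t; field; rewrite gt_eqF.
  by rewrite ltr_pdivrMr//; lra.
have be0 : 0 < be by rewrite mulr_gt0.
(* [n%:R * K] offsets the exponential volume growth, [n%:R] the factor r^n, and 1 leaves the
   geometric decay e^(-k). *)
pose a := n%:R * (K + 1) + 1.
have a0 : 0 <= a by rewrite addr_ge0// mulr_ge0 ?addr_ge0 ?ltW.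
pose C := 2 * K ^+ n * expR (t * C0 + n%:R * (K + 1)).
pose C' := 2 * (K * L) ^+ n * expR (t * C0 + be + a * L + n%:R * (K * L)).
have r1 : 0 <= (expR (-1) : R) < 1 by rewrite expR_ge0/= -[X in _ < X]expR0 ltr_expR oppr_lt0.
have r2 : 0 <= expR (be - n%:R) < 1 by rewrite expR_ge0/= -[X in _ < X]expR0 ltr_expR subr_lt0.
have Cge : 0 <= C by rewrite !mulr_ge0 ?expR_ge0 ?exprn_ge0// ltW.
have C'ge : 0 <= C' by rewrite !mulr_ge0 ?expR_ge0 ?exprn_ge0 ?mulr_ge0 ?ltW.
exists a, t, (C / (1 - expR (-1)) + C' / (1 - expR (be - n%:R))); split => // y.
have mb v r := logball_measurable gcomp sc c_m0 Hsec cX co v r.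
apply: (@shell_bound _ _ _ vol (fun k => ball 0 k.+1%:R) (fun k => ball (lg y) (L * expR (- k%:R)))
  (fun k => expR (t * C0 - a * k%:R)) (fun k => expR (t * C0 + be * k.+1%:R - a * (`|lg y| - L)))).
- exact: Cge.
- exact: r1.
- exact: C'ge.
- exact: r2.
- by move=> k; exact: mb.
- by move=> k; exact: expR_ge0.
- move=> k; apply: (@le_trans _ _ ((expR (t * C0 - a * k%:R))%:E *
    (2 * (K * expR (K * k.+1%:R) * expR k.+1%:R) ^+ n)%:E)%E).
    apply: lee_wpmul2l; first by rewrite lee_fin expR_ge0.
    apply: le_trans (HG _ _ _) _ => //; rewrite lee_fin normr0 add0r ler_wpM2l//.
    have p1 : 0 <= K * expR (K * k.+1%:R) by rewrite mulr_ge0 ?expR_ge0 ?ltW.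
    apply: lerXn2r; rewrite ?nnegrE; [exact: mulr_ge0 | by rewrite mulr_ge0 ?expR_ge0 |].
    by rewrite ler_wpM2l//; apply: le_trans (expR_ge1Dx _); rewrite lerDr.
  rewrite -EFinM lee_fin -mulrA -expRD exprMn -expRM_natl -expRM_natl.
  rewrite le_eqVlt; apply/orP; left; apply/eqP; rewrite /C.
  rewrite mulrCA -!mulrA; congr (_ * _); rewrite mulrCA; congr (_ * _).
  rewrite -!expRD; congr expR; rewrite /a -natr1; ring.
- by move=> k; exact: mb.
- by move=> k; exact: expR_ge0.
(* The volume constant grows with |lg y|. The weight compensates for it, since the points of these
   balls have logarithms within [L] of that of [y]. *)
- move=> k; have r0 : 0 <= L * expR (- k%:R) by rewrite mulr_ge0 ?expR_ge0 ?ltW.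
  have rL : L * expR (- k%:R) <= L.
    by rewrite ler_piMr ?(ltW L0)// -[leRHS]expR0 ler_expR oppr_le0.
  apply: (@le_trans _ _ ((expR (t * C0 + be * k.+1%:R - a * (`|lg y| - L)))%:E *
    (2 * (K * expR (K * (`|lg y| + L)) * (L * expR (- k%:R))) ^+ n)%:E)%E).
    apply: lee_wpmul2l; first by rewrite lee_fin expR_ge0.
    apply: le_trans (HG _ _ r0) _; rewrite lee_fin ler_wpM2l//.
    have p1 u : 0 <= K * expR u by rewrite mulr_ge0 ?expR_ge0 ?ltW.
    apply: lerXn2r; rewrite ?nnegrE; [exact: mulr_ge0 | exact: mulr_ge0 |].
    by rewrite ler_wpM2r// ler_wpM2l ?(ltW K0)// ler_expR ler_wpM2l ?(ltW K0)// lerD2l.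
  rewrite mulrACA -expRD -EFinM lee_fin exprMn -expRM_natl -expRM_natl.
  rewrite mulrCA [X in _ * X]mulrCA [leLHS]mulrA /C' -[leRHS]mulrA ler_wpM2l//; first by rewrite mulr_ge0// exprn_ge0// mulr_ge0// ltW.
  rewrite -!expRD ler_expR -natr1; have h1 := normr_ge0 (lg y).
  have : n%:R * (K * `|lg y|) <= a * `|lg y|.
    rewrite mulrA ler_wpM2r// /a mulrDr mulr1 -addrA lerDl addr_ge0// ltW//.
  lra.
- by move=> x; exact: expR_ge0.
- move=> x; have wx : `|lg x| <= \sum_i `|lg x 0 i| := norm_le_l1 _.
  have hK := ler_wpM2l (ltW t0) (HK x y).
  (* Points at distance 0 fall under the first case, as [ln 0 = 0]. *)
  have [dx|dx] := leP 0 (ln (dist x y)).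
    left; exists (Num.truncn `|lg x|); split.
      by rewrite /logball /= subr0 ltW// truncnS_gt.
    rewrite ler_expR; apply: lerD.
      by apply: (le_trans hK); rewrite (min_r dx) mulr0 subr0.
    rewrite lerN2 ler_wpM2l//; apply: le_trans wx; by rewrite truncn_le.
  right; exists (Num.truncn (- ln (dist x y))).
  have ld0 : 0 <= - ln (dist x y) by rewrite oppr_ge0 ltW.
  have h1 : _ <= _ := introT idP (etrans (truncn_le _) ld0); have h2 := truncnS_gt (- ln (dist x y)).
  have Dp : 0 < dist x y.
    rewrite lt_neqAle dist_ge0// andbT eq_sym; apply/eqP => D0.
    by rewrite D0 ln0 ?ltxx in dx.
  have Dk : dist x y <= expR (- (Num.truncn (- ln (dist x y)))%:R).
    by rewrite -[leLHS]lnK ?posrE// ler_expR lerNr.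
  have Bx : `|lg x - lg y| <= L * expR (- (Num.truncn (- ln (dist x y)))%:R).
    by apply: le_trans (HL x y) _; rewrite ler_wpM2l// ltW.
  split => //; rewrite ler_expR; apply: lerD.
    apply: (le_trans hK); rewrite (min_l (ltW dx)) mulrBr lerD2l -mulrN -mulrN mulrA.
    by apply: (ler_wpM2l (ltW be0)); exact: ltW.
  rewrite lerN2 ler_wpM2l//; apply: le_trans wx; rewrite lerBlDr -[X in `|X|](subrK (lg x)).
  apply: le_trans (ler_normD _ _) _; rewrite addrC lerD2l distrC; apply: (le_trans Bx).
  by rewrite ler_piMr ?(ltW L0)// -[leRHS]expR0 ler_expR oppr_le0.
Qed.

(** The unperturbed solution is the vector (1, ..., 1), and the perturbation is too small to change
    a sign. *)
Lemma perturbed_system (B : 'M[R]_n) (b : 'rV[R]_n) (r : R) : 0 <= r -> r * n%:R <= 4^-1 ->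
  (forall i j, `|B i j - (i == j)%:R| <= r) -> (forall j, `|b 0 j + 1| <= r) ->
  exists u : 'rV[R]_n, u *m B = - b /\ forall i, 0 < u 0 i.
Proof.
move=> r0 rn HB Hb; pose D := B - 1%:M.
have np : 1 <= n%:R :> R by rewrite ler1n.
have r4 : r <= 4^-1 by apply: le_trans rn; rewrite ler_peMr.
have HD (u : 'rV[R]_n) : `|u *m D| <= `|u| / 4.
  apply: norm_le_coord => [|j]; first by rewrite divr_ge0.
  rewrite mxE; apply: le_trans (ler_norm_sum _ _ _) _.
  apply: (@le_trans _ _ (\sum_(i < n) `|u| * r)).
    apply: ler_sum => i _; rewrite normrM; apply: ler_pM => //; first exact: coord_le_norm.
    by have := HB i j; rewrite !mxE.
  rewrite sumr_const card_ord -[leLHS]mulr_natr -mulrA ler_wpM2l//.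
have BE (u : 'rV[R]_n) : u = u *m B - u *m D by rewrite /D mulmxBr mulmx1 opprB addrC subrK.
have uB : B \in unitmx.
  rewrite unitmxE unitfE; apply/negP => /det0P[u u0 uB].
  have : `|u| <= `|u| / 4 by rewrite {1}[u]BE uB sub0r normrN.
  by move: u0; rewrite -normr_gt0; lra.
exists (- b *m invmx B); split; first by rewrite mulmxKV.
set u := - b *m invmx B; have uE : u = - b - u *m D by rewrite {1}[u]BE /u mulmxKV.
have nu : `|u| <= 5 / 3.
  have nb : `|- b| <= 1 + r.
    apply: norm_le_coord => [|j]; first by rewrite addr_ge0.
    have := Hb j; rewrite mxE !ler_norml => /andP[h1 h2]; apply/andP; split; lra.
  have : `|u| <= (1 + r) + `|u| / 4.
    by rewrite {1}uE; apply: le_trans (ler_normB _ _) _; apply: lerD.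
  lra.
move=> i; rewrite uE !mxE; have := le_trans (coord_le_norm _ i) (HD u); rewrite mxE => h.
have := Hb i; rewrite !ler_norml in h * => /andP[h1 h2].
by move/andP: h => [h3 h4]; lra.
Qed.

Lemma cube_density (u : 'rV[R]_n) (r : R) : 0 < r -> exists f : borel M -> R,
  [/\ dens vol f, forall i, itg vol (fun x => lg x 0 i * f x),
    forall i, `|ri vol (fun x => lg x 0 i * f x) - u 0 i| <= r &
    itg vol (fun x : borel M => dist x o * f x)].
Proof.
move=> r0; have r0' := ltW r0.
have mB := logball_measurable gcomp sc c_m0 Hsec cX co u r.
have pB := logball_pos u r0; have fB := logball_fin u r0'.
pose m := fine (vol (ball u r)).
have mE : vol (ball u r) = m%:E by rewrite fineK// ge0_fin_numE.
have m0 : 0 < m by rewrite -lte_fin -mE.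
have i1 : itg vol (\1_(ball u r) : borel M -> R).
  apply: itg_fin => [|x|]; [exact: measurable_indic | by have /andP[] := ind01 R (ball u r) x |].
  by rewrite integral_indic// setIT.
pose f (x : borel M) : R := m^-1 * \1_(ball u r) x.
have fi : itg vol f by exact: itgZ.
have f0 x : 0 <= f x by rewrite mulr_ge0 ?invr_ge0 ?(ltW m0)//; have /andP[] := ind01 R (ball u r) x.
have f1 : ri vol f = 1.
  have rm : ri vol (\1_(ball u r) : borel M -> R) = m by rewrite /ri /Rintegral integral_indic// setIT.
  by rewrite riZ// rm mulVf// gt_eqF.
have mf := itg_meas fi.
have bound (phi : borel M -> R) (K : R) : measurable_fun setT phi -> (forall x, ball u r x -> `|phi x| <= K) ->
    itg vol (fun x => phi x * f x) /\ `|ri vol (fun x => phi x * f x)| <= K.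
  move=> mp pK; have dom x : `|phi x * f x| <= K * f x.
    rewrite normrM (ger0_norm (f0 x)) /f indicE; case: (boolP (x \in _)) => [|_]; last by rewrite !mulr0.
    by rewrite inE => Bx; rewrite ler_wpM2r ?mulr1 ?invr_ge0 ?(ltW m0)// pK.
  have ip : itg vol (fun x => phi x * f x).
    by apply: (itg_dom _ (itgZ K fi)) => //; exact: measurable_funM.
  split => //; apply: le_trans (ri_norm ip) _; rewrite -[K]mulr1 -f1 -riZ//.
  by apply: ri_le => //; [exact: integrable_norm ip | exact: itgZ].
have ml i := log_coord_meas i.
have cl x i : ball u r x -> `|lg x 0 i - u 0 i| <= r.
  by move=> Bx; have := le_trans (coord_le_norm (lg x - u) i) Bx; rewrite !mxE.
exists f; split => // [i|i|].
- apply: (bound _ (`|u 0 i| + r) (ml i) _).1 => x /(cl _ i) h.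
  by rewrite -[X in `|X|](subrK (u 0 i)) addrC; apply: le_trans (ler_normD _ _) _; rewrite lerD2l.
- have [h1 h2] := bound (fun x => lg x 0 i - u 0 i) r (measurable_funB (ml i) (measurable_cst _)) (fun x => cl x i).
  apply: le_trans h2; rewrite -[u 0 i]mulr1 -{1}f1 -riZ// -riB.
  + rewrite le_eqVlt; apply/orP; left; apply/eqP; congr `|_|; congr ri; apply/funext => x.
    by rewrite mulr1 mulrBl.
  + apply: (bound _ (`|u 0 i| + r) (ml i) _).1 => x /(cl _ i) h.
    by rewrite -[X in `|X|](subrK (u 0 i)) addrC; apply: le_trans (ler_normD _ _) _; rewrite lerD2l.
  + exact: itgZ.
- have [K HK] := dist_bounded u r; apply: (bound _ K _ _).1 => [|x Bx].
    exact: (meas_sec (k := fun z : borel M * borel M => dist z.1 z.2) o dist_meas).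
  by rewrite ger0_norm ?dist_ge0//; exact: HK.
Qed.

(** Normalized volumes of small cubes around (-1, ..., -1) and the standard basis vectors have means
    close to the vertices of a simplex around 0, so a convex combination of them has mean exactly 0.
    It shows that the constraint set is nonempty. *)
Lemma centered_density : exists f : borel M -> R, [/\ dens vol f,
  forall i, (\int[vol]_x (lg x 0 i * f x)%:E = 0)%E &
  (\int[vol]_x (dist x o * f x)%:E < +oo)%E].
Proof.
pose r : R := (4 * n%:R)^-1.
have np : 0 < n%:R :> R by rewrite ltr0n.
have r0 : 0 < r by rewrite invr_gt0 mulr_gt0.
have rn : r * n%:R <= 4^-1 by rewrite /r invfM -mulrA mulVf ?mulr1// gt_eqF.
have [f0 [d0 l0 b0 m0]] := cube_density (const_mx (-1)) r0.
have /choice[f Hf] := fun i : 'I_n => cube_density (delta_mx 0 i) r0.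
have [d' l' b' m'] : [/\ forall i, dens vol (f i), forall i j, itg vol (fun x => lg x 0 j * f i x),
    forall i j, `|ri vol (fun x => lg x 0 j * f i x) - (delta_mx 0 i : 'rV[R]_n) 0 j| <= r &
    forall i, itg vol (fun x : borel M => dist x o * f i x)].
  by split=> i; have [h1 h2 h3 h4] := Hf i.
pose B : 'M[R]_n := \matrix_(i, j) ri vol (fun x => lg x 0 j * f i x).
pose b : 'rV[R]_n := \row_j ri vol (fun x => lg x 0 j * f0 x).
have [|j|u [uB u0]] := @perturbed_system B b r (ltW r0) rn.
- by move=> i j; have := b' i j; rewrite !mxE eqxx eq_sym.
- by have := b0 j; rewrite !mxE opprK.
pose m := 1 + \sum_i u 0 i.
have m1 : 0 < m by rewrite ltr_pwDl// sumr_ge0// => i _; exact: ltW.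
pose F (x : borel M) := m^-1 * (f0 x + \sum_i u 0 i * f i x).
have [if0 p0 r1] := d0.
have if' i : itg vol (f i) by have [] := d' i.
have lin (phi : borel M -> R) : itg vol (fun x => phi x * f0 x) -> (forall i, itg vol (fun x => phi x * f i x)) ->
    itg vol (fun x => phi x * F x) /\ ri vol (fun x => phi x * F x) =
      m^-1 * (ri vol (fun x => phi x * f0 x) + \sum_i u 0 i * ri vol (fun x => phi x * f i x)).
  move=> h0 h; have E : (fun x => phi x * F x) = fun x => m^-1 * (phi x * f0 x + \sum_i u 0 i * (phi x * f i x)).
    apply/funext => x; rewrite /F mulrCA mulrDr mulr_sumr; congr (_ * (_ + _)).
    by apply: eq_bigr => i _; rewrite mulrCA.
  have hs : itg vol (fun x => \sum_i u 0 i * (phi x * f i x)) by apply: itg_sum => i; exact: itgZ.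
  rewrite E; split; first by apply: itgZ; exact: itgD.
  rewrite riZ ?riD ?ri_sum//; [|by move=> i; exact: itgZ|exact: itgD].
  by congr (_ * (_ + _)); apply: eq_bigr => i _; rewrite riZ.
have c1 (G : borel M -> R) : (fun x => 1 * G x) = G by apply/funext => x; rewrite mul1r.
have [iF rF] : itg vol F /\ ri vol F = 1.
  have [||h1 h2] := lin (fun=> 1); rewrite ?c1//; first by move=> i; rewrite c1.
  have h3 (G : borel M -> R) : ri vol (fun x => 1 * G x) = ri vol G by congr ri; exact: c1.
  split; first by rewrite -[F]c1.
  rewrite -h3 h2 h3 r1; under eq_bigr do rewrite h3.
  have -> : \sum_i u 0 i * ri vol (f i) = \sum_i u 0 i.
    by apply: eq_bigr => i _; have [_ _ ->] := d' i; rewrite mulr1.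
  by rewrite mulVf// gt_eqF.
have F0 x : 0 <= F x.
  rewrite mulr_ge0 ?invr_ge0 ?(ltW m1)// addr_ge0// sumr_ge0// => i _.
  by rewrite mulr_ge0 ?(ltW (u0 i))//; have [] := d' i.
exists F; split => // [j|].
  have [h1 h2] := lin (fun x => lg x 0 j) (l0 j) (fun i => l' i j).
  rewrite riE// h2; congr EFin; apply/eqP; rewrite mulf_eq0 invr_eq0 gt_eqF//=.
  have := congr1 (fun v : 'rV[R]_n => v 0 j) uB; rewrite !mxE => uBj.
  have uBj' : \sum_i u 0 i * ri vol (fun x => lg x 0 j * f i x) = - ri vol (fun x => lg x 0 j * f0 x).
    by rewrite -uBj; apply: eq_bigr => i _; rewrite mxE.
  apply/eqP; apply: (etrans (congr1 (fun z => _ + z) uBj')); exact: subrr.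
by have [h1 _] := lin (fun x => dist x o) m0 m'; rewrite riE// ltry.
Qed.

End VolumeConsequences.

(** * Existence of a minimizer *)

Lemma limf_einf_bound (R : realType) (f : R -> \bar R) (F : set_system R) :
  Filter F -> (-oo < limf_einf f F)%E -> exists m : R, \forall t \near F, (m%:E <= f t)%E.
Proof.
move=> FF; rewrite /limf_einf limf_esupE -[X in (X < _)%E]/(- +oo)%E lteN2 => /ereal_inf_lt[_ [V FV <-] sV].
have ub t : V t -> (- f t <= ereal_sup ((\- f)%E @` V))%E by move=> Vt; apply: ereal_sup_ubound; exists t.
case: (ereal_sup _) ub sV => [b| |]// ub _.
  by exists (- b); apply: filterS FV => t /ub; rewrite EFinN leeNl.
exists 0; apply: filterS FV => t /ub; rewrite leeNy_eq => /eqP E.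
by rewrite -[f t]oppeK E leey.
Qed.

(** * The interaction potential with finite values *)

Section Interaction.
Context {R : realType}.
Variables (A1 : R) (h : R -> \bar R) (phi : R -> R).
Hypothesis hlt : forall t, 0 <= t -> (h t < +oo)%E.
Hypothesis hinc : forall s t, 0 <= s -> s <= t -> (h s <= h t)%E.
Hypothesis A10 : 0 < A1.
Hypothesis h0 : (-oo < limf_einf (fun t => h t - (A1 * ln t)%:E) 0^'+)%E.
Hypothesis phiinf : phi t / t @[t --> +oo] --> +oo.
Hypothesis hinf : (-oo < limf_einf (fun t => h t - (phi t)%:E) +oo%R)%E.

(** [h] may be -oo at 0. The value put there matters only on the diagonal, which is a null set. *)
Definition hfin t : R := if 0 < t then fine (h t) else 0.

Lemma h_near0 : exists m d : R, 0 < d /\ forall t, 0 < t -> t < d -> ((m + A1 * ln t)%:E <= h t)%E.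
Proof.
have [m] := limf_einf_bound _ h0; rewrite near_withinE => /nbhs_ballP[d /= d0 Hd].
exists m, d; split => // t t0 td; rewrite EFinD -leeBrDr//; apply: Hd => //.
by rewrite /ball /= sub0r normrN gtr0_norm.
Qed.

(** The lower bound near 0 excludes -oo at small positive arguments, and monotonicity excludes it at
    the larger ones. *)
Lemma hfinE t : 0 < t -> h t = (hfin t)%:E.
Proof.
move=> t0; rewrite /hfin t0 fineK// fin_numE; apply/andP; split; last first.
  by have := hlt (ltW t0); case: (h t).
have [m [d [d0 Hd]]] := h_near0; pose s := Num.min t (d / 2).
have s0 : 0 < s by rewrite lt_min t0 divr_gt0.
have sd : s < d by rewrite gt_min; apply/orP; right; rewrite ltr_pdivrMr// ltr_pMr// ltr1n.
have st : s <= t by rewrite ge_min lexx.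
by rewrite gt_eqF//; apply: lt_le_trans (le_trans (Hd s s0 sd) (hinc (ltW s0) st)); exact: ltNyr.
Qed.

Lemma hfin_inc s t : 0 < s -> s <= t -> hfin s <= hfin t.
Proof.
move=> s0 st; have t0 := lt_le_trans s0 st.
by rewrite -lee_fin -!hfinE//; apply: hinc => //; exact: ltW.
Qed.

Lemma hfin_meas : measurable_fun setT hfin.
Proof.
apply: measurable_preimage_gt => a; set P := _ @^-1` _.
rewrite (_ : P = (P `&` [set t | 0 < t]) `|` (P `&` [set t | t <= 0])); last first.
  rewrite -setIUr; apply/seteqP; split => [t Pt|t []//]; split => //=.
  by have [t0|t0] := leP t 0; [right | left].
apply: measurableU.
  apply: is_interval_measurable => s t [Ps s0] [Pt t0] u /andP[su ut]; rewrite /= in s0.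
  split; last exact: lt_le_trans s0 su.
  by apply: lt_le_trans Ps _; exact: hfin_inc.
have z0 t : t <= 0 -> hfin t = 0 by rewrite /hfin; case: ltP.
have [a0|a0] := ltP a 0.
  rewrite (_ : P `&` _ = `]-oo, 0]%classic)//; apply/seteqP; split => t; rewrite /= in_itv /=; first by case.
  by move=> t0; split => //; rewrite /P /= z0.
rewrite (_ : P `&` _ = set0)//; apply/seteqP; split => // t [+ t0].
by rewrite /P /= z0// ltNge a0.
Qed.

Lemma hfin_superlinear (L : R) : 0 <= L -> exists2 C : R, 0 <= C &
  forall t, 0 <= t -> L * t <= C + Num.max (hfin t) 0.
Proof.
move=> L0; have [m Hm] := limf_einf_bound _ hinf.
have HL : \forall t \near +oo, L <= phi t / t by have /cvgryPge := phiinf; apply.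
have [T [_ HT]] : \forall t \near +oo, (m%:E <= h t - (phi t)%:E)%E /\ L <= phi t / t.
  exact: filterI Hm HL.
pose T1 := `|T| + 1; have T10 : 0 < T1 by rewrite ltr_wpDl.
exists (`|m| + L * T1) => [|t t0]; first by rewrite addr_ge0// mulr_ge0// ltW.
have mx : 0 <= Num.max (hfin t) 0 by rewrite le_max lexx orbT.
have [tT|tT] := leP t T1.
  have := ler_wpM2l L0 tT; have := normr_ge0 m; lra.
have tp : 0 < t by exact: lt_trans tT.
have [|h1 h2] := HT t.
  by apply: lt_trans tT; rewrite /T1 (le_lt_trans (ler_norm T))// ltrDl.
move: h2; rewrite ler_pdivlMr// => h2.
move: h1; rewrite hfinE// -EFinB lee_fin => h1.
have h3 : hfin t <= Num.max (hfin t) 0 by rewrite le_max lexx.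
have h4 := ler_norm (- m); rewrite normrN in h4.
have : 0 <= L * T1 by rewrite mulr_ge0// ltW.
lra.
Qed.

Lemma hfin_singular : exists2 C : R, 0 <= C &
  forall t, 0 <= t -> Num.max (- hfin t) 0 <= C - A1 * Num.min (ln t) 0.
Proof.
have [m [d [d0 Hd]]] := h_near0; have d2 : 0 < d / 2 by rewrite divr_gt0.
exists (`|m| + `|hfin (d / 2)|) => [|t t0]; first by rewrite addr_ge0.
have n1 := normr_ge0 m; have n2 := normr_ge0 (hfin (d / 2)).
have n3 : A1 * Num.min (ln t) 0 <= 0 by rewrite mulr_ge0_le0 ?(ltW A10)// ge_min lexx orbT.
have n4 : A1 * Num.min (ln t) 0 <= A1 * ln t by rewrite ler_wpM2l ?(ltW A10)// ge_min lexx.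
rewrite ge_max; apply/andP; split; last by lra.
have [tp|tn] := ltP 0 t; last by rewrite /hfin ltNge tn /=; lra.
have [td|td] := ltP t d.
  have := Hd t tp td; rewrite hfinE// lee_fin => h1.
  by have h4 := ler_norm (- m); rewrite normrN in h4; lra.
have h1 : hfin (d / 2) <= hfin t.
  by apply: hfin_inc => //; apply: le_trans td; rewrite ler_pdivrMr// ler_pMr// ler1n.
by have h4 := ler_norm (- hfin (d / 2)); rewrite normrN in h4; lra.
Qed.

End Interaction.

(** * Independence of the chart at the base point *)

Section ExpChart.
Context {R : realType} {n : nat} {M : ptopologicalType} {X : manifold R n M}.
Variable g : riemannian_metric X.
Hypothesis gcomp : geodesically_complete g.
Hypothesis sc : simply_connected R M.
Variable c_m : R.
Hypothesis c_m0 : 0 < c_m.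
Hypothesis Hsec : sectional_bounds g (- c_m) 0.
Variables (c c' : chart R n M) (o : M).
Hypothesis cX : atlas X c.
Hypothesis co : dom c o.
Hypothesis c'X : atlas X c'.
Hypothesis c'o : dom c' o.

Transparent vel.

(** The two initial velocities describe the same set of geodesics, so [xget] chooses from equal sets
    of end points. *)
Lemma exp_chart u : exp_map g c' o (dd (trans c c') (c o) u) = exp_map g c o u.
Proof.
have fwd b b' w gam : atlas X b -> dom b o -> atlas X b' -> dom b' o -> geodesic_from g b o w gam ->
    geodesic_from g b' o (dd (trans b b') (b o) w) gam.
  move=> bX bo b'X b'o [gg g0 gw]; split => //.
  have := @vel_trans _ _ _ _ g gam b b' 0 gg bX b'X; rewrite g0 => /(_ bo b'o).
  by rewrite /vel gw.
have inv w : dd (trans c' c) (c' o) (dd (trans c c') (c o) w) = w.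
  have [gam gw] := gcomp w cX co; have gw' := fwd _ _ _ _ cX co c'X c'o gw.
  have [_ _ <-] := fwd _ _ _ _ c'X c'o cX co gw'; by case: gw.
rewrite /exp_map; congr (xget o _); apply/seteqP; split => x [gam gw gx]; exists gam => //.
  by have := fwd _ _ _ _ c'X c'o cX co gw; rewrite inv.
exact: fwd.
Qed.

Lemma log_chart x : log_map g c' o x = dd (trans c c') (c o) (log_map g c o x).
Proof.
rewrite -{1}[x](logK gcomp sc c_m0 Hsec cX co) -exp_chart.
exact: (expK gcomp sc c_m0 Hsec c'X c'o).
Qed.

End ExpChart.

(** * Application to the energy on the manifold *)

Section Assembly.
Context {R : realType} {n : nat} {M : ptopologicalType} {X : manifold R n M}.
Variable g : riemannian_metric X.
Variable vol : {sigma_finite_measure set (borel M) -> \bar R}.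
Hypothesis gcomp : geodesically_complete g.
Hypothesis sc : simply_connected R M.
Hypothesis Hvol : riemannian_volume g vol.
Variable c_m : R.
Hypothesis c_m0 : 0 < c_m.
Hypothesis Hsec : sectional_bounds g (- c_m) 0.
Variables (c : chart R n M) (o : M).
Hypothesis cX : atlas X c.
Hypothesis co : dom c o.
Hypothesis n0 : (0 < n)%N.
Variables (A1 : R) (h : R -> \bar R) (phi : R -> R).
Hypothesis hlt : forall t, 0 <= t -> (h t < +oo)%E.
Hypothesis hinc : forall s t, 0 <= s -> s <= t -> (h s <= h t)%E.
Hypothesis A10 : 0 < A1.
Hypothesis A1n : A1 < 2 * n%:R.
Hypothesis h0 : (-oo < limf_einf (fun t => h t - (A1 * ln t)%:E) 0^'+)%E.
Hypothesis phiinf : phi t / t @[t --> +oo] --> +oo.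
Hypothesis hinf : (-oo < limf_einf (fun t => h t - (phi t)%:E) +oo%R)%E.

Local Notation lg := (log_map g c o).
Local Notation dist := (geodesic_dist g).
Local Notation dist2 := (fun z : borel M * borel M => dist z.1 z.2).
Local Notation vol2 := (vol \x vol)%E.

Definition logc (i : 'I_n) (x : borel M) : R := lg x 0 i.
Definition kernel (z : borel M * borel M) : R := hfin h (dist z.1 z.2).

Lemma logc_meas i : measurable_fun setT (logc i).
Proof. exact: (log_coord_meas gcomp sc c_m0 Hsec cX co). Qed.

Lemma kernel_meas : measurable_fun setT kernel.
Proof. by apply: (measurableT_comp (hfin_meas hlt hinc h0)); exact: dist_meas. Qed.

(** The points at distance 0 from [x] have the same logarithm as [x], and cubes of radius 0 have
    volume 0. *)
Lemma diagonal_null : vol2 [set z | dist z.1 z.2 = 0] = 0%E.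
Proof.
rewrite /product_measure1; apply: integral0_eq => x _ /=.
apply/eqP; rewrite -measure_le0 -(logball0 gcomp sc Hvol c_m0 Hsec cX co n0 (lg x)).
have mD : measurable [set z : borel M * borel M | dist z.1 z.2 = 0].
  rewrite (_ : [set z | _] = dist2 @^-1` [set 0])//.
  by rewrite -[_ @^-1` _]setTI; apply: (dist_meas g sc).
apply: le_measure; rewrite ?inE; first exact: measurable_xsection.
  exact: (logball_measurable gcomp sc c_m0 Hsec cX co).
move=> y; rewrite /xsection /= inE /= => D0.
have [L L0 HL] := log_lipschitz gcomp sc c_m0 Hsec cX co.
by rewrite /logball /= distrC; apply: (le_trans (HL x y)); rewrite D0 mulr0.
Qed.

Lemma P_ac_dens rho : P_ac vol rho <-> dens vol rho.
Proof.
split=> [[m p e]|[i p e]].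
  split => //; last by rewrite /ri /Rintegral e.
  by apply: itg_fin => //; rewrite e ltry.
by split => //; [exact: itg_meas i | rewrite riE// e].
Qed.

(** The extended and the real integrand differ only on the null diagonal, so their positive parts
    and their negative parts have equal integrals. *)
Lemma energy_functional rho : dens vol rho -> energy g vol h rho = functional vol kernel rho.
Proof.
move=> [i p _]; rewrite /energy /functional; congr (_ + _ * _)%dE.
have mr := itg_meas i.
have mrr : measurable_fun setT (fun z : borel M * borel M => rho z.1 * rho z.2).
  by apply: measurable_funM; [exact: (meas1 mr) | exact: (meas2 mr)].
set F := (fun z : borel M * borel M => _); set G := (fun z => (kernel z * _)%:E).
have hE z : h (dist z.1 z.2) = if 0 < dist z.1 z.2 then (kernel z)%:E else h 0.
  case: ltP => [|d0]; first exact: (hfinE hlt hinc h0).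
  by congr h; apply/eqP; rewrite eq_le d0 dist_ge0.
have mF : measurable_fun setT F.
  apply: emeasurable_funM; last exact/measurable_EFinP.
  rewrite (_ : (fun z => _) = fun z => if 0 < dist z.1 z.2 then (kernel z)%:E else h 0); last first.
    by apply/funext => z; exact: hE.
  apply: measurable_fun_if => //.
  - apply: measurable_fun_ltr => //; exact: (dist_meas g sc).
  - by apply: measurable_funTS; apply/measurable_EFinP; exact: kernel_meas.
have mG : measurable_fun setT G.
  by apply/measurable_EFinP; apply: measurable_funM => //; exact: kernel_meas.
have N0 : vol2.-negligible [set z | dist z.1 z.2 = 0].
  exists [set z | dist z.1 z.2 = 0]; split => //; last exact: diagonal_null.
  rewrite (_ : [set z | _] = dist2 @^-1` [set 0])//.
  by rewrite -[_ @^-1` _]setTI; apply: (dist_meas g sc).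
have FG z : dist z.1 z.2 <> 0 -> F z = G z.
  move=> /eqP z0; rewrite /F /G EFinM (hfinE hlt hinc h0)//.
  by rewrite lt_neqAle eq_sym z0 dist_ge0.
rewrite /integral_dE; congr (_ - _)%dE.
  apply: ge0_ae_eq_integral => //; [exact: measurable_funepos | exact: measurable_funepos |].
  apply: negligibleS N0 => z; apply: contra_notP => /FG E _.
  by rewrite !funeposE E.
apply: ge0_ae_eq_integral => //; [exact: measurable_funeneg | exact: measurable_funeneg |].
apply: negligibleS N0 => z; apply: contra_notP => /FG E _.
by rewrite !funenegE E.
Qed.

Lemma kernel_superlinear (L : R) : 0 <= L -> exists2 C : R, 0 <= C &
  forall z, L * dist z.1 z.2 <= C + Kp kernel z.
Proof.
move=> L0; have [C C0 HC] := hfin_superlinear hlt hinc h0 phiinf hinf L0.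
by exists C => // z; apply: HC; exact: dist_ge0.
Qed.

Lemma vari_kernel (eta : R) : 0 < eta -> exists2 r : R, 0 <= r &
  forall z, vari logc z <= r + eta * Kp kernel z.
Proof.
move=> e0; have [L L0 HL] := log_lipschitz gcomp sc c_m0 Hsec cX co.
have nL : 0 <= n%:R * L / eta by rewrite divr_ge0 ?(ltW e0)// mulr_ge0// ltW.
have [C C0 HC] := kernel_superlinear nL.
exists (eta * C) => [|z]; first by rewrite mulr_ge0// ltW.
rewrite -mulrDr; apply: le_trans (ler_wpM2l (ltW e0) (HC z)).
rewrite mulrA [eta * _]mulrC divfK ?gt_eqF//.
apply: (@le_trans _ _ (\sum_(i < n) L * dist z.1 z.2)).
  apply: ler_sum => i _; apply: le_trans (HL z.1 z.2).
  by have := coord_le_norm (lg z.1 - lg z.2) i; rewrite !mxE.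
by rewrite sumr_const card_ord -[leLHS]mulr_natl mulrA.
Qed.

Lemma centered_chart rho : dens vol rho ->
  (forall i, (\int[vol]_x (logc i x * rho x)%:E = 0)%E) -> centered g vol o rho.
Proof.
move=> [ir _ _] H c' c'X c'o k.
have mi i : measurable_fun setT (fun x => logc i x * rho x).
  by apply: measurable_funM; [exact: logc_meas | exact: itg_meas ir].
have iz i := integral_zero_itg (mi i) (H i).
pose J := jacobian (trans c c') (c o).
have E : (fun x => log_map g c' o x 0 k * rho x) = fun x : borel M => \sum_i J i k * (logc i x * rho x).
  apply/funext => x; rewrite (log_chart gcomp sc c_m0 Hsec cX co c'X c'o) dd_jacobian mxE mulr_suml.
  by apply: eq_bigr => i _; rewrite mulrAC mulrC.
have iJ i : itg vol (fun x => J i k * (logc i x * rho x)) by apply: itgZ; have [] := iz i.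
rewrite -[LHS]/(\int[vol]_x ((fun x : borel M => log_map g c' o x 0 k * rho x) x)%:E)%E E riE; last exact: itg_sum.
rewrite ri_sum//; congr EFin; apply: big1 => i _; have [h1 h2] := iz i.
by rewrite riZ// h2 mulr0.
Qed.

Lemma P_o_admissible rho : P_o g vol o rho -> admissible vol logc rho.
Proof.
move=> [/P_ac_dens d _ cn]; split => // i; exact: cn.
Qed.

(** Superlinear growth bounds the double integral of the distance, so by Tonelli the first moment
    about at least one base point is finite. *)
Lemma finite_energy_P_o rho : finite_energy vol logc kernel rho -> P_o g vol o rho.
Proof.
move=> [d _ ip _ cn]; split; first exact/P_ac_dens.
- have [ir p r1] := d; have [C C0 HC] := kernel_superlinear ler01.
  have [irr prr rr1] := dens_prod d; have mr := itg_meas ir.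
  have iD : itg vol2 (fun z => dist z.1 z.2 * (rho z.1 * rho z.2)).
    apply: (itg_dom _ (itgD (itgZ C irr) ip)).
      apply: measurable_funM; first exact: (dist_meas g sc).
      by apply: measurable_funM; [exact: (meas1 mr) | exact: (meas2 mr)].
    move=> z; rewrite ger0_norm ?mulr_ge0 ?dist_ge0// -mulrDl ler_wpM2r ?prr//.
    by have := HC z; rewrite mul1r.
  have [//|none] := pselect (finite_first_moment g vol rho).
  (* Otherwise every inner integral is infinite, and the double integral exceeds its own finite
     value. *)
  have inf y : (\int[vol]_x (dist x y * rho x)%:E = +oo)%E.
    by apply/eqP; rewrite -leye_eq leNgt; apply/negP => hy; apply: none; exists y.
  pose N := ri vol2 (fun z => dist z.1 z.2 * (rho z.1 * rho z.2)).
  have : (\int[vol2]_z (dist z.1 z.2 * (rho z.1 * rho z.2))%:E < (N + 1)%:E)%E by rewrite riE// lte_fin ltrDl.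
  rewrite fubini_tonelli2; [|apply/measurable_EFinP; exact: itg_meas iD|]; last first.
    by move=> z; rewrite lee_fin mulr_ge0 ?dist_ge0 ?prr.
  rewrite ltNge => /negP[].
  have N0 : 0 <= N by apply: ri_ge0 => z; rewrite mulr_ge0 ?dist_ge0 ?prr.
  rewrite (_ : (N + 1)%:E = \int[vol]_y ((N + 1) * rho y)%:E)%E; last first.
    by rewrite riE; [rewrite riZ// r1 mulr1 | exact: itgZ].
  apply: ge0_le_integralT => y; first by rewrite lee_fin mulr_ge0// addr_ge0.
  rewrite /fubini_G /=.
  rewrite (eq_integral (fun x : borel M => (rho y)%:E * (dist x y * rho x)%:E)%E); last first.
    by move=> x _; rewrite -EFinM; congr EFin; rewrite mulrA mulrC.
  rewrite ge0_integralZl ?lee_fin//; last 2 first.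
  + apply/measurable_EFinP; apply: measurable_funM => //.
    exact: (meas_sec y (dist_meas g sc)).
  + by move=> x _; rewrite lee_fin mulr_ge0// dist_ge0.
  rewrite inf; have := p y; rewrite le_eqVlt => /orP[/eqP <-|ry]; first by rewrite mulr0 mul0e.
  by rewrite gt0_muley ?leey// lte_fin.
- by apply: centered_chart => // i; have [h1 h2] := cn i; rewrite riE// h2.
Qed.

Lemma energy_minimizer : exists rho : borel M -> R, P_o g vol o rho /\
  forall rho' : borel M -> R, P_o g vol o rho' -> (energy g vol h rho <= energy g vol h rho')%E.
Proof.
have [C0 C00 HC] := hfin_singular hlt hinc A10 h0.
have [|a [t [s [a0 t2 HS]]]] := @kernel_integral _ _ _ _ g vol gcomp sc Hvol c_m c_m0 Hsec c o cX co n0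
  (Km kernel) A1 C0 A10 A1n C00.
  by move=> x y; apply: HC; exact: dist_ge0.
(* If all energies are +oo, every element of the constraint set is a minimizer and it remains to
   exhibit one. *)
have [inf|[rho [gr min]]] := minimizer logc_meas kernel_meas vari_kernel a0 t2 HS.
  have [f [df cf mf]] := centered_density gcomp sc Hvol c_m0 Hsec cX co n0.
  exists f; split => [|rho' Pr'].
    by split; [exact/P_ac_dens | exists o | exact: centered_chart].
  rewrite (energy_functional (P_o_admissible Pr').1) inf ?leey//; exact: P_o_admissible.
exists rho; split => [|rho' Pr']; first exact: finite_energy_P_o.
have [dr _ _ _ _] := gr.
by rewrite (energy_functional dr) (energy_functional (P_o_admissible Pr').1); apply: min; exact: P_o_admissible.
Qed.

End Assembly.

Theorem theorem2p2 (R : realType) (n : nat) (M : ptopologicalType)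
    (X : manifold R n M) (g : riemannian_metric X)
    (vol : {sigma_finite_measure set (borel M) -> \bar R})
    (c_m A1 : R) (h : R -> \bar R) (phi : R -> R) :
  cartan_hadamard g ->
  riemannian_volume g vol ->
  0 < c_m ->
  sectional_bounds g (- c_m) 0 ->
  (forall t, 0 <= t -> (h t < +oo)%E) ->
  (forall s t, 0 <= s -> s <= t -> (h s <= h t)%E) ->
  lower_semicontinuous (h : subspace `[0, +oo[ -> \bar R) ->
  0 < A1 -> A1 < 2 * n%:R ->
  (-oo < limf_einf (fun t => h t - (A1 * ln t)%:E) 0^'+)%E ->
  (forall s t, 0 <= s -> s <= t -> phi s <= phi t) ->
  convex_function (`[0, +oo[%classic : set R) phi ->
  phi t / t @[t --> +oo] --> +oo ->
  (-oo < limf_einf (fun t => h t - (phi t)%:E) +oo%R)%E ->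
  forall o : M, exists rho : borel M -> R,
    P_o g vol o rho /\
    forall rho' : borel M -> R, P_o g vol o rho' ->
      (energy g vol h rho <= energy g vol h rho')%E.
Proof.
move=> [gcomp sc _] Hvol c_m0 Hsec hlt hinc _ A10 A1n h0 _ _ phiinf hinf o.
have [c cX co] := atlas_cover X o.
(* The bounds 0 < A1 < 2 n exclude dimension 0. *)
have n0 : (0 < n)%N.
  by have := lt_trans A10 A1n; rewrite pmulr_rgt0// ltr0n.
exact: (energy_minimizer gcomp sc Hvol c_m0 Hsec cX co n0 hlt hinc A10 A1n h0 phiinf hinf).
Qed.
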